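(* Let $S$ and $R$ be finite-dimensional quantum systems and suppose $\mathcal{H}^S=\bigoplus_{j\in\mathcal{J}}\mathcal{H}^S_j$ (finite index set $\mathcal{J}$), with $D_S=\dim\mathcal{H}^S$, $d_j=\dim\mathcal{H}^S_j$ and $\Pi^S_j$ the orthogonal projection onto $\mathcal{H}^S_j$. Let $\varrho^{SR}$ be a subnormalized state (positive semidefinite, $\operatorname{tr}\varrho^{SR}\le 1$) and let $\mathcal{M}^{S\to E}$ be a completely positive, trace-non-increasing map. Let $U^S=\bigoplus_{j\in\mathcal{J}}U^S_j$, where the $U^S_j$ are independent Haar-random unitaries on $\mathcal{H}^S_j$ (i.e. $U^S$ is distributed according to the product measure $\mathsf{H}_\times=\times_j \mathsf{H}_j$ of the Haar measures $\mathsf{H}_j$ on $\mathsf{U}(d_j)$). Define $\Gamma^{ER}$ and $\Gamma^{S^*ER}$ as in the context. Then for every $\delta>0$, $$\bigl\|\mathcal{M}^{S\to E}(U^S\varrho^{SR}U^{S\dagger})-\Gamma^{ER}\bigr\|_1\le 2^{-\frac12 H_{\min}(S^*|ER)_{\Gamma}}+\delta$$ holds with probability at least $1-\exp\!\bigl[-\frac{\delta^2 d_{\min}}{48\|\varrho^S\|_\infty}\bigr]$ over the choice of $U^S\sim\mathsf{H}_\times$, where $d_{\min}=\min_{j\in\mathcal{J}}d_j$ and $\varrho^S=\operatorname{tr}_R\varrho^{SR}$.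
   Context: Let $S'$ and $S''$ be copies of $S$ and $S^*=S'S''$. Let $\Phi^{SS'}$ be the maximally entangled state between $S$ and $S'$, and $\zeta^{S'E}=(\mathrm{id}^{S'}\otimes\mathcal{M}^{S\to E})(\Phi^{SS'})$ the Choi–Jamiołkowski operator of $\mathcal{M}$. Let $\Pi^{S'}_j$ be the copy of $\Pi^S_j$ on $S'$, $V^{S\to S''}$ the unitary identifying $S$ with $S''$, and $\Pi^{S\to S''}_j=V^{S\to S''}\Pi^S_j$. Set $\zeta^{S'E}_{jj'}=\Pi^{S'}_j\zeta^{S'E}\Pi^{S'}_{j'}$, $\varrho^{S''R}_{jj'}=\Pi^{S\to S''}_j\varrho^{SR}(\Pi^{S\to S''}_{j'})^\dagger$, $\zeta^E_{jj}=\operatorname{tr}_{S'}[\Pi^{S'}_j\zeta^{S'E}]$, $\varrho^R_{jj}=\operatorname{tr}_S[\Pi^S_j\varrho^{SR}]$, and $$\Gamma^{ER}=\sum_{j\in\mathcal{J}}\frac{D_S}{d_j}\zeta^E_{jj}\otimes\varrho^R_{jj},\qquad \Gamma^{S^*ER}=\sum_{j,j'\in\mathcal{J}}\frac{D_S}{\sqrt{d_jd_{j'}}}\zeta^{S'E}_{jj'}\otimes\varrho^{S''R}_{jj'}.$$ For a positive semidefinite operator $\rho^{AB}$, the conditional min-entropy is $H_{\min}(A|B)_\rho=\sup_{\sigma^B}\sup\{\lambda\in\mathbb{R}:2^{-\lambda}I^A\otimes\sigma^B-\rho^{AB}\ge0\}$, the outer supremum over (normalized) density operators $\sigma^B$.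 $\|\cdot\|_1$ is the trace norm, $\|\cdot\|_\infty$ the operator norm; logarithms are base 2. *)

(* Defs.v *)
From HB Require Import structures.
From mathcomp Require Import all_boot all_order all_algebra.
From mathcomp Require Import complex.
From mathcomp Require Import all_classical all_reals all_analysis.

Set Implicit Arguments.
Unset Strict Implicit.
Unset Printing Implicit Defensive.

Import Order.TTheory GRing.Theory Num.Theory.
Local Open Scope ring_scope.
Local Open Scope classical_set_scope.

Section QDefs.
Variable R : realType.
Local Notation C := R[i].

Definition toC (r : R) : C := Complex r 0.

Definition adj m n (A : 'M[C]_(m, n)) : 'M[C]_(n, m) := \matrix_(i, j) (A j i)^*.

(* positive semidefinite (w.r.t. the partial order of C: z >= 0 iff z real, nonneg) *)
Definition psd n (A : 'M[C]_n) : Prop :=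
  forall v : 'cV[C]_n, 0 <= (adj v *m A *m v) 0 0.

Definition density n (A : 'M[C]_n) : Prop := psd A /\ \tr A = 1.

Definition subnormalized n (A : 'M[C]_n) : Prop := psd A /\ \tr A <= 1.

Definition unitary n (U : 'M[C]_n) : Prop := adj U *m U = 1%:M.

Definition tens m n (A : 'M[C]_m) (B : 'M[C]_n) : 'M[C]_(m * n) :=
  \sum_(i : 'I_m) \sum_(i' : 'I_m) \sum_(k : 'I_n) \sum_(k' : 'I_n)
     (A i i' * B k k') *: delta_mx (mxvec_index i k) (mxvec_index i' k').

Definition ptrace2 m n (A : 'M[C]_(m * n)) : 'M[C]_m :=
  \matrix_(i, i') \sum_(k : 'I_n) A (mxvec_index i k) (mxvec_index i' k).

Definition ptrace1 m n (A : 'M[C]_(m * n)) : 'M[C]_n :=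
  \matrix_(k, k') \sum_(i : 'I_m) A (mxvec_index i k) (mxvec_index i k').

Definition ampl n m p (M : 'M[C]_m -> 'M[C]_p) (X : 'M[C]_(n * m)) : 'M[C]_(n * p) :=
  \sum_(a : 'I_n) \sum_(a' : 'I_n)
    tens (delta_mx a a')
         (M (\matrix_(s, s') X (mxvec_index a s) (mxvec_index a' s'))).

Definition ampr n m p (M : 'M[C]_m -> 'M[C]_p) (X : 'M[C]_(m * n)) : 'M[C]_(p * n) :=
  \sum_(b : 'I_n) \sum_(b' : 'I_n)
    tens (M (\matrix_(s, s') X (mxvec_index s b) (mxvec_index s' b')))
         (delta_mx b b').

Definition completely_positive m p (M : {linear 'M[C]_m -> 'M[C]_p}) : Prop :=
  forall n (X : 'M[C]_(n * m)), psd X -> psd (ampl M X).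

Definition trace_nonincreasing m p (M : {linear 'M[C]_m -> 'M[C]_p}) : Prop :=
  forall X : 'M[C]_m, psd X -> \tr (M X) <= \tr X.

Definition tens22 m1 m2 n1 n2 (A : 'M[C]_(m1 * m2)) (B : 'M[C]_(n1 * n2))
  : 'M[C]_((m1 * n1) * (m2 * n2)) :=
  \sum_(a : 'I_m1) \sum_(a' : 'I_m1) \sum_(b : 'I_m2) \sum_(b' : 'I_m2)
  \sum_(c : 'I_n1) \sum_(c' : 'I_n1) \sum_(d : 'I_n2) \sum_(d' : 'I_n2)
    (A (mxvec_index a b) (mxvec_index a' b') * B (mxvec_index c d) (mxvec_index c' d'))
      *: delta_mx (mxvec_index (mxvec_index a c) (mxvec_index b d))
                  (mxvec_index (mxvec_index a' c') (mxvec_index b' d')).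

Definition psd_sqrt n (B : 'M[C]_n) : 'M[C]_n :=
  xget 0 [set P : 'M[C]_n | psd P /\ P *m P = B].
Definition trnorm n (A : 'M[C]_n) : R := complex.Re (\tr (psd_sqrt (adj A *m A))).

Definition vnorm n (v : 'cV[C]_n) : R := Num.sqrt (complex.Re ((adj v *m v) 0 0)).
Definition opnorm n (A : 'M[C]_n) : R :=
  sup [set vnorm (A *m v) | v in [set v : 'cV[C]_n | vnorm v = 1]].

Definition Hmin dA dB (rho : 'M[C]_(dA * dB)) : \bar R :=
  ereal_sup [set ereal_sup
      [set (l%:E)%E | l in [set l : R |
          psd (toC (2 `^ (- l)) *: tens (1%:M : 'M[C]_dA) sigma - rho)]]
    | sigma in [set s : 'M[C]_dB | density s]].

(* ---- direct sum decomposition H^S = (+)_j H^S_j, adapted to the basis ---- *)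
Section Blocks.
Variables (D : nat) (J : finType) (blk : 'I_D -> J).

(* Pi_j : orthogonal projection onto H^S_j = span {e_i | blk i = j} *)
Definition Pi (j : J) : 'M[C]_D := \matrix_(i, i') ((i == i') && (blk i == j))%:R.
Definition bdim (j : J) : nat := #|[set i | blk i == j]|.
Definition dmin : nat := \big[minn/D]_(j : J) bdim j.

Definition block_unitary (U : 'M[C]_D) : Prop :=
  unitary U /\ (forall i i', blk i != blk i' -> U i i' = 0).

Definition maxent : 'M[C]_(D * D) :=
  (D%:R)^-1 *: \sum_(i : 'I_D) \sum_(k : 'I_D) delta_mx (mxvec_index i i) (mxvec_index k k).

Variables (dR dE : nat) (M : {linear 'M[C]_D -> 'M[C]_dE}) (rho : 'M[C]_(D * dR)).

(* Choi operator zeta^{S'E} = (id^{S'} (x) M^{S->E})(Phi^{SS'}) (Phi symmetric) *)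
Definition zeta : 'M[C]_(D * dE) := ampl M maxent.

Definition zeta_jj' (j j' : J) : 'M[C]_(D * dE) :=
  tens (Pi j) 1%:M *m zeta *m tens (Pi j') 1%:M.
Definition rho_jj' (j j' : J) : 'M[C]_(D * dR) :=
  tens (Pi j) 1%:M *m rho *m adj (tens (Pi j') 1%:M).
Definition zetaE (j : J) : 'M[C]_dE := ptrace1 (tens (Pi j) 1%:M *m zeta).
Definition rhoR (j : J) : 'M[C]_dR := ptrace1 (tens (Pi j) 1%:M *m rho).

Definition GammaER : 'M[C]_(dE * dR) :=
  \sum_(j : J) toC (D%:R / (bdim j)%:R) *: tens (zetaE j) (rhoR j).

(* Gamma^{S* E R}, S* = S' S'' *)
Definition GammaSER : 'M[C]_((D * D) * (dE * dR)) :=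
  \sum_(j : J) \sum_(j' : J)
    toC (D%:R / Num.sqrt ((bdim j)%:R * (bdim j')%:R)) *:
      tens22 (zeta_jj' j j') (rho_jj' j j').

End Blocks.

Definition mxBorel n : set (set 'M[C]_n) :=
  <<s [set X | exists (i j : 'I_n) (B : set R), measurable B /\
         (X = (fun A : 'M[C]_n => complex.Re (A i j)) @^-1` B \/
          X = (fun A : 'M[C]_n => complex.Im (A i j)) @^-1` B)] >>.

End QDefs.

(* Main.v *)
Require Import Defs.
From HB Require Import structures.
From mathcomp Require Import all_boot all_order all_algebra all_fingroup.
From mathcomp Require Import complex spectral ring lra.
From mathcomp Require Import all_classical all_reals all_analysis.
From mathcomp Require Import measurable_realfun.
Set Implicit Arguments.
Unset Strict Implicit.
Unset Printing Implicit Defensive.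
Import Order.TTheory GRing.Theory Num.Theory.
Import numFieldNormedType.Exports.
Local Open Scope ring_scope.
Local Open Scope classical_set_scope.

Local Notation Re := complex.Re.
Local Notation Im := complex.Im.

(** The trace norm of the Hermitian deviation X(U) = M(U rho U^-1) - Gamma is the
    supremum of Re tr (K X(U)) over Hermitian K with -1 <= K <= 1.  Over a finite
    net of such K, a softmax turns this supremum into a smooth function f of U,
    whose left-invariant gradient has Frobenius norm at most
    L = 2 sqrt ||rho^S||, by polarization of the quadratic form
    U |-> tr (K M(U rho U^-1)).

    Mean value.  The second moments of U follow from its invariance under
    diagonal phases, transpositions inside a block and one reflection with
    entries 3/5 and 4/5.  They bound the mean of the squared Hilbert-Schmidt
    norm of t X(U) t for t = sigma^(-1/4), and Gamma <= 2^-l (1 (x) sigma) and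
    Hoelder's inequality then give E ||X(U)||_1 <= 2^(-l/2).

    Fluctuations.  E exp (lam (f - E f)) <= exp (3 lam^2 L^2 / d_min) without any
    logarithmic Sobolev inequality.  First, f is averaged over x |-> V h V^-1 x,
    where V is a random block unitary and h is a fixed diagonal matrix at distance
    of order s from 1.  Such a step costs a factor exp (lam^2 s^2 Ls^2 / 2 + O(s^3)),
    where Ls bounds the gradient along the traceless directions, and it contracts
    Ls by 1 - d_min s^2 / 4; iterating, the total cost is at most
    exp (lam^2 L^2 / d_min), and only the dependence on the block phases remains.
    These are then averaged over random signs: block j is turned by
    p_j / 4 +- p_j / 8 +- ... with p_j = 2 pi / d_j, and since the phase
    e^(i p_j) on block j has determinant 1, the averaged function is almost
    constant.  The sub-Gaussian cost of the signs is
    exp (lam^2 pi^2 L^2 / (6 d_min)), and 1 + pi^2 / 6 <= 3.  Chernoff's bound with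
    lam = d_min delta / (6 L^2) concludes. *)

(** * Complex matrices and the Hilbert-Schmidt inner product *)

(** A conjugation step cannot smooth everything: block scalars commute with all block unitaries, so
    only gradients in [su] shrink and the block phases survive. Hence the two bounds [L] and [Ls] in
    [grad_bound] and the separate averaging of the phases; a one-dimensional block has nothing but
    its phase. On [su] the rate is the Casimir value of the adjoint action: commutators with the
    generator of a step have mean square at least 2 d_min s^2 times the squared norm, which is how
    d_min enters. The law of U is used only through its left invariance; independent copies of U
    come from the product of P with itself. The trace norm is not smooth and the supremum in H_min
    need not be attained, so both are approached up to an error that [le_eps_expR] removes at the
    end. The second-order constant [K] may blow up meanwhile: it only decides how small the steps
    are and is absent from the conclusion of [mgf_bound]. The constant: 3 lam^2 L^2 / d_min - lam
    delta has minimum - delta^2 d_min / (12 L^2), and L^2 = 4 ||rho^S|| turns 12 into 48. *)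

Section ComplexNumbers.
Variable R : realType.
Local Notation C := R[i].
Implicit Types x y z : C.

Lemma conjE z : z^* = Complex (Re z) (- Im z).
Proof. by case: z. Qed.

Lemma ceqP x y : Re x = Re y -> Im x = Im y -> x = y.
Proof. by case: x => a b; case: y => c d /= -> ->. Qed.

Lemma cReD x y : Re (x + y) = Re x + Re y. Proof. by case: x; case: y. Qed.
Lemma cImD x y : Im (x + y) = Im x + Im y. Proof. by case: x; case: y. Qed.
Lemma cReN x : Re (- x) = - Re x. Proof. by case: x. Qed.
Lemma cImN x : Im (- x) = - Im x. Proof. by case: x. Qed.
Lemma cReB x y : Re (x - y) = Re x - Re y. Proof. by rewrite cReD cReN. Qed.
Lemma cImB x y : Im (x - y) = Im x - Im y. Proof. by rewrite cImD cImN. Qed.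
Lemma cReM x y : Re (x * y) = Re x * Re y - Im x * Im y.
Proof. by case: x; case: y. Qed.
Lemma cImM x y : Im (x * y) = Re x * Im y + Im x * Re y.
Proof. by case: x; case: y. Qed.
Lemma cReJ x : Re x^* = Re x. Proof. by rewrite conjE. Qed.
Lemma cImJ x : Im x^* = - Im x. Proof. by rewrite conjE. Qed.

Lemma cRe_sum (I : Type) (r : seq I) (P : pred I) (F : I -> C) :
  Re (\sum_(i <- r | P i) F i) = \sum_(i <- r | P i) Re (F i).
Proof. by elim/big_rec2 : _ => // i a b _ <-; rewrite cReD. Qed.
Lemma cIm_sum (I : Type) (r : seq I) (P : pred I) (F : I -> C) :
  Im (\sum_(i <- r | P i) F i) = \sum_(i <- r | P i) Im (F i).
Proof. by elim/big_rec2 : _ => // i a b _ <-; rewrite cImD. Qed.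

Lemma toCD (a b : R) : toC (a + b) = toC a + toC b.
Proof. by rewrite /toC; apply: ceqP => /=; rewrite ?addr0. Qed.
Lemma toCN (a : R) : toC (- a) = - toC a.
Proof. by apply: ceqP => /=; rewrite ?oppr0. Qed.
Lemma toCM (a b : R) : toC (a * b) = toC a * toC b.
Proof. by apply: ceqP; rewrite ?cReM ?cImM /=; ring. Qed.
Lemma toC0 : toC (0 : R) = 0. Proof. by []. Qed.
Lemma toC1 : toC (1 : R) = 1. Proof. by []. Qed.
Lemma toC_nat n : toC (n%:R : R) = n%:R.
Proof. by elim: n => [//|n IH]; rewrite -!natr1 toCD IH. Qed.
Lemma toCV (a : R) : toC a^-1 = (toC a)^-1.
Proof.
have [->|a0] := eqVneq a 0; first by rewrite toC0 !invr0.
have t0 : toC a != 0 by apply: contra_neq a0 => /(congr1 (@complex.Re R)).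
by apply: (mulIf t0); rewrite mulVf // -toCM mulVf.
Qed.
Lemma conj_toC (a : R) : (toC a)^* = toC a.
Proof. by rewrite conjE /= oppr0. Qed.
Lemma toC_sum (I : Type) (r : seq I) (P : pred I) (F : I -> R) :
  toC (\sum_(i <- r | P i) F i) = \sum_(i <- r | P i) toC (F i).
Proof. by elim/big_rec2 : _ => // i a b _ <-; rewrite toCD. Qed.
Lemma cRe_toC (a : R) z : Re (toC a * z) = a * Re z.
Proof. by rewrite cReM /=; ring. Qed.
Lemma toC_ge0 (a : R) : (0 <= toC a) = (0 <= a).
Proof. by rewrite lecE /= eqxx. Qed.
Lemma cge0P z : reflect (Im z = 0 /\ 0 <= Re z) (0 <= z).
Proof. by rewrite lecE /=; apply: (iffP andP) => -[/eqP]. Qed.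

(** The squared modulus, kept in [R] so that sums and expectations of it stay real. *)
Definition n2 z : R := Re z ^+ 2 + Im z ^+ 2.
Lemma n2_ge0 z : 0 <= n2 z.
Proof. by rewrite addr_ge0 // sqr_ge0. Qed.
Lemma n2J z : n2 z^* = n2 z.
Proof. by rewrite /n2 cReJ cImJ sqrrN. Qed.
Lemma n2M x y : n2 (x * y) = n2 x * n2 y.
Proof. by rewrite /n2 cReM cImM; ring. Qed.
Lemma n2E z : toC (n2 z) = z^* * z.
Proof. by rewrite conjE; apply: ceqP; rewrite ?cReM ?cImM /= /n2; ring. Qed.
Lemma n2E' z : n2 z = Re (z^* * z).
Proof. by rewrite -n2E. Qed.
Lemma n2_toC (a : R) : n2 (toC a) = a ^+ 2.
Proof. by rewrite /n2 /= expr0n addr0. Qed.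
Lemma n2_eq0 z : (n2 z == 0) = (z == 0).
Proof.
apply/idP/eqP => [|->]; last by rewrite /n2 /= expr0n addr0.
rewrite /n2 paddr_eq0 ?sqr_ge0// !sqrf_eq0 => /andP[/eqP a /eqP b].
exact: ceqP.
Qed.
Lemma n2_0 : n2 0 = 0. Proof. by apply/eqP; rewrite n2_eq0. Qed.
End ComplexNumbers.

Section MatrixBasics.
Variable R : realType.
Local Notation C := R[i].

Lemma hadjE m n (A : 'M[C]_(m, n)) i j : adj A i j = (A j i)^*.
Proof. by rewrite mxE. Qed.
Lemma hadjK m n (A : 'M[C]_(m, n)) : adj (adj A) = A.
Proof. by apply/matrixP => i j; rewrite !hadjE conjCK. Qed.
Lemma hadjM m n p (A : 'M[C]_(m, n)) (B : 'M[C]_(n, p)) : adj (A *m B) = adj B *m adj A.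
Proof.
apply/matrixP => i j; rewrite !mxE rmorph_sum; apply: eq_bigr => k _.
by rewrite !mxE rmorphM mulrC.
Qed.
Lemma hadjD m n (A B : 'M[C]_(m, n)) : adj (A + B) = adj A + adj B.
Proof. by apply/matrixP => i j; rewrite !mxE rmorphD. Qed.
Lemma hadjN m n (A : 'M[C]_(m, n)) : adj (- A) = - adj A.
Proof. by apply/matrixP => i j; rewrite !mxE rmorphN. Qed.
Lemma hadjB m n (A B : 'M[C]_(m, n)) : adj (A - B) = adj A - adj B.
Proof. by rewrite hadjD hadjN. Qed.
Lemma hadjZ m n (a : C) (A : 'M[C]_(m, n)) : adj (a *: A) = (a^* ) *: adj A.
Proof. by apply/matrixP => i j; rewrite !mxE rmorphM. Qed.
Lemma hadj0 m n : adj (0 : 'M[C]_(m, n)) = 0.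
Proof. by apply/matrixP => i j; rewrite !mxE rmorph0. Qed.
Lemma hadj1 n : adj (1%:M : 'M[C]_n) = 1%:M.
Proof. by apply/matrixP => i j; rewrite !mxE eq_sym rmorph_nat. Qed.
Lemma hadj_sum m n (I : Type) (r : seq I) (P : pred I) (F : I -> 'M[C]_(m, n)) :
  adj (\sum_(i <- r | P i) F i) = \sum_(i <- r | P i) adj (F i).
Proof. by elim/big_rec2 : _ => [|i a b _ <-]; rewrite ?hadj0 ?hadjD. Qed.
Lemma tr_adj n (A : 'M[C]_n) : \tr (adj A) = (\tr A)^*.
Proof. by rewrite /mxtrace rmorph_sum; apply: eq_bigr => i _; rewrite hadjE. Qed.

Definition dot m n (A B : 'M[C]_(m, n)) : C := \sum_i \sum_j (A i j)^* * B i j.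
(** Taking the real part makes the complex matrices a Euclidean space over [R]. Gradients of real
    functions of U live there, and skew-Hermitian matrices are orthogonal to Hermitian ones. *)
Definition hs m n (A B : 'M[C]_(m, n)) : R := Re (dot A B).
Definition fro2 m n (A : 'M[C]_(m, n)) : R := \sum_i \sum_j n2 (A i j).
Definition fro m n (A : 'M[C]_(m, n)) : R := Num.sqrt (fro2 A).

Lemma dotE m n (A B : 'M[C]_(m, n)) : dot A B = \tr (adj A *m B).
Proof.
rewrite /dot /mxtrace exchange_big; apply: eq_bigr => j _.
by rewrite mxE; apply: eq_bigr => i _; rewrite hadjE.
Qed.
Lemma dotDr m n (A B B' : 'M[C]_(m, n)) : dot A (B + B') = dot A B + dot A B'.
Proof. by rewrite !dotE mulmxDr mxtraceD. Qed.
Lemma dotDl m n (A A' B : 'M[C]_(m, n)) : dot (A + A') B = dot A B + dot A' B.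
Proof. by rewrite !dotE hadjD mulmxDl mxtraceD. Qed.
Lemma dotZr m n a (A B : 'M[C]_(m, n)) : dot A (a *: B) = a * dot A B.
Proof. by rewrite !dotE -scalemxAr mxtraceZ. Qed.
Lemma dotZl m n a (A B : 'M[C]_(m, n)) : dot (a *: A) B = a^* * dot A B.
Proof. by rewrite !dotE hadjZ -scalemxAl mxtraceZ. Qed.
Lemma dotC m n (A B : 'M[C]_(m, n)) : dot A B = (dot B A)^*.
Proof. by rewrite !dotE -tr_adj hadjM hadjK. Qed.
Lemma dot_sumr m n (I : Type) (r : seq I) (P : pred I) (A : 'M[C]_(m, n)) F :
  dot A (\sum_(i <- r | P i) F i) = \sum_(i <- r | P i) dot A (F i).
Proof.
elim/big_rec2 : _ => [|i a b _ <-]; last by rewrite dotDr.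
by rewrite dotE mulmx0 mxtrace0.
Qed.

Lemma hsC m n (A B : 'M[C]_(m, n)) : hs A B = hs B A.
Proof. by rewrite /hs dotC cReJ. Qed.
Lemma hsDr m n (A B B' : 'M[C]_(m, n)) : hs A (B + B') = hs A B + hs A B'.
Proof. by rewrite /hs dotDr cReD. Qed.
Lemma hsDl m n (A A' B : 'M[C]_(m, n)) : hs (A + A') B = hs A B + hs A' B.
Proof. by rewrite /hs dotDl cReD. Qed.
Lemma hsZr m n (a : R) (A B : 'M[C]_(m, n)) : hs A (toC a *: B) = a * hs A B.
Proof. by rewrite /hs dotZr cRe_toC. Qed.
Lemma hsZl m n (a : R) (A B : 'M[C]_(m, n)) : hs (toC a *: A) B = a * hs A B.
Proof. by rewrite hsC hsZr hsC. Qed.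
Lemma hsNr m n (A B : 'M[C]_(m, n)) : hs A (- B) = - hs A B.
Proof. by rewrite /hs -scaleN1r dotZr mulN1r cReN. Qed.
Lemma hsNl m n (A B : 'M[C]_(m, n)) : hs (- A) B = - hs A B.
Proof. by rewrite hsC hsNr hsC. Qed.
Lemma hsBl m n (A A' B : 'M[C]_(m, n)) : hs (A - A') B = hs A B - hs A' B.
Proof. by rewrite hsDl hsNl. Qed.
Lemma hs0r m n (A : 'M[C]_(m, n)) : hs A 0 = 0.
Proof. by rewrite /hs dotE mulmx0 mxtrace0. Qed.
Lemma hs0l m n (A : 'M[C]_(m, n)) : hs 0 A = 0.
Proof. by rewrite hsC hs0r. Qed.
Lemma hsE m n (A B : 'M[C]_(m, n)) :
  hs A B = \sum_i \sum_j (Re (A i j) * Re (B i j) + Im (A i j) * Im (B i j)).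
Proof.
rewrite /hs /dot cRe_sum; apply: eq_bigr => i _; rewrite cRe_sum.
by apply: eq_bigr => j _; rewrite cReM cReJ cImJ; ring.
Qed.
Lemma hs_adj m n (A B : 'M[C]_(m, n)) : hs (adj A) (adj B) = hs A B.
Proof.
rewrite !hsE exchange_big; apply: eq_bigr => i _; apply: eq_bigr => j _.
by rewrite !hadjE !cReJ !cImJ mulrNN.
Qed.
Lemma hs_mull m n p (A : 'M[C]_(m, n)) (B : 'M[C]_(n, p)) D :
  hs A (D *m adj B) = hs (A *m B) D.
Proof. by rewrite /hs !dotE hadjM mxtrace_mulC -!mulmxA mxtrace_mulC -mulmxA. Qed.
Lemma hs_mulr m n p (A : 'M[C]_(m, n)) (B : 'M[C]_(p, m)) D :
  hs A (adj B *m D) = hs (B *m A) D.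
Proof. by rewrite /hs !dotE hadjM mulmxA. Qed.

Lemma fro2_hs m n (A : 'M[C]_(m, n)) : fro2 A = hs A A.
Proof.
by rewrite hsE; apply: eq_bigr => i _; apply: eq_bigr => j _; rewrite /n2 !expr2.
Qed.
Lemma fro2_dot m n (A : 'M[C]_(m, n)) : toC (fro2 A) = dot A A.
Proof.
rewrite /dot /fro2 toC_sum; apply: eq_bigr => i _; rewrite toC_sum.
by apply: eq_bigr => j _; rewrite n2E.
Qed.
Lemma fro2_ge0 m n (A : 'M[C]_(m, n)) : 0 <= fro2 A.
Proof. by do 2! (apply: sumr_ge0 => ? _); exact: n2_ge0. Qed.
Lemma fro_ge0 m n (A : 'M[C]_(m, n)) : 0 <= fro A.
Proof. exact: sqrtr_ge0. Qed.
Lemma fro_sqr m n (A : 'M[C]_(m, n)) : fro A ^+ 2 = fro2 A.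
Proof. by rewrite sqr_sqrtr // fro2_ge0. Qed.
Lemma fro2_eq0 m n (A : 'M[C]_(m, n)) : fro2 A = 0 -> A = 0.
Proof.
move=> h; apply/matrixP => i j; rewrite mxE; apply/eqP; rewrite -n2_eq0.
move/eqP: h; rewrite psumr_eq0; last by move=> k _; apply: sumr_ge0 => ? _; exact: n2_ge0.
move=> /allP/(_ i (mem_index_enum _)) /=; rewrite psumr_eq0; last by move=> ? _; exact: n2_ge0.
by move=> /allP/(_ j (mem_index_enum _)).
Qed.
Lemma fro2_adj m n (A : 'M[C]_(m, n)) : fro2 (adj A) = fro2 A.
Proof. by rewrite !fro2_hs hs_adj. Qed.
Lemma fro_adj m n (A : 'M[C]_(m, n)) : fro (adj A) = fro A.
Proof. by rewrite /fro fro2_adj. Qed.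
Lemma fro2Z m n (a : R) (A : 'M[C]_(m, n)) : fro2 (toC a *: A) = a ^+ 2 * fro2 A.
Proof. by rewrite !fro2_hs hsZl hsZr mulrA expr2. Qed.
Lemma froZ m n (a : R) (A : 'M[C]_(m, n)) : fro (toC a *: A) = `|a| * fro A.
Proof. by rewrite /fro fro2Z sqrtrM ?sqr_ge0// sqrtr_sqr. Qed.
Lemma froN m n (A : 'M[C]_(m, n)) : fro (- A) = fro A.
Proof. by rewrite /fro !fro2_hs hsNl hsNr opprK. Qed.
Lemma fro2D m n (A B : 'M[C]_(m, n)) :
  fro2 (A + B) = fro2 A + 2 * hs A B + fro2 B.
Proof. by rewrite !fro2_hs !hsDl !hsDr (hsC B A); ring. Qed.

Lemma hs_CS m n (A B : 'M[C]_(m, n)) : hs A B <= fro A * fro B.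
Proof.
have [B0|B0] := eqVneq (fro B) 0.
  have /fro2_eq0 -> : fro2 B = 0 by rewrite -fro_sqr B0 expr0n.
  by rewrite hs0r mulr_ge0 ?fro_ge0.
have [A0|A0] := eqVneq (fro A) 0.
  have /fro2_eq0 -> : fro2 A = 0 by rewrite -fro_sqr A0 expr0n.
  by rewrite hs0l mulr_ge0 ?fro_ge0.
have ap : 0 < fro A by rewrite lt_def A0 fro_ge0.
have bp : 0 < fro B by rewrite lt_def B0 fro_ge0.
have := fro2_ge0 (toC (fro B) *: A - toC (fro A) *: B).
rewrite fro2D -scaleNr -toCN !fro2Z hsZl hsZr -!fro_sqr => h.
have ab := mulr_gt0 ap bp.
rewrite -(ler_pM2l ab); nra.
Qed.
Lemma hs_CS_abs m n (A B : 'M[C]_(m, n)) : `|hs A B| <= fro A * fro B.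
Proof.
rewrite ler_norml hs_CS andbT lerNl -hsNl; apply: le_trans (hs_CS _ _) _.
by rewrite froN.
Qed.
Lemma froD m n (A B : 'M[C]_(m, n)) : fro (A + B) <= fro A + fro B.
Proof.
rewrite -(@ler_pXn2r _ 2) ?nnegrE ?fro_ge0 ?addr_ge0 ?fro_ge0//.
rewrite fro_sqr fro2D sqrrD !fro_sqr lerD2r lerD2l mulr_natl.
by rewrite ler_wMn2r // hs_CS.
Qed.
Lemma froB m n (A B : 'M[C]_(m, n)) : fro (A - B) <= fro A + fro B.
Proof. by rewrite -(froN B) froD. Qed.

Lemma fro2_isol m n p (V : 'M[C]_(p, m)) (A : 'M[C]_(m, n)) :
  adj V *m V = 1%:M -> fro2 (V *m A) = fro2 A.
Proof. by move=> h; rewrite !fro2_hs /hs !dotE hadjM -mulmxA (mulmxA (adj V)) h mul1mx. Qed.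
Lemma fro2_isor m n p (V : 'M[C]_(n, p)) (A : 'M[C]_(m, n)) :
  V *m adj V = 1%:M -> fro2 (A *m V) = fro2 A.
Proof.
by move=> h; rewrite -fro2_adj hadjM fro2_isol ?fro2_adj // hadjK.
Qed.

(** Cauchy-Schwarz for each entry. The complex modulus is reached from the real inequality [hs_CS]
    by first multiplying one of the vectors by z = dot a b. *)
Lemma fro2_mul m n p (A : 'M[C]_(m, n)) (B : 'M[C]_(n, p)) :
  fro2 (A *m B) <= fro2 A * fro2 B.
Proof.
have key : forall i j, n2 ((A *m B) i j) <= (\sum_k n2 (A i k)) * (\sum_k n2 (B k j)).
  move=> i j; pose a : 'rV[C]_n := \row_k (A i k)^*; pose b : 'rV[C]_n := \row_k B k j.
  have ea : \sum_k n2 (A i k) = fro2 a.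
    by rewrite /fro2 big_ord1; apply: eq_bigr => k _; rewrite mxE n2J.
  have eb : \sum_k n2 (B k j) = fro2 b.
    by rewrite /fro2 big_ord1; apply: eq_bigr => k _; rewrite mxE.
  have -> : (A *m B) i j = dot a b.
    rewrite mxE /dot big_ord1; apply: eq_bigr => k _; by rewrite !mxE conjCK.
  rewrite ea eb; set z := dot a b.
  have h : hs (z *: a) b = n2 z by rewrite /hs dotZl -/z n2E'.
  have h2 : fro2 (z *: a) = n2 z * fro2 a.
    by rewrite fro2_hs /hs dotZl dotZr mulrA -n2E -fro2_dot -toCM.
  have [z0|z0] := eqVneq (n2 z) 0; first by rewrite z0 mulr_ge0 ?fro2_ge0.
  have zp : 0 < n2 z by rewrite lt_def z0 n2_ge0.
  rewrite -(ler_pM2l zp).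
  have := hs_CS (z *: a) b; rewrite h => h3.
  rewrite -expr2 mulrA -h2 -!fro_sqr -exprMn.
  by rewrite ler_pXn2r // nnegrE ?mulr_ge0 ?fro_ge0 ?n2_ge0.
apply: (@le_trans _ _ (\sum_i \sum_j (\sum_k n2 (A i k)) * (\sum_k n2 (B k j)))).
  by apply: ler_sum => i _; apply: ler_sum => j _; exact: key.
by rewrite -big_distrlr /= [X in _ * X]exchange_big.
Qed.

End MatrixBasics.

(** * Positive matrices, trace norm and operator norm *)

Section Psd.
Variable R : realType.
Local Notation C := R[i].

Lemma hadjmxE m n (A : 'M[C]_(m, n)) : adj A = map_mx Num.conj (A^T).
Proof. by apply/matrixP => i j; rewrite !mxE. Qed.

Lemma sesq_delta n (A : 'M[C]_n) i j :
  (adj (delta_mx i 0 : 'cV[C]_n) *m A *m (delta_mx j 0 : 'cV[C]_n)) 0 0 = A i j.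
Proof.
have -> : adj (delta_mx i 0 : 'cV[C]_n) = delta_mx 0 i.
  by apply/matrixP => a b; rewrite !mxE andbC rmorph_nat.
by rewrite -rowE -colE !mxE.
Qed.

Lemma addmxE m n (A B : 'M[C]_(m, n)) i j : (A + B) i j = A i j + B i j.
Proof. by rewrite mxE. Qed.

(** Polarization: reality at [u + v] settles the imaginary parts of the mixed terms, reality at
    [u + 'i%C *: v] their real parts. *)
Lemma sesq_real_herm (V : lmodType C) (h : V -> V -> C) :
  (forall u u' v v', h (u + u') (v + v') = h u v + h u v' + (h u' v + h u' v')) ->
  (forall a u v, h u (a *: v) = a * h u v) ->
  (forall a u v, h (a *: u) v = a^* * h u v) ->
  (forall u, Im (h u u) = 0) -> forall u v, h v u = (h u v)^*.
Proof.
move=> hD hZ hZl im u v.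
have := im (u + v); rewrite hD !cImD !im => e1.
have := im (u + 'i%C *: v); rewrite hD !hZ !hZl !cImD !im add0r.
have -> : Im ('i%C * ('i%C^* * h v v)) = 0.
  by rewrite !(cImM, cReM) !cReJ !cImJ /= im; ring.
rewrite !cImM !cReJ !cImJ /= => e2.
rewrite conjE; apply: ceqP => /=; lra.
Qed.

(** In the order of [C], 0 <= z includes that z is real, so polarization extracts hermiticity from
    [psd]. *)
Lemma psd_adj n (A : 'M[C]_n) : psd A -> adj A = A.
Proof.
move=> hA; pose h (u v : 'cV[C]_n) : C := (adj u *m A *m v) 0 0.
have key := @sesq_real_herm _ h _ _ _ _.
apply/matrixP => i j; rewrite hadjE -(sesq_delta A j i) -(sesq_delta A i j).
rewrite -[RHS]/(h _ _) key ?conjCK // => [u u' v v'|a u v|a u v|u].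
- rewrite /h hadjD mulmxDl; move: (adj u *m A) (adj u' *m A) => p p'.
  by rewrite mulmxDl !mulmxDr !addmxE addrACA.
- by rewrite /h -scalemxAr mxE.
- by rewrite /h hadjZ -!scalemxAl mxE.
- by have /cge0P[] := hA u.
Qed.

Lemma spectral n (A : 'M[C]_n) : adj A *m A = A *m adj A ->
  exists V : 'M[C]_n, exists a : 'I_n -> C,
  [/\ adj V *m V = 1%:M, V *m adj V = 1%:M & A = V *m diag_mx (\row_i a i) *m adj V].
Proof.
move=> hA.
have nA : A \is normalmx by apply/normalmxP; rewrite -!hadjmxE.
have /orthomx_spectralP := nA; set P := spectralmx A => e.
have uP : P \is unitarymx := spectral_unitarymx A.
have PP : P *m adj P = 1%:M by rewrite hadjmxE; apply/unitarymxP.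
have PP' : adj P *m P = 1%:M by apply: mulmx1C.
exists (adj P), (fun i => spectral_diag A 0 i); rewrite hadjK; split; [exact: PP|exact: PP'|].
rewrite [LHS]e (invmx_unitary uP) -hadjmxE; congr (_ *m diag_mx _ *m _).
by apply/rowP => i; rewrite mxE.
Qed.

Lemma spectral_herm n (A : 'M[C]_n) : adj A = A ->
  exists V : 'M[C]_n, exists a : 'I_n -> R,
  [/\ adj V *m V = 1%:M, V *m adj V = 1%:M & A = V *m diag_mx (\row_i toC (a i)) *m adj V].
Proof.
move=> hA; have [|V [a [h1 h2 eA]]] := @spectral n A; first by rewrite hA.
exists V, (fun i => Re (a i)); split => //; rewrite [LHS]eA.
congr (_ *m diag_mx _ *m _).
have e : diag_mx (\row_i a i) = adj V *m A *m V.
  by rewrite eA !mulmxA h1 mul1mx -!mulmxA h1 mulmx1.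
apply/rowP => i; rewrite !mxE.
have : adj (diag_mx (\row_i a i)) = diag_mx (\row_i a i).
  by rewrite e !hadjM hadjK hA mulmxA.
move/matrixP/(_ i i); rewrite !mxE eqxx mulr1n conjE => /(congr1 (@complex.Im R)) /= im.
by apply: ceqP => //=; lra.
Qed.

Lemma psd_gram m n (B : 'M[C]_(m, n)) : psd (B *m adj B).
Proof.
move=> v; have -> : adj v *m (B *m adj B) *m v = adj (adj B *m v) *m (adj B *m v).
  by rewrite hadjM hadjK !mulmxA.
set u := adj B *m v; rewrite mxE; apply: sumr_ge0 => i _.
by rewrite hadjE -n2E toC_ge0 n2_ge0.
Qed.

Lemma psd_spectral n (A : 'M[C]_n) : psd A ->
  exists V : 'M[C]_n, exists a : 'I_n -> R,
  [/\ adj V *m V = 1%:M, V *m adj V = 1%:M, A = V *m diag_mx (\row_i toC (a i)) *m adj V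
    & forall i, 0 <= a i].
Proof.
move=> hA; have [V [a [h1 h2 eA]]] := spectral_herm (psd_adj hA).
exists V, a; split => // i.
have := hA (V *m delta_mx i 0).
rewrite hadjM -!mulmxA (mulmxA (adj V)) (mulmxA (adj V *m A)).
have -> : adj V *m A *m V = diag_mx (\row_i toC (a i)).
  by rewrite eA !mulmxA h1 mul1mx -!mulmxA h1 mulmx1.
by rewrite mulmxA sesq_delta !mxE eqxx mulr1n toC_ge0.
Qed.

Definition diagR n (a : 'I_n -> R) : 'M[C]_n := diag_mx (\row_i toC (a i)).

Lemma diagR_mul n (a b : 'I_n -> R) : diagR a *m diagR b = diagR (fun i => a i * b i).
Proof.
rewrite /diagR mulmx_diag; congr diag_mx; apply/rowP => i; by rewrite !mxE toCM.
Qed.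
Lemma diagR_adj n (a : 'I_n -> R) : adj (diagR a) = diagR a.
Proof.
apply/matrixP => i j; rewrite hadjE !mxE eq_sym; case: eqP => [->|_].
  by rewrite !mulr1n conj_toC.
by rewrite !mulr0n conjC0.
Qed.
Lemma diagR_const n (c : R) : diagR (fun=> c) = (toC c)%:M :> 'M[C]_n.
Proof. by apply/matrixP => i j; rewrite !mxE. Qed.
Lemma conj_diagR n (V : 'M[C]_n) a b : adj V *m V = 1%:M ->
  (V *m diagR a *m adj V) *m (V *m diagR b *m adj V)
  = V *m diagR (fun i => a i * b i) *m adj V.
Proof. by move=> h; rewrite -diagR_mul !mulmxA -(mulmxA _ (adj V) V) h mulmx1. Qed.

Lemma psd_diagR n (V : 'M[C]_n) a : (forall i, 0 <= a i) ->
  psd (V *m diagR a *m adj V).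
Proof.
move=> a0.
have -> : V *m diagR a *m adj V
  = (V *m diagR (fun i => Num.sqrt (a i))) *m adj (V *m diagR (fun i => Num.sqrt (a i))).
  rewrite hadjM diagR_adj !mulmxA; congr (_ *m _); rewrite -!mulmxA diagR_mul.
  by congr (_ *m diagR _); apply/funext => i; rewrite -expr2 sqr_sqrtr.
exact: psd_gram.
Qed.

Lemma psd_factor n (A : 'M[C]_n) : psd A -> exists B : 'M[C]_n, A = B *m adj B.
Proof.
move=> /psd_spectral[V [a [h1 h2 eA a0]]].
exists (V *m diagR (fun i => Num.sqrt (a i))).
rewrite hadjM diagR_adj !mulmxA eA; congr (_ *m _); rewrite -!mulmxA diagR_mul.
by congr (_ *m diagR _); apply/funext => i; rewrite -expr2 sqr_sqrtr.
Qed.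

Lemma psd_sqrtP n (B : 'M[C]_n) : psd B ->
  psd (psd_sqrt B) /\ psd_sqrt B *m psd_sqrt B = B.
Proof.
move=> /psd_spectral[V [a [h1 h2 eA a0]]].
have h : [set P : 'M[C]_n | psd P /\ P *m P = B] (V *m diagR (fun i => Num.sqrt (a i)) *m adj V).
  split; first by apply: psd_diagR => i; exact: sqrtr_ge0.
  rewrite conj_diagR // eA; congr (_ *m diagR _ *m _).
  by apply/funext => i; rewrite -expr2 sqr_sqrtr.
exact: (@xgetPex _ 0 _ (ex_intro _ _ h)).
Qed.

Lemma psd_conj m n (B : 'M[C]_(m, n)) (A : 'M[C]_n) : psd A -> psd (B *m A *m adj B).
Proof.
move=> /psd_factor[D ->].
have -> : B *m (D *m adj D) *m adj B = (B *m D) *m adj (B *m D).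
  by rewrite hadjM !mulmxA.
exact: psd_gram.
Qed.

Lemma psdD n (A B : 'M[C]_n) : psd A -> psd B -> psd (A + B).
Proof. by move=> hA hB v; rewrite mulmxDr mulmxDl mxE addr_ge0. Qed.
Lemma psd0 n : psd (0 : 'M[C]_n).
Proof. by move=> v; rewrite mulmx0 mul0mx mxE. Qed.

(** Hermitian matrices with spectrum in [-1, 1], expressed by their quadratic form: the ball dual to
    the trace norm on Hermitian matrices. *)
Definition cball n (K : 'M[C]_n) :=
  adj K = K /\ forall v : 'cV[C]_n, `|hs v (K *m v)| <= fro2 v.

Lemma fro2_col n (v : 'cV[C]_n) : fro2 v = \sum_i n2 (v i 0).
Proof. by apply: eq_bigr => i _; rewrite big_ord1. Qed.

Lemma cball_mx n m (K : 'M[C]_n) (X : 'M[C]_(n, m)) : cball K -> `|hs X (K *m X)| <= fro2 X.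
Proof.
move=> [hK cK].
have e (Y Z : 'M[C]_(n, m)) : hs Y Z = \sum_j hs (col j Y) (col j Z).
  rewrite hsE exchange_big; apply: eq_bigr => j _; rewrite hsE; apply: eq_bigr => i _.
  by rewrite big_ord1 !mxE.
rewrite fro2_hs !e (le_trans (ler_norm_sum _ _ _))//; apply: ler_sum => j _.
by rewrite -fro2_hs; have := cK (col j X); rewrite !colE -!mulmxA.
Qed.

(** The form at u + w minus the form at u - w is four times the mixed term, and the parallelogram
    law bounds the difference. Rescaling u and w by sqrt c and its inverse brings in the weight,
    which later balances two factors of different size. *)
Lemma cball_polar n m (K : 'M[C]_n) (u w : 'M[C]_(n, m)) (c : R) : cball K -> 0 < c ->
  2 * hs u (K *m w) <= c * fro2 u + fro2 w / c.
Proof.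
move=> hK c0.
have key (u' w' : 'M[C]_(n, m)) : 2 * hs u' (K *m w') <= fro2 u' + fro2 w'.
  have := cball_mx (u' + w') hK; have := cball_mx (u' - w') hK.
  rewrite !ler_norml => /andP[h1 _] /andP[_ h2].
  have s : hs w' (K *m u') = hs u' (K *m w').
    by case: hK => hK _; rewrite -{2}hK hs_mulr hsC.
  move: h1 h2; rewrite !fro2D hsNr !fro2_hs hsNl hsNr opprK -!fro2_hs.
  rewrite mulmxBr mulmxDr !hsDl !hsDr !hsNl !hsNr s; lra.
have s0 : 0 < Num.sqrt c by rewrite sqrtr_gt0.
have := key (toC (Num.sqrt c) *: u) (toC (Num.sqrt c)^-1 *: w).
have -> : K *m (toC (Num.sqrt c)^-1 *: w) = toC (Num.sqrt c)^-1 *: (K *m w).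
  by rewrite scalemxAr.
rewrite !fro2Z exprVn sqr_sqrtr; last exact: ltW.
rewrite hsZl hsZr.
by rewrite (mulrA (Num.sqrt c)) mulfV ?gt_eqF// mul1r [fro2 w / c]mulrC.
Qed.

Lemma cball_contr n m (K : 'M[C]_n) (X : 'M[C]_(n, m)) : cball K -> fro2 (K *m X) <= fro2 X.
Proof.
move=> hK; have := cball_polar (K *m X) X hK ltr01.
by rewrite -fro2_hs; lra.
Qed.

Lemma cball_entry n (K : 'M[C]_n) i j : cball K -> n2 (K i j) <= 1.
Proof.
move=> hK; have := cball_contr (delta_mx j 0 : 'cV[C]_n) hK.
rewrite -colE !fro2_col => h.
have e : \sum_i0 n2 ((delta_mx j 0 : 'cV[C]_n) i0 0) = 1.
  rewrite (bigD1 j) //= big1 ?addr0 => [|k /negbTE kj]; rewrite mxE ?eqxx ?kj /=; first by rewrite n2_toC expr1n.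
  by rewrite n2_0.
apply: le_trans (_ : _ <= \sum_i0 n2 (col j K i0 0)) _; last by rewrite -e.
rewrite (bigD1 i) //= mxE lerDl; apply: sumr_ge0 => ? _; exact: n2_ge0.
Qed.

(** The traces are taken in an eigenbasis of |X|, where X v_i has norm p_i; Cauchy-Schwarz and the
    contraction property of [K] bound the i-th diagonal term by p_i. *)
Lemma trnorm_ge n (X K : 'M[C]_n) : cball K -> Re (\tr (K *m X)) <= trnorm X.
Proof.
move=> hK; rewrite /trnorm.
have [] := @psd_sqrtP n (adj X *m X); first by rewrite -{2}(hadjK X); exact: psd_gram.
set P := psd_sqrt _ => psP PP.
have [V [p [h1 h2 eP p0]]] := psd_spectral psP.
have e (Y : 'M[C]_n) : Re (\tr Y) = \sum_i Re ((adj V *m Y *m V) i i).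
  rewrite -cRe_sum; congr Re; rewrite -/(\tr (adj V *m Y *m V)).
  by rewrite mxtrace_mulC mulmxA h2 mul1mx.
rewrite !e; apply: ler_sum => i _.
have -> : Re ((adj V *m P *m V) i i) = p i.
  by rewrite eP !mulmxA h1 mul1mx -mulmxA h1 mulmx1 !mxE eqxx mulr1n.
pose v := V *m delta_mx i 0 : 'cV[C]_n.
have -> : Re ((adj V *m (K *m X) *m V) i i) = hs (K *m v) (X *m v).
  case: hK => hK _; rewrite -(sesq_delta _ i i) /hs dotE /v !hadjM hK !mulmxA.
  by rewrite [\tr _]big_ord1.
have f1 : fro2 (K *m v) <= 1.
  apply: le_trans (cball_contr _ hK) _; rewrite fro2_isol // fro2_col.
  rewrite (bigD1 i) //= big1 ?addr0 => [|k /negbTE kj]; rewrite mxE ?eqxx ?kj /=; first by rewrite n2_toC expr1n.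
  by rewrite n2_0.
have f2 : fro2 (X *m v) = p i ^+ 2.
  have -> : fro2 (X *m v) = fro2 (P *m v).
    by rewrite !fro2_hs /hs !dotE !hadjM (psd_adj psP) -!mulmxA (mulmxA (adj X)) -PP -!mulmxA.
  rewrite eP /v -/(diagR p) -!mulmxA (mulmxA (adj V)) h1 mul1mx fro2_isol // -colE fro2_col.
  rewrite (bigD1 i) //= big1 ?addr0 => [|k /negbTE kj]; rewrite !mxE ?eqxx ?kj /=.
    by rewrite mulr1n n2_toC.
  by rewrite mulr0n n2_0.
apply: le_trans (hs_CS _ _) _; rewrite /fro f2 sqrtr_sqr ger0_norm //.
rewrite ler_piMl //.
by rewrite -[leRHS](@sqrtr1 R) ler_sqrt.
Qed.

(** The maximizer is the sign of [X], obtained as the Hermitian part of [W] = Q X with [Q] the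
    pseudo-inverse of |X|; the convention 0^-1 = 0 makes [Q] vanish on the kernel. Taking the
    Hermitian part spares a proof that [Q] and [X] commute. *)
Lemma trnorm_attained n (X : 'M[C]_n) : adj X = X ->
  exists2 K, cball K & Re (\tr (K *m X)) = trnorm X.
Proof.
move=> hX; rewrite /trnorm.
have [] := @psd_sqrtP n (adj X *m X); first by rewrite -{2}(hadjK X); exact: psd_gram.
set P := psd_sqrt _ => psP; rewrite hX => PP.
have [V [p [h1 h2 eP p0]]] := psd_spectral psP.
pose Q := V *m diagR (fun i => (p i)^-1) *m adj V; pose W := Q *m X.
have aQ : adj Q = Q by rewrite /Q !hadjM diagR_adj hadjK mulmxA.
have QPP : Q *m (P *m P) = P.
  rewrite eP -/(diagR p) /Q !(conj_diagR _ _ h1); congr (_ *m diagR _ *m _).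
  apply/funext => i; have [->|pi0] := eqVneq (p i) 0; first by rewrite !mulr0.
  by rewrite mulrA mulVf // mul1r.
have WX : W *m X = P by rewrite -mulmxA -PP QPP.
have WW (v : 'cV[C]_n) : fro2 (adj W *m v) <= fro2 v.
  have -> : fro2 (adj W *m v) = hs v ((W *m adj W) *m v).
    rewrite fro2_hs -[in RHS]mulmxA -[in RHS](hadjK W) hs_mulr hadjK hsC //.
  have -> : W *m adj W = V *m diagR (fun i => (p i != 0)%:R) *m adj V.
    rewrite hadjM hX aQ /W mulmxA -(mulmxA Q X X) -PP QPP eP -/(diagR p) (conj_diagR _ _ h1).
    congr (_ *m diagR _ *m _); apply/funext => i.
    by case: eqVneq => [->|pi0]; rewrite ?mul0r // mulfV.
  rewrite -mulmxA -mulmxA -{1}(hadjK V) hs_mulr -(fro2_isol (V:=adj V) v) ?hadjK //.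
  rewrite !hsE fro2_col; apply: ler_sum => i _; rewrite big_ord1 /n2.
  rewrite mul_diag_mx !mxE; case: (_ != 0); rewrite cReM cImM /=; first by rewrite !expr2; lra.
  have := n2_ge0 ((adj V *m v) i 0); rewrite /n2 !mxE; lra.
have WW' (v : 'cV[C]_n) : `|hs v (W *m v)| <= fro2 v.
  rewrite -{1}(hadjK W) hs_mulr; apply: le_trans (hs_CS_abs _ _) _.
  rewrite -(fro_sqr v) expr2 ler_wpM2r ?fro_ge0 //.
  by rewrite /fro ler_sqrt ?fro2_ge0.
pose K := toC (2^-1) *: (W + adj W).
exists K.
  split; first by rewrite /K hadjZ conj_toC hadjD hadjK addrC.
  move=> v; rewrite /K -scalemxAl hsZr mulmxDl hsDr hs_mulr (hsC (W *m v)) -mulr2n.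
  by have -> : forall x : R, 2^-1 * (x *+ 2) = x by move=> x; field.
rewrite /K -scalemxAl mxtraceZ cRe_toC mulmxDl mxtraceD cReD WX.
have -> : Re (\tr (adj W *m X)) = Re (\tr P).
  by rewrite -{1}hX -hadjM tr_adj cReJ mxtrace_mulC WX.
lra.
Qed.

Lemma fro2_vnorm n (v : 'cV[C]_n) : vnorm v = fro v.
Proof.
rewrite /vnorm /fro; congr Num.sqrt; rewrite mxE cRe_sum fro2_col.
by apply: eq_bigr => i _; rewrite hadjE -n2E'.
Qed.

Lemma opnorm_vec n (A : 'M[C]_n) (v : 'cV[C]_n) : fro (A *m v) <= opnorm A * fro v.
Proof.
have [v0|v0] := eqVneq (fro v) 0.
  have /fro2_eq0 -> : fro2 v = 0 by rewrite -fro_sqr v0 expr0n.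
  by rewrite mulmx0 /fro fro2_hs hs0r sqrtr0 mulr0.
have vp : 0 < fro v by rewrite lt_def v0 fro_ge0.
pose u := toC (fro v)^-1 *: v.
have u1 : fro u = 1 by rewrite froZ ger0_norm ?invr_ge0 ?fro_ge0 // mulVf.
have -> : A *m v = toC (fro v) *: (A *m u).
  by rewrite /u -scalemxAr scalerA -toCM mulfV // scale1r.
rewrite froZ ger0_norm ?fro_ge0 // mulrC ler_wpM2r ?fro_ge0 //.
rewrite /opnorm; apply: ub_le_sup; last by exists u; rewrite /= ?fro2_vnorm.
exists (fro A) => _ [w /= + <-]; rewrite !fro2_vnorm => w1.
rewrite /fro ler_sqrt ?fro2_ge0 //; apply: le_trans (fro2_mul _ _) _.
by rewrite -[fro2 w]fro_sqr w1 expr1n mulr1.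
Qed.

Lemma opnorm_ge0 n (A : 'M[C]_n) : 0 <= opnorm A.
Proof.
rewrite /opnorm; set S := (X in sup X).
(* For n = 0 there is no unit vector, and the supremum of the empty set is 0. *)
have [->|/set0P[x Sx]] := eqVneq S set0; first by rewrite sup0.
case: (Sx) => v v1 e; apply: le_trans (_ : x <= _); first by rewrite -e fro2_vnorm fro_ge0.
apply: ub_le_sup => //; exists (fro A) => _ [w /= + <-]; rewrite !fro2_vnorm => w1.
  rewrite /fro ler_sqrt ?fro2_ge0 //; apply: le_trans (fro2_mul _ _) _.
  by rewrite -[fro2 w]fro_sqr w1 expr1n mulr1.
Qed.

End Psd.

(** * Expectations over Haar-distributed block unitaries *)

Section MeasurableMatrices.
Variables (R : realType) (D : nat).
Local Notation C := R[i].

(* The measurable sets of [mxT] are, by conversion, those of [mxBorel]. *)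
Definition mxP := 'M[C]_D.
HB.instance Definition _ := Choice.on mxP.
HB.instance Definition _ := isPointed.Build mxP (0 : 'M[C]_D).
Definition coord_sets : set (set mxP) :=
  [set X | exists (i j : 'I_D) (B : set R), measurable B /\
         (X = (fun A : 'M[C]_D => complex.Re (A i j)) @^-1` B \/
          X = (fun A : 'M[C]_D => complex.Im (A i j)) @^-1` B)].
Definition mxT := g_sigma_algebraType coord_sets.

Definition cmeas d (X : measurableType d) (f : X -> C) :=
  measurable_fun [set: X] (fun x => Re (f x)) /\ measurable_fun [set: X] (fun x => Im (f x)).

Section Cmeas.
Context d (X : measurableType d).
Implicit Types f g : X -> C.
Lemma cmeas_cst (c : C) : cmeas (fun _ : X => c).
Proof. by split; exact: measurable_cst. Qed.
Lemma cmeasD f g : cmeas f -> cmeas g -> cmeas (fun x => f x + g x).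
Proof.
move=> [f1 f2] [g1 g2]; split.
- by under eq_fun do rewrite cReD; exact: measurable_funD.
- by under eq_fun do rewrite cImD; exact: measurable_funD.
Qed.
Lemma cmeasN f : cmeas f -> cmeas (fun x => - f x).
Proof.
move=> [f1 f2]; split.
- by under eq_fun do rewrite cReN; exact: measurable_funN.
- by under eq_fun do rewrite cImN; exact: measurable_funN.
Qed.
Lemma cmeasB f g : cmeas f -> cmeas g -> cmeas (fun x => f x - g x).
Proof. by move=> hf hg; apply: cmeasD => //; exact: cmeasN. Qed.
Lemma cmeasM f g : cmeas f -> cmeas g -> cmeas (fun x => f x * g x).
Proof.
move=> [f1 f2] [g1 g2]; split.
- by under eq_fun do rewrite cReM; apply: measurable_funB; exact: measurable_funM.
- by under eq_fun do rewrite cImM; apply: measurable_funD; exact: measurable_funM.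
Qed.
Lemma cmeasJ f : cmeas f -> cmeas (fun x => (f x)^*).
Proof.
move=> [f1 f2]; split.
- by under eq_fun do rewrite cReJ.
- by under eq_fun do rewrite cImJ; exact: measurable_funN.
Qed.
Lemma cmeas_sum (I : Type) (r : seq I) (F : I -> X -> C) :
  (forall i, cmeas (F i)) -> cmeas (fun x => \sum_(i <- r) F i x).
Proof.
move=> hF; elim: r => [|i r IH].
  by under eq_fun do rewrite big_nil; exact: cmeas_cst.
by under eq_fun do rewrite big_cons; exact: cmeasD.
Qed.
Lemma cmeas_toC (f : X -> R) : measurable_fun [set: X] f -> cmeas (fun x => toC (f x)).
Proof. by move=> hf; split => //=; exact: measurable_cst. Qed.
Lemma cmeas_mulmx m n p (F : X -> 'M[C]_(m, n)) (G : X -> 'M[C]_(n, p)) :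
  (forall i j, cmeas (fun x => F x i j)) -> (forall i j, cmeas (fun x => G x i j)) ->
  forall i j, cmeas (fun x => (F x *m G x) i j).
Proof.
move=> hF hG i j; under eq_fun do rewrite mxE.
by apply: cmeas_sum => k; exact: cmeasM.
Qed.
Lemma cmeas_adj m n (F : X -> 'M[C]_(m, n)) :
  (forall i j, cmeas (fun x => F x i j)) -> forall i j, cmeas (fun x => adj (F x) i j).
Proof. by move=> hF i j; under eq_fun do rewrite hadjE; exact: cmeasJ. Qed.
Lemma measurable_hs m n (F G : X -> 'M[C]_(m, n)) :
  (forall i j, cmeas (fun x => F x i j)) -> (forall i j, cmeas (fun x => G x i j)) ->
  measurable_fun [set: X] (fun x => hs (F x) (G x)).
Proof.
move=> hF hG; suff [] : cmeas (fun x => dot (F x) (G x)) by [].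
rewrite /dot; apply: cmeas_sum => i; apply: cmeas_sum => j.
by apply: cmeasM => //; exact: cmeasJ.
Qed.

Lemma measurable_mx (F : X -> mxT) :
  (forall i j, cmeas (fun x => (F x : 'M[C]_D) i j)) -> measurable_fun [set: X] F.
Proof.
move=> hF; apply: (@measurability _ _ X mxT setT F coord_sets) => // Y [Z [i [j [B [mB hZ]]]] <-].
have [h1 h2] := hF i j.
by case: hZ => ->; [exact: h1 | exact: h2].
Qed.
End Cmeas.

Lemma cmeas_entry i j : cmeas (fun x : mxT => (x : 'M[C]_D) i j).
Proof.
split => _ B mB; rewrite setTI; apply: sub_sigma_algebra; exists i, j, B; split => //.
  by left.
by right.
Qed.

Lemma cmeas_comp d d' (X : measurableType d) (Y : measurableType d') (g : X -> Y) (f : Y -> C) :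
  measurable_fun [set: X] g -> cmeas f -> cmeas (fun x => f (g x)).
Proof. by move=> hg [f1 f2]; split; [exact: measurableT_comp f1 hg|exact: measurableT_comp f2 hg]. Qed.

Lemma cmeas_fst d (X : measurableType d) i j : cmeas (fun p : mxT * X => (p.1 : 'M[C]_D) i j).
Proof. exact: (cmeas_comp measurable_fst (cmeas_entry i j)). Qed.
Lemma cmeas_snd d (X : measurableType d) i j : cmeas (fun p : X * mxT => (p.2 : 'M[C]_D) i j).
Proof. exact: (cmeas_comp measurable_snd (cmeas_entry i j)). Qed.
End MeasurableMatrices.

Section Haar.
Variables (R : realType) (D : nat) (J : finType) (blk : 'I_D -> J).
Local Notation C := R[i].
Local Notation mxT := (mxT R D).
Local Notation G := (@block_unitary R D J blk).

Lemma G1 : G 1%:M.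
Proof.
split; first by rewrite /unitary hadj1 mulmx1.
move=> i i' ii'; rewrite mxE; case: (i =P i') => // e.
by move: ii'; rewrite e eqxx.
Qed.
Lemma unitary_r n (V : 'M[C]_n) : unitary V -> V *m adj V = 1%:M.
Proof. exact: mulmx1C. Qed.
Lemma G_adj g : G g -> G (adj g).
Proof.
move=> [h1 h2]; split; first by rewrite /unitary hadjK unitary_r.
by move=> i i' ii'; rewrite hadjE h2 ?conjC0 // eq_sym.
Qed.
Lemma G_mul g h : G g -> G h -> G (g *m h).
Proof.
move=> [g1 g2] [h1 h2]; split.
  by rewrite /unitary hadjM mulmxA -(mulmxA (adj h)) g1 mulmx1.
move=> i i' ii'; rewrite mxE big1 // => k _.
have [e|ne] := eqVneq (blk i) (blk k); last by rewrite g2 // mul0r.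
by rewrite h2 ?mulr0 // -e.
Qed.

Variables (d : measure_display) (T : measurableType d) (P : probability T R)
  (U : T -> 'M[C]_D).
Hypothesis hU : forall w, G (U w).
Hypothesis mU : forall A, mxBorel A -> measurable (U @^-1` A).
Hypothesis iU : forall g, G g -> forall A, mxBorel A ->
     P ((fun w => g *m U w) @^-1` A) = P (U @^-1` A).

Definition mxmeas (F : 'M[C]_D -> R) := measurable_fun [set: mxT] (F : mxT -> R).
Definition bnd (F : 'M[C]_D -> R) := exists B, forall x, G x -> `|F x| <= B.
(** Integrability always comes from measurability and a bound on the block unitaries, where [U]
    takes all its values; outside of them [F] may be unbounded. *)
Definition ok F := mxmeas F /\ bnd F.
Definition ex (F : 'M[C]_D -> R) : R := \int[P]_w F (U w).

Lemma mU' : measurable_fun [set: T] (U : T -> mxT).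
Proof. by move=> _ A mA; rewrite setTI; exact: mU. Qed.

Lemma ok_int F : ok F -> P.-integrable [set: T] (EFin \o (fun w => F (U w))).
Proof.
move=> [mF [B hB]]; apply: measurable_bounded_integrable => //.
- exact: (le_lt_trans (probability_le1 P measurableT) (ltry _)).
- exact: (measurableT_comp mF mU').
- exists B; split; first exact: num_real.
  by move=> M BM w _ /=; apply: (le_trans (hB _ (hU w))); exact: ltW.
Qed.

Lemma ok_cst c : ok (fun=> c).
Proof. by split; [exact: measurable_cst|exists `|c|]. Qed.
Lemma okD F F' : ok F -> ok F' -> ok (fun x => F x + F' x).
Proof.
move=> [m1 [B1 h1]] [m2 [B2 h2]]; split; first exact: measurable_funD.
by exists (B1 + B2) => x Gx; rewrite (le_trans (ler_normD _ _)) // lerD // (h1, h2).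
Qed.
Lemma okM F F' : ok F -> ok F' -> ok (fun x => F x * F' x).
Proof.
move=> [m1 [B1 h1]] [m2 [B2 h2]]; split; first exact: measurable_funM.
by exists (B1 * B2) => x Gx; rewrite normrM ler_pM // (h1, h2).
Qed.
Lemma okZ c F : ok F -> ok (fun x => c * F x).
Proof. by move=> hF; apply: okM => //; exact: ok_cst. Qed.
Lemma okN F : ok F -> ok (fun x => - F x).
Proof. by move=> hF; under eq_fun do rewrite -mulN1r; exact: okZ. Qed.
Lemma okB F F' : ok F -> ok F' -> ok (fun x => F x - F' x).
Proof. by move=> h h'; apply: okD => //; exact: okN. Qed.
Lemma ok_sum (I : Type) (r : seq I) (F : I -> 'M[C]_D -> R) :
  (forall i, ok (F i)) -> ok (fun x => \sum_(i <- r) F i x).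
Proof.
move=> hF; elim: r => [|i r IH].
  by under eq_fun do rewrite big_nil; exact: ok_cst.
by under eq_fun do rewrite big_cons; exact: okD.
Qed.
Lemma ok_expR F : ok F -> ok (fun x => expR (F x)).
Proof.
move=> [m1 [B1 h1]]; split; first exact: (measurableT_comp (@measurable_expR R) m1).
exists (expR B1) => x Gx; rewrite ger0_norm ?expR_ge0 // ler_expR.
exact: le_trans (ler_norm _) (h1 _ Gx).
Qed.
Lemma mx_mul_meas (g h : 'M[C]_D) : measurable_fun [set: mxT] ((fun x => g *m x *m h) : mxT -> mxT).
Proof.
apply: measurable_mx => i j; apply: cmeas_mulmx => {i j} [i j|i j]; last exact: cmeas_cst.
by apply: cmeas_mulmx => {i j} i j; [exact: cmeas_cst|exact: cmeas_entry].
Qed.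
Lemma ok_trans F g h : G g -> G h -> ok F -> ok (fun x => F (g *m x *m h)).
Proof.
move=> hg hh [m1 [B1 h1]]; split; first exact: (measurableT_comp m1 (mx_mul_meas g h)).
by exists B1 => x Gx; apply: h1; apply: G_mul => //; exact: G_mul.
Qed.
Lemma ok_transl F g : G g -> ok F -> ok (fun x => F (g *m x)).
Proof.
move=> hg hF; have := ok_trans hg G1 hF.
by under eq_fun do rewrite mulmx1.
Qed.

Lemma ex_cst c : ex (fun=> c) = c.
Proof. rewrite /ex Rintegral_cst // -[RHS]mulr1; congr (_ * _).
exact: (congr1 fine (@probability_setT _ _ _ P)). Qed.
Lemma exD F F' : ok F -> ok F' -> ex (fun x => F x + F' x) = ex F + ex F'.
Proof. by move=> h h'; rewrite /ex RintegralD //; exact: ok_int. Qed.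
Lemma exZ c F : ok F -> ex (fun x => c * F x) = c * ex F.
Proof. by move=> h; rewrite /ex RintegralZl //; exact: ok_int. Qed.
Lemma exN F : ok F -> ex (fun x => - F x) = - ex F.
Proof. by move=> h; rewrite -mulN1r -exZ //; congr ex; apply/funext => x; rewrite mulN1r. Qed.
Lemma exB F F' : ok F -> ok F' -> ex (fun x => F x - F' x) = ex F - ex F'.
Proof. by move=> h h'; rewrite exD ?exN //; exact: okN. Qed.
Lemma ex_sum (I : Type) (r : seq I) (F : I -> 'M[C]_D -> R) :
  (forall i, ok (F i)) -> ex (fun x => \sum_(i <- r) F i x) = \sum_(i <- r) ex (F i).
Proof.
move=> hF; elim: r => [|i r IH].
  by rewrite big_nil -[RHS](ex_cst 0); congr ex; apply/funext => x; rewrite big_nil.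
rewrite big_cons -IH -exD //; last exact: ok_sum.
by congr ex; apply/funext => x; rewrite big_cons.
Qed.
Lemma ex_le F F' : ok F -> ok F' -> (forall x, G x -> F x <= F' x) -> ex F <= ex F'.
Proof.
move=> h h' le; apply: le_Rintegral => //; [exact: ok_int|exact: ok_int|].
by move=> w _; exact: le.
Qed.
Lemma eq_ex F F' : (forall x, G x -> F x = F' x) -> ex F = ex F'.
Proof. by move=> h; rewrite /ex; apply: eq_Rintegral => w _; exact: h. Qed.

(** Both sides integrate [F] against the laws of g U and of U, which the invariance hypothesis
    identifies on [mxBorel]. *)
Lemma ex_inv F g : G g -> ok F -> ex (fun x => F (g *m x)) = ex F.
Proof.
move=> hg hF; have [mF _] := hF.
have mgU : measurable_fun [set: T] ((fun w => g *m U w) : T -> mxT).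
  have := measurableT_comp (mx_mul_meas g 1%:M) mU'.
  by rewrite /comp; under eq_fun do rewrite mulmx1.
have mE : measurable_fun [set: mxT] (EFin \o F) by exact/measurable_EFinP.
rewrite /ex /Rintegral; congr fine.
have := integral_pushforward mgU mE (ok_int (ok_transl hg hF)) measurableT.
have := integral_pushforward mU' mE (ok_int hF) measurableT.
rewrite !preimage_setT /= => <- <-.
apply: eq_measure_integral => [|h A mA _]; [exact: mU'|exact: (iU hg mA)].
Qed.

Definition mxmeas2 (F : 'M[C]_D -> 'M[C]_D -> R) :=
  measurable_fun [set: mxT * mxT] (fun p => F p.1 p.2).
Definition ok2 F := mxmeas2 F /\ exists B, forall x y, G x -> G y -> `|F x y| <= B.

(** The integral splits into those of the positive and negative parts, each measurable in the
    parameter by Tonelli on [mxT * T]. *)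
Lemma mxmeas2_ex F : mxmeas2 F -> mxmeas (fun u => ex (fun v => F u v)).
Proof.
move=> mF; rewrite /mxmeas /ex /Rintegral.
pose f (p : mxT * T) : \bar R := (F p.1 (U p.2))%:E.
have mf : measurable_fun [set: mxT * T] f.
  apply/measurable_EFinP.
  apply: (@measurableT_comp _ _ _ _ _ _ (fun p : mxT * mxT => F p.1 p.2) _ (fun p : mxT * T => (p.1, U p.2 : mxT)) mF).
  apply: measurable_fun_pair; first exact: measurable_fst.
  exact: (measurableT_comp mU' measurable_snd).
apply: measurableT_comp; first exact: fine_measurable.
under eq_fun do rewrite integralE.
apply: emeasurable_funB.
- have := @measurable_fun_fubini_tonelli_F _ _ mxT T R P (f ^\+)%E.
  move=> /(_ (measurable_funepos mf) (fun x => funepos_ge0 _ _)) h.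
  by move: h; apply: eq_measurable_fun => x _; apply: eq_integral => w _; rewrite ?funeposE ?funenegE /f /=.
- have := @measurable_fun_fubini_tonelli_F _ _ mxT T R P (f ^\-)%E.
  move=> /(_ (measurable_funeneg mf) (fun x => funeneg_ge0 _ _)) h.
  by move: h; apply: eq_measurable_fun => x _; apply: eq_integral => w _; rewrite ?funeposE ?funenegE /f /=.
Qed.

Lemma ok2_ok F u : G u -> ok2 F -> ok (F u).
Proof.
move=> hu [mF [B hB]]; split; last by exists B => x; exact: hB.
apply: (@measurableT_comp _ _ _ _ _ _ (fun p : mxT * mxT => F p.1 p.2) _ (fun p : mxT => (u : mxT, p)) mF).
by apply: measurable_fun_pair; [exact: measurable_cst|exact: measurable_id].
Qed.
Lemma ok2_swap F : ok2 F -> ok2 (fun u v => F v u).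
Proof.
move=> [mF [B hB]]; split; last by exists B => x y Gx Gy; exact: hB.
apply: (measurableT_comp (f := fun p : mxT * mxT => F p.1 p.2) (g := fun p => (p.2, p.1)) mF).
by apply: measurable_fun_pair; [exact: measurable_snd|exact: measurable_fst].
Qed.
Lemma ok2_ex F : ok2 F -> ok (fun u => ex (fun v => F u v)).
Proof.
move=> hF; have [mF [B hB]] := hF; split; first exact: mxmeas2_ex.
exists B => x Gx; rewrite ler_norml -{1}(ex_cst (- B)) -{2}(ex_cst B).
apply/andP; split; apply: ex_le; try exact: ok_cst; try exact: ok2_ok.
- by move=> y Gy; have := hB _ _ Gx Gy; rewrite ler_norml => /andP[].
- by move=> y Gy; have := hB _ _ Gx Gy; rewrite ler_norml => /andP[].
Qed.

(** The product of P with itself provides an independent copy of U. Exchanging the two expectations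
    is what later makes a random conjugate preserve the law of U. *)
Lemma ex_fubini F : ok2 F ->
  ex (fun u => ex (fun v => F u v)) = ex (fun v => ex (fun u => F u v)).
Proof.
move=> hF; have [mF [B hB]] := hF.
have fin (H : 'M[C]_D -> R) : ok H -> (\int[P]_w (H (U w))%:E)%E = (ex H)%:E.
  move=> hH; rewrite /ex /Rintegral fineK //.
  exact: (integrable_fin_num measurableT (ok_int hH)).
apply: EFin_inj; rewrite -!fin; [|exact/ok2_ex/ok2_swap|exact: ok2_ex].
transitivity (\int[P]_w \int[P]_w' (F (U w) (U w'))%:E)%E.
  by apply: eq_integral => w _; rewrite fin //; exact: ok2_ok.
transitivity (\int[P]_w' \int[P]_w (F (U w) (U w'))%:E)%E; last first.
  by apply: eq_integral => w _; rewrite (fin (fun u => F u (U w))) //; exact: (ok2_ok (hU w) (ok2_swap hF)).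
pose f (p : T * T) := F (U p.1) (U p.2).
have : (P \x P)%E.-integrable [set: T * T] (EFin \o f).
  apply: measurable_bounded_integrable => //.
  - have e : ((P \x P) [set: T * T] = 1)%E.
      rewrite -setXTT product_measure1E //.
      rewrite -[RHS]mule1; congr (_ * _)%E; exact: probability_setT.
    by move: (ltry (1 : R)); rewrite -e.
  - apply: (measurableT_comp (f := fun p : mxT * mxT => F p.1 p.2) (g := fun p => (U p.1, U p.2)) mF).
    by apply: measurable_fun_pair; [exact: (measurableT_comp mU' measurable_fst)|exact: (measurableT_comp mU' measurable_snd)].
  - exists B; split; first exact: num_real.
    by move=> M BM w _ /=; apply: (le_trans (hB _ _ (hU _) (hU _))); exact: ltW.
by move/Fubini.
Qed.
End Haar.

(** * Second moments *)

Section Cov.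
Variables (R : realType) (D : nat) (J : finType) (blk : 'I_D -> J).
Local Notation C := R[i].
Local Notation mxT := (mxT R D).
Local Notation G := (@block_unitary R D J blk).
Local Notation Pi := (Pi R blk).
Implicit Types (X Y g x : 'M[C]_D).

Lemma Pi_mul j (A : 'M[C]_D) a b : (Pi j *m A) a b = (blk a == j)%:R * A a b.
Proof.
rewrite mxE (bigD1 a) //= mxE eqxx /= big1 ?addr0 // => k ka.
by rewrite mxE eq_sym (negbTE ka) mul0r.
Qed.
Lemma mul_Pi j (A : 'M[C]_D) a b : (A *m Pi j) a b = A a b * (blk b == j)%:R.
Proof.
rewrite mxE (bigD1 b) //= mxE eqxx /= big1 ?addr0 // => k kb.
by rewrite mxE (negbTE kb) mulr0.
Qed.
Lemma Pi_comm g j : G g -> Pi j *m g = g *m Pi j.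
Proof.
move=> [_ hg]; apply/matrixP => a b; rewrite Pi_mul mul_Pi.
have [e|ne] := eqVneq (blk a) (blk b); first by rewrite e mulrC.
by rewrite hg // mulr0 mul0r.
Qed.
Lemma adj_Pi j : adj (Pi j) = Pi j.
Proof.
apply/matrixP => a b; rewrite hadjE !mxE rmorph_nat eq_sym.
by case: eqP => [->|//].
Qed.
Lemma tr_Pi j (A : 'M[C]_D) : \tr (Pi j *m A) = \sum_(a | blk a == j) A a a.
Proof.
rewrite /mxtrace [RHS]big_mkcond; apply: eq_bigr => a _; rewrite Pi_mul.
by case: ifP; rewrite ?mul1r ?mul0r.
Qed.

Lemma G_entry x i j : G x -> n2 (x i j) <= 1.
Proof.
move=> [ux _]; have : (adj x *m x) j j = 1 by rewrite ux mxE eqxx.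
rewrite mxE => /(congr1 (@complex.Re R)); rewrite cRe_sum /= => <-.
under eq_bigr do rewrite hadjE -n2E'.
by rewrite (bigD1 i) //= lerDl sumr_ge0 // => k _; exact: n2_ge0.
Qed.
Lemma n2_normRe (z : C) : n2 z <= 1 -> `|Re z| <= 1.
Proof.
rewrite /n2 => h; rewrite -[leRHS]ger0_norm // -ler_sqr ?nnegrE // ?real_normK ?num_real //.
by rewrite -ler_sqrt // !sqrtr_sqr normr1 ?normr_id; rewrite -[leRHS]sqrtr1 -sqrtr_sqr ler_sqrt // ; have := sqr_ge0 (Im z); lra.
Qed.

Variables (d : measure_display) (T : measurableType d) (P : probability T R)
  (U : T -> 'M[C]_D).
Hypothesis hU : forall w, G (U w).
Hypothesis mU : forall A, mxBorel A -> measurable (U @^-1` A).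
Hypothesis iU : forall g, G g -> forall A, mxBorel A ->
     P ((fun w => g *m U w) @^-1` A) = P (U @^-1` A).
Local Notation ok := (@ok R D J blk).
Local Notation ex := (@ex R D d T P U).

Definition okC (F : 'M[C]_D -> C) := ok (fun x => Re (F x)) /\ ok (fun x => Im (F x)).
Definition cex (F : 'M[C]_D -> C) : C := Complex (ex (fun x => Re (F x))) (ex (fun x => Im (F x))).

Lemma okC_cst c : okC (fun=> c).
Proof. by split; exact: ok_cst. Qed.
Lemma okCD F F' : okC F -> okC F' -> okC (fun x => F x + F' x).
Proof.
move=> [f1 f2] [g1 g2]; split.
- by under eq_fun do rewrite cReD; exact: okD.
- by under eq_fun do rewrite cImD; exact: okD.
Qed.
Lemma okCM F F' : okC F -> okC F' -> okC (fun x => F x * F' x).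
Proof.
move=> [f1 f2] [g1 g2]; split.
- by under eq_fun do rewrite cReM; apply: okB; exact: okM.
- by under eq_fun do rewrite cImM; apply: okD; exact: okM.
Qed.
Lemma okCJ F : okC F -> okC (fun x => (F x)^*).
Proof.
move=> [f1 f2]; split.
- by under eq_fun do rewrite cReJ.
- by under eq_fun do rewrite cImJ; exact: okN.
Qed.
Lemma okC_sum (I : Type) (r : seq I) (p : pred I) (F : I -> 'M[C]_D -> C) :
  (forall i, okC (F i)) -> okC (fun x => \sum_(i <- r | p i) F i x).
Proof.
move=> hF; elim: r => [|i r IH].
  by under eq_fun do rewrite big_nil; exact: okC_cst.
under eq_fun do rewrite big_cons.
by case: (p i) => //; exact: okCD.
Qed.
Lemma okC_entry a b : okC (fun x => x a b).
Proof.
have [h1 h2] := cmeas_entry R a b.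
split; split => //; exists 1 => x Gx; have := G_entry a b Gx; first exact: n2_normRe.
by move=> h; have := @n2_normRe ('i%C * x a b); rewrite n2M cReM /= mul0r mul1r sub0r normrN; apply; rewrite /n2 /= expr0n expr1n add0r mul1r.
Qed.
Lemma okC_mulmx m n p (F : 'M[C]_D -> 'M[C]_(m, n)) (H : 'M[C]_D -> 'M[C]_(n, p)) :
  (forall a b, okC (fun x => F x a b)) -> (forall a b, okC (fun x => H x a b)) ->
  forall a b, okC (fun x => (F x *m H x) a b).
Proof.
move=> hF hH a b; under eq_fun do rewrite mxE.
by apply: okC_sum => k; exact: okCM.
Qed.
Lemma okC_conj X a b : okC (fun x => (x *m X *m adj x) a b).
Proof.
apply: okC_mulmx => {a b} a b; last by under eq_fun do rewrite hadjE; apply/okCJ/okC_entry.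
by apply: okC_mulmx => {a b} a b; [exact: okC_entry|exact: okC_cst].
Qed.
Lemma cex_cst c : cex (fun=> c) = c.
Proof. by rewrite /cex !ex_cst; case: c. Qed.
Lemma cexD F F' : okC F -> okC F' -> cex (fun x => F x + F' x) = cex F + cex F'.
Proof.
move=> [f1 f2] [g1 g2]; apply: ceqP; rewrite ?cReD ?cImD /= -(exD P hU mU) //.
- by congr ex; apply/funext => x; rewrite cReD.
- by congr ex; apply/funext => x; rewrite cImD.
Qed.
Lemma cexZ c F : okC F -> cex (fun x => c * F x) = c * cex F.
Proof.
move=> [f1 f2]; apply: ceqP; rewrite ?cReM ?cImM /= -!(exZ P hU mU) //.
- rewrite -(exB P hU mU) //; try exact: okZ.
  by congr ex; apply/funext => x; rewrite cReM.
- rewrite -(exD P hU mU) //; try exact: okZ.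
  by congr ex; apply/funext => x; rewrite cImM.
Qed.
Lemma cex_sum (I : Type) (r : seq I) (p : pred I) (F : I -> 'M[C]_D -> C) :
  (forall i, okC (F i)) ->
  cex (fun x => \sum_(i <- r | p i) F i x) = \sum_(i <- r | p i) cex (F i).
Proof.
move=> hF; elim: r => [|i r IH].
  by rewrite big_nil -[RHS](cex_cst 0); congr cex; apply/funext => x; rewrite big_nil.
rewrite big_cons; case: ifP => pi; last first.
  by rewrite -IH; congr cex; apply/funext => x; rewrite big_cons pi.
rewrite -IH -cexD //; last exact: okC_sum.
by congr cex; apply/funext => x; rewrite big_cons pi.
Qed.
Lemma eq_cex F F' : (forall x, G x -> F x = F' x) -> cex F = cex F'.
Proof. by move=> h; apply: ceqP => /=; apply: (eq_ex P hU) => x Gx; rewrite h. Qed.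
Lemma cex_inv F g : G g -> okC F -> cex (fun x => F (g *m x)) = cex F.
Proof.
move=> hg [f1 f2]; apply: ceqP => /=.
- exact: (ex_inv hU mU iU hg f1).
- exact: (ex_inv hU mU iU hg f2).
Qed.

Lemma G_diag (z : 'I_D -> C) : (forall i, n2 (z i) = 1) -> G (diag_mx (\row_i z i)).
Proof.
move=> hz; split.
  apply/matrixP => a b; rewrite mul_mx_diag !mxE eq_sym.
  case: (b =P a) => [->|ba]; first by rewrite eqxx !mulr1n -n2E hz toC1.
  by case: (a =P b) => [ab|_]; [case: ba|rewrite mulr0n conjC0 mul0r].
move=> a b ab; rewrite !mxE; case: (a =P b) => [e|//].
by move: ab; rewrite e eqxx.
Qed.

Lemma G_perm (s : 'S_D) : (forall i, blk (s i) = blk i) -> G (perm_mx s).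
Proof.
move=> hs; split.
  have e : adj (perm_mx s : 'M[C]_D) = perm_mx s^-1.
    rewrite -tr_perm_mx; apply/matrixP => a b; rewrite hadjE !mxE.
    by rewrite rmorph_nat.
  by rewrite /unitary e -perm_mxM mulVg perm_mx1.
move=> a b ab; rewrite !mxE; case: (s a =P b) => //= e.
by move: ab; rewrite -e hs eqxx.
Qed.

Section Twirl.
Variables X Y : 'M[C]_D.
Let ZX x := x *m X *m adj x.
Let ZY x := x *m Y *m adj x.
(** The second moments of the randomly conjugated [X] and [Y]. Invariance under a few explicit block
    unitaries g turns into linear relations between these numbers, and the relations determine them
    when [X] is blockwise traceless. *)
Definition covT a b c e := cex (fun x => ZX x a b * (ZY x c e)^*).

Lemma covT_ok a b c e : okC (fun x => ZX x a b * (ZY x c e)^*).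
Proof. by apply: okCM; [exact: okC_conj|apply/okCJ/okC_conj]. Qed.

Lemma conj_G (W : 'M[C]_D) g x :
  (g *m x) *m W *m adj (g *m x) = g *m (x *m W *m adj x) *m adj g.
Proof. by rewrite hadjM !mulmxA. Qed.

Lemma covT_inv g a b c e : G g ->
  covT a b c e = cex (fun x => (g *m ZX x *m adj g) a b * ((g *m ZY x *m adj g) c e)^*).
Proof.
move=> hg; rewrite /covT -(cex_inv hg (covT_ok a b c e)).
by congr cex; apply/funext => x; rewrite /ZX /ZY !conj_G.
Qed.

Lemma covT_phase p a b c e (ph : 'I_D -> C) :
  (forall i, ph i = if i == p then 'i%C else 1) ->
  covT a b c e = ph a * (ph b)^* * (ph c)^* * ph e * covT a b c e.
Proof.
move=> hph; have hg : G (diag_mx (\row_i ph i)).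
  apply: G_diag => i; rewrite hph; case: ifP => _; rewrite /n2 /=; ring.
rewrite {1}(covT_inv _ _ _ _ hg) -cexZ; last exact: covT_ok.
congr cex; apply/funext => x.
have e1 (Z : 'M[C]_D) i k : (diag_mx (\row_i ph i) *m Z *m adj (diag_mx (\row_i ph i))) i k
    = ph i * Z i k * (ph k)^*.
  have -> : adj (diag_mx (\row_i ph i)) = diag_mx (\row_i (ph i)^*).
    apply/matrixP => u v; rewrite hadjE !mxE eq_sym.
    by case: eqP => [->|_]; rewrite ?mulr1n ?mulr0n ?conjC0.
  by rewrite mul_mx_diag mul_diag_mx !mxE.
rewrite !e1; move: (ph a) (ph b) (ph c) (ph e) (ZX x a b) (ZY x c e) => z1 z2 z3 z4 z5 z6.
rewrite !rmorphM /= conjCK; ring.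
Qed.

(** Multiplying one coordinate by i multiplies the moment by a product of powers of i. Unless the
    indices pair up, some coordinate gives a factor i, -i or -1, all different from 1; the cases
    locate that coordinate. *)
Lemma covT0 a b c e : ~~ ((a == b) && (c == e)) -> ~~ ((a == c) && (b == e)) ->
  covT a b c e = 0.
Proof.
move=> h1 h2.
have z0 z (t : C) : z != 1 -> t = z * t -> t = 0.
  move=> z1 /eqP; rewrite -subr_eq0 -{1}[t]mul1r -mulrBl mulf_eq0 subr_eq0 eq_sym (negbTE z1).
  by move/eqP.
have i1 : 'i%C != 1 :> C by apply/eqP => -[] /eqP; rewrite eq_sym oner_eq0.
have i2 : ('i%C)^* != 1 :> C by rewrite conjE; apply/eqP => -[] /eqP; rewrite eq_sym oner_eq0.
have i3 : 'i%C * 'i%C != 1 :> C.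
  by rewrite -expr2 sqr_i; apply/eqP => -[] /eqP; rewrite -subr_eq0 -opprD oppr_eq0 (_ : 1 + 1 = 2%:R) // pnatr_eq0.
pose ph p := fun i : 'I_D => if i == p then 'i%C else 1 : C.
have [ab|ab] := eqVneq a b.
  have ce : c != e by move: h1; rewrite ab eqxx.
  apply: (z0 _ _ i2); rewrite {1}(@covT_phase c a b c e (ph c)) // /ph ab eqxx eq_sym [e == c]eq_sym (negbTE ce).
  case: (c == b); rewrite ?conjC1 ?mulr1 ?mul1r //.
  have -> : 'i%C * 'i%C^* = 1 :> C by rewrite mulrC -n2E /n2 /= expr0n expr1n add0r.
  by rewrite mul1r.
have [ac|ac] := eqVneq a c.
  have be : b != e by move: h2; rewrite ac eqxx.
  apply: (z0 _ _ i2); rewrite {1}(@covT_phase b a b c e (ph b)) // /ph eqxx -ac (negbTE ab) [e == b]eq_sym (negbTE be).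
  by rewrite conjC1 !mulr1 mul1r.
have [ae|ae] := eqVneq a e.
  apply: (z0 _ _ i3); rewrite {1}(@covT_phase a a b c e (ph a)) // /ph eqxx -ae eqxx ![_ == a]eq_sym (negbTE ab) (negbTE ac).
  by rewrite !conjC1 !mulr1.
apply: (z0 _ _ i1); rewrite {1}(@covT_phase a a b c e (ph a)) // /ph eqxx ![_ == a]eq_sym (negbTE ab) (negbTE ac) (negbTE ae).
by rewrite !conjC1 !mulr1.
Qed.

Lemma covT_perm (s : 'S_D) a b c e : (forall i, blk (s i) = blk i) ->
  covT a b c e = covT (s a) (s b) (s c) (s e).
Proof.
move=> hs; rewrite (covT_inv _ _ _ _ (G_perm hs)) [in RHS]/covT; congr cex; apply/funext => x.
have e1 (Z : 'M[C]_D) i k : (perm_mx s *m Z *m adj (perm_mx s)) i k = Z (s i) (s k).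
  have -> : adj (perm_mx s : 'M[C]_D) = perm_mx s^-1.
    by rewrite -tr_perm_mx; apply/matrixP => u v; rewrite hadjE !mxE rmorph_nat.
  by rewrite -row_permE -col_permE !mxE.
by rewrite (e1 (ZX x)) (e1 (ZY x)).
Qed.

Lemma tperm_blk p q : blk p = blk q -> forall i, blk (tperm p q i) = blk i.
Proof. by move=> e i; case: tpermP => // ->. Qed.

(** One transposition carries a to a'. The image b2 of b stays in its block and differs from a', so
    a second transposition carries it to b' without moving a'. *)
Lemma covT_offdiag a b a' b' : a != b -> a' != b' -> blk a = blk a' -> blk b = blk b' ->
  covT a b a b = covT a' b' a' b'.
Proof.
move=> ab ab' ea eb.
rewrite (covT_perm _ _ _ _ (tperm_blk ea)) tpermL.
set b2 := tperm a a' b.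
have eb2 : blk b2 = blk b' by rewrite /b2 (tperm_blk ea).
have ab2 : a' != b2.
  by rewrite /b2; apply: contra_neq ab => h; apply: (perm_inj (s := tperm a a')); rewrite tpermL.
rewrite (covT_perm _ _ _ _ (tperm_blk eb2)) tpermL tpermD // eq_sym //.
Qed.

Lemma covT_diag a a' : blk a = blk a' -> covT a a a a = covT a' a' a' a'.
Proof. by move=> ea; rewrite (covT_perm _ _ _ _ (tperm_blk ea)) tpermL. Qed.

Lemma covT_diag2 a a' c : blk a = blk a' -> a != c -> a' != c ->
  covT a a c c = covT a' a' c c.
Proof.
by move=> ea ac ac'; rewrite (covT_perm _ _ _ _ (tperm_blk ea)) tpermL tpermD.
Qed.

Lemma covT_expand (I : Type) (r : seq I) (f h : I -> 'I_D) (z : I -> C) p g :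
  G g ->
  (forall W : 'M[C]_D, (g *m W *m adj g) p p = \sum_(i <- r) z i * W (f i) (h i)) ->
  covT p p p p = \sum_(i <- r) \sum_(k <- r) z i * (z k)^* * covT (f i) (h i) (f k) (h k).
Proof.
move=> hg hz; rewrite (covT_inv _ _ _ _ hg).
transitivity (cex (fun x => \sum_(i <- r) \sum_(k <- r)
   (z i * (z k)^*) * (ZX x (f i) (h i) * (ZY x (f k) (h k))^*))).
  congr cex; apply/funext => x; rewrite (hz (ZX x)) (hz (ZY x)) rmorph_sum mulr_suml.
  apply: eq_bigr => i _; rewrite mulr_sumr; apply: eq_bigr => k _.
  by rewrite rmorphM /= mulrACA.
rewrite cex_sum; last by move=> i; apply: okC_sum => k; apply: okCM; [exact: okC_cst|exact: covT_ok].
apply: eq_bigr => i _.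
rewrite cex_sum; last by move=> k; apply: okCM; [exact: okC_cst|exact: covT_ok].
by apply: eq_bigr => k _; rewrite cexZ //; exact: covT_ok.
Qed.

(** The reflection along e_p + 2 e_q, of squared norm 5: its entries 3/5 and 4/5 are rational, so
    that a rotation mixing two coordinates is available without square roots. *)
Lemma householder p q : p != q -> blk p = blk q ->
  exists2 g : 'M[C]_D, G g & row p g = (3%:R / 5%:R) *: delta_mx 0 p + (- (4%:R / 5%:R)) *: delta_mx 0 q.
Proof.
move=> pq epq.
have qp : q != p by rewrite eq_sym.
pose w : 'cV[C]_D := delta_mx p 0 + 2%:R *: delta_mx q 0.
have aw : adj w = delta_mx 0 p + 2%:R *: delta_mx 0 q.
  by apply/matrixP => i k; rewrite hadjE !mxE rmorphD rmorphM /= !rmorph_nat !(andbC (_ == 0)).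
have ww : adj w *m w = (5%:R)%:M.
  rewrite aw mulmxDl !mulmxDr -!scalemxAl -!scalemxAr !mul_delta_mx_cond !eqxx (negbTE pq) (negbTE qp) !mulr0n !mulr1n !scaler0 !addr0.
  apply/matrixP => i k; rewrite !ord1 !mxE !eqxx; ring.
pose k5 : C := 2%:R / 5%:R.
have k5J : k5^* = k5 by rewrite rmorphM /= fmorphV /= !rmorph_nat.
pose g : 'M[C]_D := 1%:M - k5 *: (w *m adj w).
have ag : adj g = g by rewrite /g hadjB hadj1 hadjZ k5J hadjM hadjK.
have hg : G g.
  split.
    rewrite /unitary ag /g mulmxBl mul1mx mulmxBr mulmx1 -scalemxAl -scalemxAr.
    rewrite mulmxA -(mulmxA w (adj w) w) ww mul_mx_scalar -scalemxAl !scalerA opprB.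
    rewrite -addrA -[RHS]addr0; congr (_ + _).
    by rewrite -!scaleNr -!scalerDl (_ : _ + _ = 0) ?scale0r // /k5; field.
  move=> i k ik; rewrite /g !mxE big_ord1 aw !mxE.
  have /negbTE ik' : i != k by apply: contra_neq ik => ->.
  rewrite ik' !eqxx !andbT !andTb.
  have ni : (i == p) || (i == q) -> (k == p) = false /\ (k == q) = false.
    move=> hi; split; apply/negbTE; apply: contra_neq ik => ->;
      by case/orP: hi => /eqP ->; rewrite ?epq.
  case: (boolP ((i == p) || (i == q))) => [/ni[-> ->]|]; first by rewrite mulr0 addr0 mulr0 mulr0 subr0.
  by rewrite negb_or => /andP[/negbTE -> /negbTE ->]; rewrite mulr0 addr0 mul0r mulr0 subr0.
exists g; first exact: hg.
apply/matrixP => i k; rewrite ord1 !mxE big_ord1 aw !mxE !eqxx !andbT !andTb (negbTE pq) mulr0 addr0.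
  case: (eqVneq k p) => [->|kp].
    by rewrite (negbTE pq) /k5 /= ?mulr1n ?mulr0n; field.
  by case: (k == q); rewrite /k5 /= ?mulr1n ?mulr0n; field.
Qed.

Lemma conj_row2 (g W : 'M[C]_D) p q (al be : C) : q != p ->
  row p g = al *: delta_mx 0 p + be *: delta_mx 0 q -> al^* = al -> be^* = be ->
  (g *m W *m adj g) p p =
    \sum_(i <- [:: (p, p); (p, q); (q, p); (q, q)])
      ((if i.1 == p then al else be) * (if i.2 == p then al else be)) * W i.1 i.2.
Proof.
move=> qp rg alJ beJ.
have -> : (g *m W *m adj g) p p = (row p g *m W *m adj (row p g)) 0 0.
  by rewrite -row_mul !mxE; apply: eq_bigr => k _; rewrite !hadjE !mxE.
have ad a : adj (delta_mx 0 a : 'rV[C]_D) = delta_mx a 0.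
  by apply/matrixP => i k; rewrite hadjE !mxE andbC rmorph_nat.
rewrite rg hadjD !hadjZ alJ beJ !ad !(mulmxDl, mulmxDr) -!(scalemxAl, scalemxAr) -!rowE -!colE.
have zE (z : C) (Z : 'M[C]_1) : (z *: Z) 0 0 = z * Z 0 0 by rewrite mxE.
have crE i k : (col k (row i W)) 0 0 = W i k by rewrite !mxE.
rewrite !(addmxE, zE, crE).
rewrite !big_cons big_nil /= !eqxx (negbTE qp).
move: (W p p) (W p q) (W q p) (W q q) => w1 w2 w3 w4; ring.
Qed.

Lemma householder2 p q : p != q -> blk p = blk q ->
  exists (g : 'M[C]_D) (al be : C), [/\ G g, row p g = al *: delta_mx 0 p + be *: delta_mx 0 q,
    al^* = al, be^* = be & al * al = 9%:R / 25%:R /\ be * be = 16%:R / 25%:R].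
Proof.
move=> pq epq; have [g hg rg] := householder pq epq.
exists g, (3%:R / 5%:R), (- (4%:R / 5%:R)); split => //.
- by rewrite rmorphM /= fmorphV /= !rmorph_nat.
- by rewrite rmorphN rmorphM /= fmorphV /= !rmorph_nat.
- by split; field.
Qed.

(** Permutations and phases leave three unknowns in a block: s on the diagonal, r between two
    diagonal entries, and the off-diagonal variance. Expanding s after the reflection gives (1 -
    al^4 - be^4) s = 2 al^2 be^2 (r + q'), and both coefficients equal 288/625. *)
Lemma covT_rot p q : p != q -> blk p = blk q ->
  covT p p p p = covT p p q q + covT p q p q.
Proof.
move=> pq epq; have qp : q != p by rewrite eq_sym.
have [g [al [be [hg rg alJ beJ [aa bb]]]]] := householder2 pq epq.
have hz (W : 'M[C]_D) := conj_row2 W qp rg alJ beJ.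
have z a b c e : ~~ ((a == b) && (c == e)) && ~~ ((a == c) && (b == e)) -> covT a b c e = 0.
  by case/andP; exact: covT0.
have := covT_expand hg hz.
rewrite !big_cons !big_nil /= !eqxx (negbTE qp) !rmorphM /= !alJ !beJ.
rewrite (z p p p q) ?(z p p q p) ?(z p q p p) ?(z p q q p) ?(z p q q q) ?(z q p p p)
  ?(z q p p q) ?(z q p q q) ?(z q q p q) ?(z q q q p); try by rewrite ?eqxx ?(negbTE pq) ?(negbTE qp).
have -> : covT q q p p = covT p p q q.
  by rewrite (covT_perm _ _ _ _ (tperm_blk epq)) tpermL tpermR.
rewrite -(covT_diag epq) (covT_offdiag qp pq) //.
move: (covT p p p p) (covT p p q q) (covT p q p q) => s r q'.
rewrite ?mulr0 ?addr0 ?add0r (mulrACA al be al be) (mulrACA be al be al) aa bb => h.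
suff : (288%:R / 625%:R : C) * (s - (r + q')) = 0.
  by move/eqP; rewrite mulf_eq0 subr_eq0 => /orP[|/eqP//]; rewrite mulf_eq0 invr_eq0 !pnatr_eq0.
rewrite mulrBr; apply/eqP; rewrite subr_eq0; apply/eqP.
have -> : 288%:R / 625%:R * s = s - 337%:R / 625%:R * s by field.
by rewrite {1}h; field.
Qed.

Definition centered (W : 'M[C]_D) := forall j : J, \sum_(a | blk a == j) W a a = 0.

Lemma tr_conj_Pi x (W : 'M[C]_D) j : G x ->
  \sum_(a | blk a == j) (x *m W *m adj x) a a = \sum_(a | blk a == j) W a a.
Proof.
move=> hx; rewrite -!tr_Pi mulmxA mxtrace_mulC !mulmxA -(mulmxA (adj x)) Pi_comm //.
by rewrite mulmxA (proj1 hx) mul1mx.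
Qed.

(** Conjugation by a block unitary preserves the trace of each diagonal block, and those of [X]
    vanish. *)
Lemma covT_tr0 j c e : centered X -> \sum_(a | blk a == j) covT a a c e = 0.
Proof.
move=> hX; rewrite -cex_sum; last by move=> i; exact: covT_ok.
rewrite -[RHS](cex_cst 0); apply: eq_cex => x hx.
by rewrite -mulr_suml tr_conj_Pi // hX mul0r.
Qed.

(** The Hilbert-Schmidt product of the (j, j') blocks of [X] and [Y]. It is invariant under
    conjugation by block unitaries, hence also the sum of the corresponding second moments. *)
Definition blkS j j' : C := \sum_(a | blk a == j) \sum_(b | blk b == j') X a b * (Y a b)^*.

Lemma blkSE (V W : 'M[C]_D) j j' :
  \sum_(a | blk a == j) \sum_(b | blk b == j') V a b * (W a b)^* = \tr (Pi j *m V *m Pi j' *m adj W).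
Proof.
rewrite -!mulmxA tr_Pi; apply: eq_bigr => a _; rewrite mxE [LHS]big_mkcond.
apply: eq_bigr => b _; rewrite Pi_mul hadjE.
by case: ifP => _; rewrite ?mul1r ?mul0r ?mulr0.
Qed.

Lemma covT_S j j' : \sum_(a | blk a == j) \sum_(b | blk b == j') covT a b a b = blkS j j'.
Proof.
transitivity (cex (fun x => \sum_(a | blk a == j) \sum_(b | blk b == j') ZX x a b * (ZY x a b)^*)).
  rewrite cex_sum; last by move=> i; apply: okC_sum => k; exact: covT_ok.
  by apply: eq_bigr => a _; rewrite cex_sum // => k; exact: covT_ok.
rewrite -[RHS]cex_cst; apply: eq_cex => x hx.
rewrite /blkS !blkSE /ZX /ZY !hadjM hadjK !mulmxA Pi_comm // -(mulmxA _ (adj x) (Pi j')).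
rewrite -(Pi_comm j' (G_adj hx)) !mulmxA -(mulmxA _ (adj x) x) (proj1 hx) mulmx1.
by rewrite mxtrace_mulC !mulmxA (proj1 hx) mul1mx.
Qed.

Lemma bdimE j : (bdim blk j)%:R = \sum_(a | blk a == j) 1 :> C.
Proof.
rewrite /bdim -sum1_card natr_sum; apply: eq_bigl => a.
by apply/idP/idP; rewrite inE.
Qed.

Lemma bdim_sum (F : 'I_D -> C) j z : (forall a, blk a = j -> F a = z) ->
  \sum_(a | blk a == j) F a = (bdim blk j)%:R * z.
Proof.
move=> h; rewrite bdimE mulr_suml; apply: eq_bigr => a /eqP ja.
by rewrite mul1r h.
Qed.

Lemma bdim_sum1 (F : 'I_D -> C) a z : (forall a', blk a' = blk a -> a' != a -> F a' = z) ->
  \sum_(a' | blk a' == blk a) F a' = F a + ((bdim blk (blk a))%:R - 1) * z.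
Proof.
move=> h; rewrite (bigD1 a) //=; congr (_ + _).
have -> : (bdim blk (blk a))%:R - 1 = \sum_(i | (blk i == blk a) && (i != a)) 1 :> C.
  rewrite bdimE [X in X - 1](bigD1 a) //=; ring.
rewrite mulr_suml; apply: eq_bigr => a' /andP[/eqP e ne].
by rewrite mul1r h.
Qed.

(** Three linear equations for the three unknowns of a block of size n: the vanishing trace gives s
    + (n - 1) r = 0, the conserved norm gives n s + n (n - 1) q = [blkS], and the reflection gives s
    = r + q. *)
Lemma covT_same a b : centered X -> a != b -> blk a = blk b ->
  let n : C := (bdim blk (blk a))%:R in
  [/\ (n * n - 1) * covT a b a b = blkS (blk a) (blk a),
      n * covT a a a a = (n - 1) * covT a b a b
    & covT a a a a = covT a a b b + covT a b a b].
Proof.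
move=> hX ab eab n; have rot := covT_rot ab eab.
have e2 : covT a a a a + (n - 1) * covT a a b b = 0.
  rewrite -(covT_tr0 (blk a) b b hX) eab (bdim_sum1 (z := covT a a b b)) -?eab //.
    by rewrite -(covT_diag eab).
  by move=> a' ea' ne; apply: covT_diag2 => //; rewrite ea'.
have e3 : n * covT a a a a + n * ((n - 1) * covT a b a b) = blkS (blk a) (blk a).
  rewrite -covT_S -mulrDr; symmetry; apply: bdim_sum => a' ea'.
  rewrite -ea' (bdim_sum1 (z := covT a b a b)); first by rewrite ea' (covT_diag ea').
  by move=> b' eb' ne; apply: covT_offdiag => //; rewrite ?eb' ?ea' // eq_sym.
have e4 : n * covT a a a a = (n - 1) * covT a b a b.
  by move: e2; rewrite rot; move: (covT a a b b) (covT a b a b) => r q h; rewrite -[RHS]add0r -h; ring.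
split => //; rewrite -e3 e4; ring.
Qed.

(** For a one-dimensional block j = j' this is the inverse of 0, that is 0, in accordance with the
    fact that a traceless block of size one is zero. *)
Definition kapC j j' : C := ((bdim blk j)%:R * (bdim blk j')%:R - (j == j')%:R)^-1.

Lemma bdim_card j : bdim blk j = #|[pred a | blk a == j]|.
Proof. by rewrite /bdim; apply: eq_card => a; apply/idP/idP; rewrite !inE. Qed.
Lemma bdim_gt0 a : (0 < bdim blk (blk a))%N.
Proof. by rewrite bdim_card; apply/card_gt0P; exists a; rewrite inE. Qed.
Lemma bdim_neq0 a : (bdim blk (blk a))%:R != 0 :> C.
Proof. by rewrite pnatr_eq0 -lt0n bdim_gt0. Qed.
Lemma bdim_gt1 a b : a != b -> blk a = blk b -> (1 < bdim blk (blk a))%N.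
Proof.
move=> ab e; rewrite bdim_card (cardD1 a) inE /= eqxx (cardD1 b) !inE.
by rewrite eq_sym ab /= e eqxx.
Qed.

(** The bracket is the kernel of the orthogonal projection onto the matrices with vanishing block
    traces, the shape that Schur's lemma predicts. The proof runs through the coincidences between
    the four indices. *)
Theorem covT_formula a b c e : centered X ->
  covT a b c e = kapC (blk a) (blk b) * blkS (blk a) (blk b) *
    (((a == c) && (b == e))%:R - ((a == b) && (c == e) && (blk a == blk c))%:R / (bdim blk (blk a))%:R).
Proof.
move=> hX.
have sq1 (x y : 'I_D) : x != y -> blk x = blk y ->
    (bdim blk (blk x))%:R * (bdim blk (blk x))%:R - 1 != 0 :> C.
  move=> xy exy; rewrite -natrM subr_eq0 pnatr_eq1.
  have := bdim_gt1 xy exy; case: (bdim _ _) => [|[|m]] //.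
have [ab|ab] := eqVneq a b; last first.
  rewrite !andFb mul0r subr0.
  have [ac|ac] := eqVneq a c; last by rewrite mulr0 covT0 // ?(negbTE ab) ?(negbTE ac).
  have [be|be] := eqVneq b e; last by rewrite andbF mulr0 covT0 // ?(negbTE ab) ?(negbTE be) ?andbF.
  rewrite -ac -be mulr1 /kapC.
  have [eab|eab] := eqVneq (blk a) (blk b).
    have [h _ _] := covT_same hX ab eab.
    by rewrite -eab -h mulKf // (sq1 _ _ ab).
  rewrite subr0 -covT_S (bdim_sum (z := (bdim blk (blk b))%:R * covT a b a b)).
    by rewrite (mulrA (bdim blk (blk a))%:R) mulKf // mulf_neq0 // bdim_neq0.
  move=> a' ea'; apply: bdim_sum => b' eb'; apply: covT_offdiag => //.
  by apply: contra_neq eab => ee; rewrite -ea' -eb' ee.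
rewrite -ab; have [ce|ce] := eqVneq c e; last first.
  rewrite andbF mul0r subr0 [_ && _](_ : _ = false) ?mulr0 ?covT0 ?eqxx ?(negbTE ce) //.
  - by apply/negP => /andP[/eqP h1 /eqP h2]; rewrite -h1 -h2 eqxx in ce.
  - by apply/negP => /andP[/eqP h1 /eqP h2]; rewrite -h1 -h2 eqxx in ce.
rewrite -ce andTb; have [ac|ac] := eqVneq a c.
  rewrite -ac eqxx andTb.
  (* In a one-dimensional block there is no partner index: the moment vanishes by centering, and the
     bracket is 1 - 1. *)
  have [[b' [ab' eab']]|no] := pselect (exists b', a != b' /\ blk a = blk b').
    have [<- e1 _] := covT_same hX ab' eab'.
    rewrite /kapC eqxx mulKf ?(sq1 _ _ ab') //.
    apply: (mulfI (bdim_neq0 a)); rewrite e1 /=; field; exact: bdim_neq0.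
  have e0 : covT a a a a = 0.
    rewrite -(covT_tr0 (blk a) a a hX) (bigD1 a) //= big1 ?addr0 // => a' /andP[/eqP e1 e2].
    by case: no; exists a'; rewrite eq_sym e1.
  have d1 : (bdim blk (blk a))%:R = 1 :> C.
    rewrite bdimE (bigD1 a) //= big1 ?addr0 // => a' /andP[/eqP e1 e2].
    by case: no; exists a'; rewrite eq_sym e1.
  by rewrite e0 d1 divr1 subrr mulr0.
rewrite andFb; have [eac|eac] := eqVneq (blk a) (blk c); last first.
  rewrite mul0r subrr mulr0; apply: (mulfI (bdim_neq0 a)); rewrite mulr0.
  rewrite -(covT_tr0 (blk a) c c hX); symmetry; apply: bdim_sum => a' ea'.
  by apply: covT_diag2 => //; apply: contra_neq eac => <-.
have [<- e1 e2] := covT_same hX ac eac.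
rewrite /kapC eqxx mulKf ?(sq1 _ _ ac) //.
apply: (mulfI (bdim_neq0 a)).
have -> : covT a a c c = covT a a a a - covT a c a c by rewrite e2 addrK.
by rewrite mulrBr e1 /=; field; exact: bdim_neq0.
Qed.

End Twirl.

(** The identity is fixed by conjugation, so first moments are second moments against Y = 1, and
    [blkS] against 1 is a block trace of [X]. *)
Lemma cex_conj0 X a b : centered X -> cex (fun x => (x *m X *m adj x) a b) = 0.
Proof.
move=> hX; transitivity (covT X 1%:M a b a a).
  by apply: eq_cex => x hx; rewrite mulmx1 (unitary_r (proj1 hx)) [X in _ * X^*](_ : _ = 1) ?conjC1 ?mulr1 // mxE eqxx.
rewrite covT_formula // (_ : blkS _ _ _ _ = 0) ?mulr0 ?mul0r //.
rewrite /blkS; have [<-|ne] := eqVneq (blk a) (blk b).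
  rewrite -[RHS](hX (blk a)); apply: eq_bigr => i ei; rewrite (bigD1 i) //= big1 => [|k /andP[_ ki]].
    by rewrite mxE eqxx conjC1 mulr1 addr0.
  by rewrite mxE eq_sym (negbTE ki) conjC0 mulr0.
rewrite big1 // => i /eqP ei; rewrite big1 // => k /eqP ek; rewrite mxE.
by rewrite (_ : (i == k) = false) ?conjC0 ?mulr0 //; apply/eqP => ik; move: ne; rewrite -ei -ek ik eqxx.
Qed.

End Cov.

(** * Real inequalities *)

Section Calculus.
Variable R : realType.
Implicit Types x y z : R.

(** Drives the Taylor bounds below: for sin, cos and exp, each bound is the sign of the derivative
    in the next one. *)
Lemma ge0_mvt (f df : R -> R) x : 0 <= x -> (forall y, is_derive y 1 f (df y)) ->
  (forall y, 0 <= y -> 0 <= df y) -> f 0 <= f x.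
Proof.
move=> x0 hd hdf.
have cf : {within `[0, x], continuous f}.
  apply: derivable_within_continuous => y _; exact: (@ex_derive _ _ _ _ _ _ _ (hd y)).
have [c + e] := @MVT_segment R f df 0 x x0 (fun y _ => hd y) cf.
rewrite in_itv /= => /andP[c0 _].
by rewrite -subr_ge0 e subr0 mulr_ge0 // hdf.
Qed.

Lemma sin_le x : 0 <= x -> sin x <= x.
Proof.
move=> x0; have := @ge0_mvt (fun y => y - sin y) (fun y => 1 - cos y) x x0.
rewrite sin0 subrr => h; rewrite -subr_ge0; apply: h => y _.
by rewrite subr_ge0 cos_le1.
Qed.
Lemma cos_ge x : 0 <= x -> 1 - x ^+ 2 / 2 <= cos x.
Proof.
move=> x0; have := @ge0_mvt (fun y => cos y - 1 + y ^+ 2 / 2) (fun y => y - sin y) x x0.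
rewrite cos0 subrr expr0n mul0r addr0 => h; rewrite -subr_ge0.
rewrite (_ : cos x - _ = cos x - 1 + x ^+ 2 / 2); last by ring.
apply: h => [y|y y0]; last by rewrite subr_ge0 sin_le.
by apply: is_derive_eq; rewrite /GRing.scale /=; field.
Qed.
Lemma sin_ge x : 0 <= x -> x - x ^+ 3 / 6 <= sin x.
Proof.
move=> x0; have := @ge0_mvt (fun y => sin y - y + y ^+ 3 / 6) (fun y => cos y - 1 + y ^+ 2 / 2) x x0.
rewrite sin0 subrr expr0n mul0r addr0 => h; rewrite -subr_ge0.
rewrite (_ : sin x - _ = sin x - x + x ^+ 3 / 6); last by ring.
apply: h => [y|y y0]; last by have := cos_ge y0; lra.
by apply: is_derive_eq; rewrite /GRing.scale /=; field.
Qed.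
Lemma cos_le x : 0 <= x -> cos x <= 1 - x ^+ 2 / 2 + x ^+ 4 / 24.
Proof.
move=> x0; have := @ge0_mvt (fun y => 1 - y ^+ 2 / 2 + y ^+ 4 / 24 - cos y)
  (fun y => sin y - (y - y ^+ 3 / 6)) x x0.
rewrite cos0 !expr0n !mul0r subr0 addr0 subrr => h; rewrite -subr_ge0.
apply: h => [y|y y0]; last by rewrite subr_ge0 sin_ge.
by apply: is_derive_eq; rewrite /GRing.scale /=; field.
Qed.

(** Otherwise sqrt 3 <= pi / 2, so its cosine is nonnegative, whereas the Taylor bound gives 1 - 3/2
    + 9/24 < 0. It yields pi^2 / 6 <= 2, the contribution of the phases to the constant 3. *)
Lemma pi2_lt12 : (pi : R) ^+ 2 < 12.
Proof.
rewrite ltNge; apply/negP => h.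
have s0 : 0 <= Num.sqrt (3 : R) by exact: sqrtr_ge0.
have s2 : Num.sqrt (3 : R) ^+ 2 = 3 by rewrite sqr_sqrtr.
have : 0 <= cos (Num.sqrt (3 : R)).
  apply: cos_ge0_pihalf; apply/andP; split.
    by apply: le_trans s0; rewrite lerNl oppr0 divr_ge0 // pi_ge0.
  rewrite -ler_sqr ?nnegrE // ?divr_ge0 ?pi_ge0 // s2 expr_div_n; lra.
have s4 : Num.sqrt (3 : R) ^+ 4 = 9 by rewrite (exprM _ 2 2) s2 -natrX.
have := cos_le s0; rewrite s2 s4; lra.
Qed.

Lemma norm_sin_sub x : `|sin x - x| <= x ^+ 2 / 2.
Proof.
wlog x0 : x / 0 <= x => [h|].
  have [|/ltW] := leP 0 x; first exact: h.
  by rewrite -oppr_ge0 => /h; rewrite sinN -opprD normrN sqrrN.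
rewrite ler0_norm ?subr_le0 ?sin_le // opprB.
have := @ge0_mvt (fun y => y ^+ 2 / 2 - (y - sin y)) (fun y => y - 1 + cos y) x x0.
rewrite sin0 expr0n mul0r subrr subr0 subr_ge0 => h.
apply: h => [y|y y0]; first by apply: is_derive_eq; rewrite /GRing.scale /=; field.
have := cos_geN1 y; have := cos_ge y0; rewrite expr2.
by have [y2|y2] := leP y 2 => c1 c2; [nra|lra].
Qed.
Lemma cos_ge' x : 1 - cos x <= x ^+ 2 / 2.
Proof.
wlog x0 : x / 0 <= x => [h|].
  have [|/ltW] := leP 0 x; first exact: h.
  by rewrite -oppr_ge0 => /h; rewrite cosN sqrrN.
by have := cos_ge x0; lra.
Qed.

Lemma expRN_le y : 0 <= y -> expR (- y) <= 1 - y + y ^+ 2 / 2.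
Proof.
move=> y0; have := @ge0_mvt (fun y => 1 - y + y ^+ 2 / 2 - expR (- y)) (fun y => expR (- y) - (1 - y)) y y0.
rewrite (_ : 1 - 0 + _ - _ = 0); last by rewrite oppr0 expR0; field.
move=> h; rewrite -subr_ge0.
apply: h => [z|z z0]; last by rewrite subr_ge0; exact: expR_ge1Dx.
by apply: is_derive_eq; rewrite /GRing.scale /=; field.
Qed.
Lemma expRN_ge y : 0 <= y -> 1 - y + y ^+ 2 / 2 - y ^+ 3 / 6 <= expR (- y).
Proof.
move=> y0; have := @ge0_mvt (fun y => expR (- y) - (1 - y + y ^+ 2 / 2 - y ^+ 3 / 6))
  (fun y => 1 - y + y ^+ 2 / 2 - expR (- y)) y y0.
rewrite (_ : expR (- 0) - _ = 0); last by rewrite oppr0 expR0; field.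
move=> h; rewrite -subr_ge0.
apply: h => [z|z z0]; last by rewrite subr_ge0; exact: expRN_le.
by apply: is_derive_eq; rewrite /GRing.scale /=; field.
Qed.

(** For z >= 0 the bound passes to the reciprocal: the cubic p lies below exp (- z), and the claimed
    polynomial q satisfies 1 <= q p on [0, 1]. *)
Lemma expR_taylor z : `|z| <= 1 -> expR z <= 1 + z + z ^+ 2 / 2 + `|z| ^+ 3.
Proof.
move=> z1; have [z0|z0] := leP 0 z; last first.
  have := @expRN_le (- z); rewrite opprK oppr_ge0 sqrrN => /(_ (ltW z0)).
  have : 0 <= `|z| ^+ 3 by rewrite exprn_ge0. lra.
rewrite (ger0_norm z0) in z1 *.
have h := expRN_ge z0.
set p := 1 - z + z ^+ 2 / 2 - z ^+ 3 / 6 in h.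
set q := 1 + z + z ^+ 2 / 2 + z ^+ 3.
have p0 : 0 < p.
  rewrite /p; have -> : z ^+ 3 = z * z ^+ 2 by rewrite exprS.
  rewrite !expr2; nra.
have pq : 1 <= q * p.
  rewrite -subr_ge0.
  have -> : q * p - 1 = z ^+ 3 * ((5 / 6) - (11 / 12) * z + (5 / 12) * z ^+ 2 - z ^+ 3 / 6).
    by rewrite /p /q; field.
  apply: mulr_ge0; first exact: exprn_ge0.
  have -> : z ^+ 3 = z * z ^+ 2 by rewrite exprS.
  rewrite !expr2; nra.
rewrite -(ler_pM2r (expR_gt0 (- z))) expRxMexpNx_1.
apply: le_trans pq _; rewrite ler_wpM2l // /q.
have := exprn_ge0 3 z0; have := sqr_ge0 z; lra.
Qed.

(** The quotient of the two sides decreases for x >= 0 because x cosh x >= sinh x, which in turn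
    holds since the derivative of the difference is x sinh x. *)
Lemma cosh_le x : (expR x + expR (- x)) / 2 <= expR (x ^+ 2 / 2).
Proof.
wlog x0 : x / 0 <= x => [h|].
  have [|/ltW] := leP 0 x; first exact: h.
  by rewrite -oppr_ge0 => /h; rewrite opprK sqrrN addrC.
have sinh0 y : 0 <= y -> 0 <= expR y - expR (- y).
  by move=> y0; rewrite subr_ge0 ler_expR; lra.
have h1 y : 0 <= y -> 0 <= y * (expR y + expR (- y)) - (expR y - expR (- y)).
  move=> y0; have := @ge0_mvt (fun y => y * (expR y + expR (- y)) - (expR y - expR (- y)))
    (fun y => y * (expR y - expR (- y))) y y0.
  rewrite oppr0 expR0 mul0r subrr subr0; apply => [z|z z0]; last by rewrite mulr_ge0 // sinh0.
  by apply: is_derive_eq; rewrite /GRing.scale /=; ring.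
have := @ge0_mvt (fun y => - ((expR y + expR (- y)) * expR (- (y ^+ 2 / 2))))
    (fun y => (y * (expR y + expR (- y)) - (expR y - expR (- y))) * expR (- (y ^+ 2 / 2))) x x0.
rewrite oppr0 expr0n mul0r oppr0 expR0 mulr1 lerN2 => h.
have {h} : (expR x + expR (- x)) * expR (- (x ^+ 2 / 2)) <= 1 + 1.
  apply: h => [z|z z0]; last by rewrite mulr_ge0 ?h1 // expR_ge0.
  by apply: is_derive_eq; rewrite /GRing.scale /=; field.
by rewrite (expRN (x ^+ 2 / 2)) ler_pdivrMr ?expR_gt0 // => h; rewrite ler_pdivrMr //; lra.
Qed.

Lemma expR_mid x y : expR ((x + y) / 2) <= (expR x + expR y) / 2.
Proof.
have -> : expR x = expR (x / 2) ^+ 2 by rewrite expr2 -expRD -splitr.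
have -> : expR y = expR (y / 2) ^+ 2 by rewrite expr2 -expRD -splitr.
rewrite mulrDl expRD; have := sqr_ge0 (expR (x / 2) - expR (y / 2)).
rewrite !expr2; lra.
Qed.

Lemma expR_jensen (I : finType) (a : I -> R) : (0 < #|I|)%N ->
  expR ((\sum_i a i) / #|I|%:R) <= (\sum_i expR (a i)) / #|I|%:R.
Proof.
move=> I0; set n : R := #|I|%:R; have n0 : 0 < n by rewrite ltr0n.
set m := _ / n; rewrite ler_pdivlMr //.
have : \sum_i (expR m * (1 + (a i - m))) <= \sum_i expR (a i).
  apply: ler_sum => i _; have -> : expR (a i) = expR m * expR (a i - m) by rewrite -expRD addrC subrK.
  by rewrite ler_wpM2l ?expR_ge0 // expR_ge1Dx.
apply: le_trans; rewrite -mulr_sumr ler_wpM2l ?expR_ge0 // big_split /= sumr_const sumrB sumr_const.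
rewrite -mulr_natr mul1r -[m *+ _]mulr_natr -/n /m divfK ?gt_eqF //; lra.
Qed.

Lemma le_eps_expR (a b : R) : 0 <= b ->
  (forall e, 0 < e -> a <= expR e * b) -> a <= b.
Proof.
move=> b0 h; rewrite leNgt; apply/negP => ab.
have [b00|bn] := eqVneq b 0; first by have := h 1 ltr01; rewrite b00 mulr0 leNgt -b00 ab.
have bp : 0 < b by rewrite lt_def bn.
have r1 : 1 < a / b by rewrite ltr_pdivlMr // mul1r.
have e0 : 0 < ln (a / b) / 2 by rewrite divr_gt0 // ln_gt0.
have := h _ e0; rewrite -ler_pdivrMr // -{1}(@lnK R (a / b)) ?posrE; last exact: lt_trans r1.
by rewrite ler_expR; lra.
Qed.
End Calculus.

(** * Averaging along random conjugates *)

Section Gradient.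
Variables (R : realType) (D : nat) (J : finType) (blk : 'I_D -> J).
Local Notation C := R[i].
Local Notation mxT := (mxT R D).
Local Notation G := (@block_unitary R D J blk).
Local Notation Pi := (Pi R blk).
Implicit Types (X g h x B : 'M[C]_D).

Lemma fro2_unitary (V : 'M[C]_D) : unitary V -> fro2 V = D%:R.
Proof.
move=> hV; have := fro2_dot V; rewrite dotE hV mxtrace1 => /(congr1 (@complex.Re R)) /=.
by rewrite -toC_nat.
Qed.

Lemma fro2_sub1 g : G g -> fro2 (g - 1%:M) <= 4 * D%:R.
Proof.
move=> [ug _]; have := fro2_ge0 (g + 1%:M).
rewrite !fro2D hsNr -(fro_sqr (- _)) froN fro_sqr (fro2_unitary ug).
rewrite fro2_unitary ?/unitary ?hadj1 ?mulmx1 //; lra.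
Qed.

Definition su B := [/\ adj B = - B, forall i i', blk i != blk i' -> B i i' = 0 & centered blk B].

(* [Y] is the gradient of [f] for the left multiplication by the block unitaries;
   [Ls] only bounds it along the Lie algebra [su] of the product of the SU(d_j). *)
Record grad_bound (K L Ls : R) (f : 'M[C]_D -> R) (Y : 'M[C]_D -> 'M[C]_D) : Prop := GradBound {
  grad_f : mxmeas f;
  grad_Y : forall a b, cmeas (fun x : mxT => Y x a b);
  grad_skew : forall x, G x -> adj (Y x) = - Y x;
  grad_L : forall x, G x -> fro (Y x) <= L;
  grad_Ls : forall x B, G x -> su B -> hs (Y x) B <= Ls * fro B;
  grad_K : forall x g, G x -> G g -> `|f (g *m x) - f x - hs (Y x) (g - 1%:M)| <= K * fro2 (g - 1%:M) }.

Lemma grad_le K K' L L' Ls Ls' f Y : K <= K' -> L <= L' -> Ls <= Ls' ->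
  grad_bound K L Ls f Y -> grad_bound K' L' Ls' f Y.
Proof.
move=> hK hL hLs [h1 h2 h3 h4 h5 h6]; split => //.
- by move=> x Gx; exact: le_trans (h4 _ Gx) hL.
- by move=> x B Gx sB; apply: le_trans (h5 _ _ Gx sB) _; rewrite ler_wpM2r ?fro_ge0.
- by move=> x g Gx Gg; apply: le_trans (h6 _ _ Gx Gg) _; rewrite ler_wpM2r ?fro2_ge0.
Qed.

Lemma grad_L0 K L Ls f Y : grad_bound K L Ls f Y -> 0 <= L.
Proof. by move=> h; apply: le_trans (grad_L h (G1 R blk)); exact: fro_ge0. Qed.

Lemma grad_hs K L Ls f Y x X : grad_bound K L Ls f Y -> G x -> `|hs (Y x) X| <= L * fro X.
Proof.
move=> h Gx; apply: le_trans (hs_CS_abs _ _) _.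
by rewrite ler_wpM2r ?fro_ge0 // (grad_L h).
Qed.

(** A block unitary x is the translate of 1 by g = x, so a single expansion at 1 reaches the whole
    group. *)
Lemma grad_bnd K L Ls f Y : 0 <= K -> grad_bound K L Ls f Y ->
  forall x, G x -> `|f x - f 1%:M| <= K * (4 * D%:R) + L * Num.sqrt (4 * D%:R).
Proof.
move=> K0 h x Gx; have := grad_K h (G1 R blk) Gx; rewrite mulmx1.
have := @grad_hs K L Ls f Y _ (x - 1%:M) h (G1 R blk).
have h1 := fro2_sub1 Gx.
have h2 : fro (x - 1%:M) <= Num.sqrt (4 * D%:R) by rewrite ler_sqrt // mulr_ge0.
have := grad_L0 h => L0.
have := ler_wpM2l L0 h2; have := ler_wpM2l K0 h1.
rewrite !ler_norml => h3 h4 /andP[h5 h6] /andP[h7 h8]; apply/andP; split; lra.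
Qed.

Lemma grad_ok K L Ls f Y : 0 <= K -> grad_bound K L Ls f Y -> ok blk f.
Proof.
move=> K0 h; split; first exact: grad_f h.
exists (K * (4 * D%:R) + L * Num.sqrt (4 * D%:R) + `|f 1%:M|) => x Gx.
rewrite -(subrK (f 1%:M) (f x)); apply: le_trans (ler_normD _ _) _.
by rewrite lerD2r (grad_bnd K0 h).
Qed.

Variables (d : measure_display) (T : measurableType d) (P : probability T R)
  (U : T -> 'M[C]_D).
Hypothesis hU : forall w, G (U w).
Hypothesis mU : forall A : set 'M[C]_D, mxBorel A -> measurable (U @^-1` A).
Hypothesis iU : forall g, G g -> forall A : set 'M[C]_D, mxBorel A ->
     P ((fun w => g *m U w) @^-1` A) = P (U @^-1` A).
Local Notation ok := (@ok R D J blk).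
Local Notation okC := (@okC R D J blk).
Local Notation ex := (@ex R D d T P U).
Local Notation cex := (@cex R D d T P U).

(** Keeps the diagonal blocks and removes their traces. On skew-Hermitian matrices it is the
    orthogonal projection onto [su]. *)
Definition suproj X : 'M[C]_D := \matrix_(i, k)
  ((blk i == blk k)%:R * (X i k - (i == k)%:R * (\tr (Pi (blk i) *m X) / (bdim blk (blk i))%:R))).

Lemma su_suproj X : adj X = - X -> su (suproj X).
Proof.
move=> hX; have tX j : (\tr (Pi j *m X))^* = - \tr (Pi j *m X).
  by rewrite -tr_adj hadjM adj_Pi hX mulNmx raddfN /= mxtrace_mulC.
split.
- have hX' i k : (X k i)^* = - X i k by rewrite -hadjE hX mxE.
  apply/matrixP => i k; rewrite hadjE [RHS]mxE !mxE rmorphM rmorph_nat rmorphB rmorphM rmorph_nat /= hX'.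
  have [->|ne] := eqVneq i k.
    by rewrite !eqxx !mul1r fmorph_div rmorph_nat /= tX mulNr opprK opprB addrC.
  by rewrite !mul0r !subr0 (eq_sym (blk k)) mulrN.
- by move=> i i' ii'; rewrite mxE (negbTE ii') mul0r.
- move=> j; have [a ja|none] := pickP [pred a | blk a == j]; last by rewrite big_pred0.
  under eq_bigr do rewrite mxE !eqxx !mul1r.
  have e : \sum_(k | blk k == j) \tr (Pi (blk k) *m X) / (bdim blk (blk k))%:R
      = (bdim blk j)%:R * (\tr (Pi j *m X) / (bdim blk j)%:R) :> C.
    by apply: bdim_sum => k ->.
  by rewrite sumrB -tr_Pi e mulrC divfK ?subrr // -(eqP ja) bdim_neq0.
Qed.

Lemma hs_suproj X B : su B -> hs X B = hs (suproj X) B.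
Proof.
move=> [b1 b2 b3]; rewrite /hs; congr Re; rewrite /dot; apply/eqP; rewrite -subr_eq0 -sumrB.
under eq_bigr do rewrite -sumrB.
rewrite (eq_bigr (fun i => (\tr (Pi (blk i) *m X) / (bdim blk (blk i))%:R)^* * B i i)); last first.
  move=> i _; rewrite (bigD1 i) //= big1 ?addr0 => [|k ki]; rewrite mxE.
    by rewrite !eqxx !mul1r -mulrBl rmorphB opprB addrCA subrr addr0.
  have [e|ne] := eqVneq (blk i) (blk k); last by rewrite b2 // !mulr0 subrr.
  by rewrite mul1r eq_sym (negbTE ki) mul0r subr0 subrr.
rewrite (partition_big blk predT) //= big1 // => j _.
under eq_bigr => i /eqP -> do [].
by rewrite -mulr_sumr b3 mulr0.
Qed.

Definition mex (F : 'M[C]_D -> 'M[C]_D) : 'M[C]_D := \matrix_(a, b) cex (fun u => F u a b).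
Definition okM2 (F : 'M[C]_D -> 'M[C]_D) := forall a b, okC (fun u => F u a b).

Lemma hs_mex F B : okM2 F -> hs (mex F) B = ex (fun u => hs (F u) B).
Proof.
move=> hF; rewrite hsE.
transitivity (ex (fun u => \sum_a \sum_b (Re (B a b) * Re (F u a b) + Im (B a b) * Im (F u a b)))).
  rewrite (ex_sum P hU mU) => [|a]; last first.
    by apply: ok_sum => b; apply: okD; apply: okZ; [exact: (hF a b).1|exact: (hF a b).2].
  apply: eq_bigr => a _; rewrite (ex_sum P hU mU) => [|b]; last first.
    by apply: okD; apply: okZ; [exact: (hF a b).1|exact: (hF a b).2].
  apply: eq_bigr => b _; rewrite (exD P hU mU); [|apply: okZ; exact: (hF a b).1|apply: okZ; exact: (hF a b).2].
  rewrite !(exZ P hU mU); [|exact: (hF a b).2|exact: (hF a b).1].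
  by rewrite mxE /=; ring.
apply: (eq_ex P hU) => x _; rewrite hsE; apply: eq_bigr => a _; apply: eq_bigr => b _; ring.
Qed.

Lemma ok_hs F B : okM2 F -> ok (fun u => hs (F u) B).
Proof.
move=> hF; have : okC (fun u => dot (F u) B).
  rewrite /dot; apply: okC_sum => a; apply: okC_sum => b; apply: okCM; last exact: okC_cst.
  exact/okCJ/hF.
by case.
Qed.

Lemma ok_fro2 F : okM2 F -> ok (fun u => fro2 (F u)).
Proof.
move=> hF; have : okC (fun u => dot (F u) (F u)).
  rewrite /dot; apply: okC_sum => a; apply: okC_sum => b; apply: okCM; last exact: hF.
  exact/okCJ/hF.
by case=> h _; under eq_fun do rewrite fro2_hs.
Qed.

Lemma okM2_conj X : okM2 (fun u => u *m X *m adj u).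
Proof. by move=> a b; exact: okC_conj. Qed.
Lemma okM2_mul F F' : okM2 F -> okM2 F' -> okM2 (fun u => F u *m F' u).
Proof. by move=> h h' a b; exact: okC_mulmx. Qed.
Lemma okM2_cst B : okM2 (fun=> B).
Proof. by move=> a b; exact: okC_cst. Qed.
Lemma okM2D F F' : okM2 F -> okM2 F' -> okM2 (fun u => F u + F' u).
Proof. by move=> h h' a b; under eq_fun do rewrite mxE; exact: okCD. Qed.
Lemma okM2_adj F : okM2 F -> okM2 (fun u => adj (F u)).
Proof. by move=> h a b; under eq_fun do rewrite hadjE; exact: okCJ. Qed.

Lemma G_conj h u : G h -> G u -> G (u *m h *m adj u).
Proof. by move=> Gh Gu; apply: G_mul; [exact: G_mul|exact: G_adj]. Qed.

Lemma conj_unit_sub1 (u h : 'M[C]_D) : unitary u ->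
  u *m h *m adj u - 1%:M = u *m (h - 1%:M) *m adj u.
Proof. by move=> hu; rewrite mulmxBr mulmxBl mulmx1 unitary_r. Qed.
Lemma fro2_conj (u X : 'M[C]_D) : unitary u -> fro2 (u *m X *m adj u) = fro2 X.
Proof. by move=> hu; rewrite fro2_isor ?hadjK // fro2_isol. Qed.
Lemma fro2_conj' (u X : 'M[C]_D) : unitary u -> fro2 (adj u *m X *m u) = fro2 X.
Proof. by move=> hu; rewrite fro2_isor ?fro2_isol ?hadjK // unitary_r. Qed.

Lemma conj_mul (s g x : 'M[C]_D) : unitary s -> s *m g *m adj s *m (s *m x) = s *m (g *m x).
Proof. by move=> us; rewrite -(mulmxA (s *m g)) (mulmxA (adj s)) us mul1mx mulmxA. Qed.

Lemma hs_conj_adj g X B : hs (adj g *m X *m g) B = hs X (g *m B *m adj g).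
Proof. by rewrite /hs !dotE !hadjM hadjK -!mulmxA mxtrace_mulC !mulmxA. Qed.

Lemma conj_skew g B : adj B = - B -> adj (adj g *m B *m g) = - (adj g *m B *m g).
Proof. by move=> hB; rewrite !hadjM hadjK hB mulNmx mulmxN mulmxA. Qed.

Lemma ex_norm_le F (c : R) : ok F -> (forall u, G u -> `|F u| <= c) -> `|ex F| <= c.
Proof.
move=> okF hF; rewrite ler_norml; apply/andP; split.
- rewrite -(ex_cst P U (- c)); apply: (ex_le P hU mU) => //; first exact: ok_cst.
  by move=> u Gu; have := hF u Gu; rewrite ler_norml => /andP[].
- rewrite -[leRHS](ex_cst P U c); apply: (ex_le P hU mU) => //; first exact: ok_cst.
  by move=> u Gu; have := hF u Gu; rewrite ler_norml => /andP[].
Qed.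

Section Step.
Variables (h : 'M[C]_D) (K L Ls c : R) (f : 'M[C]_D -> R) (Y : 'M[C]_D -> 'M[C]_D).
Hypotheses (Gh : G h) (K0 : 0 <= K) (Ls0 : 0 <= Ls) (hf : grad_bound K L Ls f Y).
Hypotheses (c0 : 0 < c) (hc : forall B, su B ->
  ex (fun u => fro2 (B + (u *m h *m adj u) *m B *m adj (u *m h *m adj u))) <= 4 * c ^+ 2 * fro2 B).
Local Notation st u := (u *m h *m adj u).

(* The gradient of [stepf] comes from two expansions of [stepf (g *m x)]: that of
   [f (st u *m g *m x)], and, by invariance, that of [f (g *m st u *m x)].  Their mean
   is what makes the gradient contract along [su]. *)
Definition stepf x := ex (fun u => f (st u *m x)).
Definition stepH x u := toC 2^-1 *: (adj (st u) *m Y (st u *m x) *m st u + Y (st u *m x)).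
Definition stepY x := mex (stepH x).

Lemma meas_step : measurable_fun [set: mxT * mxT] ((fun p => st p.2 *m p.1) : mxT * mxT -> mxT).
Proof.
apply: measurable_mx; apply: cmeas_mulmx => a b; last exact: cmeas_fst.
move: a b; apply: cmeas_mulmx => a b; last by move: a b; apply: cmeas_adj => a b; exact: cmeas_snd.
move: a b; apply: cmeas_mulmx => a b; last exact: cmeas_cst.
exact: cmeas_snd.
Qed.

Lemma cmeas_st a b : cmeas (fun p : mxT * mxT => (st p.2) a b).
Proof.
move: a b; apply: cmeas_mulmx => a b; last by move: a b; apply: cmeas_adj => a b; exact: cmeas_snd.
move: a b; apply: cmeas_mulmx => a b; last exact: cmeas_cst.
exact: cmeas_snd.
Qed.

Lemma ok2_stepf : ok2 blk (fun x u => f (st u *m x)).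
Proof.
split; first exact: (measurableT_comp (grad_f hf) meas_step).
have [_ [B hB]] := grad_ok K0 hf.
by exists B => x u Gx Gu; apply: hB; apply: G_mul => //; exact: G_conj.
Qed.

Lemma cmeas_stepH a b : cmeas (fun p : mxT * mxT => stepH p.1 p.2 a b).
Proof.
have hY a' b' : cmeas (fun p : mxT * mxT => Y (st p.2 *m p.1) a' b').
  exact: (cmeas_comp meas_step (grad_Y hf a' b')).
under eq_fun do rewrite 2!mxE.
apply: cmeasM; first exact: cmeas_cst.
apply: cmeasD; last exact: hY.
move: a b; apply: cmeas_mulmx => a b; last exact: cmeas_st.
move: a b; apply: cmeas_mulmx => a b; last exact: hY.
by move: a b; apply: cmeas_adj => a b; exact: cmeas_st.
Qed.

Lemma stepH_fro x u : G x -> G u -> fro (stepH x u) <= L.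
Proof.
move=> Gx Gu; rewrite froZ ger0_norm ?invr_ge0 //.
have Gs := G_conj Gh Gu; have Gsx := G_mul Gs Gx.
have h1 := froD (adj (st u) *m Y (st u *m x) *m st u) (Y (st u *m x)).
have e : fro (adj (st u) *m Y (st u *m x) *m st u) = fro (Y (st u *m x)).
  by rewrite /fro fro2_conj' //; case: Gs.
have := grad_L hf Gsx; rewrite e in h1; lra.
Qed.

Lemma n2_le_fro (X : 'M[C]_D) a b : n2 (X a b) <= fro2 X.
Proof.
rewrite /fro2 (bigD1 a) //= (bigD1 b) //= -addrA lerDl addr_ge0 //.
  by apply: sumr_ge0 => k _; exact: n2_ge0.
by apply: sumr_ge0 => k _; apply: sumr_ge0 => k' _; exact: n2_ge0.
Qed.

Lemma okM2_stepH x : G x -> okM2 (stepH x).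
Proof.
move=> Gx a b.
have [m1 m2] := cmeas_stepH a b.
have mp : measurable_fun [set: mxT] ((fun u => (x, u)) : mxT -> mxT * mxT).
  by apply: measurable_fun_pair; [exact: measurable_cst|exact: measurable_id].
have bd u : G u -> n2 (stepH x u a b) <= L ^+ 2.
  move=> Gu; apply: le_trans (n2_le_fro _ _ _) _; rewrite -fro_sqr.
  by rewrite ler_pXn2r ?nnegrE ?fro_ge0 ?(grad_L0 hf) //; exact: stepH_fro.
have sq (r : R) : r ^+ 2 <= L ^+ 2 -> `|r| <= L.
  by move=> rL; rewrite -ler_sqr ?nnegrE ?(grad_L0 hf) // real_normK ?num_real.
split; split.
- exact: (measurableT_comp m1 mp).
- exists L => u Gu; apply: sq; have := bd u Gu; rewrite /n2; have := sqr_ge0 (Im (stepH x u a b)); lra.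
- exact: (measurableT_comp m2 mp).
- exists L => u Gu; apply: sq; have := bd u Gu; rewrite /n2; have := sqr_ge0 (Re (stepH x u a b)); lra.
Qed.

Lemma hs_stepH x u B : hs (stepH x u) B =
  2^-1 * (hs (Y (st u *m x)) (st u *m B *m adj (st u)) + hs (Y (st u *m x)) B).
Proof.
rewrite hsZl hsDl; congr (_ * (_ + _)).
exact: hs_conj_adj.
Qed.

Lemma su_conj B g : G g -> su B -> su (g *m B *m adj g).
Proof.
move=> Gg [b1 b2 b3]; split.
- by rewrite !hadjM hadjK b1 mulNmx mulmxN mulmxA.
- have bP j : Pi j *m B = B *m Pi j.
    apply/matrixP => a b; rewrite Pi_mul mul_Pi.
    have [e|ne] := eqVneq (blk a) (blk b); first by rewrite e mulrC.
    by rewrite b2 // mulr0 mul0r.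
  move=> i i' ii'; have : (Pi (blk i) *m (g *m B *m adj g)) i i' = ((g *m B *m adj g) *m Pi (blk i)) i i'.
    by rewrite !mulmxA Pi_comm // -(mulmxA g) bP !mulmxA -(mulmxA _ (Pi _)) Pi_comm ?mulmxA //; exact: G_adj.
  by rewrite Pi_mul mul_Pi eqxx eq_sym (negbTE ii') mulr0 mul1r.
- by move=> j; rewrite tr_conj_Pi.
Qed.

Lemma stepY_skew x : G x -> adj (stepY x) = - stepY x.
Proof.
move=> Gx; apply/matrixP => a b; rewrite hadjE [RHS]mxE !mxE.
have e u : G u -> stepH x u a b = - (stepH x u b a)^*.
  move=> Gu; have Gs := G_conj Gh Gu.
  have : adj (stepH x u) = - stepH x u.
    have yk := grad_skew hf (G_mul Gs Gx).
    by rewrite /stepH hadjZ conj_toC hadjD (conj_skew _ yk) yk -opprD scalerN.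
  by move=> /matrixP/(_ a b); rewrite hadjE [RHS]mxE => ->; rewrite opprK.
have h1 := okM2_stepH Gx b a; have h2 := okM2_stepH Gx a b.
apply: ceqP; rewrite ?cReN ?cImN /=.
  rewrite -(exN P hU mU) ?h2.1 //; last exact: h2.1.
  by apply: (eq_ex P hU) => u Gu; rewrite (e u Gu) cReN cReJ opprK.
rewrite -!(exN P hU mU); [|exact: h1.2|exact: h2.2].
by apply: (eq_ex P hU) => u Gu; rewrite (e u Gu) cImN cImJ !opprK.
Qed.

Lemma stepY_L x : G x -> fro (stepY x) <= L.
Proof.
move=> Gx; have ok1 := okM2_stepH Gx.
have [->|n0] := eqVneq (fro (stepY x)) 0; first exact: grad_L0 hf.
have np : 0 < fro (stepY x) by rewrite lt_def n0 fro_ge0.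
rewrite -(ler_pM2r np) -expr2 fro_sqr fro2_hs {1}/stepY hs_mex //.
rewrite -[leRHS](ex_cst P U (L * fro (stepY x))); apply: (ex_le P hU mU); [exact: ok_hs|exact: ok_cst|].
move=> u Gu; apply: le_trans (hs_CS _ _) _.
by rewrite ler_wpM2r ?fro_ge0 // stepH_fro.
Qed.

(** Against [B], the new gradient is half the mean of the old one against F = B + (st u) B (st
    u)^-1, which lies in [su]. The bound fro F <= (t + fro2 F / t) / 2 brings in the second moment
    in [hc], and t = 2 c fro B balances the two terms. *)
Lemma stepY_Ls x B : G x -> su B -> hs (stepY x) B <= c * Ls * fro B.
Proof.
move=> Gx sB; have ok1 := okM2_stepH Gx.
have [B0|B0] := eqVneq (fro B) 0.
  by have /fro2_eq0 -> : fro2 B = 0; [rewrite -fro_sqr B0 expr0n|rewrite hs0r mulr_ge0 ?fro_ge0 // mulr_ge0 // ltW].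
have Bp : 0 < fro B by rewrite lt_def B0 fro_ge0.
pose t := 2 * c * fro B; have tp : 0 < t by rewrite !mulr_gt0.
have okF : ok (fun u => fro2 (B + st u *m B *m adj (st u))).
  apply: ok_fro2; apply: okM2D; first exact: okM2_cst.
  apply: okM2_mul; last exact/okM2_adj/okM2_conj.
  by apply: okM2_mul; [exact: okM2_conj|exact: okM2_cst].
have : ex (fun u => hs (stepH x u) B) <= ex (fun u => Ls / 4 * t + Ls / (4 * t) * fro2 (B + st u *m B *m adj (st u))).
  apply: (ex_le P hU mU); [exact: ok_hs|by apply: okD; [exact: ok_cst|exact: okZ]|].
  move=> u Gu; have Gs := G_conj Gh Gu; have Gsx := G_mul Gs Gx.
  rewrite hs_stepH -hsDr addrC.
  have sB' : su (B + st u *m B *m adj (st u)).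
    have [b1 b2 b3] := sB; have [b4 b5 b6] := su_conj Gs sB; split.
    - by rewrite hadjD b1 b4 opprD.
    - by move=> i i' ii'; rewrite mxE b2 // b5 // addr0.
    - by move=> j; under eq_bigr do rewrite mxE; rewrite big_split /= b3 b6 addr0.
  have h1 := grad_Ls hf Gsx sB'.
  set F := _ + _ in h1 *; apply: le_trans (_ : 2^-1 * (Ls * fro F) <= _).
    by rewrite ler_wpM2l // invr_ge0.
  have h2 := sqr_ge0 (fro F - t); rewrite -fro_sqr.
  have e : Ls / 4 * t + Ls / (4 * t) * fro F ^+ 2 = (Ls / (4 * t)) * (t ^+ 2 + fro F ^+ 2).
    by field; rewrite gt_eqF.
  rewrite e; have e2 : 2^-1 * (Ls * fro F) = (Ls / (4 * t)) * (2 * t * fro F).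
    by field; rewrite gt_eqF.
  rewrite e2; apply: ler_wpM2l; first by apply: divr_ge0 => //; apply: mulr_ge0 => //; exact: ltW.
  by move: h2; rewrite sqrrB; lra.
rewrite -hs_mex // => h1; apply: le_trans h1 _.
rewrite (exD P hU mU); [|exact: ok_cst|exact: okZ].
rewrite ex_cst (exZ P hU mU) //.
have h1 : Ls / (4 * t) * ex (fun u => fro2 (B + st u *m B *m adj (st u))) <= Ls / (4 * t) * (4 * c ^+ 2 * fro2 B).
  by rewrite ler_wpM2l ?hc // divr_ge0 // mulr_ge0 // ltW.
apply: le_trans (lerD (lexx _) h1) _.
rewrite le_eqVlt; apply/orP; left; apply/eqP; rewrite /t -fro_sqr; field.
by rewrite !gt_eqF.
Qed.

Lemma stepf_K x g : G x -> G g ->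
  `|stepf (g *m x) - stepf x - hs (stepY x) (g - 1%:M)| <= K * fro2 (g - 1%:M).
Proof.
move=> Gx Gg; have Ggx := G_mul Gg Gx.
have okx y : G y -> ok (fun u => f (st u *m y)) by move=> Gy; exact: (ok2_ok Gy ok2_stepf).
have ok1 := okM2_stepH Gx.
have ug : unitary g := Gg.1.
(* Replacing u by g u moves g in front of the random conjugate; this produces the second of the two
   expansions. *)
have stg u : st (g *m u) *m (g *m x) = g *m (st u *m x).
  by rewrite hadjM !mulmxA -(mulmxA _ (adj g) g) ug mulmx1.
have okg : ok (fun u => f (g *m (st u *m x))).
  by have := ok_transl Gg (okx _ Ggx); under eq_fun do rewrite stg.
have e1 : stepf (g *m x) = ex (fun u => f (g *m (st u *m x))).
  rewrite /stepf -(ex_inv hU mU iU Gg (okx _ Ggx)).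
  by apply: (eq_ex P hU) => u _; rewrite stg.
pose A u := f (st u *m (g *m x)) - f (st u *m x) - hs (Y (st u *m x)) (st u *m (g - 1%:M) *m adj (st u)).
pose A' u := f (g *m (st u *m x)) - f (st u *m x) - hs (Y (st u *m x)) (g - 1%:M).
have hA u : G u -> `|A u| <= K * fro2 (g - 1%:M).
  move=> Gu; have Gs := G_conj Gh Gu; have us : unitary (st u) := Gs.1.
  have := grad_K hf (G_mul Gs Gx) (G_conj Gg Gs).
  have -> : st u *m g *m adj (st u) *m (st u *m x) = st u *m (g *m x).
    by exact: conj_mul.
  by rewrite (conj_unit_sub1 _ us) (fro2_conj _ us).
have hA' u : G u -> `|A' u| <= K * fro2 (g - 1%:M).
  by move=> Gu; exact: (grad_K hf (G_mul (G_conj Gh Gu) Gx) Gg).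
pose F u := 2^-1 * f (st u *m (g *m x)) + (2^-1 * f (g *m (st u *m x)) + ((-1) * f (st u *m x) + (-1) * hs (stepH x u) (g - 1%:M))).
have okF : ok F.
  apply: okD; first exact/okZ/okx.
  apply: okD; first exact/okZ.
  by apply: okD; [exact/okZ/okx|exact/okZ/ok_hs].
have -> : stepf (g *m x) - stepf x - hs (stepY x) (g - 1%:M) = ex F.
  rewrite /F (exD P hU mU); [|exact/okZ/okx|]; last first.
    by apply: okD; [exact/okZ|apply: okD; [exact/okZ/okx|exact/okZ/ok_hs]].
  rewrite (exD P hU mU); [|exact/okZ|]; last by apply: okD; [exact/okZ/okx|exact/okZ/ok_hs].
  rewrite (exD P hU mU); [|exact/okZ/okx|exact/okZ/ok_hs].
  rewrite !(exZ P hU mU); [|exact: ok_hs|exact: okx|exact: okg|exact: okx].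
  rewrite -e1 -(hs_mex _ ok1) -/(stepf (g *m x)) -/(stepf x) -/(stepY x).
  move: (stepf _) (stepf _) (hs _ _) => p q r; lra.
apply: (ex_norm_le okF) => u Gu.
have -> : F u = 2^-1 * (A u + A' u).
  rewrite /F hs_stepH /A /A'.
  move: (f _) (f _) (f _) (hs _ _) (hs _ _) => p q r t v; lra.
have := ler_normD (A u) (A' u); have := hA u Gu; have := hA' u Gu.
by rewrite normrM (_ : `|2^-1| = 2^-1 :> R); [lra|rewrite ger0_norm].
Qed.

Lemma ok_stepf : ok stepf.
Proof. exact: (ok2_ex P hU mU ok2_stepf). Qed.

Lemma step_grad_bound : grad_bound K L (c * Ls) stepf stepY.
Proof.
split; [exact: ok_stepf.1|move=> a b| exact: stepY_skew|exact: stepY_L|exact: stepY_Ls|exact: stepf_K].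
have [m1 m2] := cmeas_stepH a b.
have e x : stepY x a b = cex (fun u => stepH x u a b) by rewrite mxE.
have -> : (fun x : mxT => stepY x a b) = (fun x => cex (fun u => stepH x u a b)) by apply/funext => x; exact: e.
by split; [exact: (mxmeas2_ex P mU m1)|exact: (mxmeas2_ex P mU m2)].
Qed.

(** For fixed u, multiplication of x by [st u] preserves the law of x, so the exchange of
    expectations removes the conjugate. *)
Lemma ex_translate F : ok F -> ex (fun x => ex (fun u => F (st u *m x))) = ex F.
Proof.
move=> okF.
have ok2F : ok2 blk (fun x u => F (st u *m x)).
  have [mF [B hB]] := okF; split; first exact: (measurableT_comp mF meas_step).
  by exists B => x u Gx Gu; apply: hB; apply: G_mul => //; exact: G_conj.
rewrite (ex_fubini P hU mU ok2F) -[RHS](ex_cst P U (ex F)); apply: (eq_ex P hU) => u Gu.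
by apply: (ex_inv hU mU iU) => //; exact: G_conj.
Qed.

Lemma ex_stepf : ex stepf = ex f.
Proof. by apply: ex_translate; exact: grad_ok hf. Qed.

(** To first order in s, [h] is 1 + a with [a] in [su]; the Hermitian part [e] of h - 1 is
    orthogonal to every skew gradient. The bounds m1 s and m2 s^2 below are for the linear term and
    for the centred remainder of f along a step. *)
Variables (s b lam : R) (a e : 'M[C]_D).
Hypotheses (s0 : 0 <= s) (s1 : s <= 1) (b0 : 0 <= b) (lam0 : 0 <= lam).
Hypothesis hb : fro2 (h - 1%:M) <= b * s ^+ 2.
Hypotheses (sa : su a) (ha : h - 1%:M = a + e) (he : adj e = e) (fa : fro2 a <= b * s ^+ 2).
Hypothesis hvar : forall B, su B -> ex (fun u => (hs B (u *m a *m adj u)) ^+ 2) <= s ^+ 2 * fro2 B.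
Let m1 := L * Num.sqrt b.
Let m2 := 2 * K * b.
Hypothesis small : lam * (m1 + m2) * s <= 1.
Let CC := lam ^+ 2 * (m1 * m2 + m2 ^+ 2 / 2) + (lam * (m1 + m2)) ^+ 3.

Lemma hs_skew_herm (A B : 'M[C]_D) : adj A = - A -> adj B = B -> hs A B = 0.
Proof. by move=> hA hB; have := hs_adj A B; rewrite hA hB hsNl; lra. Qed.

(** For given x, f along the step is f x + w + r with w linear and r of order s^2. The mean of w
    vanishes since [a] is blockwise traceless, and its variance is at most s^2 Ls^2, because w only
    sees the projection of the gradient to [su]. Taylor's bound for exp around the mean [stepf x]
    then gives the Gaussian exponent up to s^3. *)
Lemma local_mgf x : G x ->
  ex (fun u => expR (lam * f (st u *m x))) <=
  expR (lam ^+ 2 * s ^+ 2 * Ls ^+ 2 / 2 + CC * s ^+ 3) * expR (lam * stepf x).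
Proof.
move=> Gx.
have okx : ok (fun u => f (st u *m x)) := ok2_ok Gx ok2_stepf.
pose B := suproj (Y x).
have sB : su B by apply: su_suproj; exact: (grad_skew hf).
pose w u := hs B (u *m a *m adj u).
have okw : ok w.
  have := ok_hs B (okM2_conj a); rewrite /w.
  by under [in X in _ -> X]eq_fun do rewrite hsC.
have ew : ex w = 0.
  have -> : ex w = hs (mex (fun u => u *m a *m adj u)) B.
    by rewrite hs_mex; [apply: (eq_ex P hU) => u _; rewrite hsC|exact: okM2_conj].
  rewrite (_ : mex _ = 0) ?hs0l //; apply/matrixP => i k; rewrite !mxE.
  by apply: (cex_conj0 hU mU iU); case: sa.
have wE u : G u -> hs (Y x) (st u - 1%:M) = w u.
  move=> Gu; rewrite (conj_unit_sub1 h Gu.1) ha mulmxDr mulmxDl hsDr (hs_skew_herm (B := u *m e *m adj u) (grad_skew hf Gx)) ?addr0.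
    by apply: hs_suproj; exact: su_conj.
  by rewrite !hadjM hadjK he mulmxA.
have fB : fro B <= Ls.
  have [->//|B0] := eqVneq (fro B) 0.
  have Bp : 0 < fro B by rewrite lt_def B0 fro_ge0.
  rewrite -(ler_pM2r Bp) -expr2 fro_sqr fro2_hs -[hs B B]hs_suproj //.
  exact: (grad_Ls hf).
have w2 : ex (fun u => w u ^+ 2) <= s ^+ 2 * Ls ^+ 2.
  apply: le_trans (hvar sB) _; rewrite ler_wpM2l ?sqr_ge0 // -fro_sqr.
  by rewrite ler_pXn2r ?nnegrE ?fro_ge0.
have m10 : 0 <= m1 by rewrite mulr_ge0 ?sqrtr_ge0 // (grad_L0 hf).
have m20 : 0 <= m2 by rewrite !mulr_ge0.
have wb u : G u -> `|w u| <= m1 * s.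
  move=> Gu; rewrite -wE // (conj_unit_sub1 h Gu.1) ha mulmxDr mulmxDl hsDr (hs_skew_herm (B := u *m e *m adj u) (grad_skew hf Gx)) ?addr0; last first.
    by rewrite !hadjM hadjK he mulmxA.
  apply: le_trans (grad_hs _ hf Gx) _; rewrite /m1 -mulrA ler_wpM2l ?(grad_L0 hf) //.
  rewrite /fro (fro2_conj _ Gu.1) -(ger0_norm s0) -sqrtr_sqr -sqrtrM //.
  by rewrite ler_sqrt // mulr_ge0 // sqr_ge0.
pose r u := f (st u *m x) - f x - w u.
have okr : ok r by apply: okB => //; apply: okB => //; exact: ok_cst.
have rb u : G u -> `|r u| <= K * (b * s ^+ 2).
  move=> Gu; have := grad_K hf Gx (G_conj Gh Gu); rewrite (wE _ Gu) => h1.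
  apply: le_trans h1 _; rewrite ler_wpM2l // (conj_unit_sub1 _ Gu.1) (fro2_conj _ Gu.1) //.
have er : ex r = stepf x - f x.
  rewrite /r (exB P hU mU) //; last by apply: okB => //; exact: ok_cst.
  by rewrite (exB P hU mU) ?ex_cst ?ew ?subr0 //; exact: ok_cst.
have erb : `|ex r| <= K * (b * s ^+ 2) by apply: ex_norm_le.
pose z u := lam * (f (st u *m x) - stepf x).
have zE u : z u = lam * (w u + (r u - ex r)) by rewrite /z er /r; congr (_ * _); lra.
have eb u : G u -> `|r u - ex r| <= m2 * s ^+ 2.
  by move=> Gu; apply: le_trans (ler_normB _ _) _; have := rb u Gu; rewrite /m2; lra.
have ss : s ^+ 2 <= s by rewrite expr2 ler_piMl.
have zb u : G u -> `|z u| <= lam * (m1 + m2) * s.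
  move=> Gu; rewrite zE normrM (ger0_norm lam0) -mulrA ler_wpM2l //.
  apply: le_trans (ler_normD _ _) _; have := wb u Gu; have := eb u Gu.
  by have := ler_wpM2l m20 ss; lra.
(* The cubic errors: the cross term of w with r - E r, the square of r - E r, and the Taylor
   remainder. *)
pose q := lam ^+ 2 * (m1 * m2 + m2 ^+ 2 / 2) * s ^+ 3 + (lam * (m1 + m2)) ^+ 3 * s ^+ 3.
have pt u : G u -> expR (z u) <= 1 + (z u + ((lam ^+ 2 / 2) * w u ^+ 2 + q)).
  move=> Gu; have zb1 := le_trans (zb u Gu) small.
  apply: le_trans (expR_taylor zb1) _.
  have h3 : `|z u| ^+ 3 <= (lam * (m1 + m2)) ^+ 3 * s ^+ 3.
    by rewrite -exprMn lerXn2r ?nnegrE ?normr_ge0 ?zb // (le_trans _ (zb u Gu)).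
  have h2 : z u ^+ 2 / 2 <= (lam ^+ 2 / 2) * w u ^+ 2 + lam ^+ 2 * (m1 * m2 + m2 ^+ 2 / 2) * s ^+ 3.
    rewrite zE exprMn.
    have e1 : `|w u * (r u - ex r)| <= (m1 * s) * (m2 * s ^+ 2).
      by rewrite normrM ler_pM // ?wb ?eb.
    have e2 : (r u - ex r) ^+ 2 <= m2 ^+ 2 * s ^+ 3.
      apply: le_trans (_ : (m2 * s ^+ 2) ^+ 2 <= _).
        by rewrite -(real_normK (num_real (r u - ex r))) lerXn2r ?nnegrE ?normr_ge0 ?eb // mulr_ge0 // sqr_ge0.
      rewrite exprMn ler_wpM2l ?sqr_ge0 // -exprM; apply: ler_wiXn2l => //.
    have e3 := ler_norm (w u * (r u - ex r)).
    have e4 : (w u + (r u - ex r)) ^+ 2 <= w u ^+ 2 + 2 * (m1 * m2 * s ^+ 3) + m2 ^+ 2 * s ^+ 3.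
      rewrite sqrrD -mulr_natl.
      have : m1 * s * (m2 * s ^+ 2) = m1 * m2 * s ^+ 3 by ring.
      by move=> e5; rewrite e5 in e1; lra.
    by have := ler_wpM2l (sqr_ge0 lam) e4; lra.
  by rewrite /q; lra.
have okz : ok z by apply: okZ; apply: okB => //; exact: ok_cst.
have okw2 : ok (fun u => w u ^+ 2) by under eq_fun do rewrite expr2; exact: okM.
have main : ex (fun u => expR (z u)) <= 1 + (lam ^+ 2 * s ^+ 2 * Ls ^+ 2 / 2 + q).
  have okt : ok (fun u => (lam ^+ 2 / 2) * w u ^+ 2 + q) by apply: okD; [exact: okZ|exact: ok_cst].
  apply: le_trans (ex_le P hU mU _ _ pt) _.
  - exact: ok_expR.
  - by apply: okD; [exact: ok_cst|exact: okD].
  rewrite (exD P hU mU); [|exact: ok_cst|exact: okD].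
  rewrite (exD P hU mU) // (exD P hU mU); [|exact: okZ|exact: ok_cst].
  rewrite !ex_cst (exZ P hU mU) // {1}/z (exZ P hU mU); last by apply: okB => //; exact: ok_cst.
  rewrite (exB P hU mU) ?ex_cst -/(stepf x) ?subrr //; last exact: ok_cst.
  have := ler_wpM2l (sqr_ge0 lam) w2; lra.
have -> : ex (fun u => expR (lam * f (st u *m x))) = expR (lam * stepf x) * ex (fun u => expR (z u)).
  rewrite -(exZ P hU mU); last exact: ok_expR.
  by apply: (eq_ex P hU) => u _; rewrite -expRD /z; congr expR; lra.
rewrite mulrC ler_wpM2r ?expR_ge0 //; apply: le_trans main _.
apply: le_trans (expR_ge1Dx _) _; rewrite ler_expR /q /CC; lra.
Qed.

(** Inserting the random conjugate into the left side is free by [ex_translate]; what is paid for is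
    the inner expectation at fixed x. *)
Lemma step_mgf : ex (fun x => expR (lam * f x)) <=
  expR (lam ^+ 2 * s ^+ 2 * Ls ^+ 2 / 2 + CC * s ^+ 3) * ex (fun x => expR (lam * stepf x)).
Proof.
have okf := grad_ok K0 hf.
have oke : ok (fun x => expR (lam * f x)) by exact/ok_expR/okZ.
have oks : ok (fun x => expR (lam * stepf x)) by apply: ok_expR; exact/okZ/ok_stepf.
rewrite -(ex_translate oke) -(exZ P hU mU) //; apply: (ex_le P hU mU).
- apply: (ok2_ex P hU mU); have [mF [Bd hB]] := oke; split; first exact: (measurableT_comp mF meas_step).
  by exists Bd => x u Gx Gu; apply: hB; apply: G_mul => //; exact: G_conj.
- exact: okZ.
- by move=> x Gx; exact: local_mgf.
Qed.
End Step.
End Gradient.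

(** * ** The diagonal matrix of a step: variance and contraction rate *)

Section StepElem.
Variables (R : realType) (D : nat) (J : finType) (blk : 'I_D -> J).
Local Notation C := R[i].
Local Notation mxT := (mxT R D).
Local Notation G := (@block_unitary R D J blk).
Local Notation Pi := (Pi R blk).
Implicit Types (X g h x B F W : 'M[C]_D).
Local Notation dd a := ((bdim blk (blk a))%:R : R).

Lemma sum_blk (j : J) (c : R) : \sum_(a | blk a == j) c = (bdim blk j)%:R * c.
Proof.
by rewrite sumr_const bdim_card mulr_natl.
Qed.

Lemma dmin_le_dim : (dmin blk <= D)%N.
Proof. by rewrite /dmin; elim/big_ind: _ => // [x y hx hy|i _]; [rewrite geq_min hx|rewrite bdim_card -[leqRHS]card_ord max_card]. Qed.

Lemma bdim_le j : (bdim blk j <= D)%N.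
Proof. by rewrite bdim_card -[leqRHS]card_ord max_card. Qed.

Lemma dmin_le j : (dmin blk <= bdim blk j)%N.
Proof.
rewrite /dmin; have : j \in index_enum J by rewrite mem_index_enum.
elim: (index_enum J) => // i r IH; rewrite inE big_cons => /orP[/eqP <-|/IH h]; first exact: geq_minl.
exact: leq_trans (geq_minr _ _) h.
Qed.

(** A representative of the block of [a]. The search succeeds at [a] itself, so the default is never
    returned and the result depends on the block alone. *)
Definition ctr (a : 'I_D) : 'I_D := odflt a [pick i | blk i == blk a].
Lemma ctr_blk a : blk (ctr a) = blk a.
Proof. by rewrite /ctr; case: pickP => //= i /eqP. Qed.
Lemma ctr_eq a b : blk a = blk b -> ctr a = ctr b.
Proof. by move=> e; rewrite /ctr e; case: pickP => //= /(_ b); rewrite eqxx. Qed.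

(** One index of the block against all the others, with zero sum. The factor makes the sum of
    squares d^2 - 1, the inverse of the weight [kapC] of the block, so that the variance of a step
    is s^2 in blocks of every size above one. *)
Definition tau a : R := Num.sqrt ((dd a + 1) / dd a) * (dd a * (a == ctr a)%:R - 1).

Lemma dd_gt0 a : 0 < dd a.
Proof. by rewrite ltr0n bdim_gt0. Qed.

Lemma sum_ctr (a0 : 'I_D) (p q : R) :
  \sum_(a | blk a == blk a0) (p * (a == ctr a)%:R + q) = p + dd a0 * q.
Proof.
rewrite big_split /= sum_blk; congr (_ + _).
rewrite (bigD1 (ctr a0)) ?ctr_blk //= (ctr_eq (ctr_blk a0)) eqxx mulr1 big1 ?addr0 // => a /andP[/eqP e1 e2].
by rewrite (ctr_eq e1) (negbTE e2) mulr0.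
Qed.

Lemma sum_tau j : \sum_(a | blk a == j) tau a = 0.
Proof.
have [a0 /eqP <-|none] := pickP [pred a | blk a == j]; last by rewrite big_pred0.
rewrite (eq_bigr (fun a => Num.sqrt ((dd a0 + 1) / dd a0) * (dd a0 * (a == ctr a)%:R + (-1)))).
  by rewrite -mulr_sumr sum_ctr mulrN1 subrr mulr0.
by move=> a /eqP e; rewrite /tau e.
Qed.

Lemma sum_tau2 j : \sum_(a | blk a == j) tau a ^+ 2 =
  if (bdim blk j == 0)%N then 0 else (bdim blk j)%:R ^+ 2 - 1.
Proof.
have [a0 /eqP <-|none] := pickP [pred a | blk a == j]; last first.
  by rewrite big_pred0 // bdim_card eq_card0.
rewrite (negbTE (lt0n_neq0 (bdim_gt0 blk a0))).
have n0 := dd_gt0 a0.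
rewrite (eq_bigr (fun a => ((dd a0 + 1) * (dd a0 - 2)) * (a == ctr a)%:R + (dd a0 + 1) / dd a0)).
  by rewrite sum_ctr; field; rewrite gt_eqF.
move=> a /eqP e; rewrite /tau exprMn e sqr_sqrtr; last by rewrite divr_ge0 // ?addr_ge0 // ltW.
by case: (a == ctr a) => /=; field; rewrite gt_eqF.
Qed.

Lemma tau2_le a : tau a ^+ 2 <= D%:R ^+ 2.
Proof.
have h : tau a ^+ 2 <= \sum_(b | blk b == blk a) tau b ^+ 2.
  by rewrite (bigD1 a) //= lerDl; apply: sumr_ge0 => b _; exact: sqr_ge0.
apply: le_trans h _; rewrite sum_tau2 (negbTE (lt0n_neq0 (bdim_gt0 blk a))).
rewrite lerBlDr (@le_trans _ _ (D%:R ^+ 2)) ?lerDl // lerXn2r ?nnegrE ?ler0n // ler_nat.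
exact: bdim_le.
Qed.

Variables (d : measure_display) (T : measurableType d) (P : probability T R)
  (U : T -> 'M[C]_D).
Hypothesis hU : forall w, G (U w).
Hypothesis mU : forall A : set 'M[C]_D, mxBorel A -> measurable (U @^-1` A).
Hypothesis iU : forall g, G g -> forall A : set 'M[C]_D, mxBorel A ->
     P ((fun w => g *m U w) @^-1` A) = P (U @^-1` A).
Local Notation ok := (@ok R D J blk).
Local Notation okC := (@okC R D J blk).
Local Notation ex := (@ex R D d T P U).
Local Notation cex := (@cex R D d T P U).

Variable s : R.
Hypotheses (s0 : 0 <= s) (sD : s * D%:R <= 1).

Let sg i := s * tau i.
Lemma sg2_le1 i : sg i ^+ 2 <= 1.
Proof.
rewrite exprMn; apply: le_trans (ler_wpM2l (sqr_ge0 s) (tau2_le i)) _.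
by rewrite -exprMn expr_le1 // mulr_ge0.
Qed.

(** Points of the unit circle with imaginary part s tau; s D <= 1 keeps the square root meaningful.
    [sA] and [sE] are the skew and the Hermitian part of [sH] - 1. *)
Definition sH : 'M[C]_D := diag_mx (\row_i Complex (Num.sqrt (1 - sg i ^+ 2)) (sg i)).
Definition sA : 'M[C]_D := diag_mx (\row_i Complex 0 (sg i)).
Definition sE : 'M[C]_D := diagR (fun i => Num.sqrt (1 - sg i ^+ 2) - 1).

Lemma sH_G : G sH.
Proof.
apply: (@G_diag R D J blk (fun i => Complex (Num.sqrt (1 - sg i ^+ 2)) (sg i))) => i.
by rewrite /n2 /= sqr_sqrtr ?subrK // subr_ge0 sg2_le1.
Qed.

Lemma sH_decomp : sH - 1%:M = sA + sE.
Proof.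
apply/matrixP => i k; rewrite !mxE; case: (i == k); last by rewrite !mulr0n subr0 addr0.
by rewrite !mulr1n; apply: ceqP => /=; rewrite ?add0r ?addr0 ?subr0.
Qed.

Lemma sE_adj : adj sE = sE. Proof. exact: diagR_adj. Qed.

Lemma su_sA : su blk sA.
Proof.
split.
- apply/matrixP => i k; rewrite hadjE !mxE eq_sym.
  have [->|ne] := eqVneq i k; last by rewrite !mulr0n conjC0 oppr0.
  by rewrite !mulr1n; apply: ceqP; rewrite ?cReJ ?cImJ ?cReN ?cImN /= ?oppr0.
- move=> i k ik; rewrite !mxE; case: (i =P k) => [e|]; last by rewrite mulr0n.
  by rewrite e eqxx in ik.
- move=> j; apply: ceqP; rewrite ?cRe_sum ?cIm_sum /=.
    by rewrite big1 // => a _; rewrite !mxE eqxx mulr1n.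
  under eq_bigr do rewrite !mxE eqxx mulr1n /=.
  by rewrite -mulr_sumr sum_tau mulr0.
Qed.

Lemma fro2_diag (z : 'I_D -> C) : fro2 (diag_mx (\row_i z i)) = \sum_i n2 (z i).
Proof.
rewrite /fro2; apply: eq_bigr => i _; rewrite (bigD1 i) //= big1 ?addr0 => [|k ki]; rewrite !mxE.
  by rewrite eqxx mulr1n.
by rewrite eq_sym (negbTE ki) mulr0n /n2 /= expr0n addr0.
Qed.

Lemma sg2_sum : \sum_i sg i ^+ 2 <= D%:R ^+ 3 * s ^+ 2.
Proof.
apply: le_trans (_ : \sum_(i < D) (D%:R ^+ 2 * s ^+ 2) <= _).
  by apply: ler_sum => i _; rewrite exprMn mulrC ler_wpM2r ?sqr_ge0 // tau2_le.
rewrite big_const card_ord iter_addr_0 -mulr_natl le_eqVlt; apply/orP; left; apply/eqP; ring.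
Qed.

Lemma fro2_sA : fro2 sA <= (2 * D%:R ^+ 3) * s ^+ 2.
Proof.
rewrite fro2_diag; apply: le_trans (_ : \sum_i sg i ^+ 2 <= _).
  by apply: ler_sum => i _; rewrite /n2 /= expr0n add0r.
by apply: le_trans sg2_sum _; rewrite ler_wpM2r ?sqr_ge0 // ler_peMl ?ler1n // exprn_ge0.
Qed.

Lemma fro2_sH : fro2 (sH - 1%:M) <= (2 * D%:R ^+ 3) * s ^+ 2.
Proof.
have -> : sH - 1%:M = diag_mx (\row_i Complex (Num.sqrt (1 - sg i ^+ 2) - 1) (sg i)).
  apply/matrixP => i k; rewrite !mxE; case: (i == k); last by rewrite !mulr0n subr0.
  by rewrite !mulr1n; apply: ceqP => /=; rewrite ?subr0.
rewrite fro2_diag; apply: le_trans (_ : \sum_i 2 * sg i ^+ 2 <= _).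
  apply: ler_sum => i _; rewrite /n2 /=.
  have h1 : 0 <= 1 - sg i ^+ 2 by rewrite subr_ge0 sg2_le1.
  have h2 := sqr_sqrtr h1; have h3 := sqrtr_ge0 (1 - sg i ^+ 2).
  have h4 : Num.sqrt (1 - sg i ^+ 2) <= 1.
    by rewrite -[leRHS]sqrtr1 ler_sqrt // gerBl sqr_ge0.
  have := mulr_ge0 h3 (_ : 0 <= 1 - Num.sqrt (1 - sg i ^+ 2)); rewrite subr_ge0 => /(_ h4).
  by move: (Num.sqrt _) h2 {h3 h4 h1} => q h2 h3; nra.
by rewrite -mulr_sumr -mulrA ler_wpM2l // sg2_sum.
Qed.

(** The normalization of [tau] cancels the weight of [covT_formula], leaving s^2 times a projection.
    In a one-dimensional block [tau] is 0, and so is the bracket. *)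
Lemma cov_sA p q r t : covT P U sA sA p q r t = toC (s ^+ 2) *
  ((blk p == blk q)%:R * (((p == r) && (q == t))%:R -
   ((p == q) && (r == t) && (blk p == blk r))%:R / (bdim blk (blk p))%:R)).
Proof.
have [_ _ cA] := su_sA.
rewrite (covT_formula hU mU iU) //.
have kap0 j j' : kapC R blk j j' * blkS blk sA sA j j' = toC (s ^+ 2) * ((j == j')%:R * (1 < bdim blk j)%:R).
  have [<-|jj] := eqVneq j j'; last first.
    rewrite mul0r mulr0 (_ : blkS _ _ _ _ _ = 0) ?mulr0 // /blkS big1 // => x /eqP ex1; rewrite big1 // => y /eqP ey.
    rewrite !mxE; case: (x =P y) => [e|]; last by rewrite !mulr0n mul0r.
    by move: jj; rewrite -ex1 -ey e eqxx.
  have -> : blkS blk sA sA j j = toC (s ^+ 2 * \sum_(a | blk a == j) tau a ^+ 2).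
    rewrite mulr_sumr toC_sum; apply: eq_bigr => x /eqP ex1.
    rewrite (bigD1 x) ?ex1 //= big1 ?addr0 => [|y /andP[_ ne]]; rewrite !mxE; last first.
      by rewrite eq_sym (negbTE ne) mulr0n mul0r.
    by rewrite eqxx mulr1n mulrC -n2E /n2 /= expr0n add0r exprMn.
  rewrite sum_tau2 /kapC eqxx mul1r.
  case e : (bdim blk j) => [|[|m]] /=; rewrite ?mulr0 ?toC0 ?mulr0 //; first by rewrite expr1n subrr mulr0 toC0 mulr0.
  rewrite toCM mulr1 mulrC -mulrA; set w := (X in _ * (X * _)); set v := (X in _ * (_ * X)).
  suff -> : w * v = 1 by rewrite mulr1.
  have -> : w = m.+2%:R ^+ 2 - 1 by rewrite /w toCD toCN expr2 toCM toC_nat toC1 expr2.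
  rewrite /v -expr2 divff // expr2 -natrM subr_eq0 pnatr_eq1 //.
rewrite kap0 -mulrA; congr (_ * _).
have [epq|npq] := eqVneq (blk p) (blk q); last by rewrite !mul0r.
rewrite !mul1r; have [d1|d1] := ltnP 1 (bdim blk (blk p)); first by rewrite mul1r.
have d1' : bdim blk (blk p) = 1%N by apply/eqP; rewrite eqn_leq d1 bdim_gt0.
have un (x y : 'I_D) : blk x = blk y -> blk x = blk p -> x = y.
  move=> e1 e2; apply/eqP; apply/negPn/negP => xy.
  by have := bdim_gt1 xy e1; rewrite e2 d1'.
rewrite mul0r d1' divr1 -(un p q) // eqxx andTb.
have [rt|nrt] := eqVneq r t; last first.
  rewrite subr0; case: (p =P r) => [e1|]//=; case: (p =P t) => // e2.
  by move: nrt; rewrite -e1 -e2 eqxx.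
rewrite -rt andbb; have [->|pr] := eqVneq p r; first by rewrite eqxx subrr.
case: (blk p =P blk r) => [e|]; last by rewrite subrr.
by move: pr; rewrite (un p r) ?eqxx.
Qed.

Lemma sqr_sumC (I : finType) (F : I -> C) : toC (n2 (\sum_i F i)) = \sum_i \sum_k F i * (F k)^*.
Proof.
rewrite n2E mulrC rmorph_sum mulr_suml; apply: eq_bigr => i _.
by rewrite mulr_sumr.
Qed.

(** The kernel in [cov_sA] projects away the block traces, which [F] does not have ([inner]); what
    remains is the squared norm of the diagonal blocks of [F]. *)
Lemma var_sA F : (forall j, \sum_(a | blk a == j) F a a = 0) ->
  ex (fun u => n2 (dot F (u *m sA *m adj u))) = s ^+ 2 * \sum_a \sum_(b | blk b == blk a) n2 (F a b).
Proof.
move=> tF; pose W (u : 'M[C]_D) := u *m sA *m adj u.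
pose g u (x y : 'I_D * 'I_D) := ((F x.1 x.2)^* * F y.1 y.2) * (W u x.1 x.2 * (W u y.1 y.2)^*).
have e1 u : toC (n2 (dot F (W u))) = \sum_x \sum_y g u x y.
  rewrite /dot pair_bigA /= sqr_sumC; apply: eq_bigr => x _; apply: eq_bigr => y _.
  by rewrite /g rmorphM /= conjCK; ring.
have okW (x y : 'I_D * 'I_D) : okC (fun u => g u x y).
  by apply: okCM; [exact: okC_cst|apply: covT_ok].
have -> : ex (fun u => n2 (dot F (W u))) = Re (cex (fun u => \sum_x \sum_y g u x y)).
  by apply: (eq_ex P hU) => u _; rewrite -e1.
rewrite (cex_sum P hU mU) => [|x]; last by apply: okC_sum => y.
have inner (x : 'I_D * 'I_D) : \sum_(y : 'I_D * 'I_D) F y.1 y.2 * (((x.1 == y.1) && (x.2 == y.2))%:R -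
   ((x.1 == x.2) && (y.1 == y.2) && (blk x.1 == blk y.1))%:R / (bdim blk (blk x.1))%:R) = F x.1 x.2.
  under eq_bigr do rewrite mulrBr.
  rewrite sumrB (bigD1 x) //= !eqxx mulr1 big1 ?addr0 => [|[r t] /= ne]; last first.
    case: (x.1 =P r) => [q1|_]; last by rewrite mulr0.
    case: (x.2 =P t) => [q2|_]; last by rewrite mulr0.
    by move: ne; rewrite -q1 -q2 -surjective_pairing eqxx.
  rewrite -(pair_bigA _ (fun r t => F r t * (((x.1 == x.2) && (r == t) && (blk x.1 == blk r))%:R / (bdim blk (blk x.1))%:R))) /=.
  rewrite (eq_bigr (fun r => (if blk r == blk x.1 then F r r else 0) * ((x.1 == x.2)%:R / (bdim blk (blk x.1))%:R))); last first.
    move=> r _; rewrite (bigD1 r) //= big1 ?addr0 => [|t tr]; last first.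
      by rewrite [r == t]eq_sym (negbTE tr) andbF mul0r mulr0.
    rewrite eqxx andbT [_ == blk r]eq_sym; case: (blk r == _); rewrite ?andbT ?andbF //.
    by rewrite !mul0r mulr0.
  by rewrite -mulr_suml -big_mkcond tF mul0r subr0.
transitivity (Re (\sum_x toC (s ^+ 2) * toC ((blk x.1 == blk x.2)%:R * n2 (F x.1 x.2)))).
  congr Re; apply: eq_bigr => x _; rewrite (cex_sum P hU mU) //.
  rewrite toCM toC_nat n2E -{2}(inner x) !mulr_sumr; apply: eq_bigr => y _.
  rewrite /g (cexZ P hU mU); last exact: covT_ok.
  have -> : cex (fun u => W u x.1 x.2 * (W u y.1 y.2)^*) = covT P U sA sA x.1 x.2 y.1 y.2 by [].
  by rewrite cov_sA; ring.
under eq_bigr do rewrite -toCM.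
rewrite -toC_sum /= -mulr_sumr -(pair_bigA _ (fun p q => (blk p == blk q)%:R * n2 (F p q))) /=.
congr (_ * _); apply: eq_bigr => p _; rewrite [RHS]big_mkcond; apply: eq_bigr => q _.
by rewrite eq_sym; case: (_ == _); rewrite ?mul1r ?mul0r.
Qed.

Lemma var_step B : su blk B ->
  ex (fun u => (hs B (u *m sA *m adj u)) ^+ 2) <= s ^+ 2 * fro2 B.
Proof.
move=> [_ _ cB].
have okd : okC (fun u => dot B (u *m sA *m adj u)).
  apply: okC_sum => a; apply: okC_sum => b; apply: okCM; first exact: okC_cst.
  exact: okC_conj.
have okn : ok (fun u => n2 (dot B (u *m sA *m adj u))).
  by case: okd => o1 o2; rewrite /n2; apply: okD; under eq_fun do rewrite expr2; exact: okM.
apply: le_trans (_ : ex (fun u => n2 (dot B (u *m sA *m adj u))) <= _).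
  apply: (ex_le P hU mU) => //.
    by case: okd => o1 _; under eq_fun do rewrite expr2; exact: okM.
  by move=> u _; rewrite /n2 lerDl sqr_ge0.
rewrite var_sA // ler_wpM2l ?sqr_ge0 // /fro2; apply: ler_sum => a _.
rewrite [leLHS]big_mkcond; apply: ler_sum => b _; case: ifP => // _; exact: n2_ge0.
Qed.

Lemma hs_comm_decomp B g : unitary g -> adj B = - B ->
  2 * hs B (g *m B *m adj g) = 2 * fro2 B - fro2 (B *m g - g *m B).
Proof.
move=> ug sB; rewrite fro2D hsNr -(fro_sqr (- _)) froN fro_sqr.
rewrite (fro2_isor B (unitary_r ug)) (fro2_isol B ug) -hs_mull.
lra.
Qed.

(** The matrix whose inner product with W is the (p, q) entry of the commutator of [B] and W;
    through it the variance formula applies to commutators. *)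
Definition comF B p q : 'M[C]_D := \matrix_(a, b) ((B p a)^* * (b == q)%:R - (a == p)%:R * (B b q)^*).

Lemma comF_dot B W p q : dot (comF B p q) W = (B *m W - W *m B) p q.
Proof.
rewrite /dot !mxE.
transitivity (\sum_a \sum_b (B p a * (b == q)%:R * W a b - (a == p)%:R * B b q * W a b)).
  apply: eq_bigr => a _; apply: eq_bigr => b _; rewrite mxE rmorphB !rmorphM !rmorph_nat /= !conjCK.
  by rewrite mulrBl.
under eq_bigr do rewrite sumrB; rewrite sumrB; congr (_ - _).
  apply: eq_bigr => a _; rewrite (bigD1 q) //= eqxx mulr1 big1 ?addr0 // => b bq.
  by rewrite (negbTE bq) mulr0 mul0r.
rewrite (bigD1 p) //= eqxx [X in _ + X]big1 ?addr0 => [|a ap]; last first.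
  by apply: big1 => b _; rewrite (negbTE ap) !mul0r.
by apply: eq_bigr => b _; rewrite mul1r mulrC.
Qed.

Lemma comF_centered B p q j : blk p = blk q -> \sum_(a | blk a == j) comF B p q a a = 0.
Proof.
move=> pq; under eq_bigr do rewrite mxE.
rewrite sumrB (eq_bigr (fun a => (a == q)%:R * (B p q)^*)); last first.
  by move=> a _; case: (a =P q) => [->|]; rewrite ?mulr0 ?mul0r // mulrC.
rewrite [X in _ - X](eq_bigr (fun a => (a == p)%:R * (B p q)^*)); last first.
  by move=> a _; case: (a =P p) => [->|]; rewrite ?mulr0 ?mul0r // mulrC.
rewrite -!mulr_suml.
have e (x : 'I_D) : \sum_(a | blk a == j) (a == x)%:R = (blk x == j)%:R :> C.
  rewrite big_mkcond (bigD1 x) //= eqxx big1 ?addr0 => [|a ax]; last by rewrite (negbTE ax); case: ifP.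
  by case: (_ == _).
by rewrite !e pq subrr.
Qed.

(** [comF] is a matrix supported in column q minus one supported in row p. They meet only at (p, q),
    which produces the cross term; as [B] is block diagonal, nothing lies outside the diagonal
    blocks. *)
Lemma comF_fro2 B p q : su blk B -> blk q = blk p ->
  \sum_a \sum_(b | blk b == blk a) n2 (comF B p q a b) =
  \sum_a n2 (B p a) + \sum_b n2 (B b q) - 2 * Re (B p p * (B q q)^*).
Proof.
move=> [_ b0 _] qp.
pose X : 'M[C]_D := \matrix_(a, b) ((B p a)^* * (b == q)%:R).
pose Y : 'M[C]_D := \matrix_(a, b) ((a == p)%:R * (B b q)^*).
have n20 : n2 (0 : C) = 0 by rewrite /n2 /= expr0n addr0.
transitivity (fro2 (X - Y)).
  rewrite /fro2; apply: eq_bigr => a _; rewrite [LHS]big_mkcond; apply: eq_bigr => b _.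
  rewrite !mxE; case: (blk b =P blk a) => // /eqP ba.
  have [e|_] := eqVneq b q; have [e'|_] := eqVneq a p; rewrite ?mulr0 ?mul0r ?subrr ?n20 //.
  - by rewrite e e' qp eqxx in ba.
  - by rewrite b0 ?conjC0 ?mul0r ?subr0 ?n20 // -qp -e.
  - by rewrite (b0 b) ?conjC0 ?mulr0 ?subr0 ?n20 // qp -e'.
rewrite fro2D hsNr -(fro_sqr (- _)) froN fro_sqr.
have -> : fro2 X = \sum_a n2 (B p a).
  apply: eq_bigr => a _; rewrite (bigD1 q) //= big1 ?addr0 => [|b bq]; rewrite mxE.
    by rewrite eqxx mulr1 n2J.
  by rewrite (negbTE bq) mulr0.
have -> : fro2 Y = \sum_b n2 (B b q).
  rewrite /fro2 (bigD1 p) //= [X in _ + X]big1 ?addr0 => [|a ap].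
    by apply: eq_bigr => b _; rewrite mxE eqxx mul1r n2J.
  by apply: big1 => b _; rewrite mxE (negbTE ap) mul0r.
have -> : hs X Y = Re (B p p * (B q q)^*).
  congr Re; rewrite /dot (bigD1 p) //= [X in _ + X]big1 ?addr0 => [|a ap]; last first.
    by apply: big1 => b _; rewrite [Y _ _]mxE (negbTE ap) mul0r mulr0.
  rewrite (bigD1 q) //= big1 ?addr0 => [|b bq]; last first.
    by rewrite [X _ _]mxE (negbTE bq) mulr0 conjC0 mul0r.
  by rewrite !mxE !eqxx mulr1 mul1r conjCK.
lra.
Qed.

(** Summed over q in the block of p, the cross terms contain a block trace of [B] and vanish. Each
    of the two remaining terms counts every entry of [B] once per index of its block, at least d_min
    times: the Casimir value 2 d_j of the adjoint representation. *)
Lemma comF_sum B : su blk B ->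
  2 * (dmin blk)%:R * fro2 B <= \sum_p \sum_(q | blk q == blk p) \sum_a \sum_(b | blk b == blk a) n2 (comF B p q a b).
Proof.
move=> sB.
have -> : \sum_p \sum_(q | blk q == blk p) \sum_a \sum_(b | blk b == blk a) n2 (comF B p q a b) =
   \sum_p \sum_(q | blk q == blk p) \sum_a n2 (B p a) + \sum_p \sum_(q | blk q == blk p) \sum_b n2 (B b q)
   - 2 * Re (\sum_p \sum_(q | blk q == blk p) (B p p * (B q q)^*)).
  rewrite cRe_sum mulr_sumr -big_split -sumrB; apply: eq_bigr => p _.
  rewrite cRe_sum mulr_sumr -big_split -sumrB; apply: eq_bigr => q /eqP qp.
  exact: comF_fro2.
have -> : \sum_p \sum_(q | blk q == blk p) (B p p * (B q q)^*) = 0.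
  apply: big1 => p _; rewrite -mulr_sumr -rmorph_sum; have [_ _ ->] := sB.
  by rewrite rmorph0 mulr0.
have -> : \sum_p \sum_(q | blk q == blk p) \sum_b n2 (B b q) = \sum_q \sum_(p | blk p == blk q) \sum_b n2 (B b q).
  under eq_bigr do rewrite big_mkcond.
  rewrite exchange_big; apply: eq_bigr => q _; rewrite [RHS]big_mkcond.
  by apply: eq_bigr => p _; rewrite eq_sym.
have h1 : (dmin blk)%:R * fro2 B <= \sum_p \sum_(q | blk q == blk p) \sum_a n2 (B p a).
  rewrite /fro2 mulr_sumr; apply: ler_sum => p _; rewrite sum_blk ler_wpM2r ?ler_nat ?dmin_le //.
  by apply: sumr_ge0 => a _; exact: n2_ge0.
have h2 : (dmin blk)%:R * fro2 B <= \sum_q \sum_(p | blk p == blk q) \sum_b n2 (B b q).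
  rewrite -fro2_adj /fro2 mulr_sumr; apply: ler_sum => p _; rewrite sum_blk.
  rewrite (eq_bigr (fun b => n2 (B b p))) => [|b _]; last by rewrite hadjE n2J.
  by rewrite ler_wpM2r ?ler_nat ?dmin_le // sumr_ge0 // => a _; exact: n2_ge0.
by rewrite /= mulr0 subr0; lra.
Qed.

Lemma okM2N (F : 'M[C]_D -> 'M[C]_D) : okM2 blk F -> okM2 blk (fun u => - F u).
Proof.
by move=> h a b; under eq_fun do rewrite mxE -mulN1r; apply: okCM; [exact: okC_cst|exact: h].
Qed.

Lemma ok_comm B X : ok (fun u => fro2 (B *m (u *m X *m adj u) - (u *m X *m adj u) *m B)).
Proof.
apply: ok_fro2; apply: okM2D; last apply: okM2N.
- by apply: okM2_mul; [exact: okM2_cst|exact: okM2_conj].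
- by apply: okM2_mul; [exact: okM2_conj|exact: okM2_cst].
Qed.

Lemma comm_step B : su blk B ->
  2 * (dmin blk)%:R * s ^+ 2 * fro2 B <=
  ex (fun u => fro2 (B *m (u *m sA *m adj u) - (u *m sA *m adj u) *m B)).
Proof.
move=> sB.
have okd F : ok (fun u => n2 (dot F (u *m sA *m adj u))).
  have [] : okC (fun u => dot F (u *m sA *m adj u)).
    apply: okC_sum => a; apply: okC_sum => b; apply: okCM; first exact: okC_cst.
    exact: okC_conj.
  by move=> o1 o2; rewrite /n2; apply: okD; under eq_fun do rewrite expr2; exact: okM.
have -> : ex (fun u => fro2 (B *m (u *m sA *m adj u) - (u *m sA *m adj u) *m B)) =
    \sum_p \sum_q ex (fun u => n2 (dot (comF B p q) (u *m sA *m adj u))).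
  transitivity (ex (fun u => \sum_p \sum_q n2 (dot (comF B p q) (u *m sA *m adj u)))).
    apply: (eq_ex P hU) => u _; apply: eq_bigr => p _; apply: eq_bigr => q _.
    by rewrite comF_dot.
  rewrite (ex_sum P hU mU) => [|p]; last by apply: ok_sum => q.
  by apply: eq_bigr => p _; rewrite (ex_sum P hU mU).
have h : s ^+ 2 * \sum_p \sum_(q | blk q == blk p) \sum_a \sum_(b | blk b == blk a) n2 (comF B p q a b)
    <= \sum_p \sum_q ex (fun u => n2 (dot (comF B p q) (u *m sA *m adj u))).
  rewrite mulr_sumr; apply: ler_sum => p _; rewrite mulr_sumr [leLHS]big_mkcond; apply: ler_sum => q _.
  case: ifP => [/eqP qp|_].
    by rewrite var_sA // => j; exact: comF_centered.
  rewrite -(ex_cst P U 0); apply: (ex_le P hU mU) => //; first exact: ok_cst.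
  by move=> u _; exact: n2_ge0.
apply: le_trans h; have := ler_wpM2l (sqr_ge0 s) (comF_sum sB); lra.
Qed.

Lemma comm_skew_herm B W E : adj B = - B -> adj W = - W -> adj E = E ->
  hs (B *m W - W *m B) (B *m E - E *m B) = 0.
Proof.
move=> hB hW hE; apply: hs_skew_herm; rewrite !hadjB !hadjM hB ?hW ?hE ?mulmxN ?mulNmx ?opprK.
  by rewrite opprB.
by rewrite addrC.
Qed.

(** The left side is 4 fro2 B minus the squared norm of the commutator of B and g. This commutator
    is the sum of a skew part from W and a Hermitian part from E, which are orthogonal, so the
    Hermitian part only helps. *)
Lemma comm_lower B W E g : unitary g -> adj B = - B -> adj W = - W -> adj E = E ->
  g = 1%:M + W + E -> fro2 (B + g *m B *m adj g) <= 4 * fro2 B - fro2 (B *m W - W *m B).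
Proof.
move=> ug hB hW hE eg; rewrite fro2D (hs_comm_decomp ug hB) (fro2_conj _ ug).
have -> : B *m g - g *m B = (B *m W - W *m B) + (B *m E - E *m B).
  rewrite eg !mulmxDr !mulmxDl mul1mx mulmx1.
  move: (B *m W) (W *m B) (B *m E) (E *m B) => a1 a2 a3 a4.
  by apply/matrixP => i k; rewrite !mxE; ring.
rewrite fro2D (comm_skew_herm hB hW hE).
have := fro2_ge0 (B *m E - E *m B).
move: (fro2 _) (fro2 _) (fro2 _) => f1 f2 f3; lra.
Qed.

Lemma contr_step B : su blk B ->
  ex (fun u => fro2 (B + (u *m sH *m adj u) *m B *m adj (u *m sH *m adj u))) <=
  (4 - 2 * (dmin blk)%:R * s ^+ 2) * fro2 B.
Proof.
move=> sB; have hB : adj B = - B by case: sB.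
have okn := ok_comm B sA.
have pt u : G u -> fro2 (B + (u *m sH *m adj u) *m B *m adj (u *m sH *m adj u)) <=
    4 * fro2 B - fro2 (B *m (u *m sA *m adj u) - (u *m sA *m adj u) *m B).
  move=> Gu; have Gg := G_conj sH_G Gu; set g := u *m sH *m adj u in Gg *.
  apply: (comm_lower (E := u *m sE *m adj u) Gg.1 hB).
  - have [h1 _ _] := su_conj Gu su_sA; exact: h1.
  - by rewrite !hadjM hadjK sE_adj mulmxA.
  - have := conj_unit_sub1 sH Gu.1; rewrite -/g sH_decomp mulmxDr mulmxDl => e.
    by rewrite -addrA -e addrC subrK.
apply: le_trans (ex_le P hU mU _ _ pt) _.
- apply: ok_fro2; apply: okM2D; first exact: okM2_cst.
  apply: okM2_mul; last exact/okM2_adj/okM2_conj.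
  by apply: okM2_mul; [exact: okM2_conj|exact: okM2_cst].
- by apply: okB => //; exact: ok_cst.
rewrite (exB P hU mU) //; last exact: ok_cst.
rewrite ex_cst; have := comm_step sB; lra.
Qed.

End StepElem.

(** * ** Iterating the steps until the traceless gradient is negligible *)

Section Stage1.
Variables (R : realType) (D : nat) (J : finType) (blk : 'I_D -> J).
Local Notation C := R[i].
Local Notation G := (@block_unitary R D J blk).
Local Notation grad_bound := (@grad_bound R D J blk).
Variables (d : measure_display) (T : measurableType d) (P : probability T R)
  (U : T -> 'M[C]_D).
Hypothesis hU : forall w, G (U w).
Hypothesis mU : forall A : set 'M[C]_D, mxBorel A -> measurable (U @^-1` A).
Hypothesis iU : forall g, G g -> forall A : set 'M[C]_D, mxBorel A ->
     P ((fun w => g *m U w) @^-1` A) = P (U @^-1` A).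
Local Notation ok := (@ok R D J blk).
Local Notation ex := (@ex R D d T P U).
Hypothesis n0 : (0 < dmin blk)%N.
Local Notation n := ((dmin blk)%:R : R).

Variables (K L lam : R).
Hypotheses (K0 : 0 <= K) (lam0 : 0 <= lam).
Let b : R := 2 * D%:R ^+ 3.
Let m1 := L * Num.sqrt b.
Let m2 := 2 * K * b.
Let CC := lam ^+ 2 * (m1 * m2 + m2 ^+ 2 / 2) + (lam * (m1 + m2)) ^+ 3.

Lemma stage1_step (s Ls : R) f Y : 0 <= s -> s <= 1 -> s * D%:R <= 1 -> n * s ^+ 2 <= 1 ->
  lam * (m1 + m2) * s <= 1 -> 0 <= Ls -> grad_bound K L Ls f Y ->
  exists f' Y', [/\ grad_bound K L (Num.sqrt (1 - n * s ^+ 2 / 2) * Ls) f' Y', ex f' = ex f &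
   ex (fun x => expR (lam * f x)) <= expR (lam ^+ 2 * s ^+ 2 * Ls ^+ 2 / 2 + CC * s ^+ 3) * ex (fun x => expR (lam * f' x))].
Proof.
move=> s0 s1 sD ns small Ls0 hf.
pose c := Num.sqrt (1 - n * s ^+ 2 / 2).
have c2 : c ^+ 2 = 1 - n * s ^+ 2 / 2 by rewrite sqr_sqrtr //; lra.
have c0 : 0 < c by rewrite sqrtr_gt0; lra.
have Gh := sH_G blk s0 sD.
have hc B : su blk B ->
  ex (fun u => fro2 (B + (u *m sH blk s *m adj u) *m B *m adj (u *m sH blk s *m adj u))) <= 4 * c ^+ 2 * fro2 B.
  move=> sB; apply: le_trans (contr_step hU mU iU s0 sD sB) _.
  by rewrite c2; have := fro2_ge0 B; move: (fro2 B) => q q0; lra.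
exists (stepf P U (sH blk s) f), (stepY P U (sH blk s) Y); split.
- exact: (step_grad_bound hU mU iU Gh K0 Ls0 hf c0 hc).
- exact: (ex_stepf hU mU iU Gh K0 hf).
- have b0 : 0 <= b by rewrite mulr_ge0 // exprn_ge0.
  have hv B : su blk B -> ex (fun u => hs B (u *m sA blk s *m adj u) ^+ 2) <= s ^+ 2 * fro2 B.
    by move=> sB; exact: (var_step hU mU iU s sB).
  exact: (step_mgf hU mU iU Gh K0 Ls0 hf s0 s1 b0 lam0 (fro2_sH blk s0 sD) (su_sA blk s) (sH_decomp blk s) (sE_adj blk s) (fro2_sA blk s) hv small).
Qed.

(** The k-th step costs lam^2 s^2 L^2 c2^k / 2, a geometric series of ratio c2 = 1 - n s^2 / 2. In
    its sum s^2 cancels, which leaves lam^2 L^2 / n however small the steps are. *)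
Lemma stage1_iter (s : R) f Y (k : nat) : 0 <= s -> s <= 1 -> s * D%:R <= 1 -> n * s ^+ 2 <= 1 ->
  lam * (m1 + m2) * s <= 1 -> grad_bound K L L f Y ->
  let c2 := 1 - n * s ^+ 2 / 2 in
  exists f' Y', [/\ grad_bound K L (Num.sqrt c2 ^+ k * L) f' Y', ex f' = ex f &
   ex (fun x => expR (lam * f x)) <= expR (lam ^+ 2 * L ^+ 2 * (1 - c2 ^+ k) / n + k%:R * (CC * s ^+ 3)) * ex (fun x => expR (lam * f' x))].
Proof.
move=> s0 s1 sD ns small hf c2; elim: k => [|k [f' [Y' [h1 h2 h3]]]].
  by exists f, Y; rewrite !expr0 !mul1r subrr mulr0 mul0r mul0r addr0 expR0 mul1r.
have L0 := grad_L0 hf.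
have Ls0 : 0 <= Num.sqrt c2 ^+ k * L by rewrite mulr_ge0 // exprn_ge0.
have [f2 [Y2 [k1 k2 k3]]] := stage1_step s0 s1 sD ns small Ls0 h1.
exists f2, Y2; split; [by rewrite exprS -mulrA|by rewrite k2|].
apply: le_trans h3 _; apply: le_trans (ler_wpM2l (expR_ge0 _) k3) _.
rewrite [leLHS]mulrA -expRD; apply: ler_wpM2r.
  rewrite -(ex_cst P U 0); apply: (ex_le P hU mU); [exact: ok_cst| |by move=> u _; exact: expR_ge0].
  exact/ok_expR/okZ/(grad_ok K0 k1).
rewrite ler_expR exprMn -exprM mulnC exprM.
have -> : Num.sqrt c2 ^+ 2 = c2 by rewrite sqr_sqrtr // /c2; lra.
have np : n != 0 by rewrite pnatr_eq0 -lt0n.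
rewrite le_eqVlt; apply/orP; left; apply/eqP.
have -> : k.+1%:R = k%:R + 1 :> R by rewrite -natr1.
have -> : c2 ^+ k.+1 = c2 ^+ k * (1 - n * s ^+ 2 / 2) by rewrite exprSr.
move: (c2 ^+ k) => q; field; exact: np.
Qed.

Theorem stage1 f Y (eps eta : R) : 0 < eps -> 0 < eta -> grad_bound K L L f Y ->
  exists f' Y', [/\ grad_bound K L eta f' Y', ex f' = ex f &
   ex (fun x => expR (lam * f x)) <= expR (lam ^+ 2 * L ^+ 2 / n + eps) * ex (fun x => expR (lam * f' x))].
Proof.
move=> e0 h0 hf; have L0 := grad_L0 hf.
have b0 : 0 <= b by rewrite mulr_ge0 // exprn_ge0.
have m10 : 0 <= m1 by rewrite mulr_ge0 // sqrtr_ge0.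
have m20 : 0 <= m2 by rewrite !mulr_ge0.
have CC0 : 0 <= CC.
  apply: addr_ge0; last by rewrite exprn_ge0 // mulr_ge0 // addr_ge0.
  by rewrite mulr_ge0 ?sqr_ge0 // addr_ge0 // ?mulr_ge0 // ?sqr_ge0.
have nat_ge (x : R) : exists a : nat, x <= a%:R.
  by exists (Num.bound `|x|); apply: le_trans (ler_norm x) _; apply: ltW; exact: archi_boundP.
(* [a] is the total time k s^2 of the k = a m^2 steps of size s = 1 / m: the squared traceless
   gradient has decayed by exp (- n a / 2), which is enough for [eta]. *)
have [a ha] := nat_ge (2 * L ^+ 2 / eta ^+ 2).
(* The cubic errors sum to k CC s^3 = a CC / m, so the first term makes them at most [eps]; the
   others ensure the smallness conditions on s. *)
have [m hm] := nat_ge (a%:R * CC / eps + D%:R + 1 + lam * (m1 + m2)).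
have q1 : 0 <= a%:R * CC / eps by rewrite divr_ge0 ?mulr_ge0 // ltW.
have q2 : 0 <= lam * (m1 + m2) by rewrite mulr_ge0 // addr_ge0.
have D0 : 0 <= D%:R :> R by [].
have mge1 : 1 <= m%:R :> R by lra.
have mp : 0 < m%:R :> R by lra.
pose s : R := m%:R^-1.
have s0 : 0 <= s by rewrite invr_ge0.
have s1 : s <= 1 by rewrite invf_le1.
have sM (x : R) : x <= m%:R -> s * x <= 1 by move=> h; rewrite mulrC ler_pdivrMr // mul1r.
have sD : s * D%:R <= 1 by apply: sM; lra.
have nD : n <= D%:R by rewrite ler_nat dmin_le_dim.
have ns : n * s ^+ 2 <= 1.
  rewrite expr2 mulrA -[1]mul1r ler_pM // ?mulr_ge0 // mulrC; apply: sM; lra.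
have small : lam * (m1 + m2) * s <= 1 by rewrite mulrC; apply: sM; lra.
have [f' [Y' [k1 k2 k3]]] := stage1_iter (a * m ^ 2) s0 s1 sD ns small hf.
set c2 := 1 - n * s ^+ 2 / 2 in k1 k3.
have np : 1 <= n by rewrite ler1n.
have c20 : 0 <= c2 by rewrite /c2; lra.
have ck0 : 0 <= c2 ^+ (a * m ^ 2) by rewrite exprn_ge0.
have ks2 : (a * m ^ 2)%:R * s ^+ 2 = a%:R by rewrite natrM natrX /s; field; rewrite gt_eqF.
exists f', Y'; split => //.
  apply: grad_le k1 => //.
  rewrite -ler_sqr ?nnegrE ?mulr_ge0 ?exprn_ge0 // ?(ltW h0) // exprMn -exprM mulnC exprM sqr_sqrtr //.
  have h1 : c2 <= expR (- (n * s ^+ 2 / 2)) by apply: (le_trans _ (expR_ge1Dx _)); rewrite /c2.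
  have h2 : c2 ^+ (a * m ^ 2) <= expR (- (a%:R / 2)).
    apply: le_trans (lerXn2r _ _ _ h1) _; rewrite ?nnegrE ?expR_ge0 //.
    rewrite -expRM_natl ler_expR mulrN lerN2.
    have -> : (a * m ^ 2)%:R * (n * s ^+ 2 / 2) = n * (a%:R / 2) by rewrite -ks2; ring.
    by rewrite ler_peMl // divr_ge0.
  apply: le_trans (ler_wpM2r (sqr_ge0 _) h2) _.
  rewrite expRN mulrC ler_pdivrMr ?expR_gt0 //.
  pose a2 : R := a%:R / 2.
  have h3 : a2 <= expR a2 by apply: (le_trans _ (expR_ge1Dx _)); lra.
  apply: (le_trans _ (ler_wpM2l (sqr_ge0 _) h3)).
  move: ha; rewrite ler_pdivrMr ?exprn_gt0 //; rewrite /a2; lra.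
apply: le_trans k3 _; rewrite ler_wpM2r //.
  rewrite -(ex_cst P U 0); apply: (ex_le P hU mU); [exact: ok_cst| |by move=> u _; exact: expR_ge0].
  exact/ok_expR/okZ/(grad_ok K0 k1).
rewrite ler_expR lerD //.
  rewrite ler_wpM2r ?invr_ge0 //.
  by rewrite ler_piMr ?mulr_ge0 ?sqr_ge0 // gerBl.
have -> : (a * m ^ 2)%:R * (CC * s ^+ 3) = a%:R * CC * s by rewrite -ks2; ring.
rewrite /s ler_pdivrMr // [eps * _]mulrC -ler_pdivrMr //; lra.
Qed.
End Stage1.

(** * Averaging over the block phases *)

Section Cis.
Variable R : realType.
Local Notation C := R[i].
Definition cis (a : R) : C := Complex (cos a) (sin a).
Lemma cisD a b : cis (a + b) = cis a * cis b.
Proof.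
apply: ceqP; rewrite ?cReM ?cImM; first exact: cosD.
exact: etrans (sinD a b) (addrC _ _).
Qed.
Lemma cis0 : cis 0 = 1. Proof. by rewrite /cis cos0 sin0. Qed.
Lemma cis_arg (z : C) : n2 z = 1 -> exists2 a, cis a = z & `|a| <= pi.
Proof.
move=> hz; have h1 : -1 <= Re z <= 1.
  by rewrite -ler_norml -[leRHS]ger0_norm // -ler_sqr ?nnegrE // !real_normK ?num_real // expr1n -hz /n2 lerDl sqr_ge0.
have e1 := acosK h1; have e2 := sin_acos h1.
have p1 : 0 <= acos (Re z) by exact: acos_ge0.
have p2 : acos (Re z) <= pi by exact: acos_lepi.
have e3 : Num.sqrt (1 - Re z ^+ 2) = `|Im z| by rewrite -sqrtr_sqr -hz /n2 addrC addKr.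
have [i0|i0] := leP 0 (Im z).
  exists (acos (Re z)); last by rewrite ger0_norm.
  by apply: ceqP => //=; rewrite e2 e3 ger0_norm.
exists (- acos (Re z)); last by rewrite normrN ger0_norm.
by apply: ceqP => /=; rewrite ?cosN ?sinN // e2 e3 ltr0_norm // opprK.
Qed.
Lemma cis_2pi a : cis (a - 2 * pi) = cis a.
Proof.
rewrite -[a in RHS](subrK (2 * pi)) [RHS]cisD; have -> : cis (2 * pi) = 1 by rewrite mulr_natl /cis cos2pi sin2pi.
by rewrite mulr1.
Qed.
End Cis.

(** * ** Paths in the group and bounds along them *)

Section Path.
Variables (R : realType) (D : nat) (J : finType) (blk : 'I_D -> J).
Local Notation C := R[i].
Local Notation G := (@block_unitary R D J blk).
Local Notation grad_bound := (@grad_bound R D J blk).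
Local Notation Pi := (Pi R blk).
Implicit Types (V x g : 'M[C]_D) (al : 'I_D -> R).

Definition dcis al : 'M[C]_D := diag_mx (\row_i cis (al i)).
Definition dI al : 'M[C]_D := diag_mx (\row_i Complex 0 (al i)).

Lemma dcisD al be : dcis (fun i => al i + be i) = dcis al *m dcis be.
Proof.
apply/matrixP => i k; rewrite mul_mx_diag !mxE cisD.
by case: (i =P k) => [->|_]; rewrite ?mulr1n // mulr0n mul0r.
Qed.
Lemma dcis0 : dcis (fun=> 0) = 1%:M.
Proof. by apply/matrixP => i k; rewrite !mxE cis0. Qed.
Lemma eq_dcis al be : al =1 be -> dcis al = dcis be.
Proof. by move=> e; congr dcis; apply/funext. Qed.
Lemma dcis_adj al : adj (dcis al) = dcis (fun i => - al i).
Proof.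
apply/matrixP => i k; rewrite hadjE !mxE eq_sym.
case: (i =P k) => [->|_]; last by rewrite !mulr0n conjC0.
by rewrite !mulr1n; apply: ceqP; rewrite ?cReJ ?cImJ /= ?cosN ?sinN.
Qed.
Lemma dcis_unitary al : unitary (dcis al).
Proof. by rewrite /unitary dcis_adj -dcisD -dcis0; apply: eq_dcis => i; rewrite addNr. Qed.

Lemma dI_skew al : adj (dI al) = - dI al.
Proof.
apply/matrixP => i k; rewrite hadjE !mxE eq_sym.
have [->|ne] := eqVneq i k; last by rewrite !mulr0n conjC0 oppr0.
by rewrite !mulr1n; apply: ceqP; rewrite ?cReJ ?cImJ ?cReN ?cImN /= ?oppr0.
Qed.
Lemma dIZ t al : dI (fun i => t * al i) = toC t *: dI al.
Proof.
apply/matrixP => i k; rewrite !mxE; case: (i == k); rewrite ?mulr0n ?mulr0 // !mulr1n.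
by apply: ceqP; rewrite ?cReM ?cImM /=; ring.
Qed.
Lemma fro2_dI al : fro2 (dI al) = \sum_i al i ^+ 2.
Proof. by rewrite fro2_diag; apply: eq_bigr => i _; rewrite /n2 /= expr0n add0r. Qed.
Lemma fro2_dcis1 al : fro2 (dcis al - 1%:M) <= \sum_i al i ^+ 2.
Proof.
have -> : dcis al - 1%:M = diag_mx (\row_i (cis (al i) - 1)).
  by apply/matrixP => i k; rewrite !mxE; case: (i == k); rewrite ?mulr0n ?subr0.
rewrite fro2_diag; apply: ler_sum => i _; rewrite /n2 cReB cImB /= subr0.
have := cos2Dsin2 (al i); have := cos_ge' (al i); lra.
Qed.
Lemma fro_dcis1I al : fro (dcis al - 1%:M - dI al) <= \sum_i al i ^+ 2.
Proof.
have S0 : 0 <= \sum_i al i ^+ 2 by apply: sumr_ge0 => i _; exact: sqr_ge0.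
rewrite -ler_sqr ?nnegrE ?fro_ge0 // fro_sqr.
have -> : dcis al - 1%:M - dI al = diag_mx (\row_i (cis (al i) - 1 - Complex 0 (al i))).
  by apply/matrixP => i k; rewrite !mxE; case: (i == k); rewrite ?mulr0n ?subr0.
rewrite fro2_diag expr2 mulr_suml; apply: ler_sum => i _.
apply: le_trans (_ : al i ^+ 2 * al i ^+ 2 <= _); last first.
  rewrite ler_wpM2l ?sqr_ge0 // (bigD1 i) //= lerDl.
  by apply: sumr_ge0 => k _; exact: sqr_ge0.
rewrite /n2 !cReB !cImB /= !subr0.
have h1 := cos_ge' (al i); have h2 := norm_sin_sub (al i); have h3 := cos_le1 (al i).
have e1 : (cos (al i) - 1) ^+ 2 <= (al i ^+ 2 / 2) ^+ 2.
  rewrite -[leLHS]sqrrN opprB lerXn2r ?nnegrE ?subr_ge0 // divr_ge0 ?sqr_ge0 //.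
have e2 : (sin (al i) - al i) ^+ 2 <= (al i ^+ 2 / 2) ^+ 2.
  by rewrite -(real_normK (num_real (sin _ - _))) lerXn2r ?nnegrE // divr_ge0 ?sqr_ge0.
move: e1 e2; move: (al i ^+ 2) => q e1 e2.
have : (q / 2) ^+ 2 <= q * q / 2 by have := sqr_ge0 q; rewrite !expr2; lra.
lra.
Qed.

Variables (K L Ls : R) (f : 'M[C]_D -> R) (Y : 'M[C]_D -> 'M[C]_D).
Hypotheses (K0 : 0 <= K) (hf : grad_bound K L Ls f Y).

Lemma path1 V al x : unitary V -> G (V *m dcis al *m adj V) -> G x ->
  `|f (V *m dcis al *m adj V *m x) - f x - hs (Y x) (V *m dI al *m adj V)| <= (K + L) * \sum_i al i ^+ 2.
Proof.
move=> uV Gg Gx; have := grad_K hf Gx Gg.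
rewrite conj_unit_sub1 // fro2_conj // => h1.
have h2 := grad_hs (V *m (dcis al - 1%:M - dI al) *m adj V) hf Gx.
have e : V *m (dcis al - 1%:M) *m adj V = V *m (dcis al - 1%:M - dI al) *m adj V + V *m dI al *m adj V.
  by rewrite -mulmxDl -mulmxDr subrK.
rewrite e hsDr in h1.
have h3 : fro (V *m (dcis al - 1%:M - dI al) *m adj V) <= \sum_i al i ^+ 2.
  by rewrite /fro fro2_conj // fro_dcis1I.
have h4 := ler_wpM2l K0 (fro2_dcis1 al).
have h5 := ler_wpM2l (grad_L0 hf) h3.
move: h1 h2 h3 h4 h5; move: (f _) (f _) (hs _ _) (hs _ _) (fro _) (fro2 _) (\sum_i _) => q1 q2 q3 q4 q5 q6 q7.
rewrite !ler_norml => /andP[a1 a2] /andP[a3 a4] h3 h4 h5; apply/andP; split; lra.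
Qed.

(** The path is cut into N equal steps. The second-order errors of [path1], of order 1 / N^2 each,
    add up to S / N and disappear in the limit; the derivative along the path remains. *)
Lemma pathN V al l x : unitary V -> (forall t, G (V *m dcis (fun i => t * al i) *m adj V)) -> G x ->
  (forall y, G y -> `|hs (Y y) (V *m dI al *m adj V)| <= l) ->
  `|f (V *m dcis al *m adj V *m x) - f x| <= l.
Proof.
move=> uV Gt Gx hl; pose S := (K + L) * \sum_i al i ^+ 2.
have S0 : 0 <= S by rewrite mulr_ge0 ?addr_ge0 ?(grad_L0 hf) // sumr_ge0 // => i _; exact: sqr_ge0.
pose g t := V *m dcis (fun i => t * al i) *m adj V.
have gD t s : g (t + s) = g t *m g s.
  rewrite /g; have -> : dcis (fun i => (t + s) * al i) = dcis (fun i => t * al i) *m dcis (fun i => s * al i).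
    by rewrite -dcisD; apply: eq_dcis => i; rewrite mulrDl.
  by rewrite !mulmxA -(mulmxA (V *m _) (adj V) V) uV mulmx1.
have step t k y : G y -> `|f (g (t *+ k) *m y) - f y| <= k%:R * (`|t| * l + t ^+ 2 * S).
  move=> Gy; elim: k => [|k IH].
    rewrite mulr0n mul0r /g (eq_dcis (be := fun=> 0)) => [|i]; last by rewrite mul0r.
    by rewrite dcis0 mulmx1 unitary_r // mul1mx subrr normr0.
  have Gk : G (g (t *+ k) *m y) by apply: G_mul => //; exact: Gt.
  have : `|f (g t *m (g (t *+ k) *m y)) - f (g (t *+ k) *m y) - hs (Y (g (t *+ k) *m y)) (V *m dI (fun i => t * al i) *m adj V)| <= _ := path1 uV (Gt t) Gk.
  rewrite dIZ -scalemxAr -scalemxAl hsZr mulmxA -gD -mulrS; have h1 := hl _ Gk.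
  have -> : (K + L) * (\sum_i (t * al i) ^+ 2) = t ^+ 2 * S.
    have -> : \sum_i (t * al i) ^+ 2 = t ^+ 2 * \sum_i al i ^+ 2.
      by rewrite mulr_sumr; apply: eq_bigr => i _; rewrite exprMn.
    by rewrite /S mulrCA.
  move=> h2.
  have h3 : `|t * hs (Y (g (t *+ k) *m y)) (V *m dI al *m adj V)| <= `|t| * l by rewrite normrM ler_wpM2l.
  have e (a b c z : R) : a - b = (c - b) + ((a - c - z) + z) by ring.
  rewrite (e _ _ (f (g (t *+ k) *m y)) (t * hs (Y (g (t *+ k) *m y)) (V *m dI al *m adj V))).
  apply: le_trans (ler_normD _ _) _; apply: le_trans (lerD IH (ler_normD _ _)) _.
  apply: le_trans (lerD (lexx _) (lerD h2 h3)) _.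
  by rewrite -natr1 [(k%:R + 1) * _]mulrDl mul1r [_ * S + _]addrC.
have e1 : V *m dcis al *m adj V = g 1 by rewrite /g; congr (_ *m _ *m _); apply: eq_dcis => i; rewrite mul1r.
rewrite e1; apply/ler_addgt0Pr => e e0.
pose N := Num.bound `|S / e|.
have hN : S / e < N.+1%:R.
  apply: le_lt_trans (ler_norm _) _; apply: lt_trans (archi_boundP _) _ => //.
  by rewrite ltr_nat.
have := step N.+1%:R^-1 N.+1 x Gx; rewrite -mulr_natr mulVf ?pnatr_eq0 // => h; apply: le_trans h _.
rewrite ger0_norm ?invr_ge0 // mulrDr mulrA mulfV ?pnatr_eq0 // mul1r lerD2l.
have -> : N.+1%:R * (N.+1%:R^-1 ^+ 2 * S) = S / N.+1%:R by field; rewrite addrC natr1 pnatr_eq0.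
by rewrite ler_pdivrMr // mulrC -ler_pdivrMr // ltW.
Qed.

(** Where a i and a k differ, the entry A i k must vanish; this is functional calculus in a diagonal
    basis. *)
Lemma commute_diag (A : 'M[C]_D) (a b : 'I_D -> C) : (forall i k, a i = a k -> b i = b k) ->
  A *m diag_mx (\row_i a i) = diag_mx (\row_i a i) *m A ->
  A *m diag_mx (\row_i b i) = diag_mx (\row_i b i) *m A.
Proof.
move=> ab h; apply/matrixP => i k; have /matrixP/(_ i k) := h.
rewrite !mul_mx_diag !mul_diag_mx !mxE.
have [/ab ->|ne] := eqVneq (a i) (a k); first by move=> _; rewrite mulrC.
move=> e; have : (a k - a i) * A i k = 0 by rewrite mulrBl -e mulrC subrr.
by move/eqP; rewrite mulf_eq0 subr_eq0 eq_sym (negbTE ne) /= => /eqP ->; rewrite mulr0 mul0r.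
Qed.

Lemma blockP (A : 'M[C]_D) : (forall j, Pi j *m A = A *m Pi j) <-> (forall i k, blk i != blk k -> A i k = 0).
Proof.
split=> [h i k ik|h j].
  have /matrixP/(_ i k) := h (blk i); rewrite Pi_mul mul_Pi eqxx mul1r => ->.
  by rewrite eq_sym (negbTE ik) mulr0.
apply/matrixP => a b; rewrite Pi_mul mul_Pi.
have [e|ne] := eqVneq (blk a) (blk b); first by rewrite e mulrC.
by rewrite h // mulr0 mul0r.
Qed.

(** A logarithm of [g] from the spectral theorem. Being a function of [g], it commutes with whatever
    commutes with [g], in particular with the block projections, so the whole path stays block
    unitary. *)
Lemma G_path g : G g -> exists V al, [/\ unitary V, g = V *m dcis al *m adj V,
  forall i, `|al i| <= pi, forall t, G (V *m dcis (fun i => t * al i) *m adj V) &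
  forall i k, blk i != blk k -> (V *m dI al *m adj V) i k = 0].
Proof.
move=> Gg; have [ug _] := Gg.
have [|V [a [h1 h2 h3]]] := @spectral R D g; first by rewrite ug unitary_r.
have hV (A : 'M[C]_D) : adj V *m (V *m A *m adj V) *m V = A.
  by rewrite !mulmxA h1 mul1mx -mulmxA h1 mulmx1.
have na i : n2 (a i) = 1.
  have : adj (diag_mx (\row_i a i)) *m diag_mx (\row_i a i) = 1%:M.
    rewrite -(hV (diag_mx _)) -h3; rewrite !hadjM hadjK.
    by rewrite !mulmxA -(mulmxA _ V (adj V)) h2 mulmx1 -(mulmxA _ (adj g) g) ug mulmx1 h1.
  move=> /matrixP/(_ i i); rewrite mul_mx_diag !mxE !eqxx mulr1n -n2E => /(congr1 (@complex.Re R)) /=.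
  by [].
(* The argument is chosen per value and not per index, so that equal eigenvalues receive equal
   arguments, as [commute_diag] requires. *)
pose arg z := xget 0 [set t : R | cis t = z /\ `|t| <= pi].
have argP i : cis (arg (a i)) = a i /\ `|arg (a i)| <= pi.
  have [t e1 e2] := cis_arg (na i).
  exact: (xgetPex 0 (ex_intro (fun t => cis t = a i /\ `|t| <= pi) t (conj e1 e2))).
have comm (A : 'M[C]_D) (b : 'I_D -> C) : (forall i k, a i = a k -> b i = b k) -> A *m g = g *m A ->
    A *m (V *m diag_mx (\row_i b i) *m adj V) = (V *m diag_mx (\row_i b i) *m adj V) *m A.
  move=> ab Ag; have : (adj V *m A *m V) *m diag_mx (\row_i b i) = diag_mx (\row_i b i) *m (adj V *m A *m V).
    apply: (commute_diag ab); rewrite -(hV (diag_mx _)) -h3.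
    have e X : adj V *m X *m V *m (adj V *m g *m V) = adj V *m (X *m g) *m V.
      by rewrite !mulmxA -(mulmxA _ V (adj V)) h2 mulmx1.
    have e' X : adj V *m g *m V *m (adj V *m X *m V) = adj V *m (g *m X) *m V.
      by rewrite !mulmxA -(mulmxA _ V (adj V)) h2 mulmx1.
    by rewrite e e' Ag.
  move=> /(congr1 (fun X => V *m X *m adj V)).
  rewrite !mulmxA h2 mul1mx => ->.
  by rewrite -(mulmxA _ V (adj V)) h2 mulmx1.
exists V, (fun i => arg (a i)); split => //.
- rewrite h3; congr (_ *m _ *m _); apply/matrixP => i k; rewrite !mxE.
  by have [-> _] := argP i.
- by move=> i; have [] := argP i.
- move=> t; split.
    have := dcis_unitary (fun i => t * arg (a i)); rewrite /unitary => ud.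
    rewrite !hadjM hadjK !mulmxA -(mulmxA _ (adj V) V) h1 mulmx1 -(mulmxA V) ud mulmx1 //.
  apply/blockP => j; apply: comm; last exact: Pi_comm.
  by move=> i k ->.
- apply/blockP => j; apply: comm; last exact: Pi_comm.
  by move=> i k ->.
Qed.
End Path.

(** * ** Averages over random signs *)

Section SignAvg.
Variables (R : realType) (J : finType).
Implicit Types (th : J -> R) (r : seq (J * R)) (H : (J -> R) -> R).

Definition dl (j : J) (a : R) : J -> R := fun k => if k == j then a else 0.
(** An entry [(j, a)] of the list shifts coordinate j by a or - a with a fair sign independent of
    the others; [sg] is the mean of [H] over all signs. *)
Fixpoint sg r H th : R :=
  if r is (j, a) :: r' then (sg r' H (th + dl j a) + sg r' H (th - dl j a)) / 2 else H th.

Lemma sg_cat r r' H th : sg (r ++ r') H th = sg r (sg r' H) th.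
Proof. by elim: r th => // -[j a] r IH th /=; rewrite !IH. Qed.
Lemma sg_le r H H' th : (forall t, H t <= H' t) -> sg r H th <= sg r H' th.
Proof. by move=> h; elim: r th => // -[j a] r IH th /=; rewrite ler_wpM2r ?invr_ge0 // lerD. Qed.
Lemma eq_sg r H H' th : (forall t, H t = H' t) -> sg r H th = sg r H' th.
Proof. by move=> h; congr sg; apply/funext. Qed.
Lemma sg_expR r H th : expR (sg r H th) <= sg r (fun t => expR (H t)) th.
Proof.
elim: r th => // -[j a] r IH th /=; apply: le_trans (expR_mid _ _) _.
by rewrite ler_wpM2r ?invr_ge0 // lerD.
Qed.
Lemma sg_shift r H s th : sg r (fun t => H (t + s)) th = sg r H (th + s).
Proof. by elim: r th => // -[j a] r IH th /=; rewrite !IH addrAC [_ - _ + _]addrAC. Qed.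
Lemma sg_affine r H c e th : sg r (fun t => c + e * H t) th = c + e * sg r H th.
Proof. by elim: r th => // -[j a] r IH th /=; rewrite !IH; lra. Qed.
Lemma sg_bnd r H H' k th : (forall t, `|H t - H' t| <= k) -> `|sg r H th - sg r H' th| <= k.
Proof.
move=> h; elim: r th => // -[j a] r IH th /=.
have := IH (th + dl j a); have := IH (th - dl j a).
by rewrite !ler_norml => /andP[a1 a2] /andP[a3 a4]; apply/andP; split; lra.
Qed.

Definition shiftb H j (be ka : R) := forall th, `|H (th + dl j be) - H th| <= ka.

Lemma shiftb_sg r H j be ka : shiftb H j be ka -> shiftb (sg r H) j be ka.
Proof. by move=> h th; rewrite -sg_shift; apply: sg_bnd => t; exact: h. Qed.

Lemma dlD j a b : dl j a + dl j b = dl j (a + b).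
Proof. by apply/funext => k; rewrite /dl fctE; case: eqP => // _; rewrite addr0. Qed.
Lemma dlN j a : - dl j a = dl j (- a).
Proof. by apply/funext => k; rewrite /dl fctE; case: eqP => // _; rewrite oppr0. Qed.

(** At distance 2 a the two averages share the value at th + a, which cancels; half a difference at
    distance 4 a is left. Halving the shift thus also halves the oscillation. *)
Lemma shiftb_double H j a ka : shiftb H j (4 * a) ka -> shiftb (sg [:: (j, a)] H) j (2 * a) (ka / 2).
Proof.
move=> h th /=; have := h (th - dl j a).
rewrite -!addrA !dlN !dlD.
have -> : - a + 4 * a = 2 * a + a by lra.
have -> : 2 * a - a = a by lra.
by rewrite !ler_norml => /andP[a1 a2]; apply/andP; split; lra.
Qed.

(* With the signs of [sg], the chunks p/4, p/8, ... of an angle p halve the oscillation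
   of a function under the shift by p at each stage; a sum of squares p^2 / 12 results. *)
Fixpoint chunk (j : J) (p : R) (b : nat) : seq (J * R) :=
  if b is b'.+1 then (j, p / 2 ^+ b'.+2) :: chunk j p b' else [::].

Lemma shiftb_chunk H j p ka b : shiftb H j p ka -> shiftb (sg (chunk j p b) H) j (p / 2 ^+ b) (ka / 2 ^+ b).
Proof.
move=> h; elim: b => [|b IH]; first by rewrite expr0 !divr1.
have n2 : 2 ^+ b != 0 :> R by rewrite expf_eq0 pnatr_eq0 andbF.
have -> : p / 2 ^+ b.+1 = 2 * (p / 2 ^+ b.+2) by rewrite !exprS; field.
have -> : ka / 2 ^+ b.+1 = ka / 2 ^+ b / 2 by rewrite !exprS; field.
apply: (@shiftb_double (sg (chunk j p b) H)).
by have -> : 4 * (p / 2 ^+ b.+2) = p / 2 ^+ b by rewrite !exprS; field.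
Qed.

Lemma chunk_sum j p b (y : J -> R) :
  \sum_(q <- chunk j p b) q.2 ^+ 2 * y q.1 ^+ 2 <= p ^+ 2 / 12 * y j ^+ 2.
Proof.
have -> : \sum_(q <- chunk j p b) q.2 ^+ 2 * y q.1 ^+ 2 = p ^+ 2 / 12 * (1 - 1 / 2 ^+ b ^+ 2) * y j ^+ 2.
  elim: b => [|b IH] /=; first by rewrite big_nil expr0 expr1n divr1 subrr mulr0 mul0r.
  have n2 : 2 ^+ b != 0 :> R by rewrite expf_eq0 pnatr_eq0 andbF.
  by rewrite big_cons IH /= !exprS; field.
by rewrite ler_wpM2r ?sqr_ge0 // ler_piMr ?divr_ge0 ?sqr_ge0 // gerBl divr_ge0 // exprn_ge0 // exprn_ge0.
Qed.

Definition allchunks (p : J -> R) b := flatten [seq chunk j (p j) b | j <- enum J].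

Lemma shiftb_all H p j ka b : shiftb H j (p j) ka ->
  shiftb (sg (allchunks p b) H) j (p j / 2 ^+ b) (ka / 2 ^+ b).
Proof.
move=> h; rewrite /allchunks; have : j \in enum J by rewrite mem_enum.
elim: (enum J) => // j' s IH; rewrite inE /=.
have e : sg (chunk j' (p j') b ++ flatten [seq chunk j (p j) b | j <- s]) H =
   sg (chunk j' (p j') b) (sg (flatten [seq chunk j (p j) b | j <- s]) H).
  by apply/funext => th; rewrite sg_cat.
rewrite e; case: (j =P j') => [<- _|_ /=]; first by apply: shiftb_chunk; exact: shiftb_sg.
by move=> /IH h'; exact: shiftb_sg.
Qed.

Lemma all_sum p b (y : J -> R) :
  \sum_(q <- allchunks p b) q.2 ^+ 2 * y q.1 ^+ 2 <= \sum_j p j ^+ 2 / 12 * y j ^+ 2.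
Proof.
by rewrite big_flatten /= big_map big_enum /=; apply: ler_sum => j _; exact: chunk_sum.
Qed.

Lemma sum_dl j a (y : J -> R) : \sum_k dl j a k * y k = a * y j.
Proof.
rewrite (bigD1 j) //= /dl eqxx big1 ?addr0 // => k kj.
by rewrite (negbTE kj) mul0r.
Qed.

(** For a linear exponent each sign contributes a factor cosh, bounded by [cosh_le]. *)
Lemma sg_cosh r (y : J -> R) th :
  sg r (fun t => expR (\sum_j t j * y j)) th <= expR (\sum_j th j * y j + (\sum_(q <- r) q.2 ^+ 2 * y q.1 ^+ 2) / 2).
Proof.
elim: r th => [|[j a] r IH] th /=; first by rewrite big_nil mul0r addr0.
rewrite big_cons /=; set Q := \sum_(q <- r) _ in IH *; set S := \sum_j th j * y j.
have e1 : \sum_k (th + dl j a) k * y k = S + a * y j.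
  by rewrite -(sum_dl j a y) -big_split; apply: eq_bigr => k _; rewrite mulrDl.
have e2 : \sum_k (th - dl j a) k * y k = S - a * y j.
  rewrite dlN -mulNr -(sum_dl j (- a) y) -big_split; apply: eq_bigr => k _; exact: mulrDl.
have h1 := IH (th + dl j a); have h2 := IH (th - dl j a); rewrite e1 in h1; rewrite e2 in h2.
apply: le_trans (_ : expR (S + Q / 2) * ((expR (a * y j) + expR (- (a * y j))) / 2) <= _).
  rewrite mulrA ler_wpM2r ?invr_ge0 // mulrDr -!expRD.
  apply: le_trans (lerD h1 h2) _; rewrite le_eqVlt; apply/orP; left; apply/eqP.
  by congr (expR _ + expR _); lra.
apply: le_trans (ler_wpM2l (expR_ge0 _) (cosh_le _)) _.
by rewrite -expRD ler_expR exprMn; lra.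
Qed.
End SignAvg.

(** * ** Translation by block phases *)

Section Phase.
Variables (R : realType) (D : nat) (J : finType) (blk : 'I_D -> J).
Local Notation C := R[i].
Local Notation mxT := (mxT R D).
Local Notation G := (@block_unitary R D J blk).
Local Notation grad_bound := (@grad_bound R D J blk).
Local Notation Pi := (Pi R blk).
Implicit Types (V x g : 'M[C]_D) (th : J -> R).

Definition ph th : 'M[C]_D := dcis (fun i => th (blk i)).
Definition phI th : 'M[C]_D := dI (fun i => th (blk i)).
Lemma phD th th' : ph (th + th') = ph th *m ph th'.
Proof. exact: dcisD. Qed.
Lemma ph0 : ph 0 = 1%:M. Proof. exact: dcis0. Qed.
Lemma ph_G th : G (ph th).
Proof.
split; first exact: dcis_unitary.
move=> i k ik; rewrite !mxE; case: (i =P k) => [e|]; last by rewrite mulr0n.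
by rewrite e eqxx in ik.
Qed.
Lemma ph_central th g : G g -> ph th *m g = g *m ph th.
Proof.
move=> [_ hg]; apply/matrixP => i k; rewrite mul_mx_diag mul_diag_mx !mxE.
have [e|ne] := eqVneq (blk i) (blk k); first by rewrite e mulrC.
by rewrite hg // mulr0 mul0r.
Qed.

(** Since [c] is central, left translation by [g] after [c] is translation by [c] after [g], and
    every bound is inherited at the point c x. *)
Lemma grad_cent K L Ls f Y c : G c -> (forall g, G g -> c *m g = g *m c) ->
  grad_bound K L Ls f Y -> grad_bound K L Ls (fun x => f (c *m x)) (fun x => Y (c *m x)).
Proof.
move=> Gc cg h; have mm : measurable_fun [set: mxT] ((fun x => c *m x) : mxT -> mxT).
  by have := mx_mul_meas c 1%:M; under eq_fun do rewrite mulmx1.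
split.
- exact: (measurableT_comp (grad_f h) mm).
- by move=> a b; exact: (cmeas_comp mm (grad_Y h a b)).
- by move=> x Gx; apply: (grad_skew h); exact: G_mul.
- by move=> x Gx; apply: (grad_L h); exact: G_mul.
- by move=> x B Gx; apply: (grad_Ls h); exact: G_mul.
- by move=> x g Gx Gg; rewrite mulmxA cg // -mulmxA; apply: (grad_K h) => //; exact: G_mul.
Qed.

Lemma grad_avg K L Ls f Y f' Y' : grad_bound K L Ls f Y -> grad_bound K L Ls f' Y' ->
  grad_bound K L Ls (fun x => (f x + f' x) / 2) (fun x => toC 2^-1 *: (Y x + Y' x)).
Proof.
move=> h h'; split.
- apply: measurable_funM; last exact: measurable_cst.
  by apply: measurable_funD; [exact: grad_f h|exact: grad_f h'].
- move=> a b; under eq_fun do rewrite 2!mxE; apply: cmeasM; first exact: cmeas_cst.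
  by apply: cmeasD; [exact: grad_Y h a b|exact: grad_Y h' a b].
- move=> x Gx; rewrite hadjZ conj_toC hadjD (grad_skew h Gx) (grad_skew h' Gx).
  by rewrite -opprD scalerN.
- move=> x Gx; rewrite froZ ger0_norm ?invr_ge0 //.
  have := froD (Y x) (Y' x); have := grad_L h Gx; have := grad_L h' Gx.
  by move: (fro _) (fro _) (fro _) => a1 a2 a3; lra.
- move=> x B Gx sB; rewrite hsZl hsDl; have := grad_Ls h Gx sB; have := grad_Ls h' Gx sB.
  by move: (hs _ _) (hs _ _) (fro _) => a1 a2 a3; lra.
- move=> x g Gx Gg; rewrite hsZl hsDl; have := grad_K h Gx Gg; have := grad_K h' Gx Gg.
  move: (f _) (f _) (f' _) (f' _) (hs _ _) (hs _ _) (fro2 _) => a1 a2 a3 a4 a5 a6 a7.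
  by rewrite !ler_norml => /andP[b1 b2] /andP[b3 b4]; apply/andP; split; lra.
Qed.

Definition av r th (f : 'M[C]_D -> R) x := sg r (fun t => f (ph t *m x)) th.

Lemma grad_av K L Ls f Y r th : grad_bound K L Ls f Y -> exists Y', grad_bound K L Ls (av r th f) Y'.
Proof.
move=> h; elim: r th => [|[j a] r IH] th.
  by exists (fun x => Y (ph th *m x)); apply: grad_cent => //; [exact: ph_G|exact: ph_central].
have [Y1 h1] := IH (th + dl j a); have [Y2 h2] := IH (th - dl j a).
by exists (fun x => toC 2^-1 *: (Y1 x + Y2 x)); exact: grad_avg.
Qed.
End Phase.

(** * ** The phase average and the sub-Gaussian bound *)

Section Stage2.
Variables (R : realType) (D : nat) (J : finType) (blk : 'I_D -> J).
Local Notation C := R[i].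
Local Notation mxT := (mxT R D).
Local Notation G := (@block_unitary R D J blk).
Local Notation grad_bound := (@grad_bound R D J blk).
Local Notation Pi := (Pi R blk).
Local Notation ph := (ph blk).
Local Notation phI := (phI blk).
Implicit Types (V x g : 'M[C]_D) (th : J -> R).
Variables (d : measure_display) (T : measurableType d) (P : probability T R)
  (U : T -> 'M[C]_D).
Hypothesis hU : forall w, G (U w).
Hypothesis mU : forall A : set 'M[C]_D, mxBorel A -> measurable (U @^-1` A).
Hypothesis iU : forall g, G g -> forall A : set 'M[C]_D, mxBorel A ->
     P ((fun w => g *m U w) @^-1` A) = P (U @^-1` A).
Local Notation ok := (@ok R D J blk).
Local Notation ex := (@ex R D d T P U).
Hypothesis n0 : (0 < dmin blk)%N.
Local Notation n := ((dmin blk)%:R : R).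

Lemma sum_cst (N : nat) (c : R) : \sum_(i < N) c = N%:R * c.
Proof. by rewrite sumr_const card_ord mulr_natl. Qed.

Lemma hs_sumr m k (I : Type) (r : seq I) (A : 'M[C]_(m, k)) (F : I -> 'M[C]_(m, k)) :
  hs A (\sum_(i <- r) F i) = \sum_(i <- r) hs A (F i).
Proof. by rewrite /hs dot_sumr cRe_sum. Qed.

Lemma bdim_pos j : 0 < (bdim blk j)%:R :> R.
Proof. by rewrite ltr0n; apply: leq_trans n0 (dmin_le blk j). Qed.

Definition dj (j : J) : 'M[C]_D := phI (fun k => (k == j)%:R).
Lemma phI_sum th : phI th = \sum_j toC (th j) *: dj j.
Proof.
apply/matrixP => i k; rewrite summxE (bigD1 (blk i)) //= big1 ?addr0 => [|j ij]; rewrite !mxE.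
  case: (i == k); rewrite ?mulr0n ?mulr0 // !mulr1n eqxx.
  by apply: ceqP; rewrite ?cReM ?cImM /=; ring.
rewrite eq_sym (negbTE ij) (_ : Complex 0 0 = 0) //.
by rewrite mul0rn mulr0.
Qed.

Lemma hs_phI X th : hs X (phI th) = \sum_j th j * hs X (dj j).
Proof. by rewrite phI_sum hs_sumr; apply: eq_bigr => j _; rewrite hsZr. Qed.

Lemma sum_by_block (F : J -> R) : \sum_i F (blk i) = \sum_j (bdim blk j)%:R * F j.
Proof.
rewrite (partition_big blk predT) //=; apply: eq_bigr => j _; rewrite -sum_blk.
by apply: eq_bigr => i /eqP ->.
Qed.

(** Bessel's inequality for the phase generators [dj], which are orthogonal with squared norm
    d_j. *)
Lemma phase_bessel (X : 'M[C]_D) : \sum_j (hs X (dj j)) ^+ 2 / (bdim blk j)%:R <= fro2 X.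
Proof.
set q := \sum_j _; pose th j : R := hs X (dj j) / (bdim blk j)%:R.
have e1 : hs X (phI th) = q.
  by rewrite hs_phI; apply: eq_bigr => j _; rewrite /th expr2 mulrAC.
have e2 : fro2 (phI th) = q.
  rewrite fro2_dI (sum_by_block (fun j => th j ^+ 2)); apply: eq_bigr => j _; rewrite /th.
  by field; rewrite gt_eqF // bdim_pos.
have q0 : 0 <= q by rewrite -e2 fro2_ge0.
have := hs_CS X (phI th); rewrite e1 => h.
have [->|qn] := eqVneq q 0; first exact: fro2_ge0.
have qp : 0 < q by rewrite lt_def qn.
have : q ^+ 2 <= fro2 X * q.
  by rewrite -(fro_sqr X) -{2}e2 -fro_sqr -exprMn ler_pXn2r ?nnegrE ?mulr_ge0 ?fro_ge0.
by rewrite expr2 ler_pM2r.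
Qed.

Lemma fro2_sub_le (B : 'M[C]_D) a : `|Im (B a a)| <= fro B.
Proof.
rewrite -ler_sqr ?nnegrE ?fro_ge0 // real_normK ?num_real // fro_sqr.
apply: le_trans (n2_le_fro B a a); by rewrite /n2 lerDr sqr_ge0.
Qed.

(** Every [g] is the end of a path with generator [B] of bounded norm. Removing the block means of
    its diagonal splits [B] into a member of [su], paid for by [eta], and a phase part, paid for by
    [mu] for each block. *)
Lemma near_const (K L eta mu : R) F Y : 0 <= K -> 0 <= eta -> 0 <= mu -> grad_bound K L eta F Y ->
  (forall y j, G y -> `|hs (Y y) (dj j)| <= mu) ->
  let m := Num.sqrt (D%:R * pi ^+ 2) in
  forall g x, G g -> G x -> `|F (g *m x) - F x| <= eta * (m + Num.sqrt (D%:R * m ^+ 2)) + #|J|%:R * (m * mu).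
Proof.
move=> K0 eta0 mu0 hF hmu m g x Gg Gx; have [V [al [uV -> hal Gt hB]]] := G_path Gg.
apply: (pathN K0 hF uV Gt Gx) => y Gy.
set B := V *m dI al *m adj V in hB *.
have sB : adj B = - B by have := conj_skew (adj V) (dI_skew al); rewrite hadjK.
have m0 : 0 <= m by exact: sqrtr_ge0.
have fB : fro B <= m.
  rewrite /fro fro2_conj // fro2_dI ler_sqrt; last by rewrite mulr_ge0 ?sqr_ge0.
  apply: le_trans (_ : \sum_(i < D) pi ^+ 2 <= _).
    by apply: ler_sum => i _; rewrite -(real_normK (num_real (al i))) ler_sqr ?nnegrE ?pi_ge0.
  by rewrite sum_cst.
clearbody B.
pose be j : R := (\sum_(a | blk a == j) Im (B a a)) / (bdim blk j)%:R.
have hbe j : `|be j| <= m.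
  rewrite normrM [`|_^-1|]ger0_norm ?invr_ge0 // ler_pdivrMr ?bdim_pos //.
  apply: le_trans (ler_norm_sum _ _ _) _; rewrite mulrC -sum_blk; apply: ler_sum => a _.
  exact: le_trans (fro2_sub_le B a) fB.
pose A := B - phI be.
have sA : su blk A.
  split.
  - by rewrite hadjB sB dI_skew opprB opprK addrC.
  - move=> i k ik; rewrite !mxE hB // add0r; case: (i =P k) => [e|_]; last by rewrite mulr0n oppr0.
    by rewrite e eqxx in ik.
  - move=> j; under eq_bigr do rewrite 2!mxE [phI be _ _]mxE mxE eqxx mulr1n.
    apply: ceqP; rewrite ?cRe_sum ?cIm_sum /=.
      apply: big1 => a _; rewrite cReB /= subr0.
      by have /matrixP/(_ a a) := sB; rewrite hadjE mxE => /(congr1 (@complex.Re R)); rewrite cReJ cReN; lra.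
    under eq_bigr do rewrite cImB /=.
    have eb : \sum_(a | blk a == j) be (blk a) = \sum_(a | blk a == j) be j by apply: eq_bigr => a /eqP ->.
    by rewrite sumrB eb sum_blk /be mulrC divfK ?subrr // gt_eqF // bdim_pos.
have -> : B = A + phI be by rewrite subrK.
have fA : fro A <= m + Num.sqrt (D%:R * m ^+ 2).
  apply: le_trans (froB _ _) _; apply: lerD => //.
  rewrite /fro fro2_dI ler_sqrt; last by rewrite mulr_ge0 ?sqr_ge0.
  apply: le_trans (_ : \sum_(i < D) m ^+ 2 <= _).
    by apply: ler_sum => i _; rewrite -(real_normK (num_real (be _))) ler_sqr ?nnegrE.
  by rewrite sum_cst.
rewrite hsDr; apply: le_trans (ler_normD _ _) _; apply: lerD.
  have h1 := grad_Ls hF Gy sA.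
  have sA' : su blk (- A).
    case: sA => [a1 a2 a3]; split.
    - by rewrite hadjN a1.
    - by move=> i k ik; rewrite mxE a2 // oppr0.
    - by move=> j; under eq_bigr do rewrite mxE; rewrite sumrN a3 oppr0.
  have h2 := grad_Ls hF Gy sA'; rewrite hsNr froN in h2.
  have h3 := ler_wpM2l eta0 fA.
  by rewrite ler_norml; apply/andP; split; lra.
rewrite hs_phI; apply: le_trans (ler_norm_sum _ _ _) _.
apply: le_trans (_ : \sum_(j : J) m * mu <= _).
  by apply: ler_sum => j _; rewrite normrM ler_pM // hmu.
by rewrite sumr_const mulr_natl.
Qed.

Definition ang (j : J) : R := 2 * pi / (bdim blk j)%:R.

Section F.
Variables (K L eta lam : R) (f : 'M[C]_D -> R) (Y : 'M[C]_D -> 'M[C]_D).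
Hypotheses (K0 : 0 <= K) (eta0 : 0 <= eta) (lam0 : 0 <= lam) (hf : grad_bound K L eta f Y).

Lemma ok_grad B : ok (fun x => hs (Y x) B).
Proof.
split; last first.
  by exists (L * fro B) => x Gx; exact: grad_hs hf Gx.
apply: measurable_hs; [exact: grad_Y hf|by move=> a b; exact: cmeas_cst].
Qed.

Lemma path_ph th x : G x -> `|f (ph th *m x) - f x - hs (Y x) (phI th)| <= (K + L) * \sum_i th (blk i) ^+ 2.
Proof.
move=> Gx; have u1 : unitary (1%:M : 'M[C]_D) by rewrite /unitary hadj1 mulmx1.
have := @path1 R D J blk K L eta f Y K0 hf 1%:M (fun i => th (blk i)) x u1.
by rewrite hadj1 !mul1mx !mulmx1; apply => //; exact: ph_G.
Qed.

(** The path from 1 to [ph th] is cut into N steps. The total increment is, up to S / N, the mean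
    over k of the linear terms at the points ph (t k) x; Jensen moves the exponential inside that
    mean, and invariance gives each of these points the law of x. No second-order term is left in
    the limit. *)
Lemma mgf_phase th : ex (fun x => expR (lam * (f x - f (ph th *m x)))) <=
  ex (fun x => expR (\sum_j th j * (- lam * hs (Y x) (dj j)))).
Proof.
have okf := grad_ok K0 hf.
pose w x := hs (Y x) (phI th).
have okw : ok w by exact: ok_grad.
have wE x : \sum_j th j * (- lam * hs (Y x) (dj j)) = - lam * w x.
  by rewrite /w hs_phI mulr_sumr; apply: eq_bigr => j _; ring.
have -> : ex (fun x => expR (\sum_j th j * (- lam * hs (Y x) (dj j)))) = ex (fun x => expR (- lam * w x)).
  by apply: (eq_ex P hU) => x _; rewrite wE.
have okew : ok (fun x => expR (- lam * w x)) by apply: ok_expR; exact: okZ.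
have ew0 : 0 <= ex (fun x => expR (- lam * w x)).
  rewrite -(ex_cst P U 0); apply: (ex_le P hU mU); [exact: ok_cst|exact: okew|].
  by move=> u _; exact: expR_ge0.
apply: le_eps_expR => // e e0.
pose S := (K + L) * \sum_i th (blk i) ^+ 2.
have S0 : 0 <= S by rewrite mulr_ge0 ?addr_ge0 ?(grad_L0 hf) // sumr_ge0 // => i _; exact: sqr_ge0.
pose M := Num.bound `|lam * S / e|.
have hM : lam * S / e <= M.+1%:R.
  apply: le_trans (ler_norm _) _; apply: ltW; apply: lt_trans (archi_boundP _) _ => //.
  by rewrite ltr_nat.
pose N := M.+1; have N0 : 0 < N%:R :> R by [].
pose t k : J -> R := fun j => (k%:R / N%:R) * th j.
have okt k F : ok F -> ok (fun x => F (ph (t k) *m x)) by apply: ok_transl; exact: ph_G.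
have pt x : G x -> expR (lam * (f x - f (ph th *m x))) <=
    expR e * ((\sum_(k < N) expR (- lam * w (ph (t k) *m x))) / N%:R).
  move=> Gx.
  have tel : f x - f (ph th *m x) = - \sum_(k < N) (f (ph (t k.+1) *m x) - f (ph (t k) *m x)).
    rewrite -(big_mkord xpredT (fun k => f (ph (t k.+1) *m x) - f (ph (t k) *m x))) telescope_sumr // opprB.
    have -> : t 0%N = 0 by apply/funext => j; rewrite /t mul0r mul0r.
    have -> : t N = th by apply/funext => j; rewrite /t divff ?mul1r // gt_eqF.
    by rewrite ph0 mul1mx.
  have st k : - (f (ph (t k.+1) *m x) - f (ph (t k) *m x)) <= - w (ph (t k) *m x) / N%:R + S / N%:R ^+ 2.
    have Gk : G (ph (t k) *m x) by apply: G_mul => //; exact: ph_G.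
    have := path_ph (fun j => N%:R^-1 * th j) Gk.
    rewrite /phI dIZ hsZr -/(phI th) -/(w _) mulmxA -phD.
    have -> : (fun j => N%:R^-1 * th j) + t k = t k.+1.
      by apply/funext => j; rewrite /t fctE -natr1; field; rewrite gt_eqF.
    have -> : (K + L) * (\sum_i (N%:R^-1 * th (blk i)) ^+ 2) = S / N%:R ^+ 2.
      have -> : \sum_i (N%:R^-1 * th (blk i)) ^+ 2 = N%:R^-1 ^+ 2 * \sum_i th (blk i) ^+ 2.
        by rewrite mulr_sumr; apply: eq_bigr => i _; rewrite exprMn.
      by rewrite /S exprVn mulrCA [RHS]mulrC.
    move: (f _) (f _) (w _) => a1 a2 a3; rewrite ler_norml => /andP[b1 b2].
    rewrite mulNr [a3 / _]mulrC; lra.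
  have up : f x - f (ph th *m x) <= (\sum_(k < N) (- w (ph (t k) *m x))) / N%:R + S / N%:R.
    rewrite tel -sumrN; apply: le_trans (ler_sum _ _) _ => [i _|]; first exact: st.
    rewrite big_split /= -mulr_suml; rewrite lerD2l sum_cst.
    by rewrite le_eqVlt; apply/orP; left; apply/eqP; field; rewrite gt_eqF.
  apply: le_trans (_ : expR (e + (\sum_(k < N) (- lam * w (ph (t k) *m x))) / N%:R) <= _).
    rewrite ler_expR; have := ler_wpM2l lam0 up.
    have -> : \sum_(k < N) - lam * w (ph (t k) *m x) = lam * \sum_(k < N) - w (ph (t k) *m x).
      by rewrite mulr_sumr; apply: eq_bigr => k _; rewrite mulrN mulNr.
    have : lam * (S / N%:R) <= e.
      by rewrite mulrA ler_pdivrMr // [e * _]mulrC -ler_pdivrMr.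
    move: (\sum_(k < N) _) => q; lra.
  rewrite expRD ler_wpM2l ?expR_ge0 //.
  have := @expR_jensen R 'I_N (fun k => - lam * w (ph (t k) *m x)).
  by rewrite card_ord; apply.
have okl : ok (fun x => expR (lam * (f x - f (ph th *m x)))).
  by apply: ok_expR; apply: okZ; apply: okB => //; apply: ok_transl => //; exact: ph_G.
apply: le_trans (ex_le P hU mU okl _ pt) _.
  apply: okZ; under eq_fun do rewrite mulrC; apply: okZ; apply: ok_sum => k.
  exact: (okt k (fun x => expR (- lam * w x))).
rewrite (exZ P hU mU); last first.
  by under eq_fun do rewrite mulrC; apply: okZ; apply: ok_sum => k; exact: (okt k (fun x => expR (- lam * w x))).
rewrite ler_wpM2l ?expR_ge0 //.
have -> : ex (fun x => (\sum_(k < N) expR (- lam * w (ph (t k) *m x))) / N%:R) =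
    N%:R^-1 * ex (fun x => \sum_(k < N) expR (- lam * w (ph (t k) *m x))).
  rewrite -(exZ P hU mU); last by apply: ok_sum => k; exact: (okt k (fun x => expR (- lam * w x))).
  by apply: (eq_ex P hU) => x _; rewrite mulrC.
rewrite (ex_sum P hU mU) => [|k]; last exact: (okt k (fun x => expR (- lam * w x))).
rewrite (eq_bigr (fun=> ex (fun x => expR (- lam * w x)))) => [|k _]; last first.
  exact: (ex_inv hU mU iU (ph_G blk (t k)) okew).
by rewrite sum_cst mulrA mulVf ?mul1r // gt_eqF.
Qed.

Lemma ok_sg r F th : (forall t, ok (F t)) -> ok (fun x => sg r (fun t => F t x) th).
Proof.
move=> h; elim: r th => [|[j a] r IH] th /=; first exact: h.
by under eq_fun do rewrite mulrC; apply: okZ; exact: okD.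
Qed.
Lemma ex_sg r F th : (forall t, ok (F t)) -> ex (fun x => sg r (fun t => F t x) th) = sg r (fun t => ex (F t)) th.
Proof.
move=> h; elim: r th => [|[j a] r IH] th //=.
rewrite -!IH -(exD P hU mU); [|exact: ok_sg|exact: ok_sg].
rewrite [RHS]mulrC -(exZ P hU mU); last by apply: okD; exact: ok_sg.
by apply: (eq_ex P hU) => x _; rewrite mulrC.
Qed.

(** Jensen takes the sign average out of the exponential and [mgf_phase] linearizes every shift in
    expectation; then the signs can be put back inside the expectation and averaged exactly as
    products of cosh. *)
Lemma mgf_av r : ex (fun x => expR (lam * (f x - av blk r 0 f x))) <=
  ex (fun x => expR ((\sum_(q <- r) q.2 ^+ 2 * (- lam * hs (Y x) (dj q.1)) ^+ 2) / 2)).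
Proof.
have okf := grad_ok K0 hf.
have okt t : ok (fun x => f (ph t *m x)) by apply: ok_transl => //; exact: ph_G.
have okt2 t : ok (fun x => expR (lam * (f x - f (ph t *m x)))) by apply: ok_expR; apply: okZ; exact: okB.
have oky t : ok (fun x => expR (\sum_j t j * (- lam * hs (Y x) (dj j)))).
  by apply: ok_expR; apply: ok_sum => j; apply: okZ; apply: okZ; exact: ok_grad.
have okav : ok (av blk r 0 f) by exact: ok_sg.
apply: le_trans (_ : ex (fun x => sg r (fun t => expR (lam * (f x - f (ph t *m x)))) 0) <= _).
  apply: (ex_le P hU mU); [by apply: ok_expR; apply: okZ; exact: okB|exact: ok_sg|].
  move=> x Gx; have -> : lam * (f x - av blk r 0 f x) = sg r (fun t => lam * (f x - f (ph t *m x))) 0.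
    have := sg_affine r (fun t => f (ph t *m x)) (lam * f x) (- lam) 0.
    rewrite -/(av blk r 0 f x) mulNr -mulrBr => <-.
    by apply: eq_sg => t; ring.
  exact: sg_expR.
rewrite ex_sg //; apply: le_trans (_ : sg r (fun t => ex (fun x => expR (\sum_j t j * (- lam * hs (Y x) (dj j))))) 0 <= _).
  by apply: sg_le => t; exact: mgf_phase.
rewrite -ex_sg //; apply: (ex_le P hU mU); first exact: ok_sg.
  apply: ok_expR; under eq_fun do rewrite mulrC; apply: okZ; apply: ok_sum => q; apply: okZ.
  by under eq_fun do rewrite expr2; apply: okM; apply: okZ; exact: ok_grad.
move=> x Gx; apply: le_trans (sg_cosh r (fun j => - lam * hs (Y x) (dj j)) 0) _.
by rewrite [X in X + _]big1 ?add0r // => j _; rewrite mul0r.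
Qed.
Local Notation p := ang.
(** For the angles 2 pi / d_j the chunks give pi^2 / (3 d_j^2), halved by the cosh bound. One factor
    1 / d_j is absorbed by [phase_bessel], the other is at most 1 / d_min; this holds for every
    number [b] of halvings. *)
Lemma mgf_av_le b :
  ex (fun x => expR (lam * (f x - av blk (allchunks p b) 0 f x))) <= expR (lam ^+ 2 * (pi ^+ 2 / 6) * L ^+ 2 / n).
Proof.
apply: le_trans (mgf_av _) _.
rewrite -(ex_cst P U (expR (lam ^+ 2 * (pi ^+ 2 / 6) * L ^+ 2 / n))).
apply: (ex_le P hU mU); [|exact: ok_cst|].
  apply: ok_expR; under eq_fun do rewrite mulrC; apply: okZ; apply: ok_sum => q; apply: okZ.
  by under eq_fun do rewrite expr2; apply: okM; apply: okZ; exact: ok_grad.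
move=> x Gx; rewrite ler_expR.
have h1 := all_sum p b (fun j => - lam * hs (Y x) (dj j)).
have h2 : \sum_j p j ^+ 2 / 12 * (- lam * hs (Y x) (dj j)) ^+ 2 <= lam ^+ 2 * (pi ^+ 2 / 3) / n * \sum_j (hs (Y x) (dj j)) ^+ 2 / (bdim blk j)%:R.
  rewrite mulr_sumr; apply: ler_sum => j _.
  have -> : p j ^+ 2 / 12 * (- lam * hs (Y x) (dj j)) ^+ 2 =
     lam ^+ 2 * (pi ^+ 2 / 3) * (hs (Y x) (dj j) ^+ 2 / (bdim blk j)%:R) * (bdim blk j)%:R^-1.
    by rewrite /ang; field; rewrite gt_eqF // bdim_pos.
  rewrite [leRHS]mulrAC; apply: ler_wpM2l.
    by apply: mulr_ge0; [apply: mulr_ge0; rewrite ?divr_ge0 ?sqr_ge0|rewrite divr_ge0 ?sqr_ge0].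
  by rewrite lef_pV2 ?posrE ?bdim_pos ?ltr0n // ler_nat dmin_le.
have h3 : \sum_j (hs (Y x) (dj j)) ^+ 2 / (bdim blk j)%:R <= L ^+ 2.
  apply: le_trans (phase_bessel _) _; rewrite -fro_sqr.
  by rewrite ler_pXn2r ?nnegrE ?fro_ge0 ?(grad_L0 hf) //; exact: (grad_L hf).
have c0 : 0 <= lam ^+ 2 * (pi ^+ 2 / 3) / n by apply: mulr_ge0; rewrite ?invr_ge0 //; apply: mulr_ge0; rewrite ?divr_ge0 ?sqr_ge0.
have := ler_wpM2l c0 h3; move: h1 h2; move: (\sum_(q <- _) _) (\sum_j _) (\sum_j _) => a1 a2 a3; lra.
Qed.

(** The phase e^(2 pi i / d_j) on block j does not change when 2 pi is subtracted from the angle at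
    one index of the block. The angles then sum to zero, so the path has its generator in [su] and
    costs only [eta]. *)
Lemma phase_center j x : G x ->
  `|f (ph (dl j (p j)) *m x) - f x| <= eta * Num.sqrt (D%:R * (2 * pi) ^+ 2).
Proof.
move=> Gx.
pose al i : R := dl j (p j) (blk i) - 2 * pi * ((blk i == j) && (i == ctr blk i))%:R.
have e : ph (dl j (p j)) = dcis al.
  apply/matrixP => i k; rewrite !mxE; congr (_ *+ _); rewrite /al.
  by case: (_ && _); rewrite ?mulr1 ?cis_2pi // mulr0 subr0.
have u1 : unitary (1%:M : 'M[C]_D) by rewrite /unitary hadj1 mulmx1.
have := @pathN R D J blk K L eta f Y K0 hf 1%:M al (eta * Num.sqrt (D%:R * (2 * pi) ^+ 2)) x u1.
rewrite hadj1 !mul1mx !mulmx1 e; apply => //.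
- move=> t; rewrite mul1mx mulmx1; split; first exact: dcis_unitary.
  move=> i k ik; rewrite !mxE; case: (i =P k) => [e'|]; last by rewrite mulr0n.
  by rewrite e' eqxx in ik.
- have sal : su blk (dI al).
    split; first exact: dI_skew.
    + move=> i k ik; rewrite !mxE; case: (i =P k) => [e'|]; last by rewrite mulr0n.
      by rewrite e' eqxx in ik.
    + move=> j'; under eq_bigr do rewrite !mxE eqxx mulr1n.
      apply: ceqP; rewrite ?cRe_sum ?cIm_sum /=; first by apply: big1.
      have [a0 /eqP <-|none] := pickP [pred a | blk a == j']; last by rewrite big_pred0.
      rewrite (eq_bigr (fun a => (- 2 * pi * (blk a0 == j)%:R) * (a == ctr blk a)%:R + dl j (p j) (blk a0))).
        rewrite sum_ctr /dl; case: (blk a0 =P j) => [->|_]; last by rewrite !mulr0 addr0.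
        by rewrite /ang mulr1; field; rewrite gt_eqF // bdim_pos.
      move=> a /eqP ea; rewrite /al ea; case: (blk a0 == j); case: (a == _) => /=; lra.
  have fal : fro (dI al) <= Num.sqrt (D%:R * (2 * pi) ^+ 2).
    rewrite /fro fro2_dI ler_sqrt; last by rewrite mulr_ge0 ?sqr_ge0.
    apply: le_trans (_ : \sum_(i < D) (2 * pi) ^+ 2 <= _); last first.
      by rewrite sum_cst.
    apply: ler_sum => i _; rewrite -(real_normK (num_real (al i))) ler_sqr ?nnegrE ?mulr_ge0 ?pi_ge0 //.
    have pi0 := @pi_ge0 R.
    have p0 : 0 <= p j by rewrite divr_ge0 ?mulr_ge0 // ltW // bdim_pos.
    have p1 : p j <= 2 * pi.
      by rewrite ler_pdivrMr ?bdim_pos // ler_peMr ?mulr_ge0 // ler1n -(ltr0n R) bdim_pos.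
    rewrite ler_norml /al /dl; apply/andP; case: (blk i == j); case: (i == _) => /=; split; lra.
  move=> y Gy.
  have sal' : su blk (- dI al).
    case: sal => [a1 a2 a3]; split.
    - by rewrite hadjN a1.
    - by move=> i k ik; rewrite mxE a2 // oppr0.
    - by move=> j'; under eq_bigr do rewrite mxE; rewrite sumrN a3 oppr0.
  have h1 := grad_Ls hf Gy sal; have h2 := grad_Ls hf Gy sal'; rewrite hsNr froN in h2.
  have h3 := ler_wpM2l eta0 fal.
  by rewrite ler_norml; apply/andP; split; lra.
Qed.
End F.

(** By [phase_center] a shift by a full angle hardly changes f, and the halvings give an oscillation
    ka / 2^b for the shift be = ang j / 2^b of the average. Compared with the first-order expansion
    over [be], this bounds the derivative along [dj] that [near_const] asks for. *)
Lemma av_const (K L eta : R) f Y b : 0 <= K -> 0 <= eta -> grad_bound K L eta f Y ->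
  let p := ang in
  let m := Num.sqrt (D%:R * pi ^+ 2) in
  let mu := eta * Num.sqrt (D%:R * (2 * pi) ^+ 2) * D%:R + (K + L) * D%:R * (2 * pi) / 2 ^+ b in
  forall g x, G g -> G x ->
  `|av blk (allchunks p b) 0 f (g *m x) - av blk (allchunks p b) 0 f x|
    <= eta * (m + Num.sqrt (D%:R * m ^+ 2)) + #|J|%:R * (m * mu).
Proof.
move=> K0 eta0 hf p m mu g x Gg Gx.
have [Y' hY'] := grad_av (allchunks p b) 0 hf.
have pi0 := @pi_gt0 R; have L0 := grad_L0 hf.
have b0 : 0 < 2 ^+ b :> R by rewrite exprn_gt0.
apply: (near_const K0 eta0 _ hY') => //.
  have KL0 : 0 <= K + L by rewrite addr_ge0.
  apply: addr_ge0; first by rewrite !mulr_ge0 // sqrtr_ge0.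
  by rewrite mulr_ge0 ?invr_ge0 ?(ltW b0) // !mulr_ge0 // ltW.
move=> y j Gy; set F := av _ _ _ _ in hY' *.
set ka := eta * Num.sqrt _ in mu *.
have h1 : shiftb (fun t => f (ph t *m y)) j (p j) ka.
  move=> th; rewrite (addrC th) phD -mulmxA; apply: (phase_center K0 eta0 hf j).
  by apply: G_mul => //; exact: ph_G.
have h2 := @shiftb_all R J (fun t => f (ph t *m y)) p j ka b h1 0.
set be := p j / 2 ^+ b in h2 *.
have e1 : sg (allchunks p b) (fun t => f (ph t *m y)) (0 + dl j be) = F (ph (dl j be) *m y).
  rewrite -sg_shift; apply: eq_sg => t; by rewrite phD mulmxA.
rewrite e1 -/(F y) in h2.
have h3 := path_ph K0 hY' (dl j be) Gy.
have e2 : hs (Y' y) (phI (dl j be)) = be * hs (Y' y) (dj j) by rewrite hs_phI sum_dl.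
rewrite e2 in h3.
have bp := bdim_pos j.
have pj0 : 0 < p j by rewrite divr_gt0 // mulr_gt0.
have be0 : 0 < be by rewrite divr_gt0.
have h4 : \sum_i dl j be (blk i) ^+ 2 <= D%:R * be ^+ 2.
  apply: le_trans (_ : \sum_(i < D) be ^+ 2 <= _); last by rewrite sum_cst.
  apply: ler_sum => i _; rewrite /dl; case: eqP => // _; by rewrite expr0n sqr_ge0.
have KL0 : 0 <= K + L by rewrite addr_ge0.
have h5 := ler_wpM2l KL0 h4.
have h6 : be * `|hs (Y' y) (dj j)| <= ka / 2 ^+ b + (K + L) * (D%:R * be ^+ 2).
  rewrite -{1}(ger0_norm (ltW be0)) -normrM.
  have e3 : be * hs (Y' y) (dj j) = (F (ph (dl j be) *m y) - F y) - (F (ph (dl j be) *m y) - F y - be * hs (Y' y) (dj j)).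
    by move: (F _) (F _) (be * _) => a1 a2 a3; lra.
  rewrite e3; apply: le_trans (ler_normB _ _) _; apply: lerD => //.
  exact: le_trans h3 h5.
rewrite -(ler_pM2l be0); apply: le_trans h6 _.
have pj1 : p j <= 2 * pi.
  by rewrite ler_pdivrMr // ler_peMr ?mulr_ge0 // ?(ltW pi0) // ler1n -(ltr0n R).
have dD : (bdim blk j)%:R <= D%:R :> R by rewrite ler_nat bdim_le.
have ka0 : 0 <= ka by rewrite mulr_ge0 // sqrtr_ge0.
rewrite /mu mulrDr; apply: lerD.
  rewrite /be mulrC [leRHS](_ : _ = (2 ^+ b)^-1 * (ka * (p j * D%:R))); last by field; rewrite gt_eqF.
  apply: ler_wpM2l; first by rewrite invr_ge0 ltW.
  (* Division by the angle is replaced by the factor D, since (2 pi / d_j) D >= 1. *)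
  rewrite ler_peMr // /p /ang mulrAC -mulrA ; apply: mulr_ege1; first by have := pi_ge2 R; lra.
  by rewrite ler_pdivlMr ?mul1r.
rewrite [leLHS](_ : _ = be * ((K + L) * D%:R * p j / 2 ^+ b)); last by rewrite /be; field; rewrite gt_eqF.
apply: ler_wpM2l; first exact: ltW.
rewrite ler_wpM2r ?invr_ge0 ?(ltW b0) // ler_wpM2l // mulr_ge0 //.
Qed.

Theorem mgf_bound (K L lam : R) f Y : 0 <= K -> 0 <= lam -> grad_bound K L L f Y ->
  ex (fun x => expR (lam * (f x - ex f))) <= expR (3 * lam ^+ 2 * L ^+ 2 / n).
Proof.
move=> K0 lam0 hf; have L0 := grad_L0 hf; have pi0 := @pi_gt0 R.
have np : 0 < n by rewrite ltr0n.
have okf := grad_ok K0 hf.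
pose m : R := Num.sqrt (D%:R * pi ^+ 2).
(* The bound of [av_const] is eta A1 + A2 / 2^b; [eta] and [b] are chosen below so that 2 lam times
   it is at most e / 2. *)
pose A1 : R := m + Num.sqrt (D%:R * m ^+ 2) + #|J|%:R * (m * (Num.sqrt (D%:R * (2 * pi) ^+ 2) * D%:R)).
pose A2 : R := #|J|%:R * (m * ((K + L) * D%:R * (2 * pi))).
have m0 : 0 <= m by exact: sqrtr_ge0.
have A10 : 0 <= A1 by rewrite /A1 !addr_ge0 ?mulr_ge0 ?sqrtr_ge0.
have KL0 : 0 <= K + L by rewrite addr_ge0.
have p20 : 0 <= 2 * pi :> R by rewrite mulr_ge0 // ltW.
have A20 : 0 <= A2 by do 3?apply: mulr_ge0 => //; apply: mulr_ge0.
have piQ : 1 + pi ^+ 2 / 6 <= 3 :> R by have := pi2_lt12 R; lra.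
apply: le_eps_expR => //; do ?exact: expR_ge0.
move=> e e0.
pose eta : R := e / (4 * (2 * lam * A1 + 1)).
have l2 : 0 <= 2 * lam by rewrite mulr_ge0.
have q1 : 0 <= 2 * lam * A1 by exact: mulr_ge0.
have q2 : 0 <= 2 * lam * A2 by exact: mulr_ge0.
have eta0 : 0 < eta by rewrite divr_gt0 //; lra.
pose b := Num.bound (4 * (2 * lam * A2) / e).
have hb : 2 * lam * A2 / 2 ^+ b <= e / 4.
  have p2 : 0 < 2 ^+ b :> R by rewrite exprn_gt0.
  rewrite ler_pdivrMr //.
  have h0 : 0 <= 4 * (2 * lam * A2) / e by rewrite divr_ge0 ?(ltW e0) // mulr_ge0.
  have h1 := archi_boundP h0; rewrite -/b in h1.
  have h2 : b%:R <= 2 ^+ b :> R by rewrite -natrX ler_nat ltnW // ltn_expl.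
  have h3 := le_trans (ltW h1) h2; rewrite ler_pdivrMr // in h3.
  by move: (2 ^+ b) (2 * lam * A2) h3 => B W; lra.
have heta : 2 * lam * A1 * eta <= e / 4.
  rewrite /eta; have -> : 2 * lam * A1 * (e / (4 * (2 * lam * A1 + 1))) = (e / 4) * (2 * lam * A1 / (2 * lam * A1 + 1)).
    by field; rewrite gt_eqF //; lra.
  by rewrite ler_piMr ?divr_ge0 ?(ltW e0) // ler_pdivrMr; move: (2 * lam * A1) q1 => W; lra.
have e4 : 0 < e / 4 by rewrite divr_gt0.
have [f' [Y' [h1 h2 h3]]] := stage1 hU mU iU n0 K0 lam0 e4 eta0 hf.
have okf' := grad_ok K0 h1.
pose F := av blk (allchunks ang b) 0 f'.
have okF : ok F by apply: ok_sg => t; apply: ok_transl => //; exact: ph_G.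
pose del := eta * A1 + A2 / 2 ^+ b.
have cF g x : G g -> G x -> `|F (g *m x) - F x| <= del.
  move=> Gg Gx; apply: le_trans (av_const b K0 (ltW eta0) h1 Gg Gx) _.
  by rewrite /del /A1 /A2 -/m le_eqVlt; apply/orP; left; apply/eqP; ring.
have hd : 2 * lam * del <= e / 2.
  have -> : 2 * lam * del = 2 * lam * A1 * eta + 2 * lam * A2 / 2 ^+ b by rewrite /del; ring.
  by apply: le_trans (lerD heta hb) _; lra.
clearbody del A1 A2 m.
have exF : ex F = ex f.
  rewrite -h2 /F /av ex_sg => [|t]; last by apply: ok_transl => //; exact: ph_G.
  have -> : (fun t => ex (fun x => f' (ph t *m x))) = (fun t => ex f').
    by apply/funext => t; apply: (ex_inv hU mU iU) => //; exact: ph_G.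
  have := sg_affine (allchunks ang b) (fun=> 0) (ex f') 0 0.
  by rewrite !mul0r !addr0.
(* All values of F lie within [del] of F 1, hence within 2 del of its mean. *)
have F1 x : G x -> F x <= ex F + 2 * del.
  move=> Gx; have h5 : F 1%:M - del <= ex F.
    rewrite -(ex_cst P U (F 1%:M - del)); apply: (ex_le P hU mU) => //; first exact: ok_cst.
    move=> y Gy; have := cF _ _ Gy (G1 R blk); rewrite mulmx1 ler_norml => /andP[].
    by move: (F y) (F 1%:M) => a a1; lra.
  have := cF _ _ Gx (G1 R blk); rewrite mulmx1 ler_norml => /andP[].
  by move: (F x) (F 1%:M) (ex F) h5 => a a1 a2; lra.
have okl c (H : 'M[C]_D -> R) : ok H -> ok (fun x => expR (lam * (H x - c))).
  by move=> hH; apply: ok_expR; apply: okZ; apply: okB => //; exact: ok_cst.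
have exs c (H : 'M[C]_D -> R) : ok H -> ex (fun x => expR (lam * (H x - c))) = expR (- lam * c) * ex (fun x => expR (lam * H x)).
  move=> hH; rewrite -(exZ P hU mU); last by apply: ok_expR; exact: okZ.
  by apply: (eq_ex P hU) => x _; rewrite -expRD; congr expR; ring.
have main : ex (fun x => expR (lam * (f' x - ex f))) <= expR (lam ^+ 2 * (pi ^+ 2 / 6) * L ^+ 2 / n + 2 * lam * del).
  rewrite expRD; apply: le_trans (ler_wpM2r (expR_ge0 _) (mgf_av_le K0 lam0 h1 b)).
  rewrite mulrC -(exZ P hU mU); last by apply: ok_expR; apply: okZ; exact: okB.
  apply: (ex_le P hU mU); first exact: okl.
    by apply: okZ; apply: ok_expR; apply: okZ; exact: okB.
  move=> x Gx; rewrite -expRD ler_expR -exF.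
  have := ler_wpM2l lam0 (F1 x Gx); rewrite -/F.
  by move: (F x) (ex F) => a a1; lra.
rewrite exs //; apply: le_trans (ler_wpM2l (expR_ge0 _) h3) _.
rewrite mulrCA -(exs (ex f) f' okf'); apply: le_trans (ler_wpM2l (expR_ge0 _) main) _.
rewrite -!expRD ler_expR.
have hL : 0 <= lam ^+ 2 * L ^+ 2 / n by rewrite divr_ge0 ?(ltW np) // mulr_ge0 ?sqr_ge0.
have := ler_wpM2l hL piQ; move: hd.
by move: (2 * lam * del) (pi ^+ 2) (L ^+ 2) (n^-1) (lam ^+ 2) => a1 a2 a3 a4 a5; lra.
Qed.
End Stage2.

(** * The mean deviation *)

Section Decoupling.
Variables (R : realType) (D : nat) (J : finType) (blk : 'I_D -> J).
Local Notation C := R[i].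
Local Notation G := (@block_unitary R D J blk).
Local Notation Pi := (Pi R blk).
Variables (d : measure_display) (T : measurableType d) (P : probability T R)
  (U : T -> 'M[C]_D).
Hypothesis hU : forall w, G (U w).
Hypothesis mU : forall A : set 'M[C]_D, mxBorel A -> measurable (U @^-1` A).
Hypothesis iU : forall g, G g -> forall A : set 'M[C]_D, mxBorel A ->
     P ((fun w => g *m U w) @^-1` A) = P (U @^-1` A).
Local Notation ok := (@ok R D J blk).
Local Notation okC := (@okC R D J blk).
Local Notation ex := (@ex R D d T P U).
Local Notation cex := (@cex R D d T P U).
Local Notation dd a := ((bdim blk (blk a))%:R : R).

Variables (N q : nat) (v : 'I_D -> 'I_D -> 'M[C]_(N, q)).

(* With [v] the amplitudes of a Kraus decomposition, [bmat u *m adj (bmat u)] is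
   M(u rho u^-1) and [gam] is GammaER. *)
Definition bmat (u : 'M[C]_D) : 'M[C]_(N, q) := \sum_s \sum_t u s t *: v s t.
Definition gam : 'M[C]_N := \sum_s \sum_(t | blk t == blk s) toC (dd s)^-1 *: (v s t *m adj (v s t)).
Definition dev (u : 'M[C]_D) := bmat u *m adj (bmat u) - gam.

Definition btr s s' x y (j : J) : C := toC ((bdim blk j)%:R)^-1 * \sum_(t | blk t == j) (v s t *m adj (v s' t)) x y.
(** The Gram entries of the amplitudes minus their block mean on the diagonal. Subtracting [gam]
    amounts to this centering, so every entry of the deviation is a sum of entries of conjugated
    traceless matrices, to which [covT_formula] applies. *)
Definition yc s s' x y : 'M[C]_D := \matrix_(t, t')
  ((v s t *m adj (v s' t')) x y - (t == t')%:R * btr s s' x y (blk t)).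

Lemma yc_centered s s' x y : centered blk (yc s s' x y).
Proof.
move=> j; have [a ja|none] := pickP [pred a | blk a == j]; last by rewrite big_pred0.
rewrite (eq_bigr (fun t => (v s t *m adj (v s' t)) x y - btr s s' x y j)).
  have e : \sum_(t | blk t == j) btr s s' x y j = (bdim blk j)%:R * btr s s' x y j by apply: bdim_sum.
  rewrite sumrB e /btr toCV toC_nat mulrA mulfV ?mul1r ?subrr //.
  by rewrite -(eqP ja) bdim_neq0.
by move=> t /eqP tj; rewrite mxE eqxx mul1r tj.
Qed.

Lemma devE u x y : G u -> dev u x y = \sum_s \sum_s' (u *m yc s s' x y *m adj u) s s'.
Proof.
move=> Gu; pose Z s s' : 'M[C]_D := \matrix_(t, t') (v s t *m adj (v s' t')) x y.
pose c s s' : 'M[C]_D := diag_mx (\row_t btr s s' x y (blk t)).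
have yE s s' : yc s s' x y = Z s s' - c s s'.
  apply/matrixP => t t'; rewrite !mxE; congr (_ - _).
  by case: (t =P t') => [->|_]; rewrite ?mul1r ?mulr1n // mul0r mulr0n.
have cc s s' : u *m c s s' *m adj u = c s s'.
  have -> : u *m c s s' = c s s' *m u.
    apply/matrixP => i k; rewrite mul_mx_diag mul_diag_mx !mxE.
    have [e|ne] := eqVneq (blk i) (blk k); first by rewrite e mulrC.
    by have [_ ->] := Gu; rewrite ?mulr0 ?mul0r.
  by rewrite -mulmxA (unitary_r Gu.1) mulmx1.
rewrite /dev mxE [(- gam) x y]mxE.
transitivity (\sum_s \sum_s' ((u *m Z s s' *m adj u) s s' - (c s s') s s')); last first.
  apply: eq_bigr => s _; apply: eq_bigr => s' _.
  rewrite yE mulmxBr mulmxBl cc; move: (u *m Z s s' *m adj u) (c s s') => A B.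
  by rewrite [RHS]mxE [(- B) s s']mxE.
under eq_bigr do rewrite sumrB; rewrite sumrB; congr (_ - _).
  rewrite /bmat hadj_sum mulmx_suml summxE; apply: eq_bigr => s _.
  rewrite mulmx_sumr summxE; apply: eq_bigr => s' _.
  rewrite hadj_sum mulmx_suml summxE mxE.
  transitivity (\sum_t \sum_t' u s t * (u s' t')^* * Z s s' t t').
    apply: eq_bigr => t _; rewrite mulmx_sumr summxE; apply: eq_bigr => t' _.
    by rewrite hadjZ -scalemxAl -scalemxAr !mxE; ring.
  rewrite exchange_big; apply: eq_bigr => t' _; rewrite mxE mulr_suml; apply: eq_bigr => t _.
  by rewrite hadjE; ring.
rewrite /gam summxE; apply: eq_bigr => s _; rewrite [RHS](bigD1 s) //= [X in _ = _ + X]big1 ?addr0 => [|s' ss'].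
  rewrite summxE [RHS]mxE eqxx mulr1n mxE /btr mulr_sumr; apply: eq_bigr => t _.
  by rewrite [LHS]mxE.
by rewrite !mxE eq_sym (negbTE ss') mulr0n.
Qed.

Definition kapR (j j' : J) : R := ((bdim blk j)%:R * (bdim blk j')%:R - (j == j')%:R)^-1.
Lemma kapCE j j' : kapC R blk j j' = toC (kapR j j').
Proof. by rewrite /kapC /kapR toCV toCD toCN toCM !toC_nat. Qed.
Lemma kapR_ge0 a b : 0 <= kapR (blk a) (blk b).
Proof.
rewrite invr_ge0 subr_ge0 -natrM ler_nat; apply: leq_trans (leq_b1 _) _.
by rewrite muln_gt0 !bdim_gt0.
Qed.

Definition yn2 s s' x y := \sum_(t | blk t == blk s) \sum_(t' | blk t' == blk s') n2 (yc s s' x y t t').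

Lemma sum_pick (p : 'I_D * 'I_D) (F : 'I_D * 'I_D -> C) :
  \sum_r F r * ((p.1 == r.1) && (p.2 == r.2))%:R = F p.
Proof.
rewrite (bigD1 p) //= !eqxx mulr1 big1 ?addr0 // => r rp.
suff -> : (p.1 == r.1) && (p.2 == r.2) = false by rewrite mulr0.
apply/negbTE; apply: contra rp => /andP[/eqP e4 /eqP e5].
by rewrite [r]surjective_pairing -e4 -e5 -surjective_pairing.
Qed.

(** In [covT_formula] the term with equal index pairs gives the right side. The trace term enters
    with a minus sign and is, block by block, a nonnegative multiple of a sum of squared moduli, so
    it is dropped. *)
Lemma dev_entry_le x y : ex (fun u => n2 (dev u x y)) <=
  \sum_s \sum_s' kapR (blk s) (blk s') * yn2 s s' x y.
Proof.
pose Y (p : 'I_D * 'I_D) := yc p.1 p.2 x y.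
pose g u (p r : 'I_D * 'I_D) := (u *m Y p *m adj u) p.1 p.2 * ((u *m Y r *m adj u) r.1 r.2)^*.
have okg p r : okC (fun u => g u p r) by exact: covT_ok.
have e1 : ex (fun u => n2 (dev u x y)) = Re (cex (fun u => \sum_p \sum_r g u p r)).
  apply: (eq_ex P hU) => u Gu; rewrite devE // pair_bigA /=.
  by rewrite -[n2 _]/(Re (toC (n2 _))) sqr_sumC.
rewrite e1 (cex_sum P hU mU) => [|p]; last by apply: okC_sum.
have e2 p : cex (fun u => \sum_r g u p r) = \sum_r kapC R blk (blk p.1) (blk p.2) * blkS blk (Y p) (Y r) (blk p.1) (blk p.2) *
    (((p.1 == r.1) && (p.2 == r.2))%:R - ((p.1 == p.2) && (r.1 == r.2) && (blk p.1 == blk r.1))%:R / (bdim blk (blk p.1))%:R).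
  rewrite (cex_sum P hU mU) //; apply: eq_bigr => r _.
  by rewrite -(covT_formula hU mU iU) //; exact: yc_centered.
under eq_bigr do rewrite e2.
pose first p := kapC R blk (blk p.1) (blk p.2) * blkS blk (Y p) (Y p) (blk p.1) (blk p.2).
pose second (p r : 'I_D * 'I_D) := ((p.1 == p.2) && (r.1 == r.2) && (blk p.1 == blk r.1))%:R *
   (kapC R blk (blk p.1) (blk p.2) * blkS blk (Y p) (Y r) (blk p.1) (blk p.2) / (bdim blk (blk p.1))%:R).
have e3 : \sum_p \sum_r kapC R blk (blk p.1) (blk p.2) * blkS blk (Y p) (Y r) (blk p.1) (blk p.2) *
    (((p.1 == r.1) && (p.2 == r.2))%:R - ((p.1 == p.2) && (r.1 == r.2) && (blk p.1 == blk r.1))%:R / (bdim blk (blk p.1))%:R)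
   = \sum_p first p - \sum_p \sum_r second p r.
  rewrite -sumrB; apply: eq_bigr => p _.
  under eq_bigr do rewrite mulrBr; rewrite sumrB; congr (_ - _).
    exact: (sum_pick p (fun r => kapC R blk (blk p.1) (blk p.2) * blkS blk (Y p) (Y r) (blk p.1) (blk p.2))).
  by apply: eq_bigr => r _; rewrite /second; ring.
rewrite e3 cReB.
have e4 : Re (\sum_p first p) = \sum_s \sum_s' kapR (blk s) (blk s') * yn2 s s' x y.
  rewrite cRe_sum -(pair_bigA _ (fun s s' => Re (first (s, s')))) /=.
  apply: eq_bigr => s _; apply: eq_bigr => s' _; rewrite /first kapCE cRe_toC; congr (_ * _).
  rewrite /blkS cRe_sum; apply: eq_bigr => t _; rewrite cRe_sum; apply: eq_bigr => t' _.
  by rewrite mulrC -n2E'.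
rewrite e4 lerBlDr lerDl.
have -> : \sum_p \sum_r second p r = \sum_s \sum_(s' | blk s' == blk s)
   toC (kapR (blk s) (blk s) / (bdim blk (blk s))%:R) * blkS blk (Y (s, s)) (Y (s', s')) (blk s) (blk s).
  rewrite -(pair_bigA _ (fun s s' => \sum_r second (s, s') r)) /=; apply: eq_bigr => s _.
  rewrite (bigD1 s) //= [X in _ + X]big1 ?addr0 => [|s' ss']; last first.
    by apply: big1 => r _; rewrite /second /= eq_sym (negbTE ss') !andFb mul0r.
  rewrite -(pair_bigA _ (fun r r' => second (s, s) (r, r'))) /= [RHS]big_mkcond; apply: eq_bigr => r _.
  rewrite (bigD1 r) //= [X in _ + X]big1 ?addr0 => [|r' rr']; last first.
    by rewrite /second /= [r == r']eq_sym (negbTE rr') andbF andFb mul0r.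
  rewrite /second /= !eqxx [blk s == _]eq_sym /=; case: (blk r == blk s); rewrite ?mul1r ?mul0r //.
  by rewrite kapCE toCM toCV toC_nat; ring.
rewrite (partition_big blk predT) //= cRe_sum; apply: sumr_ge0 => j _.
have [a /eqP ja|none] := pickP [pred a | blk a == j]; last by rewrite big_pred0.
have -> : \sum_(i | blk i == j) \sum_(s' | blk s' == blk i)
     toC (kapR (blk i) (blk i) / (bdim blk (blk i))%:R) * blkS blk (Y (i, i)) (Y (s', s')) (blk i) (blk i) =
  toC (kapR j j / (bdim blk j)%:R * \sum_(t | blk t == j) \sum_(t' | blk t' == j) n2 (\sum_(s | blk s == j) Y (s, s) t t')).
  transitivity (\sum_(i | blk i == j) \sum_(s' | blk s' == j) toC (kapR j j / (bdim blk j)%:R) * blkS blk (Y (i, i)) (Y (s', s')) j j).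
    by apply: eq_bigr => i /eqP ->.
  under eq_bigr do rewrite -mulr_sumr; rewrite -mulr_sumr [RHS]toCM; congr (_ * _).
  rewrite toC_sum /blkS; under eq_bigr do rewrite exchange_big /=; rewrite exchange_big /=.
  apply: eq_bigr => t _; under eq_bigr do rewrite exchange_big /=; rewrite exchange_big /= toC_sum.
  apply: eq_bigr => t' _; rewrite n2E mulrC rmorph_sum mulr_suml; apply: eq_bigr => s _.
  by rewrite mulr_sumr.
rewrite /= mulr_ge0 //; first by rewrite divr_ge0 // -ja kapR_ge0.
by do 2!apply: sumr_ge0 => ? _; exact: n2_ge0.
Qed.

Lemma fro2_gram (a b : 'M[C]_(N, q)) : fro2 (a *m adj b) = hs (adj a *m a) (adj b *m b).
Proof.
rewrite fro2_hs hs_mull -(hs_adj (a *m adj b *m b)) !hadjM hadjK /hs !dotE !hadjM !hadjK.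
by rewrite mxtrace_mulC !mulmxA.
Qed.

Lemma yn2_off s s' x y : blk s != blk s' ->
  yn2 s s' x y = \sum_(t | blk t == blk s) \sum_(t' | blk t' == blk s') n2 ((v s t *m adj (v s' t')) x y).
Proof.
move=> ss'; apply: eq_bigr => t /eqP ts; apply: eq_bigr => t' /eqP ts'; rewrite mxE.
suff -> : t == t' = false by rewrite mul0r subr0.
by apply/negbTE; apply: contra ss' => /eqP e; rewrite -ts -ts' e.
Qed.

(** Subtracting the mean of d numbers lowers their sum of squares by the squared modulus of their
    total over d. *)
Lemma yn2_in s s' x y : blk s' = blk s ->
  yn2 s s' x y = \sum_(t | blk t == blk s) \sum_(t' | blk t' == blk s) n2 ((v s t *m adj (v s' t')) x y)
   - (dd s)^-1 * n2 (\sum_(t | blk t == blk s) (v s t *m adj (v s' t)) x y).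
Proof.
move=> ss'; rewrite /yn2 ss'; set j := blk s.
pose w t t' := (v s t *m adj (v s' t')) x y.
pose z := \sum_(t | blk t == j) w t t.
have dn : dd s != 0 by rewrite pnatr_eq0 -lt0n bdim_gt0.
have h t : blk t == j -> \sum_(t' | blk t' == j) n2 (yc s s' x y t t') =
   \sum_(t' | blk t' == j) n2 (w t t') - (2 * (dd s)^-1 * Re ((w t t)^* * z) - (dd s)^-2 * n2 z).
  move=> tj; rewrite (bigD1 t) // [in RHS](bigD1 t) //=.
  have -> : \sum_(i | (blk i == j) && (i != t)) n2 (yc s s' x y t i) = \sum_(i | (blk i == j) && (i != t)) n2 (w t i).
    by apply: eq_bigr => i /andP[_ it]; rewrite mxE eq_sym (negbTE it) mul0r subr0.
  have -> : n2 (yc s s' x y t t) = n2 (w t t) - (2 * (dd s)^-1 * Re ((w t t)^* * z) - (dd s)^-2 * n2 z).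
    rewrite mxE eqxx mul1r (eqP tj) /btr -/j -/z -/(w t t).
    rewrite -exprVn -/j; move: (_^-1) => c; move: z (w t t) => z1 w1.
    by rewrite /n2 cReB cImB cRe_toC cReM cReJ cImJ cImM /=; ring.
  by rewrite addrAC.
rewrite (eq_bigr _ h) sumrB; congr (_ - _).
rewrite sumrB sum_blk -mulr_sumr -cRe_sum -mulr_suml -rmorph_sum -/z -n2E'.
by field.
Qed.

(** With W t t' = sum over s of (adj (v s t)) (v s t'), the left side is the sum of hs (W t t) (W t'
    t'), at most d_j times the sum of fro2 (W t t); the right side adds the off-diagonal fro2 (W t
    t') as well. *)
Lemma psd_block (j : J) :
  \sum_(s | blk s == j) \sum_(s' | blk s' == j) \sum_(t | blk t == j) \sum_(t' | blk t' == j) fro2 (v s t *m adj (v s' t'))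
  <= (bdim blk j)%:R * \sum_(s | blk s == j) \sum_(s' | blk s' == j) fro2 (\sum_(t | blk t == j) v s t *m adj (v s' t)).
Proof.
pose W t t' := \sum_(s | blk s == j) adj (v s t) *m v s t'.
have sumD (F : 'I_D -> 'M[C]_q) (B : 'M[C]_q) : hs (\sum_(s | blk s == j) F s) B = \sum_(s | blk s == j) hs (F s) B.
  by rewrite hsC /hs dot_sumr cRe_sum; apply: eq_bigr => s _; exact: hsC.
have sumD' m n (F : 'I_D -> 'M[C]_(m, n)) (B : 'M[C]_(m, n)) : hs B (\sum_(s | blk s == j) F s) = \sum_(s | blk s == j) hs B (F s).
  by rewrite /hs dot_sumr cRe_sum.
have e1 : \sum_(s | blk s == j) \sum_(s' | blk s' == j) \sum_(t | blk t == j) \sum_(t' | blk t' == j) fro2 (v s t *m adj (v s' t'))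
   = \sum_(t | blk t == j) \sum_(t' | blk t' == j) hs (W t t) (W t' t').
  under eq_bigr do rewrite exchange_big /=; rewrite exchange_big /=; apply: eq_bigr => t _.
  under eq_bigr do rewrite exchange_big /=; rewrite exchange_big /=; apply: eq_bigr => t' _.
  rewrite sumD; apply: eq_bigr => s _; rewrite sumD'; apply: eq_bigr => s' _.
  exact: fro2_gram.
have e2 : \sum_(s | blk s == j) \sum_(s' | blk s' == j) fro2 (\sum_(t | blk t == j) v s t *m adj (v s' t))
   = \sum_(t | blk t == j) \sum_(t' | blk t' == j) fro2 (W t t').
  transitivity (\sum_(s | blk s == j) \sum_(s' | blk s' == j) \sum_(t | blk t == j) \sum_(t' | blk t' == j)
      hs (v s t *m adj (v s' t)) (v s t' *m adj (v s' t'))).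
    apply: eq_bigr => s _; apply: eq_bigr => s' _; rewrite fro2_hs sumD'.
    apply: eq_bigr => t _; rewrite hsC sumD'; exact: eq_bigr.
  under eq_bigr do rewrite exchange_big /=; rewrite exchange_big /=; apply: eq_bigr => t _.
  under eq_bigr do rewrite exchange_big /=; rewrite exchange_big /=; apply: eq_bigr => t' _.
  rewrite fro2_hs sumD; apply: eq_bigr => s _; rewrite sumD'; apply: eq_bigr => s' _.
  rewrite hs_mull /hs !dotE -[in RHS]cReJ -tr_adj !hadjM !hadjK.
  by rewrite !mulmxA.
rewrite e1 e2.
apply: le_trans (_ : \sum_(t | blk t == j) \sum_(t' | blk t' == j) (fro2 (W t t) + fro2 (W t' t')) / 2 <= _).
  apply: ler_sum => t _; apply: ler_sum => t' _.
  have := fro2_ge0 (W t t - W t' t'); rewrite fro2D hsNr -(fro_sqr (- _)) froN fro_sqr.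
  by move: (fro2 _) (fro2 _) (hs _ _) => a1 a2 a3; lra.
have -> : \sum_(t | blk t == j) \sum_(t' | blk t' == j) (fro2 (W t t) + fro2 (W t' t')) / 2 = (bdim blk j)%:R * \sum_(t | blk t == j) fro2 (W t t).
  under eq_bigr do rewrite -mulr_suml big_split /= sum_blk.
  by rewrite -mulr_suml big_split /= sum_blk -mulr_sumr; lra.
rewrite ler_wpM2l //; apply: ler_sum => t tj; rewrite [leRHS](bigD1 t) //= lerDl.
by apply: sumr_ge0 => ? _; exact: fro2_ge0.
Qed.

Lemma exch4 (S S' : pred 'I_D) (F : 'I_N -> 'I_N -> 'I_D -> 'I_D -> R) :
  \sum_x \sum_y \sum_(t | S t) \sum_(t' | S' t') F x y t t' = \sum_(t | S t) \sum_(t' | S' t') \sum_x \sum_y F x y t t'.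
Proof.
under eq_bigr do rewrite exchange_big /=; rewrite exchange_big /=; apply: eq_bigr => t _.
under eq_bigr do rewrite exchange_big /=; by rewrite exchange_big.
Qed.

(** For distinct blocks the weights agree. Within a block of size n, [psd_block] bounds A - B / n by
    (1 - 1 / n^2) A, which turns the weight 1 / (n^2 - 1) into 1 / n^2. *)
Lemma dev_le : ex (fun u => fro2 (dev u)) <=
  \sum_s \sum_s' (dd s * dd s')^-1 * \sum_(t | blk t == blk s) \sum_(t' | blk t' == blk s') fro2 (v s t *m adj (v s' t')).
Proof.
have okd x y : ok (fun u => n2 (dev u x y)).
  have okb a b : okC (fun u => bmat u a b).
    under eq_fun do rewrite summxE; apply: okC_sum => s.
    under eq_fun do rewrite summxE; apply: okC_sum => t.
    by under eq_fun do rewrite mxE; apply: okCM; [exact: okC_entry|exact: okC_cst].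
  have : okC (fun u => dev u x y).
    under eq_fun do rewrite mxE; apply: okCD; last exact: okC_cst.
    apply: okC_mulmx => // a b; under eq_fun do rewrite hadjE; exact: okCJ.
  by case=> o1 o2; rewrite /n2; apply: okD; under eq_fun do rewrite expr2; exact: okM.
have -> : ex (fun u => fro2 (dev u)) = \sum_x \sum_y ex (fun u => n2 (dev u x y)).
  rewrite /fro2 (ex_sum P hU mU) => [|x]; last exact: ok_sum.
  by apply: eq_bigr => x _; rewrite (ex_sum P hU mU).
apply: le_trans (_ : \sum_x \sum_y \sum_s \sum_s' kapR (blk s) (blk s') * yn2 s s' x y <= _).
  by apply: ler_sum => x _; apply: ler_sum => y _; exact: dev_entry_le.
rewrite exch4.
have split_in (F : 'I_D -> 'I_D -> R) : \sum_s \sum_s' F s s' =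
    \sum_s \sum_(s' | blk s' != blk s) F s s' + \sum_j \sum_(s | blk s == j) \sum_(s' | blk s' == j) F s s'.
  rewrite (eq_bigr (fun s => \sum_(s' | blk s' != blk s) F s s' + \sum_(s' | blk s' == blk s) F s s')).
    rewrite big_split; congr (_ + _); rewrite (partition_big blk predT) //=.
    by apply: eq_bigr => j _; apply: eq_bigr => s /eqP ->.
  by move=> s _; rewrite (bigID (fun s' => blk s' == blk s)) /= addrC.
rewrite !split_in; apply: lerD.
  apply: ler_sum => s _; apply: ler_sum => s' ss'; rewrite eq_sym in ss'.
  rewrite le_eqVlt; apply/orP; left; apply/eqP.
  under eq_bigr do rewrite -mulr_sumr; rewrite -mulr_sumr; congr (_ * _).
    by rewrite /kapR (negbTE ss') subr0.
  rewrite -exch4; apply: eq_bigr => x _; apply: eq_bigr => y _; exact: yn2_off.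
apply: ler_sum => j _.
have [a /eqP ja|none] := pickP [pred a | blk a == j]; last by rewrite !big_pred0.
pose n : R := (bdim blk j)%:R.
pose A := \sum_(s | blk s == j) \sum_(s' | blk s' == j) \sum_(t | blk t == j) \sum_(t' | blk t' == j) fro2 (v s t *m adj (v s' t')).
pose B := \sum_(s | blk s == j) \sum_(s' | blk s' == j) fro2 (\sum_(t | blk t == j) v s t *m adj (v s' t)).
have AB : A <= n * B := psd_block j.
have A0 : 0 <= A by do 4!apply: sumr_ge0 => ? _; exact: fro2_ge0.
have -> : \sum_(s | blk s == j) \sum_(s' | blk s' == j) (dd s * dd s')^-1 * \sum_(t | blk t == blk s) \sum_(t' | blk t' == blk s') fro2 (v s t *m adj (v s' t')) = (n * n)^-1 * A.
  rewrite mulr_sumr; apply: eq_bigr => s /eqP sj; rewrite mulr_sumr; apply: eq_bigr => s' /eqP s'j.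
  by rewrite sj s'j.
have -> : \sum_(s | blk s == j) \sum_(s' | blk s' == j) \sum_x \sum_y kapR (blk s) (blk s') * yn2 s s' x y = kapR j j * (A - n^-1 * B).
  rewrite mulr_sumr -sumrB mulr_sumr; apply: eq_bigr => s /eqP sj.
  rewrite mulr_sumr -sumrB mulr_sumr; apply: eq_bigr => s' /eqP s'j.
  under eq_bigr do rewrite -mulr_sumr; rewrite -mulr_sumr sj s'j; congr (_ * _).
  rewrite -[X in X - _]exch4 [fro2 (\sum_(t | _) _)]/fro2 !mulr_sumr -sumrB; apply: eq_bigr => x _.
  rewrite mulr_sumr -sumrB; apply: eq_bigr => y _; rewrite yn2_in ?sj ?s'j //.
  by rewrite -/n summxE.
have n1 : 1 <= n by rewrite /n ler1n -ja bdim_gt0.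
(* For n = 1 the weight is the inverse of 0, that is 0. *)
have [e1|ne1] := eqVneq n 1.
  have -> : kapR j j = 0 by rewrite /kapR eqxx -/n e1 mulr1 subrr invr0.
  by rewrite mul0r mulr_ge0 // invr_ge0 mulr_ge0 // (le_trans ler01).
have n2 : 0 < n * n - 1.
  have : 1 < n by rewrite lt_neqAle eq_sym ne1.
  by move=> n2; rewrite subr_gt0; have := mulr_ege1 (ltW n2) (ltW n2); rewrite le_eqVlt => /orP[/eqP e|//]; nra.
have -> : kapR j j = (n * n - 1)^-1 by rewrite /kapR eqxx.
have n0 : 0 < n by apply: lt_le_trans n1.
have hB : n^-1 * B >= (n * n)^-1 * A.
  by rewrite invfM -mulrA ler_wpM2l ?invr_ge0 ?(ltW n0) // mulrC ler_pdivrMr // mulrC.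
apply: le_trans (_ : (n * n - 1)^-1 * (A - (n * n)^-1 * A) <= _).
  by rewrite ler_wpM2l ?invr_ge0 ?(ltW n2) // lerB.
by rewrite le_eqVlt; apply/orP; left; apply/eqP; field; rewrite !gt_eqF // ?mulr_gt0.
Qed.
End Decoupling.

(** * ** Entries of tensor products and extended maps *)

Section Entries.
Variable R : realType.
Local Notation C := R[i].
Local Notation mvi := mxvec_index.

Lemma mvi_eq m n (i i' : 'I_m) (j j' : 'I_n) : (mvi i j == mvi i' j') = (i == i') && (j == j').
Proof.
have [g h1 h2] := curry_mxvec_bij m n.
apply/eqP/andP => [e|[/eqP -> /eqP ->]] //.
have := h1 (i, j) isT; have := h1 (i', j') isT; rewrite /= e => -> [-> ->]; by rewrite !eqxx.
Qed.

Lemma mvi_surj m n (k : 'I_(m * n)) : exists i j, k = mvi i j.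
Proof. by case/mxvec_indexP: k => i j; exists i, j. Qed.

Lemma sum_mvi m n (A : nmodType) (F : 'I_(m * n) -> A) : \sum_k F k = \sum_i \sum_j F (mvi i j).
Proof. by rewrite (reindex _ (curry_mxvec_bij m n)) /= pair_bigA; apply: eq_bigr => -[]. Qed.

Lemma mx_mvi m n p q (A B : 'M[C]_(m * n, p * q)) :
  (forall i j k l, A (mvi i j) (mvi k l) = B (mvi i j) (mvi k l)) -> A = B.
Proof.
move=> h; apply/matrixP => x y.
by have [i [j ->]] := mvi_surj x; have [k [l ->]] := mvi_surj y.
Qed.

Lemma sum_d (I : finType) (a : I) (f : I -> C) : \sum_i f i * (i == a)%:R = f a.
Proof.
rewrite (bigD1 a) //= eqxx mulr1 big1 ?addr0 // => i ia.
by rewrite (negbTE ia) mulr0.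
Qed.

Lemma tensE m n (A : 'M[C]_m) (B : 'M[C]_n) i i' k k' :
  tens A B (mvi i k) (mvi i' k') = A i i' * B k k'.
Proof.
rewrite /tens summxE -[RHS](sum_d i (fun i => A i i' * B k k')); apply: eq_bigr => a _.
rewrite summxE -[RHS]mulr1 -{1}(sum_d i' (fun i' => A a i' * B k k')) !mulr_suml; apply: eq_bigr => a' _.
rewrite summxE mulr1 -(sum_d k (fun k => A a a' * B k k')) !mulr_suml; apply: eq_bigr => b _.
rewrite summxE -(sum_d k' (fun k' => A a a' * B b k')) !mulr_suml; apply: eq_bigr => b' _.
rewrite !mxE !mvi_eq (eq_sym i) (eq_sym i') (eq_sym k) (eq_sym k').
by do 4!case: (_ == _) => /=; rewrite ?mulr1 ?mulr0.
Qed.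

Lemma tens22E m1 m2 n1 n2 (A : 'M[C]_(m1 * m2)) (B : 'M[C]_(n1 * n2)) a b c e a' b' c' e' :
  tens22 A B (mvi (mvi a c) (mvi b e)) (mvi (mvi a' c') (mvi b' e')) =
  A (mvi a b) (mvi a' b') * B (mvi c e) (mvi c' e').
Proof.
rewrite /tens22.
rewrite summxE (bigD1 a) //= [X in _ + X]big1 ?addr0 => [|x xa]; last first.
  by do 7!(rewrite summxE; apply: big1 => ? _); rewrite !mxE !mvi_eq eq_sym (negbTE xa) mulr0.
rewrite summxE (bigD1 a') //= [X in _ + X]big1 ?addr0 => [|x xa]; last first.
  by do 6!(rewrite summxE; apply: big1 => ? _); rewrite !mxE !mvi_eq (eq_sym a') (negbTE xa) /= !andbF mulr0.
rewrite summxE (bigD1 b) //= [X in _ + X]big1 ?addr0 => [|x xa]; last first.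
  by do 5!(rewrite summxE; apply: big1 => ? _); rewrite !mxE !mvi_eq (eq_sym b) (negbTE xa) /= !(andbF, andFb) mulr0.
rewrite summxE (bigD1 b') //= [X in _ + X]big1 ?addr0 => [|x xa]; last first.
  by do 4!(rewrite summxE; apply: big1 => ? _); rewrite !mxE !mvi_eq (eq_sym b') (negbTE xa) /= !(andbF, andFb) mulr0.
rewrite summxE (bigD1 c) //= [X in _ + X]big1 ?addr0 => [|x xa]; last first.
  by do 3!(rewrite summxE; apply: big1 => ? _); rewrite !mxE !mvi_eq (eq_sym c) (negbTE xa) /= !(andbF, andFb) mulr0.
rewrite summxE (bigD1 c') //= [X in _ + X]big1 ?addr0 => [|x xa]; last first.
  by do 2!(rewrite summxE; apply: big1 => ? _); rewrite !mxE !mvi_eq (eq_sym c') (negbTE xa) /= !(andbF, andFb) mulr0.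
rewrite summxE (bigD1 e) //= [X in _ + X]big1 ?addr0 => [|x xa]; last first.
  by rewrite summxE; apply: big1 => ? _; rewrite !mxE !mvi_eq (eq_sym e) (negbTE xa) /= !(andbF, andFb) mulr0.
rewrite summxE (bigD1 e') //= [X in _ + X]big1 ?addr0 => [|x xa]; last first.
  by rewrite !mxE !mvi_eq (eq_sym e') (negbTE xa) /= !(andbF, andFb) mulr0.
by rewrite !mxE !eqxx mulr1.
Qed.

Lemma amplE n m p (M : 'M[C]_m -> 'M[C]_p) (X : 'M[C]_(n * m)) a a' e e' :
  ampl M X (mvi a e) (mvi a' e') = M (\matrix_(s, s') X (mvi a s) (mvi a' s')) e e'.
Proof.
rewrite /ampl summxE (bigD1 a) //= [X in _ + X]big1 ?addr0 => [|x xa]; last first.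
  by rewrite summxE big1 // => y _; rewrite tensE mxE eq_sym (negbTE xa) mul0r.
rewrite summxE (bigD1 a') //= [X in _ + X]big1 ?addr0 => [|x xa]; last first.
  by rewrite tensE mxE (eq_sym a') (negbTE xa) andbF mul0r.
by rewrite tensE mxE !eqxx mul1r.
Qed.

Lemma amprE n m p (M : 'M[C]_m -> 'M[C]_p) (X : 'M[C]_(m * n)) a a' e e' :
  ampr M X (mvi e a) (mvi e' a') = M (\matrix_(s, s') X (mvi s a) (mvi s' a')) e e'.
Proof.
rewrite /ampr summxE (bigD1 a) //= [X in _ + X]big1 ?addr0 => [|x xa]; last first.
  by rewrite summxE big1 // => y _; rewrite tensE [delta_mx _ _ _ _]mxE eq_sym (negbTE xa) mulr0.
rewrite summxE (bigD1 a') //= [X in _ + X]big1 ?addr0 => [|x xa]; last first.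
  by rewrite tensE [delta_mx _ _ _ _]mxE (eq_sym a') (negbTE xa) andbF mulr0.
by rewrite tensE [delta_mx _ _ _ _]mxE !eqxx mulr1.
Qed.

Lemma tens_mul m n p (A : 'M[C]_m) (X : 'M[C]_(m * n, p)) i k y :
  (tens A 1%:M *m X) (mvi i k) y = \sum_i' A i i' * X (mvi i' k) y.
Proof.
rewrite mxE sum_mvi; apply: eq_bigr => i' _; rewrite (bigD1 k) //= big1 ?addr0 => [|k' kk].
  by rewrite tensE mxE eqxx mulr1.
by rewrite tensE mxE eq_sym (negbTE kk) mulr0 mul0r.
Qed.
Lemma mul_tens m n p (A : 'M[C]_m) (X : 'M[C]_(p, m * n)) i k y :
  (X *m tens A 1%:M) y (mvi i k) = \sum_i' X y (mvi i' k) * A i' i.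
Proof.
rewrite mxE sum_mvi; apply: eq_bigr => i' _; rewrite (bigD1 k) //= big1 ?addr0 => [|k' kk].
  by rewrite tensE mxE eqxx mulr1.
by rewrite tensE mxE (negbTE kk) !mulr0.
Qed.
Lemma adj_tens m n (A : 'M[C]_m) (B : 'M[C]_n) : adj (tens A B) = tens (adj A) (adj B).
Proof. by apply: mx_mvi => i j k l; rewrite hadjE !tensE rmorphM !hadjE. Qed.

Lemma linE m p (M : {linear 'M[C]_m -> 'M[C]_p}) (X : 'M[C]_m) e e' :
  M X e e' = \sum_s \sum_s' X s s' * M (delta_mx s s') e e'.
Proof.
rewrite {1}(matrix_sum_delta X) linear_sum summxE; apply: eq_bigr => s _.
rewrite linear_sum summxE; apply: eq_bigr => s' _; by rewrite linearZ mxE.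
Qed.
End Entries.

(** * ** Choi factorization and the Gamma operators *)

Section Kraus.
Variables (R : realType) (D dR dE : nat) (J : finType) (blk : 'I_D -> J).
Local Notation C := R[i].
Local Notation mvi := mxvec_index.
Local Notation Pi := (Pi R blk).
Variables (M : {linear 'M[C]_D -> 'M[C]_dE}) (rho : 'M[C]_(D * dR)).
Hypotheses (rho_sub : subnormalized rho) (cpM : completely_positive M) (tniM : trace_nonincreasing M).

Lemma maxent_gram : maxent R D = (toC (Num.sqrt D%:R^-1) *: \sum_i delta_mx (mvi i i) 0) *m
   adj (toC (Num.sqrt D%:R^-1) *: \sum_i delta_mx (mvi i i) (0 : 'I_1)).
Proof.
rewrite hadjZ conj_toC -scalemxAl -scalemxAr scalerA -toCM -expr2 sqr_sqrtr ?invr_ge0 // toCV toC_nat.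
congr (_ *: _); rewrite mulmx_suml; apply: eq_bigr => i _.
rewrite hadj_sum mulmx_sumr; apply: eq_bigr => k _.
rewrite (_ : adj _ = delta_mx 0 (mvi k k)) ?mul_delta_mx //.
by apply/matrixP => a b; rewrite hadjE !mxE rmorph_nat andbC.
Qed.

Lemma zeta_psd : psd (zeta M).
Proof. by apply: cpM; rewrite maxent_gram; exact: psd_gram. Qed.

Lemma zetaE_entry s s' e e' : zeta M (mvi s e) (mvi s' e') = D%:R^-1 * M (delta_mx s s') e e'.
Proof.
rewrite amplE (_ : \matrix_(_, _) _ = D%:R^-1 *: delta_mx s s'); first by rewrite linearZ mxE.
apply/matrixP => a a'; rewrite !mxE; congr (_ * _); rewrite summxE (bigD1 s) //= [X in _ + X]big1 ?addr0 => [|i is0].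
  rewrite summxE (bigD1 s') //= [X in _ + X]big1 ?addr0 => [|k ks].
    by rewrite !mxE !mvi_eq !eqxx /=.
  by rewrite !mxE !mvi_eq [s' == k]eq_sym (negbTE ks) andbF.
by rewrite summxE big1 // => k _; rewrite !mxE !mvi_eq eq_sym (negbTE is0).
Qed.

(** Complete positivity makes the Choi operator a Gram matrix, and so is rho. The amplitude v s t
    multiplies the s rows of the one factor with the t rows of the other; sqrt D undoes the
    normalization of the maximally entangled state. *)
Lemma kraus : exists v : 'I_D -> 'I_D -> 'M[C]_(dE * dR, (D * dE) * (D * dR)),
  forall s t s' t' e a e' a', (v s t *m adj (v s' t')) (mvi e a) (mvi e' a') =
    M (delta_mx s s') e e' * rho (mvi t a) (mvi t' a').
Proof.
have [B eB] := psd_factor zeta_psd; have [r er] := psd_factor rho_sub.1.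
pose v s t : 'M[C]_(dE * dR, (D * dE) * (D * dR)) := \matrix_(x, y)
  mxvec (\matrix_(e, a) (mxvec (\matrix_(k, al) (toC (Num.sqrt D%:R) * B (mvi s e) k * r (mvi t a) al)) 0 y)) 0 x.
have vE s t e a k al : v s t (mvi e a) (mvi k al) = toC (Num.sqrt D%:R) * B (mvi s e) k * r (mvi t a) al.
  by rewrite mxE !mxvecE !mxE mxvecE mxE.
exists v => s t s' t' e a e' a'.
have D0 : D%:R != 0 :> C by rewrite pnatr_eq0; case: D s {v vE B eB r er s' t t'} => //; case.
have -> : M (delta_mx s s') e e' = D%:R * \sum_k B (mvi s e) k * (B (mvi s' e') k)^*.
  have <- : zeta M (mvi s e) (mvi s' e') = \sum_k B (mvi s e) k * (B (mvi s' e') k)^*.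
    by rewrite eB mxE; apply: eq_bigr => k _; rewrite hadjE.
  by rewrite zetaE_entry mulrA mulfV ?mul1r.
have -> : rho (mvi t a) (mvi t' a') = \sum_al r (mvi t a) al * (r (mvi t' a') al)^*.
  by rewrite er mxE; apply: eq_bigr => k _; rewrite hadjE.
rewrite [D%:R * _]mulr_sumr mulr_suml [LHS]mxE [LHS]sum_mvi; apply: eq_bigr => k _.
rewrite mulr_sumr; apply: eq_bigr => al _; rewrite hadjE !vE !rmorphM /= conj_toC.
have -> : D%:R = toC (Num.sqrt D%:R) * toC (Num.sqrt D%:R) :> C by rewrite -toCM -expr2 sqr_sqrtr // toC_nat.
ring.
Qed.

Variable v : 'I_D -> 'I_D -> 'M[C]_(dE * dR, (D * dE) * (D * dR)).
Hypothesis hv : forall s t s' t' e a e' a', (v s t *m adj (v s' t')) (mvi e a) (mvi e' a') =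
    M (delta_mx s s') e e' * rho (mvi t a) (mvi t' a').

Lemma urho_entry (u : 'M[C]_D) s a s' a' :
  (tens u 1%:M *m rho *m adj (tens u 1%:M)) (mvi s a) (mvi s' a') =
  \sum_t \sum_t' u s t * rho (mvi t a) (mvi t' a') * (u s' t')^*.
Proof.
rewrite adj_tens hadj1 mul_tens exchange_big; apply: eq_bigr => t' _.
by rewrite tens_mul mulr_suml; apply: eq_bigr => t _; rewrite hadjE.
Qed.

Lemma bmat_ampr (u : 'M[C]_D) : bmat v u *m adj (bmat v u) = ampr M (tens u 1%:M *m rho *m adj (tens u 1%:M)).
Proof.
apply: mx_mvi => e a e' a'; rewrite amprE linE.
rewrite /bmat hadj_sum mulmx_suml summxE; apply: eq_bigr => s _.
rewrite mulmx_sumr summxE; apply: eq_bigr => s' _.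
rewrite mxE urho_entry mulr_suml hadj_sum mulmx_suml summxE; apply: eq_bigr => t _.
rewrite mulr_suml mulmx_sumr summxE; apply: eq_bigr => t' _.
rewrite hadjZ -scalemxAl -scalemxAr scalerA mxE hv; ring.
Qed.

Lemma zetaE_E j e e' : zetaE blk M j e e' = D%:R^-1 * \sum_(s | blk s == j) M (delta_mx s s) e e'.
Proof.
rewrite mxE mulr_sumr [RHS]big_mkcond; apply: eq_bigr => s _.
rewrite tens_mul (bigD1 s) //= big1 ?addr0 => [|i is0]; rewrite mxE.
  rewrite eqxx zetaE_entry; case: (blk s == j); rewrite ?mul1r ?mul0r //.
by rewrite eq_sym (negbTE is0) mul0r.
Qed.
Lemma rhoR_E j a a' : rhoR blk rho j a a' = \sum_(s | blk s == j) rho (mvi s a) (mvi s a').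
Proof.
rewrite mxE [RHS]big_mkcond; apply: eq_bigr => s _.
rewrite tens_mul (bigD1 s) //= big1 ?addr0 => [|i is0]; rewrite mxE.
  by rewrite eqxx; case: (blk s == j); rewrite ?mul1r ?mul0r.
by rewrite eq_sym (negbTE is0) mul0r.
Qed.

Lemma gam_GammaER : gam blk v = GammaER blk M rho.
Proof.
apply: mx_mvi => e a e' a'; rewrite /gam /GammaER !summxE (partition_big blk predT) //=.
apply: eq_bigr => j _; rewrite [RHS]mxE tensE zetaE_E rhoR_E.
transitivity (toC (bdim blk j)%:R^-1 * ((\sum_(s | blk s == j) M (delta_mx s s) e e') * \sum_(t | blk t == j) rho (mvi t a) (mvi t a'))).
  rewrite mulr_suml mulr_sumr; apply: eq_bigr => s /eqP sj.
  by rewrite summxE sj !mulr_sumr; apply: eq_bigr => t _; rewrite mxE hv.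
have [s /eqP sj|none] := pickP [pred s | blk s == j]; last by rewrite !big_pred0 // !(mulr0, mul0r).
have D0 : D%:R != 0 :> C by rewrite pnatr_eq0; case: D s {sj} => //; case.
rewrite toCM !toCV !toC_nat; move: (\sum_(s | _) _) (\sum_(t | _) _) => S1 S2.
by field; rewrite D0 /= -sj bdim_neq0.
Qed.

(** The projections force s and t into one block, likewise s' and t', and single out one term of the
    double sum; its factor D cancels the 1 / D of the Choi operator. *)
Lemma GammaSER_entry s t e a s' t' e' a' :
  GammaSER blk M rho (mvi (mvi s t) (mvi e a)) (mvi (mvi s' t') (mvi e' a')) =
  ((blk s == blk t) && (blk s' == blk t'))%:R *
   (toC (Num.sqrt ((bdim blk (blk s))%:R * (bdim blk (blk s'))%:R))^-1 * (v s t *m adj (v s' t')) (mvi e a) (mvi e' a')).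
Proof.
rewrite hv /GammaSER summxE (bigD1 (blk s)) //= [X in _ + X]big1 ?addr0 => [|j js]; last first.
  rewrite summxE big1 // => j' _; rewrite mxE tens22E /zeta_jj' mul_tens big1 ?mul0r ?mulr0 // => i _.
  rewrite tens_mul big1 ?mul0r // => k _; rewrite mxE; case: (s =P k) => [<-|_]; last by rewrite mul0r.
  by rewrite eq_sym (negbTE js) mul0r.
rewrite summxE (bigD1 (blk s')) //= [X in _ + X]big1 ?addr0 => [|j js]; last first.
  rewrite mxE tens22E /zeta_jj' mul_tens big1 ?mul0r ?mulr0 // => i _.
  rewrite [Pi _ _ _]mxE; case: (i =P s') => [->|_]; last by rewrite mulr0.
  by rewrite eq_sym (negbTE js) mulr0.
have D0 : D%:R != 0 :> C by rewrite pnatr_eq0; case: D s {s' t t'} => //; case.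
rewrite mxE tens22E.
have -> : zeta_jj' blk M (blk s) (blk s') (mvi s e) (mvi s' e') = D%:R^-1 * M (delta_mx s s') e e'.
  rewrite -zetaE_entry /zeta_jj' mul_tens (bigD1 s') //= [X in _ + X]big1 ?addr0 => [|i is0]; last first.
    by rewrite [Pi _ _ _]mxE (negbTE is0) mulr0.
  rewrite [Pi _ _ _]mxE !eqxx mulr1 tens_mul (bigD1 s) //= [X in _ + X]big1 ?addr0 => [|i is0]; last first.
    by rewrite [Pi _ _ _]mxE eq_sym (negbTE is0) mul0r.
  by rewrite [Pi _ _ _]mxE !eqxx mul1r.
have -> : rho_jj' blk rho (blk s) (blk s') (mvi t a) (mvi t' a') = ((blk s == blk t) && (blk s' == blk t'))%:R * rho (mvi t a) (mvi t' a').
  rewrite /rho_jj' adj_tens adj_Pi hadj1 mul_tens (bigD1 t') //= [X in _ + X]big1 ?addr0 => [|i is0]; last first.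
    by rewrite [Pi _ _ _]mxE (negbTE is0) mulr0.
  rewrite [Pi _ _ _]mxE eqxx tens_mul (bigD1 t) //= [X in _ + X]big1 ?addr0 => [|i is0]; last first.
    by rewrite [Pi _ _ _]mxE eq_sym (negbTE is0) mul0r.
  rewrite [Pi _ _ _]mxE eqxx [blk t == _]eq_sym [blk t' == _]eq_sym /=.
  by case: (blk s == _); case: (blk s' == _); rewrite ?mul1r ?mulr1 ?mul0r ?mulr0.
rewrite toCM toC_nat; case: (_ && _); rewrite ?mul0r ?mulr0 // !mul1r.
by rewrite -!mulrA mulrCA; congr (_ * _); rewrite mulVKf.
Qed.
End Kraus.

(** * ** The min-entropy bound on the mean *)

Section Mean.
Variables (R : realType) (D dR dE : nat) (J : finType) (blk : 'I_D -> J).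
Local Notation C := R[i].
Local Notation mvi := mxvec_index.
Local Notation Pi := (Pi R blk).
Local Notation dd a := ((bdim blk (blk a))%:R : R).
Local Notation N := (dE * dR)%N.
Local Notation q := ((D * dE) * (D * dR))%N.
Variables (M : {linear 'M[C]_D -> 'M[C]_dE}) (rho : 'M[C]_(D * dR)).
Hypotheses (rho_sub : subnormalized rho) (cpM : completely_positive M) (tniM : trace_nonincreasing M).
Variable v : 'I_D -> 'I_D -> 'M[C]_(N, q).
Hypothesis hv : forall s t s' t' e a e' a', (v s t *m adj (v s' t')) (mvi e a) (mvi e' a') =
    M (delta_mx s s') e e' * rho (mvi t a) (mvi t' a').

Lemma hs_col m n (A B : 'M[C]_(m, n)) : hs A B = \sum_c hs (col c A) (col c B).
Proof.
rewrite hsE exchange_big; apply: eq_bigr => j _; rewrite hsE; apply: eq_bigr => i _.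
by rewrite big_ord1 !mxE.
Qed.

Lemma sesqE n (x y : 'cV[C]_n) (W : 'M[C]_n) :
  (adj x *m W *m y) 0 0 = \sum_i \sum_j (x i 0)^* * W i j * y j 0.
Proof.
rewrite mxE exchange_big; apply: eq_bigr => j _; rewrite mxE mulr_suml; apply: eq_bigr => i _.
by rewrite hadjE.
Qed.

(* GammaSER is the Gram matrix of the family [om]. *)
Definition om s t : 'M[C]_(N, q) := if blk s == blk t then toC (Num.sqrt (dd s))^-1 *: v s t else 0.

Lemma GammaSER_om s t y s' t' y' :
  GammaSER blk M rho (mvi (mvi s t) y) (mvi (mvi s' t') y') = (om s t *m adj (om s' t')) y y'.
Proof.
have [e [a ->]] := mvi_surj y; have [e' [a' ->]] := mvi_surj y'.
rewrite (GammaSER_entry _ hv) /om; case: (blk s == blk t); last by rewrite andFb mul0r mul0mx mxE.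
case: (blk s' == blk t'); last by rewrite andbF mul0r hadj0 mulmx0 mxE.
rewrite andbT mul1r hadjZ conj_toC -scalemxAl -scalemxAr scalerA [RHS]mxE; congr (_ * _).
by rewrite -toCM sqrtrM // invfM.
Qed.

(** The operator inequality is tested on the vector [z] assembled from all the x s t; there the form
    of a Gram matrix is a squared norm. *)
Lemma vec_cond (c : R) (sg : 'M[C]_N) (x : 'I_D -> 'I_D -> 'cV[C]_N) :
  psd (toC c *: tens 1%:M sg - GammaSER blk M rho) ->
  fro2 (\sum_s \sum_t adj (om s t) *m x s t) <= c * \sum_s \sum_t hs (x s t) (sg *m x s t).
Proof.
move=> h; pose z : 'cV[C]_((D * D) * N) :=
  \col_k mxvec (\matrix_(m, y) mxvec (\matrix_(s, t) x s t y 0) 0 m) 0 k.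
have zE s t y : z (mvi (mvi s t) y) 0 = x s t y 0 by rewrite mxE mxvecE mxE mxvecE mxE.
have := h z; rewrite mulmxBr mulmxBl [X in _ <= X]mxE [(- _ : 'M[C]_1) 0 0]mxE.
set H := \sum_s _; have -> : (adj z *m GammaSER blk M rho *m z) 0 0 = toC (fro2 H).
  have HH : adj H *m H = \sum_s \sum_t \sum_s' \sum_t' adj (x s t) *m (om s t *m adj (om s' t')) *m x s' t'.
    rewrite {1}/H hadj_sum mulmx_suml; apply: eq_bigr => s _; rewrite hadj_sum mulmx_suml; apply: eq_bigr => t _.
    rewrite /H mulmx_sumr; apply: eq_bigr => s' _; rewrite mulmx_sumr; apply: eq_bigr => t' _.
    by rewrite hadjM hadjK !mulmxA.
  rewrite sesqE sum_mvi sum_mvi fro2_dot dotE [\tr _]big_ord1 HH summxE; apply: eq_bigr => s _.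
  rewrite summxE; apply: eq_bigr => t _; under eq_bigr do rewrite sum_mvi sum_mvi.
  rewrite exchange_big summxE; apply: eq_bigr => s' _; rewrite exchange_big summxE; apply: eq_bigr => t' _.
  rewrite sesqE; apply: eq_bigr => y _; apply: eq_bigr => y' _.
  by rewrite !zE GammaSER_om.
have -> : (adj z *m (toC c *: tens 1%:M sg) *m z) 0 0 = toC c * \sum_s \sum_t (adj (x s t) *m sg *m x s t) 0 0.
  rewrite -scalemxAr -scalemxAl mxE; congr (_ * _); rewrite sesqE sum_mvi sum_mvi.
  apply: eq_bigr => s _; apply: eq_bigr => t _; rewrite sesqE; apply: eq_bigr => y _.
  rewrite sum_mvi (bigD1 (mvi s t)) //= [X in _ + X]big1 ?addr0 => [|m ms].
    by apply: eq_bigr => y' _; rewrite !zE tensE mxE eqxx mul1r.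
  by apply: big1 => y' _; rewrite tensE [_%:M _ _]mxE [_ == m]eq_sym (negbTE ms) mulr0n mul0r mulr0 mul0r.
move=> /cge0P[_]; rewrite cReB cRe_toC /= subr_ge0 cRe_sum.
have -> // : \sum_i Re (\sum_t (adj (x i t) *m sg *m x i t) 0 0) = \sum_s \sum_t hs (x s t) (sg *m x s t).
apply: eq_bigr => s _; rewrite cRe_sum; apply: eq_bigr => t _.
by rewrite /hs dotE mulmxA [\tr _]big_ord1.
Qed.

(** The left side is fro2 H. Each column of H has the shape treated in [vec_cond], with x s t a
    column of ta ta (om s t), and in the resulting bound the two factors ta ta cancel [sg]. One
    application of the entropy inequality thus bounds a fourth-order expression by a second-order
    one. *)
Lemma om_contr (c : R) (sg ta : 'M[C]_N) : 0 <= c ->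
  psd (toC c *: tens 1%:M sg - GammaSER blk M rho) ->
  adj ta = ta -> (ta *m ta) *m sg *m (ta *m ta) = 1%:M ->
  \sum_s \sum_t \sum_s' \sum_t' fro2 ((ta *m om s t) *m adj (ta *m om s' t')) <=
  c * \sum_s \sum_t fro2 (om s t).
Proof.
move=> c0 hp ata t1; pose H := \sum_s \sum_t adj (om s t) *m (ta *m ta *m om s t).
have gE s t : adj (ta *m om s t) *m (ta *m om s t) = adj (om s t) *m (ta *m ta *m om s t).
  by rewrite hadjM ata !mulmxA.
have -> : \sum_s \sum_t \sum_s' \sum_t' fro2 ((ta *m om s t) *m adj (ta *m om s' t')) = fro2 H.
  rewrite fro2_hs {1}/H hsC hs_sumr; apply: eq_bigr => s _; rewrite hs_sumr; apply: eq_bigr => t _.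
  rewrite hsC /H hs_sumr; apply: eq_bigr => s' _; rewrite hs_sumr; apply: eq_bigr => t' _.
  by rewrite fro2_gram !gE.
rewrite fro2_hs hs_col.
apply: le_trans (_ : \sum_k c * \sum_s \sum_t hs (ta *m ta *m om s t *m delta_mx k 0) (sg *m (ta *m ta *m om s t *m delta_mx k (0 : 'I_1))) <= _).
  apply: ler_sum => k _; rewrite -fro2_hs.
  have -> : col k H = \sum_s \sum_t adj (om s t) *m (ta *m ta *m om s t *m delta_mx k 0).
    rewrite colE /H mulmx_suml; apply: eq_bigr => s _; rewrite mulmx_suml; apply: eq_bigr => t _.
    by rewrite !mulmxA.
  exact: vec_cond.
rewrite -mulr_sumr ler_wpM2l // exchange_big; apply: ler_sum => s _; rewrite exchange_big; apply: ler_sum => t _.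
under eq_bigr do rewrite mulmxA -!colE.
rewrite -hs_col.
have -> : hs (ta *m ta *m om s t) (sg *m (ta *m ta *m om s t)) = hs (om s t) (ta *m ta *m sg *m (ta *m ta) *m om s t).
  rewrite -[in LHS](hadjK (ta *m ta)) -hs_mulr; congr hs.
  by rewrite !hadjM !hadjK ata !mulmxA.
by rewrite t1 mul1mx -fro2_hs.
Qed.

(** The sum is the trace of [GammaSER]. The trace of M at the projection of block j is at most d_j
    and cancels the weight 1 / d_j, which leaves the trace of rho. *)
Lemma om_sum : \sum_s \sum_t fro2 (om s t) <= 1.
Proof.
pose rt t : C := \sum_a rho (mvi t a) (mvi t a).
have fv s t : toC (fro2 (v s t)) = \tr (M (delta_mx s s)) * rt t.
  rewrite fro2_dot dotE mxtrace_mulC /mxtrace sum_mvi mulr_suml; apply: eq_bigr => e _.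
  by rewrite mulr_sumr; apply: eq_bigr => a _; rewrite hv.
have trho : \sum_t rt t = \tr rho by rewrite /mxtrace sum_mvi.
have rt0 t : 0 <= rt t.
  apply: sumr_ge0 => a _; have := rho_sub.1 (delta_mx (mvi t a) 0).
  by rewrite sesq_delta.
have mj j : \sum_(s | blk s == j) \tr (M (delta_mx s s)) <= (bdim blk j)%:R.
  have -> : \sum_(s | blk s == j) \tr (M (delta_mx s s)) = \tr (M (Pi j)).
    rewrite -raddf_sum -linear_sum; congr (\tr (M _)); apply/matrixP => a b; rewrite summxE mxE.
    have [<-|ab] := eqVneq a b.
      rewrite big_mkcond (bigD1 a) //= big1 ?addr0 => [|s sa]; rewrite mxE ?eqxx; first by case: ifP.
      by rewrite [a == s]eq_sym (negbTE sa); case: ifP.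
    apply: big1 => s _; rewrite mxE; case: (a =P s) => [e|//] /=; case: (b =P s) => // e'.
    by rewrite e e' eqxx in ab.
  have pP : psd (Pi j).
    have -> : Pi j = Pi j *m adj (Pi j); last exact: psd_gram.
    rewrite adj_Pi; apply/matrixP => a b; rewrite Pi_mul !mxE.
    by case: (a =P b) => [->|_]; case: (_ == j); rewrite ?mulr1 ?mulr0 ?mul1r.
  apply: le_trans (tniM pP) _; rewrite -[Pi j]mulmx1 tr_Pi bdimE.
  by rewrite (eq_bigr (fun=> 1)) // => a _; rewrite mxE eqxx.
suff h : toC (\sum_s \sum_t fro2 (om s t)) <= 1.
  have : 0 <= toC (1 - \sum_s \sum_t fro2 (om s t)) by rewrite toCD toCN toC1 subr_ge0.
  by rewrite toC_ge0 subr_ge0.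
apply: le_trans (rho_sub.2); rewrite -trho toC_sum.
have -> : \sum_s toC (\sum_t fro2 (om s t)) = \sum_s \sum_(t | blk t == blk s) toC (dd s)^-1 * (\tr (M (delta_mx s s)) * rt t).
  apply: eq_bigr => s _; rewrite toC_sum [RHS]big_mkcond; apply: eq_bigr => t _.
  rewrite /om eq_sym; case: (blk t == blk s); last by rewrite fro2_hs hs0r.
  by rewrite fro2Z toCM fv exprVn sqr_sqrtr.
rewrite (partition_big blk predT) //= [leRHS](partition_big blk predT) //=; apply: ler_sum => j _.
have -> : \sum_(i | blk i == j) \sum_(t | blk t == blk i) toC (dd i)^-1 * (\tr (M (delta_mx i i)) * rt t) =
   toC ((bdim blk j)%:R)^-1 * ((\sum_(s | blk s == j) \tr (M (delta_mx s s))) * \sum_(t | blk t == j) rt t).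
  rewrite mulr_suml mulr_sumr; apply: eq_bigr => s /eqP ->.
  by rewrite !mulr_sumr.
have [a /eqP ja|none] := pickP [pred a | blk a == j]; last by rewrite !big_pred0 // mulr0 mulr0.
have rj : 0 <= \sum_(t | blk t == j) rt t by apply: sumr_ge0.
have := ler_wpM2r rj (mj j).
have d0 : 0 <= toC (bdim blk j)%:R^-1 :> C by rewrite toC_ge0 invr_ge0.
move=> /(ler_wpM2l d0) h; apply: le_trans h _.
by rewrite mulrA toCV toC_nat mulVf ?mul1r // -ja bdim_neq0.
Qed.

Variables (d : measure_display) (T : measurableType d) (P : probability T R)
  (U : T -> 'M[C]_D).
Local Notation G := (@block_unitary R D J blk).
Hypothesis hU : forall w, G (U w).
Hypothesis mU : forall A : set 'M[C]_D, mxBorel A -> measurable (U @^-1` A).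
Hypothesis iU : forall g, G g -> forall A : set 'M[C]_D, mxBorel A ->
     P ((fun w => g *m U w) @^-1` A) = P (U @^-1` A).
Local Notation ok := (@ok R D J blk).
Local Notation ex := (@ex R D d T P U).

Definition devM (u : 'M[C]_D) : 'M[C]_N := ampr M (tens u 1%:M *m rho *m adj (tens u 1%:M)) - GammaER blk M rho.

Lemma devME u : devM u = dev blk v u.
Proof. by rewrite /devM /dev (bmat_ampr hv) (gam_GammaER _ hv). Qed.

(** The sandwiched deviation is the deviation of the amplitudes ta v, so that [dev_le] applies to it
    unchanged. *)
Lemma dev_sandwich (ta : 'M[C]_N) u : adj ta = ta ->
  dev blk (fun s t => ta *m v s t) u = ta *m dev blk v u *m ta.
Proof.
move=> ata; rewrite /dev mulmxBr mulmxBl; congr (_ - _).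
  have -> : bmat (fun s t => ta *m v s t) u = ta *m bmat v u.
    rewrite /bmat mulmx_sumr; apply: eq_bigr => s _; rewrite mulmx_sumr; apply: eq_bigr => t _.
    by rewrite scalemxAr.
  by rewrite hadjM ata !mulmxA.
rewrite /gam mulmx_sumr mulmx_suml; apply: eq_bigr => s _; rewrite mulmx_sumr mulmx_suml; apply: eq_bigr => t _.
by rewrite hadjM ata -scalemxAr -scalemxAl !mulmxA.
Qed.

Lemma okM2_dev (w : 'I_D -> 'I_D -> 'M[C]_(N, q)) a b : okC blk (fun u => dev blk w u a b).
Proof.
have okb i k : okC blk (fun u => bmat w u i k).
  under eq_fun do rewrite summxE; apply: okC_sum => s.
  under eq_fun do rewrite summxE; apply: okC_sum => t.
  by under eq_fun do rewrite mxE; apply: okCM; [exact: okC_entry|exact: okC_cst].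
under eq_fun do rewrite mxE; apply: okCD; last exact: okC_cst.
by apply: okC_mulmx => // i k; under eq_fun do rewrite hadjE; exact: okCJ.
Qed.

Lemma ok_fro2N (F : 'M[C]_D -> 'M[C]_N) : (forall a b, okC blk (fun u => F u a b)) -> ok (fun u => fro2 (F u)).
Proof.
move=> h; apply: ok_sum => a; apply: ok_sum => b; have [] := h a b.
move=> o1 o2; rewrite /n2; apply: okD; under eq_fun do rewrite expr2; exact: okM.
Qed.

Lemma sandwich_le (c : R) (sg ta : 'M[C]_N) : 0 <= c ->
  psd (toC c *: tens 1%:M sg - GammaSER blk M rho) ->
  adj ta = ta -> (ta *m ta) *m sg *m (ta *m ta) = 1%:M ->
  ex (fun u => fro2 (ta *m dev blk v u *m ta)) <= c.
Proof.
move=> c0 hp ata t1; have h := dev_le hU mU iU (fun s t => ta *m v s t).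
have -> : ex (fun u => fro2 (ta *m dev blk v u *m ta)) = ex (fun u => fro2 (dev blk (fun s t => ta *m v s t) u)).
  by apply: (eq_ex P hU) => u _; rewrite dev_sandwich.
apply: le_trans h _; apply: le_trans (_ : c * \sum_s \sum_t fro2 (om s t) <= _); last first.
  by rewrite -[leRHS]mulr1 ler_wpM2l // om_sum.
apply: le_trans (om_contr c0 hp ata t1).
rewrite le_eqVlt; apply/orP; left; apply/eqP; apply: eq_bigr => s _.
rewrite [RHS]exchange_big; apply: eq_bigr => s' _.
rewrite mulr_sumr big_mkcond; apply: eq_bigr => t _.
rewrite /om [blk s == blk t]eq_sym; case: (blk t == blk s); last first.
  by rewrite big1 // => t' _; rewrite mulmx0 mul0mx fro2_hs hs0r.
rewrite mulr_sumr big_mkcond; apply: eq_bigr => t' _; rewrite [blk t' == _]eq_sym.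
case: (blk s' == blk t'); last by rewrite mulmx0 hadj0 mulmx0 fro2_hs hs0r.
rewrite -!scalemxAr hadjZ conj_toC -scalemxAl -scalemxAr !fro2Z !exprVn !sqr_sqrtr //.
by rewrite mulrA invfM.
Qed.

(** Cauchy-Schwarz leaves the norm of th K th. By cyclicity its square is a product of th th K with
    K th th, and the contraction [K] bounds both by the norm of th th. *)
Lemma cball_sandwich (K th Z : 'M[C]_N) : cball K -> adj th = th -> fro2 (th *m th) <= 1 ->
  Re (\tr (th *m K *m th *m Z)) <= fro Z.
Proof.
move=> cK ath th1; have [aK _] := cK.
have e : Re (\tr (th *m K *m th *m Z)) = hs (th *m K *m th) Z.
  by rewrite /hs dotE !hadjM ath aK !mulmxA.
rewrite e; apply: le_trans (hs_CS _ _) _; rewrite ler_piMl ?fro_ge0 //.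
have h1 : fro2 (th *m K *m th) = hs (th *m th *m K) (K *m (th *m th)).
  rewrite fro2_hs /hs !dotE !hadjM ath aK; congr Re.
  by rewrite -!mulmxA [LHS]mxtrace_mulC -!mulmxA.
have h2 : fro2 (K *m (th *m th)) <= 1 by apply: le_trans (cball_contr _ cK) th1.
have h3 : fro2 (th *m th *m K) <= 1 by rewrite -fro2_adj !hadjM ath aK.
have h4 := hs_CS (th *m th *m K) (K *m (th *m th)); rewrite -h1 in h4.
have f1 (X : 'M[C]_N) : fro2 X <= 1 -> fro X <= 1.
  by move=> hX; rewrite -[leRHS]sqrtr1 /fro ler_sqrt.
apply: (f1 _ _); apply: le_trans h4 _; rewrite -[leRHS]mulr1.
by apply: ler_pM; rewrite ?fro_ge0 //; exact: f1.
Qed.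

Lemma tr_sandwich n (K X ta th : 'M[C]_n) : ta *m th = 1%:M -> th *m ta = 1%:M ->
  \tr (K *m X) = \tr (th *m K *m th *m (ta *m X *m ta)).
Proof.
move=> h1 h2; rewrite -!mulmxA (mulmxA th ta) h2 mul1mx [RHS]mxtrace_mulC.
by rewrite -!mulmxA h1 mulmx1.
Qed.

Lemma tens_reg m n (A B : 'M[C]_n) (p k e : R) : toC k *: A = B + toC e *: 1%:M ->
  toC (p * k) *: tens (1%:M : 'M[C]_m) A = toC p *: tens 1%:M B + toC (p * e) *: 1%:M.
Proof.
move=> h; apply: mx_mvi => i j k' j'.
have h' : toC k * A j j' = B j j' + toC e * (j == j')%:R.
  by have /matrixP/(_ j j') := h; rewrite !mxE.
rewrite [LHS]mxE [RHS]addmxE [in RHS]mxE [X in _ = _ + X]mxE !tensE ![_%:M _ _]mxE mvi_eq.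
have -> : toC (p * k) * ((i == k')%:R * A j j') = toC p * (i == k')%:R * (toC k * A j j') by rewrite toCM; ring.
rewrite h' toCM.
by case: (i == k'); case: (j == j'); rewrite ?mulr1n ?mulr0n /=; ring.
Qed.

(** A function [Q] dominating all Re tr (K X) at once stands in for the trace norm, so its
    measurability does not enter. With z the norm of the sandwiched deviation, z <= c0 / 2 + z^2 /
    (2 c0) reduces the mean to a second moment, and c0 is the square root of the bound on that
    moment. *)
Theorem mean_bound (sg : 'M[C]_N) (l e : R) : density sg -> 0 < e ->
  psd (toC (2 `^ (- l)) *: tens 1%:M sg - GammaSER blk M rho) ->
  exists Q, [/\ ok Q, ex Q <= 2 `^ (- (l / 2)) + e &
    forall u K, G u -> cball K -> Re (\tr (K *m devM u)) <= Q u].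
Proof.
move=> [psg tsg] e0 hp; have [V [a [h1 h2 eS a0]]] := psd_spectral psg.
have suma : \sum_i a i = 1.
  have : \tr sg = toC (\sum_i a i).
    rewrite eS mxtrace_mulC mulmxA h1 mul1mx toC_sum; apply: eq_bigr => i _.
    by rewrite !mxE eqxx mulr1n.
  by rewrite tsg => /(congr1 (@complex.Re R)).
pose c1 : R := 2 `^ (- (l / 2)).
have c10 : 0 < c1 by rewrite powR_gt0.
have c12 : c1 ^+ 2 = 2 `^ (- l) by rewrite expr2 -powRD ?pnatr_eq0 ?implybT //; congr (_ `^ _); lra.
(* [sg] may be singular, so it is replaced by (sg + eta) / (1 + eta N), again of trace one; this
   [eta] keeps the loss c1 eta N below e. *)
pose eta := e / (c1 * (N%:R + 1)).
have N0 : 0 <= N%:R :> R by [].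
have eta0 : 0 < eta by rewrite divr_gt0 // mulr_gt0 //; lra.
pose ka := 1 + eta * N%:R.
have ka1 : 1 <= ka by rewrite lerDl mulr_ge0 // ltW.
have ka0 : 0 < ka by lra.
pose a' i := (a i + eta) / ka.
have a'0 i : 0 < a' i by rewrite divr_gt0 // ltr_wpDl.
have suma' : \sum_i a' i = 1.
  rewrite -mulr_suml big_split /= suma sum_cst [N%:R * _]mulrC divff // gt_eqF //.
pose r4 i := Num.sqrt (Num.sqrt (a' i)).
have r40 i : 0 < r4 i by rewrite !sqrtr_gt0.
have r42 i : r4 i * r4 i = Num.sqrt (a' i) by rewrite -expr2 sqr_sqrtr // sqrtr_ge0.
have r44 i : Num.sqrt (a' i) * Num.sqrt (a' i) = a' i by rewrite -expr2 sqr_sqrtr // ltW.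
pose ta := V *m diagR (fun i => (r4 i)^-1) *m adj V.
pose th := V *m diagR r4 *m adj V.
pose sg' := V *m diagR a' *m adj V.
have herm f : adj (V *m diagR f *m adj V) = V *m diagR f *m adj V.
  by rewrite !hadjM diagR_adj hadjK mulmxA.
have one : V *m diagR (fun=> 1) *m adj V = 1%:M.
  by rewrite diagR_const mul_mx_scalar toC1 scale1r.
have zZ k f : toC k *: (V *m diagR f *m adj V) = V *m diagR (fun i => k * f i) *m adj V.
  rewrite scalemxAl scalemxAr; congr (_ *m _ *m _); apply/matrixP => x y; rewrite !mxE.
  by case: (x == y); rewrite ?mulr0n ?mulr0 // !mulr1n toCM.
have zD f g : V *m diagR f *m adj V + V *m diagR g *m adj V = V *m diagR (fun i => f i + g i) *m adj V.
  rewrite -mulmxDl -mulmxDr; congr (_ *m _ *m _); apply/matrixP => x y; rewrite !mxE.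
  by case: (x == y); rewrite ?mulr0n ?addr0 // !mulr1n toCD.
have tth : ta *m th = 1%:M.
  rewrite /ta /th conj_diagR // -one; congr (_ *m diagR _ *m _); apply/funext => i.
  by rewrite mulVf // gt_eqF.
have htt : th *m ta = 1%:M.
  rewrite /ta /th conj_diagR // -one; congr (_ *m diagR _ *m _); apply/funext => i.
  by rewrite mulfV // gt_eqF.
have t1 : (ta *m ta) *m sg' *m (ta *m ta) = 1%:M.
  rewrite /ta /sg' !conj_diagR // -one; congr (_ *m diagR _ *m _); apply/funext => i.
  by rewrite -r44 -!r42; field; rewrite gt_eqF.
have th1 : fro2 (th *m th) <= 1.
  rewrite /th conj_diagR // fro2_conj // fro2_diag -suma' le_eqVlt; apply/orP; left; apply/eqP.
  by apply: eq_bigr => i _; rewrite n2_toC r42 sqr_sqrtr // ltW.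
have p2 : 0 < 2 `^ (- l) :> R by rewrite powR_gt0.
have hp' : psd (toC (2 `^ (- l) * ka) *: tens 1%:M sg' - GammaSER blk M rho).
  have -> : toC (2 `^ (- l) * ka) *: tens 1%:M sg' - GammaSER blk M rho =
     (toC (2 `^ (- l)) *: tens 1%:M sg - GammaSER blk M rho) + toC (2 `^ (- l) * eta) *: 1%:M.
    rewrite addrAC; congr (_ - _); apply: tens_reg.
    rewrite -one eS -/(diagR a) zZ zZ zD; congr (_ *m diagR _ *m _); apply/funext => x.
    by rewrite /a' mulr1 mulrC divfK // gt_eqF.
  apply: psdD => //; move=> z; rewrite -scalemxAr mulmx1 -scalemxAl mxE.
  apply: mulr_ge0; first by rewrite toC_ge0 mulr_ge0 ?(ltW eta0) ?(ltW p2).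
  rewrite mxE; apply: sumr_ge0 => i _; rewrite hadjE -n2E toC_ge0; exact: n2_ge0.
pose c2 := 2 `^ (- l) * ka; have c20 : 0 < c2 by rewrite mulr_gt0.
pose c0 := Num.sqrt c2; have c00 : 0 < c0 by rewrite sqrtr_gt0.
have c0c : c0 ^+ 2 = c2 by rewrite sqr_sqrtr // ltW.
have okf : ok (fun u => fro2 (ta *m dev blk v u *m ta)).
  apply: ok_fro2N => i k; apply: okC_mulmx => x y; last exact: okC_cst.
  by move: x y; apply: okC_mulmx => x y; [exact: okC_cst|exact: okM2_dev].
exists (fun u => c0 / 2 + (2 * c0)^-1 * fro2 (ta *m dev blk v u *m ta)); split.
- by apply: okD; [exact: ok_cst|exact: okZ].
- rewrite (exD P hU mU); [|exact: ok_cst|exact: okZ].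
  rewrite ex_cst (exZ P hU mU) //.
  have h3 := sandwich_le (ltW c20) hp' (herm _) t1.
  have h4 : 0 <= (2 * c0)^-1 by rewrite invr_ge0 mulr_ge0 // ltW.
  apply: le_trans (lerD (lexx _) (ler_wpM2l h4 h3)) _.
  have -> : c0 / 2 + (2 * c0)^-1 * c2 = c0 by rewrite -c0c; field; rewrite gt_eqF.
  rewrite -/c1; apply: le_trans (_ : c1 * ka <= _).
    rewrite -ler_sqr ?nnegrE ?(ltW c00) ?mulr_ge0 ?(ltW c10) ?(ltW ka0) // c0c exprMn c12 /c2.
    by rewrite ler_pM2l // expr2 ler_peMr // ltW.
  rewrite /ka mulrDr mulr1 lerD2l /eta.
  have -> : c1 * (e / (c1 * (N%:R + 1)) * N%:R) = e * (N%:R / (N%:R + 1)).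
    field; rewrite (gt_eqF c10) andbT gt_eqF //; lra.
  by rewrite ler_piMr ?(ltW e0) // ler_pdivrMr ?mul1r; lra.
- move=> u K Gu cK; rewrite devME.
  have -> : \tr (K *m dev blk v u) = \tr (th *m K *m th *m (ta *m dev blk v u *m ta)).
    exact: tr_sandwich.
  apply: le_trans (cball_sandwich _ cK (herm _) th1) _.
  rewrite -fro_sqr; move: (fro _) => z.
  have := sqr_ge0 (z - c0); rewrite sqrrB.
  have -> : c0 / 2 + (2 * c0)^-1 * z ^+ 2 = (2 * c0)^-1 * (c0 ^+ 2 + z ^+ 2) by field; rewrite gt_eqF.
  move=> h; rewrite mulrC ler_pdivlMr ?mulr_gt0 //; lra.
Qed.
End Mean.

(** * Concentration of the trace norm *)

Section Softmax.
Variables (R : realType) (D : nat) (J : finType) (blk : 'I_D -> J).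
Local Notation C := R[i].
Local Notation mxT := (mxT R D).
Local Notation G := (@block_unitary R D J blk).
Local Notation grad_bound := (@grad_bound R D J blk).
Variables (I : finType) (l : I -> 'M[C]_D -> R) (Y : I -> 'M[C]_D -> 'M[C]_D) (K L Ls be : R).
Hypotheses (I0 : (0 < #|I|)%N) (K0 : 0 <= K) (be0 : 0 < be) (hl : forall i, grad_bound K L Ls (l i) (Y i)).

Definition smS x := \sum_i expR (be * l i x).
(** The Gibbs weights. The quotient is written with [expR (- ln _)], so that measurability follows
    by composition. *)
Definition smp i x := expR (be * l i x) * expR (- ln (smS x)).
Definition smf x := be^-1 * ln (smS x).
Definition smY x : 'M[C]_D := \sum_i toC (smp i x) *: Y i x.

Lemma smS_gt0 x : 0 < smS x.
Proof.
have /card_gt0P[i _] := I0.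
by rewrite /smS (bigD1 i) //= ltr_pwDl ?expR_gt0 // sumr_ge0 // => j _; exact: expR_ge0.
Qed.

Lemma smp_ge0 i x : 0 <= smp i x.
Proof. by rewrite mulr_ge0 ?expR_ge0. Qed.
Lemma smp_sum x : \sum_i smp i x = 1.
Proof.
by rewrite -mulr_suml -/(smS x) expRN lnK ?posrE ?smS_gt0 // mulfV // gt_eqF // smS_gt0.
Qed.

Lemma smp_avg x (F : I -> R) (c : R) : (forall i, F i <= c) -> \sum_i smp i x * F i <= c.
Proof.
move=> h; rewrite -[leRHS]mul1r -(smp_sum x) mulr_suml; apply: ler_sum => i _.
by rewrite ler_wpM2l ?smp_ge0.
Qed.

Lemma hs_smY x X : hs (smY x) X = \sum_i smp i x * hs (Y i x) X.
Proof. by rewrite hsC /smY hs_sumr; apply: eq_bigr => i _; rewrite hsZr hsC. Qed.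

Lemma smf_ge i x : l i x <= smf x.
Proof.
rewrite /smf ler_pdivlMl // -[leLHS]expRK ler_ln ?posrE ?expR_gt0 ?smS_gt0 //.
rewrite /smS (bigD1 i) //= lerDl; apply: sumr_ge0 => j _; exact: expR_ge0.
Qed.

Lemma smf_le x (c : R) : (forall i, l i x <= c) -> smf x <= c + be^-1 * ln #|I|%:R.
Proof.
move=> h; rewrite /smf ler_pdivrMl // mulrDr mulVKf ?gt_eqF //.
have n0 : 0 < #|I|%:R :> R by rewrite ltr0n.
rewrite -(expRK (be * c)) -lnM ?posrE ?expR_gt0 // ler_ln ?posrE ?smS_gt0 ?mulr_gt0 ?expR_gt0 //.
rewrite mulrC mulr_natl -sumr_const; apply: ler_sum => i _; rewrite ler_expR.
by rewrite ler_pM2l.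
Qed.

(** The increment of [smf] is 1 / be times the logarithm of the Gibbs mean of exp (be a_i).
    Convexity bounds it below by the mean m; above, Taylor serves while be b <= 1 and the crude
    bound exp (be b) beyond. *)
Lemma smf_diff (b m : R) (a : I -> R) x y : 0 <= b -> (forall i, l i y = l i x + a i) ->
  (forall i, `|a i| <= b) -> \sum_i smp i x * a i = m ->
  m <= smf y - smf x <= m + 2 * be * b ^+ 2.
Proof.
move=> b0 ha hb mE.
have e1 : smS y = smS x * \sum_i smp i x * expR (be * a i).
  rewrite mulr_sumr; apply: eq_bigr => i _; rewrite ha mulrDr expRD /smp expRN lnK ?posrE ?smS_gt0 //.
  by field; rewrite gt_eqF // smS_gt0.
set Z := \sum_i _ in e1.
have Zm : expR (be * m) <= Z.
  apply: le_trans (_ : \sum_i smp i x * (expR (be * m) * (1 + (be * a i - be * m))) <= _); last first.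
    apply: ler_sum => i _; rewrite ler_wpM2l ?smp_ge0 //.
    have -> : be * a i = be * m + (be * a i - be * m) by rewrite addrC subrK.
    rewrite expRD ler_wpM2l ?expR_ge0 //; apply: le_trans (expR_ge1Dx _); by lra.
  rewrite le_eqVlt; apply/orP; left; apply/eqP.
  transitivity (expR (be * m) * ((\sum_i smp i x) * (1 - be * m) + be * \sum_i smp i x * a i)).
    by rewrite smp_sum mE; ring.
  rewrite mulr_suml mulr_sumr -big_split mulr_sumr; apply: eq_bigr => i _ /=; ring.
have Z0 : 0 < Z by apply: lt_le_trans Zm; exact: expR_gt0.
have e2 : smf y - smf x = be^-1 * ln Z.
  by rewrite /smf e1 lnM ?posrE ?smS_gt0 // mulrDr addrC addKr.
have mb : `|m| <= b.
  rewrite -mE ler_norml; apply/andP; split.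
    rewrite lerNl -sumrN; under eq_bigr do rewrite -mulrN.
    by apply: smp_avg => i; have := hb i; rewrite ler_norml => /andP[]; rewrite lerNl.
  by apply: smp_avg => i; have := hb i; rewrite ler_norml => /andP[].
have Zu : Z <= expR (be * m + 2 * (be * b) ^+ 2).
  have [bb|bb] := leP (be * b) 1.
    apply: le_trans (_ : \sum_i smp i x * (1 + be * a i + 2 * (be * b) ^+ 2) <= _).
      apply: ler_sum => i _; rewrite ler_wpM2l ?smp_ge0 //.
      have z1 : `|be * a i| <= be * b by rewrite normrM (gtr0_norm be0) ler_wpM2l // ltW.
      apply: le_trans (expR_taylor (le_trans z1 bb)) _.
      have z2 : (be * a i) ^+ 2 <= (be * b) ^+ 2.
        by rewrite -(real_normK (num_real (be * a i))) lerXn2r ?nnegrE // mulr_ge0 // ltW.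
      have z3 : `|be * a i| ^+ 3 <= (be * a i) ^+ 2.
        by rewrite -[leRHS](real_normK (num_real _)) exprS ler_piMl ?sqr_ge0 // (le_trans z1).
      by have := sqr_ge0 (be * a i); lra.
    have -> : \sum_i smp i x * (1 + be * a i + 2 * (be * b) ^+ 2) = 1 + (be * m + 2 * (be * b) ^+ 2).
      transitivity ((\sum_i smp i x) * (1 + 2 * (be * b) ^+ 2) + be * \sum_i smp i x * a i).
        rewrite mulr_suml mulr_sumr -big_split; apply: eq_bigr => i _ /=; ring.
      by rewrite smp_sum mE; ring.
    exact: expR_ge1Dx.
  apply: le_trans (_ : expR (be * b) <= _).
    apply: smp_avg => i; rewrite ler_expR ler_wpM2l ?(ltW be0) //.
    exact: le_trans (ler_norm _) (hb i).
  rewrite ler_expR; have : - (be * b) <= be * m.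
    by rewrite -mulrN ler_wpM2l ?(ltW be0) //; move: mb; rewrite ler_norml => /andP[].
  have : be * b <= (be * b) ^+ 2 by rewrite expr2 ler_peMl ?(ltW bb) // (le_trans ler01 (ltW bb)).
  lra.
rewrite e2 ler_pdivlMl // -{1}[be * m]expRK ler_ln ?posrE ?expR_gt0 // Zm /= ler_pdivrMl //.
rewrite -[leRHS]expRK ler_ln ?posrE ?expR_gt0 //; apply: le_trans Zu _.
by rewrite ler_expR le_eqVlt; apply/orP; left; apply/eqP; ring.
Qed.

Lemma smS_meas : measurable_fun [set: mxT] (smS : mxT -> R).
Proof.
apply: measurable_sum => i; apply: (measurableT_comp (@measurable_expR R)).
by apply: measurable_funM; [exact: measurable_cst|exact: grad_f (hl i)].
Qed.
Lemma lnS_meas : measurable_fun [set: mxT] ((fun x => ln (smS x)) : mxT -> R).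
Proof. exact: (measurableT_comp (@measurable_ln R) smS_meas). Qed.

(** The gradient is a convex combination of the given ones, which preserves [L] and [Ls]. The price
    of smoothing, proportional to [be], falls on the second-order constant alone. *)
Lemma softmax_grad_bound : exists K', 0 <= K' /\ grad_bound K' L Ls smf smY.
Proof.
have /card_gt0P[i0 _] := I0.
have L0 := grad_L0 (hl i0).
pose A := L + K * Num.sqrt (4 * D%:R).
have A0 : 0 <= A by rewrite addr_ge0 // mulr_ge0 // sqrtr_ge0.
exists (K + 2 * be * A ^+ 2); split.
  by rewrite addr_ge0 // mulr_ge0 ?sqr_ge0 // mulr_ge0 // ltW.
split.
- by apply: measurable_funM; [exact: measurable_cst|exact: lnS_meas].
- move=> a b; rewrite /smY; under eq_fun do rewrite summxE.
  apply: cmeas_sum => i; under eq_fun do rewrite mxE; apply: cmeasM; last exact: grad_Y (hl i) a b.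
  apply: cmeas_toC; apply: measurable_funM.
    apply: (measurableT_comp (@measurable_expR R)).
    by apply: measurable_funM; [exact: measurable_cst|exact: grad_f (hl i)].
  apply: (measurableT_comp (@measurable_expR R)); apply: measurable_funN; exact: lnS_meas.
- move=> x Gx; rewrite /smY hadj_sum -sumrN; apply: eq_bigr => i _.
  by rewrite hadjZ conj_toC (grad_skew (hl i) Gx) scalerN.
- move=> x Gx; have [->//|n0] := eqVneq (fro (smY x)) 0.
  have np : 0 < fro (smY x) by rewrite lt_def n0 fro_ge0.
  rewrite -(ler_pM2r np) -expr2 fro_sqr fro2_hs hs_smY; apply: smp_avg => i.
  apply: le_trans (hs_CS _ _) _; by rewrite ler_wpM2r ?fro_ge0 // (grad_L (hl i)).
- move=> x B Gx sB; rewrite hs_smY; apply: smp_avg => i; exact: (grad_Ls (hl i)).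
- move=> x g Gx Gg; set De := g - 1%:M.
  pose a i := l i (g *m x) - l i x.
  have ab i : `|a i - hs (Y i x) De| <= K * fro2 De by exact: (grad_K (hl i)).
  have fD : fro2 De <= Num.sqrt (4 * D%:R) * fro De.
    rewrite -fro_sqr expr2 ler_wpM2r ?fro_ge0 // /fro ler_sqrt ?mulr_ge0 //; exact: fro2_sub1 Gg.
  have hb i : `|a i| <= A * fro De.
    have e : a i = (a i - hs (Y i x) De) + hs (Y i x) De by rewrite subrK.
    rewrite e; apply: le_trans (ler_normD _ _) _.
    have h2 := grad_hs De (hl i) Gx; have h1 := ab i; have h3 := ler_wpM2l K0 fD.
    by rewrite /A; lra.
  have b0 : 0 <= A * fro De by rewrite mulr_ge0 // fro_ge0.
  have ha i : l i (g *m x) = l i x + a i by rewrite /a addrC subrK.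
  have := smf_diff b0 ha hb erefl; set m := \sum_i _.
  have hm : `|m - hs (smY x) De| <= K * fro2 De.
    rewrite hs_smY -sumrB; under eq_bigr do rewrite -mulrBr.
    rewrite ler_norml; apply/andP; split.
      rewrite lerNl -sumrN; under eq_bigr do rewrite -mulrN.
      by apply: smp_avg => i; have := ab i; rewrite ler_norml => /andP[]; rewrite lerNl.
    by apply: smp_avg => i; have := ab i; rewrite ler_norml => /andP[].
  have e : 2 * be * (A * fro De) ^+ 2 = 2 * be * A ^+ 2 * fro2 De by rewrite exprMn fro_sqr mulrA.
  have p0 : 0 <= 2 * be * A ^+ 2 * fro2 De.
    by rewrite mulr_ge0 ?fro2_ge0 // mulr_ge0 ?sqr_ge0 // mulr_ge0 // ltW.
  rewrite e; move: hm p0; move: (smf _) (smf _) m (hs _ _) (2 * be * A ^+ 2) (fro2 De) => q1 q2 q3 q4 q5 q6.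
  rewrite !ler_norml => /andP[h1 h2] h3 /andP[h4 h5]; apply/andP; split; lra.
Qed.
End Softmax.

(** * ** The quadratic functionals tr (K X(U)) and their gradients *)

Section Functional.
Variables (R : realType) (D dR dE : nat) (J : finType) (blk : 'I_D -> J).
Local Notation C := R[i].
Local Notation mxT := (mxT R D).
Local Notation mvi := mxvec_index.
Local Notation G := (@block_unitary R D J blk).
Local Notation grad_bound := (@grad_bound R D J blk).
Local Notation N := (dE * dR)%N.
Local Notation q := ((D * dE) * (D * dR))%N.
Variables (M : {linear 'M[C]_D -> 'M[C]_dE}) (rho : 'M[C]_(D * dR)).
Hypotheses (rho_sub : subnormalized rho) (tniM : trace_nonincreasing M).
Variable v : 'I_D -> 'I_D -> 'M[C]_(N, q).
Hypothesis hv : forall s t s' t' e a e' a', (v s t *m adj (v s' t')) (mvi e a) (mvi e' a') =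
    M (delta_mx s s') e e' * rho (mvi t a) (mvi t' a').
Local Notation rhoS := (ptrace2 rho).
Local Notation op := (opnorm rhoS).

Lemma psd_sum n (I : Type) (r : seq I) (F : I -> 'M[C]_n) : (forall i, psd (F i)) -> psd (\sum_(i <- r) F i).
Proof.
by move=> h; elim: r => [|i r IH]; rewrite ?big_nil ?big_cons; [exact: psd0|exact: psdD].
Qed.

Lemma psd_rhoS : psd rhoS.
Proof.
have [r er] := psd_factor rho_sub.1.
have -> : rhoS = \sum_a (\matrix_(s, al) r (mvi s a) al) *m adj (\matrix_(s, al) r (mvi s a) al).
  apply/matrixP => s s'; rewrite mxE summxE; apply: eq_bigr => a _.
  by rewrite er !mxE; apply: eq_bigr => al _; rewrite !hadjE !mxE.
by apply: psd_sum => a; exact: psd_gram.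
Qed.

Lemma tr_rhoS : Re (\tr rhoS) <= 1.
Proof.
have -> : \tr rhoS = \tr rho.
  by rewrite /mxtrace sum_mvi; apply: eq_bigr => s _; rewrite mxE.
have : 0 <= 1 - \tr rho by rewrite subr_ge0; exact: rho_sub.2.
by move=> /cge0P[_]; rewrite cReB /= subr_ge0.
Qed.

(** The left side is the trace of M at X rho^S (adj X), and M does not increase traces. The bound is
    for arbitrary X because tangent directions, not only group elements, are inserted. *)
Lemma fro2_bmat_le (X : 'M[C]_D) : fro2 (bmat v X) <= Re (\tr (X *m rhoS *m adj X)).
Proof.
pose Z := tens X 1%:M *m rho *m adj (tens X 1%:M).
have e1 : toC (fro2 (bmat v X)) = \tr (M (X *m rhoS *m adj X)).
  rewrite fro2_dot dotE mxtrace_mulC (bmat_ampr hv) -/Z.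
  rewrite /mxtrace sum_mvi; apply: eq_bigr => e _.
  under eq_bigr do rewrite amprE.
  have -> : X *m rhoS *m adj X = \sum_a \matrix_(s, s') Z (mvi s a) (mvi s' a).
    apply/matrixP => s s'; rewrite summxE mxE.
    under [RHS]eq_bigr do rewrite mxE urho_entry.
    rewrite [RHS]exchange_big /= [LHS](eq_bigr (fun t' => \sum_t X s t * rhoS t t' * (X s' t')^*)).
      rewrite exchange_big; apply: eq_bigr => t _; rewrite [RHS]exchange_big; apply: eq_bigr => t' _.
      by rewrite mxE mulr_sumr mulr_suml.
    by move=> t' _; rewrite mxE mulr_suml hadjE.
  by rewrite linear_sum summxE.
have p : psd (X *m rhoS *m adj X) by apply: psd_conj; exact: psd_rhoS.
have : 0 <= \tr (X *m rhoS *m adj X) - \tr (M (X *m rhoS *m adj X)) by rewrite subr_ge0; exact: tniM.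
by move=> /cge0P[_]; rewrite -e1 cReB /= subr_ge0.
Qed.

Lemma fro2_bmat_op (X : 'M[C]_D) : fro2 (bmat v X) <= op * fro2 X.
Proof.
apply: le_trans (fro2_bmat_le X) _.
have -> : Re (\tr (X *m rhoS *m adj X)) = hs (adj X) (rhoS *m adj X).
  by rewrite /hs dotE hadjK mulmxA.
rewrite hs_col -fro2_adj (fro2_hs (adj X)) hs_col mulr_sumr; apply: ler_sum => c _.
rewrite -fro2_hs -fro_sqr expr2 mulrA [_ * _ * _]mulrC; apply: le_trans (hs_CS _ _) _.
by rewrite ler_wpM2l ?fro_ge0 // colE -mulmxA -colE opnorm_vec.
Qed.

Lemma fro2_bmat_G x : G x -> fro2 (bmat v x) <= 1.
Proof.
move=> Gx; apply: le_trans (fro2_bmat_le x) _; apply: le_trans tr_rhoS.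
by rewrite mxtrace_mulC mulmxA Gx.1 mul1mx.
Qed.

Lemma bmatD (x y : 'M[C]_D) : bmat v (x + y) = bmat v x + bmat v y.
Proof.
rewrite /bmat -big_split; apply: eq_bigr => s _; rewrite -big_split; apply: eq_bigr => t _.
by rewrite /= mxE scalerDl.
Qed.

Variable K : 'M[C]_N.
Hypothesis cK : cball K.
Hypothesis op0 : 0 < op.
Let L := 2 * Num.sqrt op.

Definition lf (x : 'M[C]_D) := hs (bmat v x) (K *m bmat v x) - Re (\tr (K *m gam blk v)).
(** The Riesz representative of the differential of [lf] under left multiplication, see [hs_lw].
    [ly] is its skew-Hermitian part, since tangent vectors of the group at 1 are skew. *)
Definition lw (x : 'M[C]_D) : 'M[C]_D := \matrix_(s, k) (2 * dot (\sum_t x k t *: v s t) (K *m bmat v x)).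
Definition ly (x : 'M[C]_D) : 'M[C]_D := toC 2^-1 *: (lw x - adj (lw x)).

Lemma lfE x : lf x = Re (\tr (K *m dev blk v x)).
Proof.
rewrite /lf /dev mulmxBr raddfB /= cReB; congr (_ - _).
by rewrite /hs dotE mxtrace_mulC mulmxA.
Qed.

Lemma hs_lw x (X : 'M[C]_D) : hs (lw x) X = 2 * hs (bmat v (X *m x)) (K *m bmat v x).
Proof.
have e : bmat v (X *m x) = \sum_s \sum_k X s k *: \sum_t x k t *: v s t.
  apply: eq_bigr => s _; rewrite (eq_bigr (fun t => \sum_k (X s k * x k t) *: v s t)).
    rewrite exchange_big; apply: eq_bigr => k _; rewrite scaler_sumr; apply: eq_bigr => t _.
    by rewrite scalerA.
  by move=> t _; rewrite mxE scaler_suml.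
rewrite [LHS]hsC e [in RHS]hsC hs_sumr mulr_sumr /hs /dot cRe_sum; apply: eq_bigr => s _.
rewrite -/(hs (K *m bmat v x) _) hs_sumr mulr_sumr cRe_sum; apply: eq_bigr => k _.
rewrite [in RHS]hsC mxE mulrCA /hs dotZl.
have -> : 2 = toC 2 :> C by rewrite toC_nat.
by rewrite cRe_toC.
Qed.

(** In [cball_polar] the two squared norms are at most op fro2 X and 1. The weight c = 1 / (sqrt op
    fro X) makes both terms sqrt op fro X, whence L = 2 sqrt op. *)
Lemma lw_le x (X : 'M[C]_D) : G x -> hs (lw x) X <= L * fro X.
Proof.
move=> Gx; rewrite hs_lw; have [X0|X0] := eqVneq (fro X) 0.
  have -> : X = 0 by apply: fro2_eq0; rewrite -fro_sqr X0 expr0n.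
  rewrite mul0mx (_ : bmat v 0 = 0) ?hs0l ?mulr0 ?mulr_ge0 ?fro_ge0 ?sqrtr_ge0 //.
  by rewrite /bmat big1 // => s _; rewrite big1 // => t _; rewrite mxE scale0r.
have Xp : 0 < fro X by rewrite lt_def X0 fro_ge0.
have so : 0 < Num.sqrt op by rewrite sqrtr_gt0.
pose c := (Num.sqrt op * fro X)^-1; have c0 : 0 < c by rewrite invr_gt0 mulr_gt0.
apply: le_trans (cball_polar _ _ cK c0) _.
have h1 : c * fro2 (bmat v (X *m x)) <= c * (op * fro2 X).
  rewrite ler_wpM2l ?(ltW c0) //; apply: le_trans (fro2_bmat_op _) _.
  by rewrite (fro2_isor X (unitary_r Gx.1)).
have h2 : fro2 (bmat v x) / c <= c^-1.
  have ci : 0 <= c^-1 by rewrite invr_ge0 ltW.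
  exact: ler_piMl ci (fro2_bmat_G Gx).
apply: le_trans (lerD h1 h2) _; rewrite le_eqVlt; apply/orP; left; apply/eqP.
rewrite /c invrK -fro_sqr /L; have [sq es] : exists sq, Num.sqrt op = sq by exists (Num.sqrt op).
have eo : op = sq ^+ 2 by rewrite -es sqr_sqrtr // ltW.
by rewrite es in so *; rewrite eo; field; rewrite !gt_eqF.
Qed.

Lemma fro_lw x : G x -> fro (lw x) <= L.
Proof.
move=> Gx; have [->|n0] := eqVneq (fro (lw x)) 0; first by rewrite mulr_ge0 ?sqrtr_ge0.
have np : 0 < fro (lw x) by rewrite lt_def n0 fro_ge0.
by rewrite -(ler_pM2r np) -expr2 fro_sqr fro2_hs lw_le.
Qed.

Lemma fro_ly x : G x -> fro (ly x) <= L.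
Proof.
move=> Gx; rewrite froZ ger0_norm ?invr_ge0 //.
have := froB (lw x) (adj (lw x)); rewrite fro_adj; have := fro_lw Gx.
by move: (fro _) (fro _) => a b; lra.
Qed.

(** [lf] is quadratic, so the expansion in De = g - 1 stops at second order with a term of size op
    fro2 De. Replacing [lw] by its skew part costs the Hermitian part of De, which unitarity makes -
    (adj De) De / 2; hence the summand L / 2. *)
Lemma lf_grad_bound : grad_bound (L / 2 + op) L L lf ly.
Proof.
have cb : forall a b, cmeas (fun x : mxT => bmat v x a b).
  move=> a b; rewrite /bmat; under eq_fun do rewrite summxE.
  apply: cmeas_sum => s; under eq_fun do rewrite summxE.
  apply: cmeas_sum => t; under eq_fun do rewrite mxE.
  by apply: cmeasM; [exact: cmeas_entry|exact: cmeas_cst].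
have cKb : forall a b, cmeas (fun x : mxT => (K *m bmat v x) a b).
  by apply: cmeas_mulmx => a b; [exact: cmeas_cst|exact: cb].
have cw a b : cmeas (fun x : mxT => lw x a b).
  under eq_fun do rewrite mxE; apply: cmeasM; first exact: cmeas_cst.
  apply: cmeas_sum => i; apply: cmeas_sum => j; apply: cmeasM; last exact: cKb.
  apply: cmeasJ; under eq_fun do rewrite summxE.
  apply: cmeas_sum => t; under eq_fun do rewrite mxE.
  by apply: cmeasM; [exact: cmeas_entry|exact: cmeas_cst].
split.
- by apply: measurable_funB; [exact: measurable_hs|exact: measurable_cst].
- have eW : forall (W : 'M[C]_D) a b, (toC 2^-1 *: (W - adj W)) a b = toC 2^-1 * (W a b - (W b a)^*).
    by move=> W a b; rewrite !mxE.
  move=> a b; under eq_fun do rewrite /ly eW.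
  apply: cmeasM; first exact: cmeas_cst.
  by apply: cmeasB; [exact: cw|apply: cmeasJ; exact: cw].
- by move=> x Gx; rewrite /ly hadjZ conj_toC hadjB hadjK -scalerN opprB.
- exact: fro_ly.
- move=> x B Gx _; apply: le_trans (hs_CS _ _) _.
  by rewrite ler_wpM2r ?fro_ge0 // fro_ly.
- move=> x g Gx Gg; set De := g - 1%:M.
  have gx : g *m x = x + De *m x by rewrite /De mulmxBl mul1mx addrC subrK.
  have e1 : lf (g *m x) - lf x = hs (lw x) De + hs (bmat v (De *m x)) (K *m bmat v (De *m x)).
    rewrite hs_lw /lf gx bmatD mulmxDr !hsDl !hsDr.
    have -> : hs (bmat v x) (K *m bmat v (De *m x)) = hs (bmat v (De *m x)) (K *m bmat v x).
      by rewrite -{1}cK.1 hs_mulr hsC.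
    move: (hs _ _) (hs _ _) (hs _ _) (Re _) => q1 q2 q3 q4; lra.
  have e2 : De + adj De = - (adj De *m De).
    rewrite /De hadjB hadj1 !mulmxBr !mulmxBl Gg.1 !mulmx1 !mul1mx.
    by apply/matrixP => i j; rewrite !mxE; ring.
  have e3 : hs (lw x) De - hs (ly x) De = - 2^-1 * hs (lw x) (adj De *m De).
    have e4 : hs (lw x) De + hs (lw x) (adj De) = - hs (lw x) (adj De *m De).
      by rewrite -hsDr e2 hsNr.
    have e5 : hs (adj (lw x)) De = hs (lw x) (adj De) by rewrite -hs_adj hadjK.
    rewrite /ly hsZl hsBl e5; lra.
  have h1 : `|hs (lw x) (adj De *m De)| <= L * fro2 De.
    apply: le_trans (hs_CS_abs _ _) _; apply: ler_pM; rewrite ?fro_ge0 ?fro_lw //.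
    rewrite -ler_sqr ?nnegrE ?fro_ge0 ?fro2_ge0 // fro_sqr; apply: le_trans (fro2_mul _ _) _.
    by rewrite fro2_adj expr2.
  have h2 := cball_mx (bmat v (De *m x)) cK.
  have h3 : fro2 (bmat v (De *m x)) <= op * fro2 De.
    by apply: le_trans (fro2_bmat_op _) _; rewrite (fro2_isor De (unitary_r Gx.1)).
  rewrite e1; move: e3 h1 h2 h3; move: (hs _ _) (hs _ _) (hs _ _) (hs _ _) (fro2 De) (fro2 _) => q1 q2 q3 q4 q5 q6.
  rewrite !ler_norml => e3 /andP[h1 h1'] /andP[h2 h2'] h3; apply/andP; split; lra.
Qed.
End Functional.

(** Entries are rounded to a grid of mesh 1 / m, and each cell met by the ball is represented by a
    member of the ball, with default 0. Representatives inside the ball keep every functional below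
    the trace norm. *)
Lemma net_cball (R : realType) n (e : R) : 0 < e ->
  exists (I : finType) (K : I -> 'M[R[i]]_n),
    [/\ (0 < #|I|)%N, forall i, cball (K i) & forall K', cball K' -> exists i, fro (K' - K i) <= e].
Proof.
move=> e0; pose m := (Num.truncn (2 * n%:R / e)).+1.
have m0 : 0 < m%:R :> R by rewrite ltr0n.
have me : 2 * n%:R <= m%:R * e.
  by rewrite -ler_pdivrMr //; apply: ltW; have /andP[] := @truncn_itv R (2 * n%:R / e) (divr_ge0 (mulr_ge0 (ler0n _ 2) (ler0n _ n)) (ltW e0)).
pose tr (x : R) : nat := Num.truncn (m%:R * (x + 1)).
have trP (x : R) : x ^+ 2 <= 1 -> (tr x < (2 * m).+1)%N /\ (tr x)%:R <= m%:R * (x + 1) < (tr x).+1%:R.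
  move=> x1; have /andP[xl xu] : - 1 <= x <= 1 by rewrite -ler_norml -(ler_sqr (normr_ge0 _)) ?nnegrE // real_normK ?num_real // expr1n.
  have h0 : 0 <= m%:R * (x + 1) by rewrite mulr_ge0 // -lerBlDr sub0r.
  have h := @truncn_itv R _ h0; split=> //; rewrite ltnS -(ler_nat R).
  move/andP: h => [h _]; apply: le_trans h _; rewrite natrM mulrC ler_wpM2r // ; lra.
have trE (x y : R) : x ^+ 2 <= 1 -> y ^+ 2 <= 1 -> tr x = tr y -> (x - y) ^+ 2 <= (m%:R ^+ 2)^-1.
  move=> /trP[_ /andP[a1 a2]] /trP[_ /andP[b1 b2]] ab; rewrite ab in a1 a2.
  rewrite -[leRHS]mul1r ler_pdivlMr ?exprn_gt0 // -exprMn -[leRHS](expr1n _ 2) -real_normK ?num_real //.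
  rewrite ler_sqr ?nnegrE // ler_norml; rewrite -natr1 in a2 b2; apply/andP; split; lra.
pose cell (K : 'M[R[i]]_n) : {ffun 'I_n * 'I_n * bool -> 'I_(2 * m).+1} :=
  [ffun p => inord (tr (if p.2 then Re (K p.1.1 p.1.2) else Im (K p.1.1 p.1.2)))].
pose rep c : 'M[R[i]]_n := xget 0 [set K | cball K /\ cell K = c].
have cball0 : cball (0 : 'M[R[i]]_n).
  by split; [rewrite hadj0|move=> v; rewrite mul0mx hs0r normr0 fro2_ge0].
exists {ffun 'I_n * 'I_n * bool -> 'I_(2 * m).+1}, rep; split.
- by apply/card_gt0P; exists (cell 0).
- by move=> c; rewrite /rep; case: xgetP => [K _ []|].
move=> K cK; exists (cell K); rewrite /rep; case: xgetP => [K' _ [cK' eK]|/(_ K)[]]; last by [].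
have part z : n2 z <= 1 -> Re z ^+ 2 <= 1 /\ Im z ^+ 2 <= 1 :> R.
  by rewrite /n2; have := sqr_ge0 (Re z); have := sqr_ge0 (Im z); split; lra.
have ent i j : n2 ((K - K') i j) <= 2 * (m%:R ^+ 2)^-1.
  have [r1 i1] := part _ (cball_entry i j cK); have [r2 i2] := part _ (cball_entry i j cK').
  have e1 (b : bool) : inord (tr (if b then Re (K i j) else Im (K i j))) = inord (tr (if b then Re (K' i j) else Im (K' i j))) :> 'I_(2 * m).+1.
    by have := congr1 (fun f : {ffun _} => f ((i, j), b)) eK; rewrite !ffunE.
  have eR : tr (Re (K i j)) = tr (Re (K' i j)).
    by have := congr1 val (e1 true); rewrite /= !inordK //; [case: (trP _ r2)|case: (trP _ r1)].
  have eI : tr (Im (K i j)) = tr (Im (K' i j)).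
    by have := congr1 val (e1 false); rewrite /= !inordK //; [case: (trP _ i2)|case: (trP _ i1)].
  have := trE _ _ r1 r2 eR; have := trE _ _ i1 i2 eI.
  have -> : (K - K') i j = K i j - K' i j by rewrite !mxE.
  by rewrite /n2 cReB cImB; lra.
rewrite -ler_sqr ?nnegrE ?fro_ge0 ?(ltW e0) // fro_sqr.
apply: le_trans (_ : \sum_(i < n) \sum_(j < n) 2 * (m%:R ^+ 2)^-1 <= _).
  by apply: ler_sum => i _; apply: ler_sum => j _; exact: ent.
rewrite !sum_cst; have -> : n%:R * (n%:R * (2 * (m%:R ^+ 2)^-1)) = 2 * n%:R ^+ 2 / m%:R ^+ 2 :> R by ring.
rewrite ler_pdivrMr ?exprn_gt0 // -exprMn [e * _]mulrC.
have h : (2 * n%:R) ^+ 2 <= (m%:R * e) ^+ 2 by rewrite lerXn2r ?nnegrE ?mulr_ge0 // ltW.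
by move: h; rewrite exprMn; have := sqr_ge0 (n%:R : R); lra.
Qed.

(** * ** Smoothing, measurability and tail of the trace norm *)

Section Concentration.
Variables (R : realType) (D dR dE : nat) (J : finType) (blk : 'I_D -> J).
Local Notation C := R[i].
Local Notation mxT := (mxT R D).
Local Notation G := (@block_unitary R D J blk).
Local Notation grad_bound := (@grad_bound R D J blk).
Local Notation N := (dE * dR)%N.
Variables (M : {linear 'M[C]_D -> 'M[C]_dE}) (rho : 'M[C]_(D * dR)).
Hypotheses (rho_sub : subnormalized rho) (cpM : completely_positive M) (tniM : trace_nonincreasing M).
Local Notation op := (opnorm (ptrace2 rho)).
Local Notation L := (2 * Num.sqrt op).
Local Notation n := ((dmin blk)%:R : R).
Local Notation X := (devM blk M rho).
Hypothesis op0 : 0 < op.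

Lemma devM_herm (x : 'M[C]_D) : adj (X x) = X x.
Proof.
have [v hv] := kraus rho_sub cpM; rewrite (devME _ hv) /dev hadjB hadjM hadjK; congr (_ - _).
rewrite /gam hadj_sum; apply: eq_bigr => s _; rewrite hadj_sum; apply: eq_bigr => t _.
by rewrite hadjZ conj_toC hadjM hadjK.
Qed.

(** The softmax over a net of [K]. From below, the net's precision e / b against the bound b of fro
    (X x) loses at most e; from above, the softmax adds ln |I| / be, at most e. *)
Lemma smooth_trnorm (e : R) : 0 < e -> exists f Y K,
  [/\ 0 <= K, grad_bound K L L f Y & forall x, G x -> trnorm (X x) - e <= f x <= trnorm (X x) + e].
Proof.
move=> e0; have [v hv] := kraus rho_sub cpM.
have [_ [B hB]] : ok blk (fun x => fro2 (X x)).
  under eq_fun do rewrite (devME _ hv); apply: ok_fro2N => a b; exact: okM2_dev.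
pose b := Num.sqrt B + 1; have b0 : 0 < b by rewrite ltr_wpDl ?sqrtr_ge0.
have Xb x : G x -> fro (X x) <= b.
  move=> /hB; rewrite ger0_norm ?fro2_ge0 // => h; apply: le_trans (_ : _ <= Num.sqrt B) _; last by rewrite /b; lra.
  by rewrite /fro ler_wsqrtr.
have [I [K [I0 cK hK]]] := net_cball N (divr_gt0 e0 b0).
pose be := (ln #|I|%:R + 1) / e.
have ln0 : 0 <= ln #|I|%:R :> R by rewrite ln_ge0 // ler1n.
have be0 : 0 < be by rewrite divr_gt0 // ltr_wpDl.
have bel : be^-1 * ln #|I|%:R <= e.
  rewrite /be invfM invrK mulrC mulrA ler_piMl ?(ltW e0) // ler_pdivrMr ?ltr_wpDl // mul1r; lra.
have hlf i : grad_bound (L / 2 + op) L L (lf blk v (K i)) (ly v (K i)) := lf_grad_bound blk rho_sub tniM hv (cK i) op0.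
have K0 : 0 <= L / 2 + op by rewrite addr_ge0 ?(ltW op0) // divr_ge0 // mulr_ge0 // sqrtr_ge0.
have [K' [K'0 hf]] := softmax_grad_bound I0 K0 be0 hlf.
exists (smf (fun i => lf blk v (K i)) be), (smY (fun i => lf blk v (K i)) (fun i => ly v (K i)) be), K'; split => //.
move=> x Gx; have lE i : lf blk v (K i) x = Re (\tr (K i *m X x)) by rewrite lfE // (devME _ hv).
apply/andP; split.
  have [K2 cK2 <-] := trnorm_attained (devM_herm x).
  have [i hi] := hK _ cK2; apply: le_trans (smf_ge _ I0 be0 i x); rewrite lE lerBlDr -lerBlDl.
  rewrite -cReB -raddfB -mulmxBl.
  have -> : Re (\tr ((K2 - K i) *m X x)) = hs (K2 - K i) (X x).
    by rewrite /hs dotE hadjB cK2.1 (cK i).1.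
  apply: le_trans (hs_CS _ _) _; rewrite -(divfK (lt0r_neq0 b0) e); apply: ler_pM; rewrite ?fro_ge0 //.
  exact: Xb.
apply: le_trans (_ : trnorm (X x) + be^-1 * ln #|I|%:R <= _); last by rewrite lerD2l.
by apply: smf_le => // i; rewrite lE; exact: trnorm_ge.
Qed.

Variables (d : measure_display) (T : measurableType d) (P : probability T R) (U : T -> 'M[C]_D).
Hypothesis hU : forall w, G (U w).
Hypothesis mU : forall A, mxBorel A -> measurable (U @^-1` A).
Hypothesis iU : forall g, G g -> forall A, mxBorel A ->
     P ((fun w => g *m U w) @^-1` A) = P (U @^-1` A).
Hypothesis n0 : (0 < dmin blk)%N.
Local Notation ok := (ok blk).
Local Notation ex := (ex P U).

(** [trnorm] goes through a chosen square root, so measurability is read off from the smooth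
    approximations of precision 1 / (m + 1), whose pointwise limit it is. *)
Lemma measurable_trnorm : measurable_fun [set: T] (fun w => trnorm (X (U w))).
Proof.
have /choice[g hg] : forall m, exists f : 'M[C]_D -> R, mxmeas f /\
    forall x, G x -> `|trnorm (X x) - f x| <= m.+1%:R^-1.
  move=> m; have i0 : 0 < m.+1%:R^-1 :> R by rewrite invr_gt0 ltr0n.
  have [f [Y [K [K0 hf hb]]]] := smooth_trnorm i0; exists f; split; first exact: grad_f hf.
  by move=> x /hb/andP[h1 h2]; move: h1 h2; move: (trnorm _) (f x) (_^-1) => q1 q2 q3 h1 h2; rewrite ler_norml; apply/andP; split; lra.
apply: (@measurable_fun_cvg _ _ _ _ (fun m w => g m (U w))).
  by move=> m; apply: (measurableT_comp (hg m).1); exact: mU'.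
move=> w _; apply/cvgrPdist_le => e e0; near=> m.
apply: le_trans ((hg m).2 _ (hU w)) _.
have me : e^-1 <= m.+1%:R.
  by apply: le_trans (_ : m%:R <= _); [near: m; exact: nbhs_infty_ger|rewrite ler_nat].
by rewrite -[leRHS]invrK lef_pV2 ?posrE ?invr_gt0.
Unshelve. all: by end_near.
Qed.

Lemma prob_le_ex F (E : set T) : ok F -> measurable E -> (forall w, 0 <= F (U w)) ->
  (forall w, E w -> 1 <= F (U w)) -> (P E <= (ex F)%:E)%E.
Proof.
move=> okF mE F0 F1; have -> : (ex F)%:E = (\int[P]_w (F (U w))%:E)%E.
  rewrite /ex /Rintegral fineK //; have iF := ok_int P hU mU okF.
  exact: (integrable_fin_num measurableT iF).
rewrite -[E]setIT -integral_indic //; apply: ge0_le_integral => //.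
- by apply/measurable_EFinP; exact: measurable_indic.
- by apply/measurable_EFinP; apply: (measurableT_comp okF.1); exact: mU'.
- move=> w _; rewrite lee_fin indicE; case: (boolP (w \in E)) => [/set_mem/F1//|_]; exact: F0.
Qed.

(** The hypothesis on [Q] carries the mean bound. Chernoff's method is applied to the smooth
    approximation, which is above t + delta - e1 wherever the trace norm exceeds t + delta. *)
Lemma trnorm_tail (t delta : R) : 0 < delta ->
  (forall e, 0 < e -> exists Q, [/\ ok Q, ex Q <= t + e &
     forall u K, G u -> cball K -> Re (\tr (K *m X u)) <= Q u]) ->
  (P [set w | t + delta < trnorm (X (U w))]%R <= (expR (- (delta ^+ 2 * n / (48 * op))))%:E)%E.
Proof.
move=> d0 hQ; set E := [set w | _].
have mE : measurable E.
  have -> : E = (fun w => trnorm (X (U w))) @^-1` `]t + delta, +oo[.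
    by apply/seteqP; split => w; rewrite /E /= in_itv /= andbT.
  by rewrite -[F in measurable F]setTI; apply: measurable_trnorm.
have fE : P E = (fine (P E))%:E by rewrite fineK // fin_num_measure.
rewrite fE lee_fin; apply: le_eps_expR => [|e e0]; first exact: expR_ge0.
rewrite -lee_fin -fE.
have np : 0 < n by rewrite ltr0n.
(* The minimizer of 12 lam^2 op / n - lam delta, with value - delta^2 n / (48 op). *)
pose lam := n * delta / (24 * op); have lam0 : 0 < lam by rewrite divr_gt0 ?mulr_gt0.
(* The approximation is paid for three times: twice in the mean of f and once in the threshold. *)
pose e1 := e / (3 * lam); have e10 : 0 < e1 by apply: divr_gt0 => //; apply: mulr_gt0.
have [f [Y [K [K0 hf hb]]]] := smooth_trnorm e10.
have [Q [okQ eQ Qu]] := hQ _ e10.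
have okf := grad_ok K0 hf.
have ef : ex f <= t + 2 * e1.
  apply: le_trans (_ : ex (fun x => Q x + e1) <= _).
    apply: (ex_le P hU mU) => //; first by apply: okD => //; exact: ok_cst.
    move=> x Gx; have /andP[_ h] := hb _ Gx; apply: le_trans h _; rewrite lerD2r.
    by have [K2 cK2 <-] := trnorm_attained (devM_herm x); exact: Qu.
  by rewrite (exD P hU mU) //; [rewrite (ex_cst P U); lra|exact: ok_cst].
pose c := expR (lam * (ex f - (t + delta - e1))).
have okF : ok (fun x => c * expR (lam * (f x - ex f))).
  apply: okZ; apply: ok_expR; apply: okZ; apply: okB => //; exact: ok_cst.
apply: le_trans (prob_le_ex okF mE _ _) _.
- by move=> w; rewrite mulr_ge0 ?expR_ge0.
- move=> w Ew; rewrite /c -expRD -[leLHS]expR0 ler_expR -mulrDr mulr_ge0 ?(ltW lam0) //.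
  have /andP[h _] := hb _ (hU w); move: Ew h; rewrite /E /=; move: (trnorm _) (f _) (ex _) => q1 q2 q3; lra.
rewrite lee_fin (exZ P hU mU); last first.
  apply: ok_expR; apply: okZ; apply: okB => //; exact: ok_cst.
apply: le_trans (ler_wpM2l (expR_ge0 _) (mgf_bound hU mU iU n0 K0 (ltW lam0) hf)) _.
rewrite -!expRD ler_expR.
have L2 : L ^+ 2 = 4 * op by rewrite exprMn sqr_sqrtr ?(ltW op0) //; ring.
rewrite L2.
have h1 : lam * (ex f - (t + delta - e1)) <= lam * (3 * e1 - delta) by rewrite ler_wpM2l ?(ltW lam0) //; lra.
apply: le_trans (lerD h1 (lexx _)) _; rewrite le_eqVlt; apply/orP; left; apply/eqP.
rewrite /e1 /lam; move: np op0 d0; move: n op => n' o' h2 h3 h4.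
by field; rewrite ?gt_eqF // mulr_gt0.
Qed.

End Concentration.

Theorem theorem1 (R : realType) (D dR dE : nat) (J : finType) (blk : 'I_D -> J)
  (rho : 'M[R[i]]_(D * dR)) (M : {linear 'M[R[i]]_D -> 'M[R[i]]_dE})
  (d : measure_display) (T : measurableType d) (P : probability T R)
  (U : T -> 'M[R[i]]_D) :
  subnormalized rho ->
  completely_positive M ->
  trace_nonincreasing M ->
  (forall w, block_unitary blk (U w)) ->
  (forall A, mxBorel A -> measurable (U @^-1` A)) ->
  (forall g, block_unitary blk g -> forall A, mxBorel A ->
     P ((fun w => g *m U w) @^-1` A) = P (U @^-1` A)) ->
  forall delta : R, 0 < delta ->
  ((1 - expR (- (delta ^+ 2 * (dmin blk)%:R / (48 * opnorm (ptrace2 rho)))))%:E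
   <= P [set w | ((trnorm (ampr M (tens (U w) 1%:M *m rho *m adj (tens (U w) 1%:M))
                          - GammaER blk M rho))%:E
                  <= expeR (- ((ln 2 / 2)%:E * Hmin (GammaSER blk M rho))) + delta%:E)%E])%E.
Proof.
move=> rho_sub cpM tniM hU mU iU delta d0; set A := [set w | _].
(* A vanishing quotient makes the claimed probability 0. This settles an empty block, where d_min =
   0, and a vanishing operator norm, where division by 0 gives 0. *)
have trivial_bound : delta ^+ 2 * (dmin blk)%:R / (48 * opnorm (ptrace2 rho)) = 0 ->
    ((1 - expR (- (delta ^+ 2 * (dmin blk)%:R / (48 * opnorm (ptrace2 rho)))))%:E <= P A)%E.
  by move=> ->; rewrite oppr0 expR0 subrr; exact: measure_ge0.
have [n0|n0] := posnP (dmin blk); first by apply: trivial_bound; rewrite n0 mulr0 mul0r.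
have := opnorm_ge0 (ptrace2 rho); rewrite le_eqVlt => /predU1P[opE|op0].
  by apply: trivial_bound; rewrite -opE mulr0 invr0 mulr0.
have {trivial_bound} ln20 : 0 < ln 2 :> R by rewrite ln_gt0 // ltr1n.
set h := Hmin _ in A *; set x := _ / (48 * _).
(* The threshold is then infinite and the event is everything. *)
have [hN|hN] := eqVneq h -oo%E.
  have -> : A = setT.
    apply/seteqP; split => // w _; rewrite /A /= hN gt0_muleNy ?lte_fin ?divr_gt0 //.
    by rewrite /= leey.
  by rewrite probability_setT lee_fin gerBl expR_ge0.
(* The finite threshold; an infinite min-entropy is allowed here and gives t = 0. *)
pose t := fine (expeR (- ((ln 2 / 2)%:E * h))).
have [t0 eT] : 0 <= t /\ expeR (- ((ln 2 / 2)%:E * h)) = t%:E.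
  rewrite /t; move: hN; case: (h) => [r _||] //=.
  by move=> _; rewrite gt0_muley ?lte_fin ?divr_gt0.
have below y : (y%:E < h)%E -> exists sg l, [/\ density sg, y < l &
    psd (toC (2 `^ (- l)) *: tens (1%:M : 'M[R[i]]_(D * D)) sg - GammaSER blk M rho)].
  move=> /ereal_sup_gt[_ [sg dsg <-]] /ereal_sup_gt[_ [l hl <-]]; rewrite lte_fin => yl.
  by exists sg, l.
have tail : (P [set w | t + delta < trnorm (devM blk M rho (U w))]%R <= (expR (- x))%:E)%E.
  apply: trnorm_tail => // e e0; have te : 0 < t + e / 2 by rewrite ltr_wpDl ?divr_gt0.
  (* The entropy for which 2^(- y / 2) is t + e / 2. As this exceeds t, y lies strictly below H_min,
     so some [sg] and some l > y satisfy the operator inequality even if the supremum is not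
     attained. *)
  pose y := - (2 / ln 2) * ln (t + e / 2).
  have ey z : y <= z -> 2 `^ (- (z / 2)) <= t + e / 2.
    move=> yz; rewrite /powR pnatr_eq0 /= -[leRHS]lnK ?posrE // ler_expR.
    have -> : ln (t + e / 2) = - (y / 2) * ln 2 by rewrite /y; field; rewrite gt_eqF.
    by rewrite ler_wpM2r ?(ltW ln20) // lerN2 ler_wpM2r ?invr_ge0.
  have yh : (y%:E < h)%E.
    rewrite ltNge; apply/negP => hy; suff : ((t + e / 2)%:E <= t%:E)%E by rewrite lee_fin; lra.
    have -> : (t + e / 2)%:E = expeR (- ((ln 2 / 2)%:E * y%:E)).
      rewrite -EFinM /= (_ : - (ln 2 / 2 * y) = ln (t + e / 2)) ?lnK //.
      by rewrite /y; field; rewrite gt_eqF.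
    by rewrite -eT lee_expeR leeN2 lee_wpmul2l // lee_fin divr_ge0 // ltW.
  have [sg [l [dsg yl hl]]] := below _ yh.
  have [v hv] := kraus rho_sub cpM.
  have e20 : 0 < e / 2 by rewrite divr_gt0.
  have [Q [okQ eQ Qu]] := mean_bound rho_sub tniM hv hU mU iU dsg e20 hl.
  exists Q; split => //; apply: le_trans eQ _; have := ey _ (ltW yl); lra.
have mE : measurable [set w | t + delta < trnorm (devM blk M rho (U w))].
  have -> : [set w | t + delta < trnorm (devM blk M rho (U w))] = (fun w => trnorm (devM blk M rho (U w))) @^-1` `]t + delta, +oo[.
    by apply/seteqP; split => w; rewrite /= in_itv /= andbT.
  by rewrite -[F in measurable F]setTI; apply: measurable_trnorm.
have -> : A = ~` [set w | t + delta < trnorm (devM blk M rho (U w))].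
  apply/seteqP; split => w; rewrite /A /= eT -EFinD lee_fin leNgt => /negP //.
rewrite probability_setC // EFinB; exact: leeB.
Qed.
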